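(* Let $d\ge2$, let $U\subset\mathbb{R}^d$ be a bounded open set, and let $q\in(2,\infty)$ if $d=2$, $q:=d$ if $d\ge3$. Let $\mathbf H\in L^q(U,\mathbb{R}^d)$ with $\|\mathbf H\|\le h$ in $U$, where $h\in L^q(U)$. Let $A=(a_{ij})_{1\le i,j\le d}$ be a (possibly non-symmetric) matrix of measurable functions on $\mathbb{R}^d$ such that for some constants $M>0,\lambda>0$, $\max_{i,j}|a_{ij}(x)|\le M$ and $\langle A(x)\xi,\xi\rangle\ge\lambda\|\xi\|^2$ for a.e. $x\in\mathbb{R}^d$ and all $\xi\in\mathbb{R}^d$. Let $\theta\in[0,\infty)$ be a constant and $c\in L^s(U)$ with $c\ge0$ a.e. in $U$, where $s\in(1,\infty)$ if $d=2$ and $s:=\frac d2$ if $d\ge3$. Let $T\in(0,\infty)$ and $g\in L^2(U)$. Let $N\ge0$ be a constant such that $$\left(\int_U1_{\{|h|\ge N\}}|h|^q\,dx\right)^{2/q}\le\frac{\lambda^2}{4}\left(\frac{q-2}{q}\right)^2|U|^{-1+\frac2q}\quad\text{if }d=2,$$ $$\left(\int_U1_{\{|h|\ge N\}}|h|^d\,dx\right)^{2/d}\le\frac{\lambda^2}{16}\left(\frac{d-2}{d-1}\right)^2\quad\text{if }d\ge3,$$ and let $\gamma:=\frac{N^2}{\lambda}$. Then the following hold. (i) There exists a $C_0$-semigroup of contractions $(S_t)_{t>0}$ on $L^2(U)$ such that the $L^2(U)$-valued function $\mathbf u\in C([0,\infty);L^2(U))$ defined by $$\mathbf u(t)=e^{\gamma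 t}S_tg,\quad t\in(0,\infty),\qquad\mathbf u(0)=g,$$ is a (unique) weak solution (in the sense of the context) to $$u_t-\operatorname{div}(A\nabla u)+\langle\mathbf H,\nabla u\rangle+(c+\theta)u=0\ \text{in }U\times(0,T),\quad u=0\ \text{on }\partial U\times[0,T],\quad u=g\ \text{on }U\times\{t=0\}.$$ In particular, $$\|\mathbf u(t)\|_{L^2(U)}\le e^{\gamma t}\|g\|_{L^2(U)}\quad\text{for all }t\in[0,\infty)$$ and $$\|\mathbf u\|_{L^2(0,T;H^{1,2}_0(U))}\le\left(\frac{e^{2\gamma T}}{\lambda}\right)^{1/2}\|g\|_{L^2(U)}.$$ (ii) The function $\mathbf u$ in (i) satisfies $\mathbf u\in C^\infty((0,\infty);L^2(U))$.
   Context: $|U|$ is the Lebesgue measure of $U$. $H^{1,2}_0(U)$ is the closure of $C_0^\infty(U)$ in the Sobolev space $H^{1,2}(U)$, normed by $\|u\|_{H^{1,2}_0(U)}:=\|\nabla u\|_{L^2(U)}$; $H^{-1,2}(U)$ is its dual, with duality pairing $\langle\cdot,\cdot\rangle_{H^{-1,2}(U)}$, and $L^2(U)$ is embedded in $H^{-1,2}(U)$ through the $L^2(U)$ inner product. $L^2(0,T;X)$ is the Bochner space with norm $(\int_0^T\|\mathbf u(t)\|_X^2dt)^{1/2}$. $C^\infty((0,\infty);X)$ is the set of $X$-valued functions on $(0,\infty)$ having continuous derivatives of all orders. The statement $\mathbf u'\in L^2(0,T;H^{-1,2}(U))$ means that there is $\mathbf u'\in L^2(0,T;H^{-1,2}(U))$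 with $\int_0^T\mathbf u'(t)\eta(t)dt=-\int_0^T\mathbf u(t)\eta'(t)dt$ in $H^{-1,2}(U)$ for all $\eta\in C_0^\infty((0,T))$. Weak solution: $\mathbf u$ is a weak solution to the initial-boundary value problem $$u_t-\operatorname{div}(A\nabla u)+\langle\mathbf H,\nabla u\rangle+(c+\theta)u=0\ \text{in }U\times(0,T),\quad u=0\ \text{on }\partial U\times[0,T],\quad u=g\ \text{on }U\times\{t=0\}$$ if: (1) $\mathbf u\in L^2(0,T;H^{1,2}_0(U))$ and $\mathbf u'\in L^2(0,T;H^{-1,2}(U))$; (2) for all $v\in H^{1,2}_0(U)$ and a.e. $t\in(0,T)$, $$\langle\mathbf u'(t),v\rangle_{H^{-1,2}(U)}+\int_U\langle A\nabla\mathbf u(t),\nabla v\rangle+\langle\mathbf H,\nabla\mathbf u(t)\rangle v+(c+\theta)\mathbf u(t)v\,dx=0;$$ (3) $\lim_{t\to0+}\mathbf u(t)=g$ in $L^2(U)$. *)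

(* Defs.v *)
From HB Require Import structures.
From mathcomp Require Import all_boot all_order all_algebra.
From mathcomp Require Import all_classical all_reals all_analysis.
From mathcomp Require Import ring_quotient measurable_realfun.

Set Implicit Arguments.
Unset Strict Implicit.
Unset Printing Implicit Defensive.
Import Order.TTheory GRing.Theory Num.Theory.
Import numFieldNormedType.Exports.
Local Open Scope classical_set_scope.
Local Open Scope ring_scope.

(* The library has no Lebesgue measure on R^n: it is built here as an iterated
   product on [n.-tuple R], transported to the Borel sets of ['rV[R]_n] and then
   completed; see [lebesgue_rV_box]. *)
Section lebesgue_tuple_step.
Context (R : realType) (n : nat).
Local Notation mR := (measurableTypeR R).
Variable m : {sigma_finite_measure set (n.-tuple mR) -> \bar R}.

Let consp (p : mR * n.-tuple mR) : n.+1.-tuple mR := [the n.+1.-tuple mR of p.1 :: p.2].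

Let mconsp : measurable_fun [set: mR * n.-tuple mR] consp.
Proof. by apply: measurable_cons. Qed.

Definition lebesgue_tuple_step : set (n.+1.-tuple mR) -> \bar R :=
  pushforward (@lebesgue_measure R \x m)%E consp.

Let PF : {measure set (n.+1.-tuple mR) -> \bar R} :=
  @measure_function_pushforward__canonical__measure_function_Measure _ _ _ _ _ (@lebesgue_measure R \x m)%E _ mconsp.

HB.instance Definition _ := isMeasure.Build _ _ _ lebesgue_tuple_step
  (measure0 PF) (measure_ge0 PF) (@measure_semi_sigma_additive _ _ _ PF).

Let sigma_finite_step : sigma_finite setT lebesgue_tuple_step.
Proof.
have /sigma_finiteP[F [TF ndF Foo]] := sigma_finiteT (@lebesgue_measure R).
have /sigma_finiteP[G [TG ndG Goo]] := sigma_finiteT m.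
pose g (t : n.+1.-tuple mR) : mR * n.-tuple mR :=
  (thead t, [tuple of behead t]).
have mg : measurable_fun setT g.
  apply/measurable_fun_pairP; split; first exact: (measurable_tnth ord0).
  exact: measurable_behead.
exists (fun k => g @^-1` (F k `*` G k)).
  apply/esym/seteqP; split=> // t _.
  have [i _ Fi] : (\bigcup_i F i) (thead t) by rewrite -TF.
  have [j _ Gj] : (\bigcup_i G i) [tuple of behead t] by rewrite -TG.
  exists (maxn i j) => //; split => /=.
  - by move: Fi; apply/subsetPset/ndF/leq_maxl.
  - by move: Gj; apply/subsetPset/ndG/leq_maxr.
move=> k; have [? ?] := Foo k; have [? ?] := Goo k; split.
  by rewrite -[X in measurable X]setTI; apply: mg => //; exact: measurableX.
rewrite /lebesgue_tuple_step /pushforward -comp_preimage.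
rewrite (_ : g \o consp = id) ?preimage_id; last first.
  apply/funext => -[x t] /=; rewrite /g/=; congr pair.
  by apply/val_inj.
by rewrite product_measure1E// lte_mul_pinfty// ge0_fin_numE.
Qed.

HB.instance Definition _ :=
  Measure_isSigmaFinite.Build _ _ _ lebesgue_tuple_step sigma_finite_step.
End lebesgue_tuple_step.

Fixpoint lebesgue_tuple (R : realType) (n : nat) :
    {sigma_finite_measure set (n.-tuple (measurableTypeR R)) -> \bar R} :=
  match n with
  | 0 => \d_([tuple] : 0.-tuple (measurableTypeR R))
  | n.+1 => lebesgue_tuple_step (lebesgue_tuple R n)
  end.

Lemma lebesgue_tuple_box (R : realType) n (A : 'I_n -> set (measurableTypeR R)) :
  (forall i, measurable (A i)) ->
  lebesgue_tuple R n [set t | forall i, A i (tnth t i)] =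
  (\prod_(i < n) lebesgue_measure (A i))%E.
Proof.
elim: n => [|n IH] in A *; move=> mA.
  rewrite big_ord0 /= diracE mem_set//= => -[]//.
rewrite big_ord_recl -IH//= -product_measure1E//; last first.
  rewrite (_ : [set _ | _] = \bigcap_(i in [set: 'I_n])
    ((fun t : n.-tuple _ => tnth t i) @^-1` A (lift ord0 i))).
    apply: fin_bigcap_measurable => // i _.
    by rewrite -[X in measurable X]setTI; exact: measurable_tnth.
  by apply/seteqP; split=> t At i; [move=> _|]; exact: At.
rewrite /lebesgue_tuple_step /pushforward; congr (_ _).
apply/seteqP; split=> [[x t] /= At|[x t] /= [Ax At] i].
  split=> [|i]; first exact: (At ord0).
  by have := At (lift ord0 i); rewrite tnthS.
case: (unliftP ord0 i) => [j ->|->]; last exact: Ax.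
by rewrite tnthS; exact: At.
Qed.

Section lebesgue_rV.
Context (R : realType) (n : nat).
Local Notation mR := (measurableTypeR R).

Definition borel_rV := g_sigma_algebraType (@open 'rV[R]_n).

Let row_of (t : n.-tuple mR) : borel_rV := \row_i tnth t i.

Let rbox (p : 'rV[rat]_n * nat) : set 'rV[R]_n :=
  ball (map_mx (@ratr R) p.1) p.2.+1%:R^-1.

Let open_rbox (A : set 'rV[R]_n) : open A ->
  A = \bigcup_(p in [set p | rbox p `<=` A]) rbox p.
Proof.
move=> oA; apply/seteqP; split=> [x Ax|x [p/= pA]]; last exact: pA.
have /nbhs_ballP[e /= e0 eA] : nbhs x A by apply: open_nbhs_nbhs.
have [k ke] : exists k : nat, (2 * k.+1%:R^-1 < e :> R).
  have [k _ /(_ _ (leqnn k))] := near_infty_natSinv_lt (PosNum (divr_gt0 e0 (ltr0n R 2))).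
  by exists k; rewrite -ltr_pdivlMl// mulrC.
have [q xq] : exists q : 'rV[rat]_n, forall i, `|x 0 i - ratr (q 0 i)| < k.+1%:R^-1.
  have /choice[f xf] : forall i : 'I_n, exists q : rat, `|x 0 i - ratr q| < k.+1%:R^-1.
    move=> i; have [] := @rat_in_itvoo R (x 0 i - k.+1%:R^-1) (x 0 i + k.+1%:R^-1).
      by rewrite ltrBlDr -addrA ltrDl addr_gt0.
    move=> q; rewrite in_itv/= => /andP[q1 q2]; exists q.
    by rewrite distrC ltr_distl q1 q2.
  by exists (\row_i f i) => i; rewrite mxE.
exists (q, k) => /=; last first.
  by split=> [|i j]; rewrite ?mxE /ball/= ?ord1 1?distrC.
move=> y [_ yq]; apply: eA; split=> // i j.
have := yq i j; rewrite mxE/ball/= ord1 => yqj.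
rewrite (lt_trans _ ke)// mulr2n mulrDl !mul1r.
rewrite (le_lt_trans (ler_distD (ratr (q 0 j)) _ _))// ltrD//.
Qed.

Let mrow_of : measurable_fun [set: n.-tuple mR] row_of.
Proof.
apply: (@measurability _ _ _ borel_rV _ _ (@open 'rV[R]_n)) => //.
move=> _ [A oA <-]; rewrite setTI.
rewrite (open_rbox oA) preimage_bigcup bigcup_mkcond.
apply: countable_bigcupT_measurable => // p; case: ifPn => // _.
rewrite (_ : _ @^-1` _ = \bigcap_(i in [set: 'I_n])
  ((fun t : n.-tuple mR => tnth t i) @^-1` ball (ratr (p.1 0 i) : R) p.2.+1%:R^-1)).
  apply: fin_bigcap_measurable => // i _.
  rewrite -[X in measurable X]setTI; apply: measurable_tnth => //.
  exact: measurable_ball.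
apply/seteqP; split=> [t [_ tp] i _|t tp].
  by have := tp 0 i; rewrite !mxE.
by split=> // i j; rewrite !mxE ?ord1; apply: tp.
Qed.

Definition lebesgue_borel_rV : set borel_rV -> \bar R :=
  pushforward (lebesgue_tuple R n) row_of.

Let PF : {measure set borel_rV -> \bar R} :=
  @measure_function_pushforward__canonical__measure_function_Measure
    _ _ _ _ _ (lebesgue_tuple R n) _ mrow_of.

HB.instance Definition _ := isMeasure.Build _ _ _ lebesgue_borel_rV
  (measure0 PF) (measure_ge0 PF) (@measure_semi_sigma_additive _ _ _ PF).

(* R^n with its Lebesgue (i.e. completed Borel) sigma-algebra *)
Definition Rn := caratheodory_type (lebesgue_borel_rV^*)%mu.
HB.instance Definition _ := Measurable.on Rn.

Definition lebesgue_rV : set Rn -> \bar R :=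
  @completed_measure_extension _ _ _ lebesgue_borel_rV.

HB.instance Definition _ := Measure.copy lebesgue_rV
  (@completed_measure_extension _ _ _ lebesgue_borel_rV).

Lemma open_measurable_rV (U : set 'rV[R]_n) : open U -> measurable (U : set Rn).
Proof.
by move=> oU; apply: caratheodory_measurable_mu_ext; exact: sub_sigma_algebra.
Qed.

Lemma lebesgue_rV_box (A : 'I_n -> set R) : (forall i, open (A i)) ->
  lebesgue_rV [set x : 'rV[R]_n | forall i, A i (x 0 i)] =
  (\prod_(i < n) lebesgue_measure (A i))%E.
Proof.
move=> oA; have oB : open [set x : 'rV[R]_n | forall i, A i (x 0 i)].
  rewrite openE => x /= Ax; rewrite /interior.
  apply: (@filter_forall _ _ (fun i y => A i (y 0 i)) (nbhs x)) => i.
  apply: (@coord_continuous _ _ _ 0 i x); apply: open_nbhs_nbhs; split => //.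
rewrite /lebesgue_rV /completed_measure_extension measurable_mu_extE; last first.
  exact: sub_sigma_algebra.
rewrite -lebesgue_tuple_box; last by move=> i; exact: open_measurable (oA i).
have -> : [set t : n.-tuple mR | forall i, A i (tnth t i)] =
    row_of @^-1` [set x : 'rV[R]_n | forall i, A i (x 0 i)]; last by [].
by apply/seteqP; split=> t At i; have := At i; rewrite /row_of mxE.
Qed.
End lebesgue_rV.

(* L^2(mu) as a normed module: [LfunType mu (lee1n 2)] modulo a.e. equality *)
Section L2.
Context d (T : measurableType d) (R : realType).
Variable mu : {measure set T -> \bar R}.

Local Notation Lf2 := (LfunType mu (lee1n 2)).
Let nm (f : Lf2) : R := fine 'N[mu]_2%:E[EFin \o f]%E.

Definition ae_null : {pred Lf2} := [pred f : Lf2 | `[< f = cst 0 %[ae mu] >]].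

Lemma ae_nullP (f : Lf2) : reflect (nm f = 0) (f \in ae_null).
Proof.
apply: (iffP idP) => [/asboolP f0|f0]; last first.
  by apply/asboolP; exact: fine_Lnormr_eq0.
rewrite /nm unlock /Lnorm.
rewrite (@ae_eq_integral _ _ _ mu setT (cst 0%E)) //.
- by rewrite integral0 poweR0r// invr_neq0.
- apply/measurable_EFinP; apply: (@measurableT_comp _ _ _ _ _ _ (@powR R ^~ 2)) => //.
  exact: measurableT_comp.
- by apply: filterS f0 => x /= -> // _; rewrite normr0 powR0.
Qed.

Let nmD (f g : Lf2) : nm (f + g) <= nm f + nm g.
Proof. exact: ler_LnormD. Qed.

Let nmZ (a : R) (f : Lf2) : nm (a *: f) = `|a| * nm f.
Proof.
apply/EFin_inj; rewrite EFinM /nm !finite_norm_fine -LnormZ; congr Lnorm.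
Qed.

Let nmN (f : Lf2) : nm (- f) = nm f.
Proof. by rewrite -scaleN1r nmZ normrN normr1 mul1r. Qed.

Let ae_null_zmod : zmod_closed ae_null.
Proof.
have nm0 : nm (0 : Lf2) = 0 by rewrite -(scale0r (0 : Lf2)) nmZ normr0 mul0r.
split; first exact/ae_nullP.
move=> f g /ae_nullP f0 /ae_nullP g0; apply/ae_nullP/eqP.
rewrite eq_le; apply/andP; split; last by rewrite fine_ge0// Lnorm_ge0.
by rewrite (le_trans (nmD _ _))// nmN f0 g0 addr0.
Qed.

HB.instance Definition _ := GRing.isZmodClosed.Build _ ae_null ae_null_zmod.

Definition L2space := Quotient.quot ae_null.
HB.instance Definition _ := GRing.Zmodule.on L2space.
HB.instance Definition _ := EqQuotient.on L2space.

Local Open Scope quotient_scope.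

Lemma L2_piP (f g : Lf2) : f = g %[mod L2space] <-> (f - g) \in ae_null.
Proof. by rewrite Quotient.idealrBE; split=> [/eqP|/eqP]. Qed.

Lemma L2_surj (x : L2space) : exists f, x = \pi_L2space f.
Proof. by exists (repr x); rewrite reprK. Qed.

Let piK (f : Lf2) : (repr (\pi_L2space f) - f) \in ae_null.
Proof. by apply/L2_piP; rewrite reprK. Qed.

Lemma L2_piD (f g : Lf2) : \pi_L2space (f + g) = \pi_L2space f + \pi_L2space g.
Proof. by rewrite piE. Qed.

Let nm_pi (f g : Lf2) : f = g %[mod L2space] -> nm f = nm g.
Proof.
have H (f' g' : Lf2) : (f' - g') \in ae_null -> nm f' <= nm g'.
  move=> /ae_nullP f0; rewrite -[f'](subrK g') (le_trans (nmD _ _))//.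
  by rewrite f0 add0r.
by move=> fg; apply/eqP; rewrite eq_le !H//; apply/L2_piP.
Qed.

Definition L2scale (a : R) (x : L2space) : L2space := \pi_L2space (a *: repr x).

Lemma L2_piZ (a : R) (f : Lf2) : L2scale a (\pi_L2space f) = \pi_L2space (a *: f).
Proof.
apply/L2_piP/ae_nullP; rewrite -scalerBr nmZ.
by have /ae_nullP -> := piK f; rewrite mulr0.
Qed.

Let scaleA a b x : L2scale a (L2scale b x) = L2scale (a * b) x.
Proof. by case: (L2_surj x) => f ->; rewrite 3!L2_piZ scalerA. Qed.
Let scale1 : left_id 1 L2scale.
Proof. by move=> x; case: (L2_surj x) => f ->; rewrite L2_piZ scale1r. Qed.
Let scaleDr : right_distributive L2scale +%R.
Proof.
by move=> a x y; case: (L2_surj x) (L2_surj y) => f -> [g ->]; rewrite -L2_piD 3!L2_piZ scalerDr L2_piD.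
Qed.
Let scaleDl x : {morph L2scale^~ x : a b / a + b}.
Proof. by case: (L2_surj x) => f -> a b; rewrite 3!L2_piZ scalerDl L2_piD. Qed.

HB.instance Definition _ := GRing.Zmodule_isLmodule.Build R L2space
  scaleA scale1 scaleDr scaleDl.

Definition L2norm (x : L2space) : R :=
  fine 'N[mu]_2%:E[EFin \o (repr x : Lf2)]%E.

Lemma L2norm_pi (f : Lf2) : L2norm (\pi_L2space f) = nm f.
Proof. by apply: nm_pi; rewrite reprK. Qed.

Let L2normD x y : L2norm (x + y) <= L2norm x + L2norm y.
Proof. by case: (L2_surj x) (L2_surj y) => f -> [g ->]; rewrite -L2_piD 3!L2norm_pi. Qed.

Let L2normZ a x : L2norm (a *: x) = `|a| * L2norm x.
Proof. by case: (L2_surj x) => f ->; rewrite [_ *: _]L2_piZ 2!L2norm_pi nmZ. Qed.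

Let L2norm_eq0 x : L2norm x = 0 -> x = 0.
Proof.
case: (L2_surj x) => f ->; rewrite L2norm_pi => f0.
rewrite (_ : 0 = \pi_L2space 0); last by rewrite piE.
by apply/L2_piP; rewrite subr0; apply/ae_nullP.
Qed.

HB.instance Definition _ := Lmodule_isNormed.Build R L2space
  L2normD L2normZ L2norm_eq0.

(* a representative; it is meaningful only up to a.e. equality *)
Definition L2fun (x : L2space) : T -> R := repr x : Lf2.
End L2.

(* Bochner theory on the interval ]0, T[ for a normed space given as a linear
   subspace [X] of [V] with norm [N]; [N] may be meaningless outside of [X]. *)
Section bochner.
Context (R : realType) (V : lmodType R) (X : set V) (N : V -> R) (T : R).
Local Notation leb := (@completed_lebesgue_measure R).

(* measurability for the domain of [completed_lebesgue_measure] *)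
Definition lebesgue_measurable (A : set R) : Prop :=
  (wlength idfun)^*%mu.-cara.-measurable A.

Definition simple_function (s : R -> V) : Prop :=
  [/\ finite_set (range s), range s `<=` X &
      forall v, lebesgue_measurable (s @^-1` [set v])].

Definition simple_integral (s : R -> V) : V :=
  \sum_(v \in range s) fine (leb (`]0, T[ `&` s @^-1` [set v])) *: v.

Definition simple_approx (s : nat -> R -> V) (f : R -> V) : Prop :=
  (forall n, simple_function (s n)) /\
  {ae leb, forall t : R, 0 < t < T ->
     X (f t) /\ N (s n t - f t) @[n --> \oo] --> (0 : R)}.

Definition strongly_measurable (f : R -> V) : Prop :=
  exists s, simple_approx s f.

(* the norm of L^2(0, T; X) *)
Definition bochner_norm2 (f : R -> V) : \bar R :=
  ((\int[leb]_(t in (`]0%R, T[%classic : set R)) ((N (f t)) ^+ 2)%:E) `^ 2^-1)%E.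

Definition bochner_L2 (f : R -> V) : Prop :=
  strongly_measurable f /\ (bochner_norm2 f < +oo)%E.

Definition is_bochner_integral (f : R -> V) (y : V) : Prop :=
  X y /\ exists s, [/\ simple_approx s f,
    (\int[leb]_(t in (`]0%R, T[%classic : set R)) (N (s n t - f t))%:E)%E
      @[n --> \oo] --> 0%E &
    N (simple_integral (s n) - y) @[n --> \oo] --> (0 : R)].

Definition time_test_function (eta : R -> R) : Prop :=
  [/\ forall k t, derivable (derive1n k eta) t 1,
      compact (closure [set t | eta t != 0]) &
      closure [set t | eta t != 0] `<=` `]0, T[].

Definition is_weak_time_derivative (f f' : R -> V) : Prop :=
  forall eta, time_test_function eta -> exists y,
    is_bochner_integral (fun t => eta t *: f' t) y /\
    is_bochner_integral (fun t => derive1 eta t *: f t) (- y).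
End bochner.

(* [derive1n] is defined on the whole line, but its values at t > 0 only depend
   on the restriction of [f] to ]0, +oo[. *)
Definition smooth_on_pos (R : realType) (V : normedModType R) (f : R -> V) : Prop :=
  forall k t, 0 < t -> derivable (derive1n k f) t 1 /\ {for t, continuous (derive1n k f)}.

Definition C0_contraction_semigroup (R : realType) (V : normedModType R)
    (S : R -> V -> V) : Prop :=
  [/\ forall t, 0 < t -> linear (S t),
      forall s t, 0 < s -> 0 < t -> S (s + t) = S s \o S t,
      forall x, S t x @[t --> 0^'+] --> x &
      forall t x, 0 < t -> `|S t x| <= `|x|].

Section euclidean.
Context (R : realType) (n : nat).
Definition dot (x y : 'rV[R]_n) : R := \sum_i x 0 i * y 0 i.
(* the canonical norm of ['rV[R]_n] is the sup norm *)
Definition enorm (x : 'rV[R]_n) : R := Num.sqrt (dot x x).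

Definition partial (i : 'I_n) (phi : 'rV[R]_n -> R) : 'rV[R]_n -> R :=
  fun x => 'D_(delta_mx 0 i) phi x.

Definition iter_partial (s : seq 'I_n) (phi : 'rV[R]_n -> R) :=
  foldr partial phi s.

Definition test_function (U : set 'rV[R]_n) (phi : 'rV[R]_n -> R) : Prop :=
  [/\ forall s x, {for x, continuous (iter_partial s phi)},
      forall s i x, derivable (iter_partial s phi) x (delta_mx 0 i),
      compact (closure [set x | phi x != 0]) &
      closure [set x | phi x != 0] `<=` U].

Local Notation leb := (@lebesgue_rV R n).
Definition Lp_on (U : set 'rV[R]_n) (p : R) (f : 'rV[R]_n -> R) : Prop :=
  measurable_fun (U : set (Rn R n)) (f : Rn R n -> R) /\
  (\int[leb]_(x in (U : set (Rn R n))) (`|f x| `^ p)%:E < +oo)%E.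
End euclidean.

Notation L2 oU :=
  (L2space (mrestr (@lebesgue_rV _ _) (open_measurable_rV oU))).

Section sobolev.
Context (R : realType) (n : nat) (U : set 'rV[R]_n) (oU : open U).
Local Notation leb := (@lebesgue_rV R n).

Local Notation L2U := (L2 oU).

Definition L2_val (u : L2U) : 'rV[R]_n -> R := L2fun u.

Definition intU (f : 'rV[R]_n -> R) : R :=
  \int[leb]_(x in (U : set (Rn R n))) f x.

Definition is_weak_partial (i : 'I_n) (u w : L2U) : Prop :=
  forall phi, test_function U phi ->
    intU (fun x => L2_val u x * partial i phi x) = - intU (fun x => L2_val w x * phi x).

Definition H12 : set L2U := [set u | forall i, exists w, is_weak_partial i u w].

(* the weak derivative is unique in L^2(U); the default value 0 is only used
   when there is none *)
Definition weak_partial (i : 'I_n) (u : L2U) : L2U := xget 0 (is_weak_partial i u).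

Definition grad (u : L2U) (x : 'rV[R]_n) : 'rV[R]_n :=
  \row_i L2_val (weak_partial i u) x.

Definition H12_norm (u : L2U) : R :=
  Num.sqrt (`|u| ^+ 2 + \sum_i `|weak_partial i u| ^+ 2).

(* C_0^oo(U) as a subset of L^2(U) *)
Definition test_class : set L2U :=
  [set u | exists2 phi, test_function U phi &
     {ae leb, forall x, U x -> L2_val u x = phi x}].

(* closure of C_0^oo(U) in H^{1,2}(U) *)
Definition H10 : set L2U :=
  [set u | H12 u /\ forall e, 0 < e -> exists2 v, test_class v & H12_norm (u - v) < e].

(* the L^2 norm of the gradient *)
Definition H10_norm (u : L2U) : R := Num.sqrt (\sum_i `|weak_partial i u| ^+ 2).

(* the dual space H^{-1,2}(U) of ([H10], [H10_norm]) *)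
Definition Hm1 : set (H10 -> R) :=
  [set F | (forall a (u v w : H10), val w = a *: val u + val v ->
              F w = a * F u + F v) /\
           exists C, forall v : H10, `|F v| <= C * H10_norm (val v)].

Definition Hm1_norm (F : H10 -> R) : R :=
  sup [set `|F v| | v in [set v : H10 | H10_norm (val v) <= 1]].

Definition L2_to_Hm1 (u : L2U) : H10 -> R :=
  fun v => intU (fun x => L2_val u x * L2_val (val v) x).

(* [grad u x] is a row vector, so that A grad u is its product with A^T *)
Definition energy_form (A : 'rV[R]_n -> 'M[R]_n) (H : 'rV[R]_n -> 'rV[R]_n)
    (c : 'rV[R]_n -> R) (theta : R) (u v : L2U) : R :=
  intU (fun x => dot (grad u x *m (A x)^T) (grad v x)
                 + dot (H x) (grad u x) * L2_val v x
                 + (c x + theta) * L2_val u x * L2_val v x).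

Definition weak_solution (A : 'rV[R]_n -> 'M[R]_n) (H : 'rV[R]_n -> 'rV[R]_n)
    (c : 'rV[R]_n -> R) (theta T : R) (g : L2U) (u : R -> L2U) : Prop :=
  exists u' : R -> H10 -> R,
  [/\ bochner_L2 H10 H10_norm T u,
      bochner_L2 Hm1 Hm1_norm T u',
      is_weak_time_derivative Hm1 Hm1_norm T (fun t => L2_to_Hm1 (u t)) u',
      forall v : H10,
        {ae (@completed_lebesgue_measure R), forall t : R, 0 < t < T ->
           u' t v + energy_form A H c theta (u t) (val v) = 0} &
      u t @[t --> 0^'+] --> g].
End sobolev.

(* Main.v *)
(** Splitting the drift at the level [|h| = N], the large part is absorbed by the Sobolev
    inequality and the small part costs [gamma |u|^2] with [gamma = N^2/lambda], so that the
    energy form plus [gamma] times the [L2] inner product is bounded and coercive on [H10] for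
    the Dirichlet norm. Lax-Milgram then gives contractive resolvents [J_e = (1 + e L)^-1], and
    [S_t] is the limit of the implicit Euler schemes with dyadic steps. Analyticity is used only
    through the estimate [k e |L J_e^k x| <= C |x|], which follows from a discrete Lyapunov
    function over the reals; it yields [|L S_t x| <= C |x| / t], hence smoothness for [t > 0].

    Uniqueness avoids the regularity theory of [L2(0,T;H10)] functions with derivative in
    [Hm1]. If [w] is the difference of two solutions, testing the equation with the adjoint
    resolvent of [phi] times [exp(-m t)] and a cut-off bounds the truncated Laplace transform
    of [<w, phi>] by [C exp(-m tau)], which forces [<w, phi> = 0] a.e. on [(0, tau)].

    The Sobolev inequality, with the explicit constant the hypothesis on [N] requires, is
    obtained from the Loomis-Whitney inequality applied to powers of test functions. *)
Require Import Defs.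
From mathcomp Require Import all_boot all_order all_algebra.
From mathcomp Require Import all_classical all_reals all_analysis.
From mathcomp Require Import ring_quotient measurable_realfun ring lra.
Set Implicit Arguments.
Unset Strict Implicit.
Unset Printing Implicit Defensive.
Import Order.TTheory GRing.Theory Num.Theory.
Import numFieldNormedType.Exports.
Local Open Scope classical_set_scope.
Local Open Scope ring_scope.

(** * Riesz and Lax-Milgram for forms on a subspace *)

Section forms.
Variables (R : realType) (X : lmodType R).
Implicit Types (V : set X) (a B : X -> X -> R) (N : X -> R) (F : X -> R).

(** Budget of constants. Ellipticity provides [lambda] in front of |grad u|^2. Young's inequality on
    the small drift takes lambda/4 and leaves exactly N^2/lambda in front of |u|^2; the large drift
    takes another lambda/4, because both thresholds on [N] are (lambda/4)^2 divided by the Sobolev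
    constant of the dimension. The remaining lambda/2 is the coercivity constant alpha, and the
    energy identity with weight exp(-2 gamma t) turns it into exp(2 gamma T)/(2 alpha) = exp(2 gamma
    T)/lambda. The form is not symmetric: all information on L is drawn from coercivity and from
    B(u,v)^2 <= M a(u,u) a(v,v). Error estimates of second order are proved on the domain of L^2;
    its density and contractivity transport their consequences to all of L2. For uniqueness the
    obstacle is that the equation is tested with v fixed in time, with a null set depending on v.
    For fixed z it only says that p = (w, z) satisfies p' = -E(w, z), where the right side is
    unknown. The adjoint resolvent z of phi makes E(w, z) + m p = (w, phi), which removes the
    unknown term from the Laplace transform at m. *)

Definition subspace V := V 0 /\ forall c u v, V u -> V v -> V (c *: u + v).

Definition linear_on V F :=
  forall c u v, V u -> V v -> F (c *: u + v) = c * F u + F v.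

Definition bilinear_on V B :=
  (forall w, V w -> linear_on V (B ^~ w)) /\ (forall w, V w -> linear_on V (B w)).

Definition sym_psd_on V a :=
  [/\ bilinear_on V a, forall u v, V u -> V v -> a u v = a v u &
      forall u, V u -> 0 <= a u u].

(** [N] is a gauge and need not be a norm: it is instantiated with the quadratic form itself, which
    has the same Cauchy sequences and limits as its square root. *)
Definition complete_on V N := forall u : nat -> X, (forall n, V (u n)) ->
  (forall e : R, 0 < e -> exists n0 : nat, forall m n : nat,
     (n0 <= m)%N -> (n0 <= n)%N -> N (u m - u n) < e) ->
  exists2 l, V l & forall e : R, 0 < e -> exists n0 : nat, forall n : nat,
     (n0 <= n)%N -> N (u n - l) < e.

Lemma subspaceZ V c u : subspace V -> V u -> V (c *: u).
Proof. by move=> [V0 VD] Vu; rewrite -[_ *: _]addr0; apply: VD. Qed.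

Lemma subspaceD V u v : subspace V -> V u -> V v -> V (u + v).
Proof. by move=> [V0 VD] Vu Vv; rewrite -[u]scale1r; apply: VD. Qed.

Lemma subspaceN V u : subspace V -> V u -> V (- u).
Proof. by move=> sV Vu; rewrite -scaleN1r; apply: subspaceZ. Qed.

Lemma subspaceB V u v : subspace V -> V u -> V v -> V (u - v).
Proof. by move=> sV Vu Vv; apply: subspaceD => //; apply: subspaceN. Qed.

Section linear_on.
Variables (V : set X) (F : X -> R).
Hypotheses (sV : subspace V) (lF : linear_on V F).

Lemma linear_on0 : F 0 = 0.
Proof.
have [V0 _] := sV; have := lF 1 V0 V0.
by rewrite scale1r addr0 mul1r => /eqP; rewrite -subr_eq subrr eq_sym => /eqP.
Qed.

Lemma linear_onZ c u : V u -> F (c *: u) = c * F u.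
Proof.
by move=> Vu; have := lF c Vu sV.1; rewrite addr0 linear_on0 addr0.
Qed.

Lemma linear_onD u v : V u -> V v -> F (u + v) = F u + F v.
Proof. by move=> Vu Vv; have := lF 1 Vu Vv; rewrite scale1r mul1r. Qed.

Lemma linear_onN u : V u -> F (- u) = - F u.
Proof. by move=> Vu; rewrite -scaleN1r linear_onZ// mulN1r. Qed.

Lemma linear_onB u v : V u -> V v -> F (u - v) = F u - F v.
Proof. by move=> Vu Vv; rewrite linear_onD ?linear_onN//; apply: subspaceN. Qed.
End linear_on.

Lemma bilinear_onBB V B u v : subspace V -> bilinear_on V B -> V u -> V v ->
  B (u - v) (u - v) = B u u - B u v - B v u + B v v.
Proof.
move=> sV [Bl Br] Vu Vv; have Vuv := subspaceB sV Vu Vv.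
by rewrite (linear_onB sV (Bl _ Vuv))// !(linear_onB sV (Br _ _))//; lra.
Qed.

Lemma bilinear_on_line V B c u v : subspace V -> bilinear_on V B -> V u -> V v ->
  B (c *: u + v) (c *: u + v) = c ^+ 2 * B u u + c * (B u v + B v u) + B v v.
Proof.
move=> sV [Bl Br] Vu Vv; have Vuv : V (c *: u + v) by apply: sV.2.
by rewrite (Bl _ Vuv)// !(Br _ _)//; ring.
Qed.

Lemma ler_all_eps (x y k : R) : 0 <= k ->
  (forall e : R, 0 < e -> x <= y + k * e) -> x <= y.
Proof.
move=> k0 h; apply/ler_addgt0Pr => e e0.
have k1 : 0 < k + 1 by lra.
apply: (le_trans (h (e / (k + 1)) _)); first by apply: divr_gt0; lra.
rewrite lerD2l mulrA ler_pdivrMr//; nra.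
Qed.

(* minimise [x^2 A + ...] at [t = - x / (A + e)]; no case distinction on [A = 0] *)
Lemma quadratic_bound (x A K e : R) : 0 <= A -> 0 < e ->
  (forall t, 0 <= t ^+ 2 * A + t * (2 * x) + K) -> x ^+ 2 <= K * (A + e).
Proof.
move=> A0 e0 h.
have Ae : 0 < A + e by lra.
have := h (- x / (A + e)).
rewrite [X in 0 <= X -> _](_ : _ = K - x ^+ 2 * (A + 2 * e) / (A + e) ^+ 2); last first.
  by field; lra.
rewrite subr_ge0 ler_pdivrMr ?exprn_gt0// => H.
have xx : 0 <= x ^+ 2 by apply: sqr_ge0.
rewrite -(ler_pM2r Ae).
apply: (@le_trans _ _ (x ^+ 2 * (A + 2 * e))); first by apply: ler_wpM2l => //; lra.
by move: H; rewrite [(A + e) ^+ 2]expr2 mulrA.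
Qed.

(** The form may be degenerate, so the discriminant bound is used with [a v v + e] in place of
    [a v v], and e goes to 0. *)
Lemma form_cauchy_schwarz V a u v : subspace V -> sym_psd_on V a -> V u -> V v ->
  a u v ^+ 2 <= a u u * a v v.
Proof.
move=> sV [ba sa pa] Vu Vv.
apply: (@ler_all_eps _ _ (a u u)); first exact: pa.
move=> e e0; rewrite -mulrDr.
apply: quadratic_bound => //; first exact: pa.
move=> t; have := pa (t *: v + u) (sV.2 _ _ _ Vv Vu).
by rewrite (bilinear_on_line _ sV ba)// (sa v u)// -mulr2n mulr_natl.
Qed.

(** A minimising sequence of [J v = a v v - 2 F v] is Cauchy by the parallelogram identity, and its
    limit solves the Euler-Lagrange equation. [a] is only semidefinite, so a solution is produced
    without a claim of uniqueness. *)
Lemma riesz V a F (C : R) : subspace V -> sym_psd_on V a ->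
  complete_on V (fun u => a u u) -> linear_on V F ->
  (forall v, V v -> F v ^+ 2 <= C * a v v) ->
  exists2 u, V u & forall v, V v -> a u v = F v.
Proof.
move=> sV spa ca lF bF; have [ba sa pa] := spa.
pose J v := a v v - 2 * F v.
have J_lb v : V v -> - (`|C| + 1) <= J v.
  move=> Vv; have := bF v Vv; have := pa v Vv; have := ler_norm C; rewrite /J.
  move=> h1 h2 h3.
  have : F v ^+ 2 <= (`|C|) * a v v by apply: (le_trans h3); apply: ler_wpM2r.
  have := normr_ge0 C; move: (`|C|) (a v v) (F v) h2 => c A f A0 c0 fcA.
  rewrite leNgt; apply/negP => h.
  have h4 : 0 <= A + c + 1 by lra.
  have h5 : (A + c + 1) ^+ 2 <= (2 * f) ^+ 2 by apply: lerXn2r; rewrite ?nnegrE; lra.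
  have := sqr_ge0 (A - c); nra.
pose S := [set J v | v in V].
have Sinf : has_inf S.
  split; first by exists (J 0); exists 0 => //; exact: sV.1.
  by exists (- (`|C| + 1)) => _ [v Vv <-]; exact: J_lb.
pose i := inf S.
have iJ v : V v -> i <= J v by move=> Vv; apply: ge_inf; [exact: Sinf.2|exists v].
have /choice[u uP] : forall n : nat, exists u, V u /\ J u < i + n.+1%:R^-1.
  move=> n; have n0 : 0 < n.+1%:R^-1 :> R by rewrite invr_gt0.
  have [_ [v Vv <-] Jv] := inf_adherent n0 Sinf.
  by exists v.
have Vu n : V (u n) by have [] := uP n.
have uJ n : J (u n) < i + n.+1%:R^-1 by have [] := uP n.
have mono (n0 n : nat) : (n0 <= n)%N -> (n.+1%:R^-1 : R) <= n0.+1%:R^-1.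
  by move=> ?; rewrite lef_pV2 ?posrE// ler_nat.
have small (e : R) : 0 < e -> exists n0 : nat, n0.+1%:R^-1 < e.
  move=> e0; have [k _ /(_ _ (leqnn k))] := near_infty_natSinv_lt (PosNum e0).
  by exists k.
have [l Vl lP] : exists2 l, V l & forall e : R, 0 < e -> exists n0 : nat,
    forall n : nat, (n0 <= n)%N -> a (u n - l) (u n - l) < e.
  apply: ca => // e e0.
  (* Parallelogram: a(u_m - u_n) = 2 J(u_m) + 2 J(u_n) - 4 J(midpoint) < 2/(m+1) + 2/(n+1) <=
     4/(n0+1). *)
  have [n0 n0e] := small (e / 4) ltac:(lra).
  exists n0 => m n /mono hm /mono hn.
  have Vmid : V (2^-1 *: (u m + u n)).
    by apply: subspaceZ => //; apply: subspaceD.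
  have := iJ _ Vmid; have := uJ m; have := uJ n.
  have Vmn : V (u m + u n) by apply: subspaceD.
  rewrite /J (bilinear_onBB sV ba)//.
  rewrite (linear_onZ sV (ba.1 _ Vmid))// (linear_onZ sV (ba.2 _ Vmn))//.
  rewrite (linear_onD (ba.1 _ Vmn))// !(linear_onD (ba.2 _ _))//.
  rewrite (linear_onZ sV lF)// (linear_onD lF)// (sa (u n) (u m))//.
  move: n0e hm hn; move: (n0.+1%:R^-1) (m.+1%:R^-1) (n.+1%:R^-1) => r0 r1 r2; lra.
exists l => // v Vv.
(* [J (t v + u_n)] stays above the infimum, hence above J(u_n) - 1/(n+1), for every t. The
   discriminant of this nonnegative quadratic in t bounds the residual at u_n; the [+ 1] is the
   slack chosen in [quadratic_bound]. *)
have key n : (a (u n) v - F v) ^+ 2 <= n.+1%:R^-1 * (a v v + 1).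
  apply: quadratic_bound => //; first exact: pa.
  move=> t; have := iJ _ (sV.2 t _ _ Vv (Vu n)); have := uJ n.
  rewrite /J (bilinear_on_line _ sV ba)// lF// (sa v (u n))//.
  move: (n.+1%:R^-1) => r; lra.
apply/eqP; rewrite -subr_eq0 -sqrf_eq0 eq_le sqr_ge0 andbT.
apply: (@ler_all_eps _ _ (2 * (a v v + a v v + 1))).
  by have := pa v Vv; lra.
move=> e e0; have [n1 n1e] := small e e0; have [n2 hn2] := lP e e0.
pose n := maxn n1 n2.
have := hn2 n (leq_maxr _ _); have := key n.
have := mono n1 n (leq_maxl _ _).
have Vnl : V (u n - l) by apply: subspaceB.
have := form_cauchy_schwarz sV spa Vnl Vv.
rewrite (linear_onB sV (ba.1 _ Vv))//.
have := pa _ Vnl; have := pa v Vv.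
move: (a (u n - l) _) (a v v) (a (u n) v) (a l v) (F v) (n.+1%:R^-1).
move=> d A x y f r A0 d0 h1 h2 h3 h4.
have h5 : r * (A + 1) <= e * (A + 1).
  by apply: ler_wpM2r; [lra | exact: le_trans h2 (ltW n1e)].
have h6 : d * A <= e * A by apply: ler_wpM2r; lra.
have := sqr_ge0 ((x - y) + (x - f)); nra.
Qed.

(** Reduction to Riesz by a normal equation. Let T u represent [B u] and f represent F with respect
    to [a]. Then [b u v = B u (T v)] equals [a (T u) (T v)], a symmetric form equivalent to [a].
    Solving [b u v = B v f] gives B v (T u - f) = 0 for all v; taking v = T u - f, coercivity forces
    T u = f up to a null vector of [a], and B u v = a (T u) v = a f v = F v. *)
Lemma lax_milgram V a B F (C M alpha : R) : subspace V -> sym_psd_on V a ->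
  complete_on V (fun u => a u u) -> bilinear_on V B -> 0 <= M ->
  (forall u v, V u -> V v -> B u v ^+ 2 <= M * a u u * a v v) ->
  0 < alpha -> (forall u, V u -> alpha * a u u <= B u u) ->
  linear_on V F -> (forall v, V v -> F v ^+ 2 <= C * a v v) ->
  exists2 u, V u & forall v, V v -> B u v = F v.
Proof.
move=> sV spa ca bB M0 BM al0 Bal lF bF; have [ba sa pa] := spa.
have [f Vf fP] := riesz sV spa ca lF bF.
have /choice[T TP] : forall u, exists w, V u -> V w /\ forall v, V v -> a w v = B u v.
  move=> u; have [Vu|nVu] := pselect (V u); last by exists 0.
  have [] := @riesz V a (B u) (M * a u u) sV spa ca (bB.2 _ Vu).
    by move=> v Vv; exact: BM.
  by move=> w Vw wP; exists w.
have VT u : V u -> V (T u) by move=> /TP[].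
have aT u v : V u -> V v -> a (T u) v = B u v by move=> /TP[_]; exact.
pose b u v := B u (T v).
have bE u v : V u -> V v -> b u v = a (T u) (T v).
  by move=> Vu Vv; rewrite aT//; exact: VT.
have sb u v : V u -> V v -> b u v = b v u.
  by move=> Vu Vv; rewrite !bE// sa//; exact: VT.
have bl w : V w -> linear_on V (b ^~ w).
  by move=> Vw c u v Vu Vv; rewrite /b bB.1//; exact: VT.
(* T is a choice of representatives, possibly nonlinear when [a] is degenerate; linearity of [b] in
   the second argument follows from linearity in the first by symmetry. *)
have spb : sym_psd_on V b.
  split=> //; last by move=> u Vu; rewrite bE//; apply: pa; exact: VT.
  split=> // w Vw c u v Vu Vv.
  by rewrite sb ?bl//; [congr (_ * _ + _); exact: sb | exact: sV.2].
have pb u : V u -> 0 <= b u u by have [_ _] := spb; exact.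
have b_ge u : V u -> alpha ^+ 2 * a u u <= b u u.
  move=> Vu; have h1 := Bal _ Vu.
  have := form_cauchy_schwarz sV spa (VT _ Vu) Vu.
  rewrite aT// -bE//; have := pa _ Vu; have := pb _ Vu.
  move: (a u u) (b u u) (B u u) h1 => A b' c h1 b0 A0 h2.
  have [->|Apos] := eqVneq A 0; first by rewrite mulr0.
  have A1 : 0 < A by rewrite lt0r Apos.
  rewrite -(ler_pM2r A1); apply: le_trans h2.
  have : 0 <= alpha * A by apply: mulr_ge0 => //; lra.
  move=> h3; have := @lerXn2r _ 2 _ _ h3 (le_trans h3 h1) h1; lra.
have b_le u : V u -> b u u <= M * a u u.
  move=> Vu; have := BM _ _ Vu (VT _ Vu).
  rewrite -(bE u u)// -/(b u u); have := pb _ Vu.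
  have [->|bn0] := eqVneq (b u u) 0.
    by move=> _ _; apply: mulr_ge0 => //; exact: pa.
  move=> b0; have b1 : 0 < b u u by rewrite lt0r bn0.
  by rewrite expr2 ler_pM2r.
have cb : complete_on V (fun u => b u u).
  move=> u Vu cu.
  have al2 : 0 < alpha ^+ 2 by apply: exprn_gt0.
  have [|l Vl lP] := ca u Vu.
    move=> e e0; have [n0 hn0] := cu (alpha ^+ 2 * e) (mulr_gt0 al2 e0).
    exists n0 => m n hm hn; have := hn0 m n hm hn.
    have := b_ge _ (subspaceB sV (Vu m) (Vu n)).
    by move=> /le_lt_trans h /h; rewrite ltr_pM2l.
  exists l => // e e0.
  have M1 : 0 < `|M| + 1 by have := normr_ge0 M; lra.
  have [n0 hn0] := lP (e / (`|M| + 1)) (divr_gt0 e0 M1).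
  exists n0 => n /hn0; rewrite ltr_pdivlMr// => h.
  have Vd := subspaceB sV (Vu n) Vl.
  apply: (le_lt_trans (b_le _ Vd)); apply: le_lt_trans h.
  by rewrite mulrC ler_wpM2l ?pa//; have := ler_norm M; lra.
have [u Vu uP] : exists2 u, V u & forall v, V v -> b u v = B v f.
  apply: (@riesz V b (fun v => B v f) (`|M| * a f f / alpha ^+ 2)) => //.
    exact: bB.1.
  move=> v Vv; apply: (le_trans (BM _ _ Vv Vf)).
  have al2 : 0 < alpha ^+ 2 by apply: exprn_gt0.
  have h1 := b_ge _ Vv; have A0 := pa _ Vf; have B0 := pa _ Vv.
  rewrite -!mulrA (mulrCA (a f f)) [_^-1 * _]mulrC.
  apply: (@le_trans _ _ (`|M| * (a v v * a f f))).
    by apply: ler_wpM2r; [apply: mulr_ge0|exact: ler_norm].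
  apply: ler_wpM2l => //; rewrite -[leRHS]mulrA [leLHS]mulrC.
  by apply: ler_wpM2l => //; rewrite ler_pdivlMr// mulrC.
exists u => // v Vv; rewrite -aT// -fP//.
have VTu := VT _ Vu.
have Vd : V (T u - f) by apply: subspaceB.
have d0 : B (T u - f) (T u - f) = 0.
  rewrite (linear_onB sV (bB.2 _ Vd)) //.
  by rewrite -(uP _ Vd) sb// /b subrr.
have ad0 : a (T u - f) (T u - f) = 0.
  apply/eqP; rewrite eq_le pa// andbT -(ler_pM2l al0) mulr0 -d0; exact: Bal.
apply/eqP; rewrite -subr_eq0 -(linear_onB sV (ba.1 _ Vv)) //.
rewrite -sqrf_eq0 eq_le sqr_ge0 andbT.
by have := form_cauchy_schwarz sV spa Vd Vv; rewrite ad0 mul0r.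
Qed.
End forms.

(* A reflexive decision procedure for identities between linear combinations:
   [lmod] reduces an equation in a left module to one scalar equation per atom. *)
Section lmodule_reflection.
Variables (R : pzRingType) (X : lmodType R).

Inductive lterm :=
  | LVar of nat | LZero | LAdd of lterm & lterm | LOpp of lterm | LScale of R & lterm.

Fixpoint leval (s : seq X) t : X :=
  match t with
  | LVar i => nth 0 s i
  | LZero => 0
  | LAdd a b => leval s a + leval s b
  | LOpp a => - leval s a
  | LScale c a => c *: leval s a
  end.

Fixpoint lcoef t (i : nat) : R :=
  match t with
  | LVar j => (i == j)%:R
  | LZero => 0
  | LAdd a b => lcoef a i + lcoef b i
  | LOpp a => - lcoef a i
  | LScale c a => c * lcoef a i
  end.

Lemma levalE s t : leval s t = \sum_(i < size s) lcoef t i *: nth 0 s i.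
Proof.
elim: t => [j||a IHa b IHb|a IHa|c a IHa] /=.
- have [js|js] := ltnP j (size s); last first.
    rewrite nth_default// big1// => i _.
    by rewrite (_ : _ == _ = false) ?scale0r//; apply/eqP => ij; have := ltn_ord i; rewrite ij ltnNge js.
  rewrite (bigD1 (Ordinal js))//= eqxx scale1r big1 ?addr0// => i ij.
  by rewrite (_ : _ == _ = false) ?scale0r//; apply: contraNF ij => /eqP ij; apply/eqP/val_inj.
- by rewrite big1// => i _; rewrite scale0r.
- by rewrite IHa IHb -big_split/=; apply: eq_bigr => i _; rewrite scalerDl.
- by rewrite IHa -sumrN; apply: eq_bigr => i _; rewrite scaleNr.
- by rewrite IHa scaler_sumr; apply: eq_bigr => i _; rewrite scalerA.
Qed.

(** A bounded quantifier that computes: on a concrete list of atoms it unfolds to a conjunction with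
    one scalar equation per atom. *)
Fixpoint lall (n : nat) (P : nat -> Prop) : Prop :=
  if n is n'.+1 then lall n' P /\ P n' else True.

Lemma leval_eq s t1 t2 :
  lall (size s) (fun i => lcoef t1 i = lcoef t2 i) -> leval s t1 = leval s t2.
Proof.
move=> h; rewrite !levalE; apply: eq_bigr => i _; congr (_ *: _).
have := ltn_ord i; move: h; elim: (size s) (nat_of_ord i) => //= n IH j [h hn].
by rewrite ltnS leq_eqVlt => /orP[/eqP ->//|/IH]; exact.
Qed.
End lmodule_reflection.

Ltac lmod_index x s :=
  match s with
  | cons x _ => constr:(O)
  | cons _ ?s' => let k := lmod_index x s' in constr:(S k)
  end.
Ltac lmod_mem x s :=
  match s with
  | cons x _ => constr:(true)
  | cons _ ?s' => lmod_mem x s'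
  | _ => constr:(false)
  end.
Ltac lmod_atoms t s :=
  lazymatch t with
  | (?a + ?b)%R => let s1 := lmod_atoms a s in lmod_atoms b s1
  | (- ?a)%R => lmod_atoms a s
  | (?c *: ?a)%R => lmod_atoms a s
  | (0)%R => s
  | _ => lazymatch lmod_mem t s with true => s | false => constr:(cons t s) end
  end.
Ltac lmod_reify R t s :=
  lazymatch t with
  | (?a + ?b)%R => let x := lmod_reify R a s in let y := lmod_reify R b s in
                   constr:(@LAdd R x y)
  | (- ?a)%R => let x := lmod_reify R a s in constr:(@LOpp R x)
  | (?c *: ?a)%R => let x := lmod_reify R a s in constr:(@LScale R c x)
  | (0)%R => constr:(@LZero R)
  | _ => let k := lmod_index t s in constr:(@LVar R k)
  end.
Ltac lmod_in R X :=
  match goal with |- @eq _ ?l ?r =>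
    let s0 := lmod_atoms l (@nil X) in
    let s := lmod_atoms r s0 in
    let x := lmod_reify R l s in
    let y := lmod_reify R r s in
    refine (@leval_eq R X s x y _); cbn [size lall lcoef]; do ?split; rewrite /=
  end.

(** * Limits and derivatives of vector-valued functions of a real variable *)

Lemma ler_norm_cvg (R : realType) (X : normedModType R) (u : nat -> X) (l : X)
    (f : nat -> R) (c : R) : u n @[n --> \oo] --> l -> f n @[n --> \oo] --> c ->
  (forall n, `|u n| <= f n) -> `|l| <= c.
Proof.
move=> ul fc uf; have ul' : `|u n| @[n --> \oo] --> `|l| by exact: cvg_norm.
by apply: (ler_cvg_to ul' fc); near=> n; exact: uf.
Unshelve. all: by end_near. Qed.

Lemma cvgn_dist0 (R : realType) (X : normedModType R) (u : nat -> X) (l : X) :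
  (u n @[n --> \oo] --> l) <-> (forall e : R, 0 < e -> exists n0 : nat,
     forall n : nat, (n0 <= n)%N -> `|l - u n| < e).
Proof.
split=> [/cvgrPdist_lt ul e /ul [n0 _ h]|h]; first by exists n0 => n; exact: h.
by apply/cvgrPdist_lt => e /h[n0 hn0]; exists n0.
Qed.

Lemma cvgn_dist (R : realType) (X : normedModType R) (u : nat -> X) (l : X) :
  u n @[n --> \oo] --> l -> `|l - u n| @[n --> \oo] --> (0 : R).
Proof.
move=> ul; rewrite -[0 in X in _ --> X](normr0 X) -(subrr l).
by apply: cvg_norm; apply: cvgB => //; exact: cvg_cst.
Qed.

Lemma geometric_small (R : realType) (C e : R) : 0 < e ->
  exists n0 : nat, forall n : nat, (n0 <= n)%N -> 2^-1 ^+ n * C < e.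
Proof.
move=> e0.
have : ((2^-1 : R) ^+ n) * C @[n --> \oo] --> 0 * C.
  by apply: cvgMr_tmp; apply: cvg_expr; rewrite ger0_norm; lra.
rewrite mul0r => /cvgn_dist0 /(_ e e0)[n0 h]; exists n0 => n /h.
by rewrite sub0r normrN; apply: le_lt_trans; exact: ler_norm.
Qed.

Lemma is_derive1P (R : realType) (X : normedModType R) (f : R -> X) (t : R) (D : X) :
  is_derive t 1 f D <-> h^-1 *: (f (t + h) - f t) @[h --> 0^'] --> D.
Proof.
have E : (fun h : R => h^-1 *: ((f \o shift t) (h *: 1) - f t)) =
         (fun h => h^-1 *: (f (t + h) - f t)).
  apply/funext => h /=; congr (_ *: (f _ - _)); rewrite addrC; congr (_ + _).
  exact: mulr1.
split=> [[]|h].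
  by rewrite /derivable /derive E => h1 <-.
split; first by rewrite /derivable E; apply/cvg_ex; exists D.
by rewrite /derive E; apply: cvg_lim.
Qed.

Lemma is_derive1_cvg (R : realType) (X : normedModType R) (f : R -> X) (t : R) (D : X) :
  is_derive t 1 f D -> f (t + h) @[h --> 0^'] --> f t.
Proof.
move=> /is_derive1P h.
have h0 : (x : R) @[x --> 0^'] --> (0 : R) by apply: cvg_within_filter; exact: cvg_id.
have : x *: (x^-1 *: (f (t + x) - f t)) + f t @[x --> 0^'] --> 0 *: D + f t.
  by apply: cvgD; [apply: cvgZ|exact: cvg_cst].
rewrite scale0r add0r; apply: cvg_trans; apply: near_eq_cvg; near=> x.
rewrite scalerA mulfV ?scale1r ?subrK//.
by near: x; exact: nbhs_dnbhs_neq.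
Unshelve. all: by end_near. Qed.

Lemma is_derive1_shiftZ (R : realType) (X : normedModType R) (f : R -> X)
    (t r c : R) (D : X) :
  is_derive (t - r) 1 f D -> is_derive t 1 (fun s => c *: f (s - r)) (c *: D).
Proof.
move=> /is_derive1P df; apply/is_derive1P.
have : c *: (x^-1 *: (f (t - r + x) - f (t - r))) @[x --> 0^'] --> c *: D.
  by apply: cvgZ => //; exact: cvg_cst.
apply: cvg_trans; apply: near_eq_cvg; near=> h.
by rewrite -scalerBr addrAC !scalerA mulrC.
Unshelve. all: by end_near. Qed.

Lemma is_derive1_continuous (R : realType) (X : normedModType R) (f : R -> X) (t : R) (D : X) :
  is_derive t 1 f D -> {for t, continuous f}.
Proof.
by move=> [df _]; apply: differentiable_continuous; apply/derivable1_diffP.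
Qed.

Lemma is_derive1_scale (R : realType) (X : normedModType R) (c : R -> R)
    (f : R -> X) (t c' : R) (D : X) :
  is_derive t 1 c c' -> is_derive t 1 f D ->
  is_derive t 1 (fun s => c s *: f s) (c' *: f t + c t *: D).
Proof.
move=> dc df; apply/is_derive1P.
have : (x^-1 *: (c (t + x) - c t)) *: f (t + x) +
  c t *: (x^-1 *: (f (t + x) - f t)) @[x --> 0^'] --> c' *: f t + c t *: D.
  apply: cvgD; last by apply: cvgZ; [exact: cvg_cst|exact/is_derive1P].
  by apply: cvgZ; [exact/is_derive1P|exact: is_derive1_cvg df].
apply: cvg_trans; apply: near_eq_cvg; near=> x.
have -> : x^-1 *: (c (t + x) - c t) = x^-1 * (c (t + x) - c t) by [].
by lmod_in R X; ring.
Unshelve. all: by end_near. Qed.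

(** The form in which differentiability of the semigroup is obtained. As soon as |h| (|C| + 1) <= e
    the remainder is at most e |h|, whatever the sign of C. *)
Lemma is_derive1_quadratic (R : realType) (X : normedModType R) (f : R -> X)
    (t C r : R) (D : X) : 0 < r ->
  (forall h : R, `|h| < r -> `|f (t + h) - f t - h *: D| <= C * h ^+ 2) ->
  is_derive t 1 f D.
Proof.
move=> r0 fC; apply/is_derive1P/cvgrPdist_le => /= e e0.
near=> h.
have h0 : h != 0 by near: h; exact: nbhs_dnbhs_neq.
have hr : `|h| < r.
  by near: h; apply: dnbhs0_lt.
have hC : `|h| * (`|C| + 1) <= e.
  rewrite -ler_pdivlMr; last by rewrite ltr_wpDl.
  by near: h; apply: dnbhs0_le; rewrite divr_gt0// ltr_wpDl.
rewrite distrC.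
have -> : h^-1 *: (f (t + h) - f t) - D = h^-1 *: (f (t + h) - f t - h *: D).
  by lmod_in R X; field.
rewrite normrZ normfV ler_pdivrMl ?normr_gt0//.
apply: (le_trans (fC _ hr)); rewrite -[h ^+ 2]real_normK ?num_real//.
have := ler_norm C; have := normr_ge0 C; have := normr_ge0 h.
move: (`|h|) (`|C|) hC => p q hC p0 q0 Cq.
have : p * (p * (q + 1)) <= p * e by apply: ler_wpM2l.
have : C * p ^+ 2 <= q * p ^+ 2 by apply: ler_wpM2r => //; exact: sqr_ge0.
have := sqr_ge0 p; lra.
Unshelve. all: by end_near. Qed.

(** * The contraction semigroup of a coercive form *)

Section semigroup.
Variables (R : realType) (X : normedModType R) (ip : X -> X -> R).
Hypothesis ipP : sym_psd_on setT ip.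
Hypothesis ip_norm : forall x, `|x| ^+ 2 = ip x x.
Hypothesis Xc : forall u : nat -> X, (forall e : R, 0 < e -> exists n0 : nat,
  forall m n : nat, (n0 <= m)%N -> (n0 <= n)%N -> `|u m - u n| < e) ->
  exists l : X, u n @[n --> \oo] --> l.
Variables (V : set X) (a B : X -> X -> R) (Cp M alpha : R).
Hypothesis sV : subspace V.
Hypothesis aP : sym_psd_on V a.
Hypothesis ac : complete_on V (fun u => a u u).
Hypothesis BP : bilinear_on V B.
Hypothesis M0 : 0 <= M.
Hypothesis BM : forall u v, V u -> V v -> B u v ^+ 2 <= M * a u u * a v v.
Hypothesis al0 : 0 < alpha.
Hypothesis Bal : forall u, V u -> alpha * a u u <= B u u.
Hypothesis Cp0 : 0 <= Cp.
Hypothesis PC : forall u, V u -> `|u| ^+ 2 <= Cp * a u u.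
Hypothesis Vd : forall x (e : R), 0 < e -> exists2 v, V v & `|x - v| < e.

Let sT : subspace [set: X].
Proof. by []. Qed.

Let ipl v : linear_on setT (ip ^~ v).
Proof. by have [[h _] _ _] := ipP; exact: h. Qed.

Let ipr v : linear_on setT (ip v).
Proof. by have [[_ h] _ _] := ipP; exact: h. Qed.

Let ipC u v : ip u v = ip v u.
Proof. by have [_ h _] := ipP; exact: h. Qed.

Let ipZl c u v : ip (c *: u) v = c * ip u v.
Proof. exact: (linear_onZ sT (ipl v)). Qed.

Let ipBl u w v : ip (u - w) v = ip u v - ip w v.
Proof. exact: (linear_onB sT (ipl v)). Qed.

Let ipBr u w v : ip v (u - w) = ip v u - ip v w.
Proof. exact: (linear_onB sT (ipr v)). Qed.

Lemma ip_cauchy_schwarz u v : `|ip u v| <= `|u| * `|v|.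
Proof.
rewrite -(@ler_pXn2r _ 2)// ?nnegrE ?mulr_ge0// exprMn !ip_norm real_normK ?num_real//.
exact: (form_cauchy_schwarz sT ipP).
Qed.

Lemma ip_le_norm u v : ip u v <= `|u| * `|v|.
Proof. exact: le_trans (ler_norm _) (ip_cauchy_schwarz u v). Qed.

(* [graph u y] states that u is in the domain of the operator L of the form B
   and that L u = y *)
Definition graph u y := V u /\ forall v, V v -> B u v = ip y v.

Lemma graph_lin c u v y z : graph u y -> graph v z ->
  graph (c *: u + v) (c *: y + z).
Proof.
move=> [Vu uP] [Vv vP]; split; first exact: sV.2.
by move=> w Vw; rewrite BP.1// uP// vP// ipl.
Qed.

Lemma graphB u v y z : graph u y -> graph v z -> graph (u - v) (y - z).
Proof.
move=> gu gv; have := graph_lin (-1) gv gu.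
by rewrite !scaleN1r ![- _ + _]addrC.
Qed.

Lemma graph_accretive u y : graph u y -> 0 <= ip y u.
Proof.
move=> [Vu uP]; rewrite -uP//; apply: le_trans (Bal Vu).
by have [_ _ pa] := aP; rewrite mulr_ge0 ?pa// ltW.
Qed.

(** y - z is orthogonal to [V], and [V] is dense: replacing one factor of |y - z|^2 by an
    approximation in [V] leaves |y - z| e. *)
Lemma graph_fun u y z : graph u y -> graph u z -> y = z.
Proof.
move=> [Vu uy] [_ uz].
have d0 v : V v -> ip (y - z) v = 0.
  by move=> Vv; rewrite ipBl -uy// -uz// subrr.
apply/eqP; rewrite -subr_eq0 -normr_eq0 -sqrf_eq0 eq_le sqr_ge0 andbT.
apply: (@ler_all_eps _ _ _ `|y - z|) => // e /(Vd (y - z))[v Vv hv].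
rewrite add0r ip_norm -[X in ip _ X](subrK v) (linear_onD (ipr _))// (d0 v)// addr0.
by apply: (le_trans (ip_le_norm _ _)); rewrite ler_wpM2l// ltW.
Qed.

(** Lax-Milgram for [ip u v + e * B u v = ip f v]. The Poincare constant [Cp] bounds the [ip] part
    in terms of [a]; coercivity is taken from [e * B] alone. *)
Lemma resolvent_ex (e : R) f : 0 < e -> exists u, graph u (e^-1 *: (f - u)).
Proof.
move=> e0.
have [ba sa pa] := aP.
pose D u v := ip u v + e * B u v.
have [|||||||u Vu uP] := @lax_milgram R X V a D (ip f) (`|f| ^+ 2 * Cp)
  (2 * Cp ^+ 2 + 2 * e ^+ 2 * M) (e * alpha) sV aP ac.
- split=> w Vw c u v Vu Vv; rewrite /D.
    by rewrite BP.1// ipl//; ring.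
  by rewrite BP.2// ipr//; ring.
- by rewrite addr_ge0// mulr_ge0 ?exprn_ge0// mulr_ge0 ?exprn_ge0// ltW.
- move=> u v Vu Vv; rewrite /D.
  apply: (@le_trans _ _ (2 * ip u v ^+ 2 + 2 * (e * B u v) ^+ 2)).
    by have := sqr_ge0 (ip u v - e * B u v); nra.
  rewrite [leRHS]mulrAC -mulrA [leRHS]mulrDl; apply: lerD.
    rewrite -!mulrA ler_wpM2l//.
    have -> : Cp * (Cp * (a v v * a u u)) = (Cp * a u u) * (Cp * a v v) by ring.
    apply: (le_trans (form_cauchy_schwarz sT ipP _ _)) => //.
    by rewrite -!ip_norm ler_pM ?sqr_ge0 ?PC.
  have := BM Vu Vv; have := sqr_ge0 e; rewrite exprMn; nra.
- exact: mulr_gt0.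
- move=> u Vu; rewrite /D -mulrA -[leLHS]add0r lerD//.
    by rewrite -ip_norm sqr_ge0.
  by rewrite ler_wpM2l ?Bal// ltW.
- by move=> c u v _ _; rewrite ipr.
- move=> v Vv; rewrite -mulrA.
  apply: (le_trans (form_cauchy_schwarz sT ipP _ _)) => //.
  by rewrite -!ip_norm ler_wpM2l ?sqr_ge0 ?PC.
exists u; split=> // v Vv.
have := uP v Vv; rewrite /D ipZl ipBl => <-.
by field; rewrite gt_eqF.
Qed.

(** J_e f = (1 + e L)^-1 f, expressed through the graph by L u = (f - u)/e. [get] selects a
    solution; [resolvent_graph] shows that it is the only one. *)
Definition resolvent (e : R) f := get [set u | graph u (e^-1 *: (f - u))].
Local Notation J := resolvent.

Lemma resolventP e f : 0 < e -> graph (J e f) (e^-1 *: (f - J e f)).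
Proof.
move=> e0; have [u uP] := resolvent_ex f e0.
by rewrite /resolvent; exact: (@getI _ [set u | graph u (e^-1 *: (f - u))] u).
Qed.

Lemma resolvent_graph (e : R) u y : 0 < e -> graph u y -> J e (u + e *: y) = u.
Proof.
move=> e0 gu; have := graphB (resolventP (u + e *: y) e0) gu.
set w := J _ _; have e1 : e != 0 by rewrite gt_eqF.
have -> : e^-1 *: (u + e *: y - w) - y = - e^-1 *: (w - u).
  by rewrite addrAC scalerDr scalerA mulVf// scale1r addrK scaleNr -scalerN opprB.
move=> /graph_accretive; rewrite ipZl mulNr oppr_ge0 -ip_norm.
rewrite pmulr_rle0 ?invr_gt0// => h.
by apply/eqP; rewrite -subr_eq0 -normr_eq0 -sqrf_eq0 eq_le h sqr_ge0.
Qed.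

Lemma resolvent_lin (e : R) c f g : 0 < e -> J e (c *: f + g) = c *: J e f + J e g.
Proof.
move=> e0; have e1 : e != 0 by rewrite gt_eqF.
rewrite -(resolvent_graph e0 (graph_lin c (resolventP f e0) (resolventP g e0))).
congr (J e _).
rewrite scalerDr !scalerA mulrAC mulfV// mul1r.
by rewrite scalerBr scale1r addrACA [X in _ = X + _]addrC subrK [X in _ = _ + X]addrC subrK.
Qed.

Lemma resolventB (e : R) f g : 0 < e -> J e (f - g) = J e f - J e g.
Proof.
by move=> e0; rewrite -scaleN1r addrC resolvent_lin// scaleN1r addrC.
Qed.

Lemma resolvent0 (e : R) : 0 < e -> J e 0 = 0.
Proof. by move=> e0; have := resolventB 0 0 e0; rewrite !subrr. Qed.

Lemma resolventZ (e : R) c f : 0 < e -> J e (c *: f) = c *: J e f.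
Proof. by move=> e0; rewrite -[c *: f]addr0 resolvent_lin// resolvent0// addr0. Qed.

Lemma resolvent_contr (e : R) f : 0 < e -> `|J e f| <= `|f|.
Proof.
move=> e0; have := graph_accretive (resolventP f e0).
rewrite ipZl pmulr_rge0 ?invr_gt0// ipBl subr_ge0 -ip_norm => h.
have := le_trans h (ip_le_norm _ _).
have [->|n0] := eqVneq (`|J e f|) 0; first by [].
by rewrite expr2 ler_pM2r// lt0r n0 /=.
Qed.

Lemma graph_resolvent (e : R) u y : 0 < e -> graph u y ->
  graph (J e u) (J e y) /\ u - J e u = e *: J e y.
Proof.
move=> e0 gu; have e1 : e != 0 by rewrite gt_eqF.
have uE : u - J e u = e *: J e y.
  rewrite -{1}(resolvent_graph e0 gu) addrC -scaleN1r -resolvent_lin//.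
  by rewrite scaleN1r addrC addrAC subrr add0r resolventZ.
by split=> //; have := resolventP u e0; rewrite uE scalerA mulVf// scale1r.
Qed.

Lemma resolvent_near (e : R) u y : 0 < e -> graph u y -> `|u - J e u| <= e * `|y|.
Proof.
move=> e0 gu; rewrite (graph_resolvent e0 gu).2 normrZ gtr0_norm//.
by rewrite ler_wpM2l ?resolvent_contr// ltW.
Qed.

(** Convergence of J_e v to v for v in [V], where L v need not exist. |v - J v|^2 = e (B(J v, v) -
    B(J v, J v)), and the coercive second term absorbs what the bound on the first one costs. *)
Lemma resolvent_form_near (e : R) v : 0 < e -> V v ->
  `|v - J e v| ^+ 2 <= e * (M * a v v / alpha).
Proof.
move=> e0 Vv; have [VJ JP] := resolventP v e0; have [_ _ pa] := aP.
have Vd' : V (v - J e v) by apply: subspaceB.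
have -> : `|v - J e v| ^+ 2 = e * B (J e v) (v - J e v).
  by rewrite JP// ipZl mulrA mulfV ?gt_eqF// mul1r ip_norm.
rewrite (linear_onB sV (BP.2 _ VJ))//; apply: ler_wpM2l; first exact: ltW.
have h1 := Bal VJ; have h2 := BM VJ Vv.
have h3 := pa _ VJ; have h4 := pa _ Vv.
rewrite ler_pdivlMr//.
move: (B _ (J e v)) (B _ v) (a _ _) (a v v) h1 h2 h3 h4 => p b u w h1 h2 h3 h4.
have h5 : b * alpha <= alpha ^+ 2 * u + M * w.
  have h6 : 0 <= alpha ^+ 2 * u + M * w.
    by apply: addr_ge0; apply: mulr_ge0 => //; exact: sqr_ge0.
  rewrite -[leRHS]ger0_norm//; apply: le_trans (ler_norm _) _.
  rewrite -(@ler_pXn2r _ 2)// ?nnegrE// !real_normK ?num_real//.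
  have h7 : (b * alpha) ^+ 2 <= M * u * w * alpha ^+ 2.
    by rewrite exprMn ler_wpM2r// sqr_ge0.
  have h8 : 0 <= (M * w) * (alpha ^+ 2 * u) by rewrite mulr_ge0 ?(mulr_ge0 M0 h4)// mulr_ge0 ?sqr_ge0.
  by have := sqr_ge0 (alpha ^+ 2 * u - M * w); nra.
have h6 : alpha ^+ 2 * u <= p * alpha.
  by rewrite expr2 -mulrA mulrC; apply: ler_wpM2r => //; exact: ltW.
lra.
Qed.

(** x lies in the domain of L^2, with y = L x and z = L^2 x. *)
Definition graph2 x y z := graph x y /\ graph y z.

Lemma graph2_resolvent (e : R) x y z : 0 < e -> graph2 x y z ->
  graph2 (J e x) (J e y) (J e z).
Proof.
by move=> e0 [/(graph_resolvent e0)[gx _] /(graph_resolvent e0)[gy _]].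
Qed.

(** J_d applied twice maps into the domain of L^2. Density of [V] and [resolvent_form_near] give |x
    - J_d x| <= 3e/8, and the second application costs at most as much again. *)
Lemma graph2_dense x (e : R) : 0 < e ->
  exists x' y z, graph2 x' y z /\ `|x - x'| < e.
Proof.
move=> e0; have e8 : 0 < e / 8 by lra.
have [v Vv xv] := Vd x e8; have [_ _ pa] := aP.
pose K := M * a v v / alpha + 1.
have K0 : 0 < K.
  by rewrite ltr_wpDl// divr_ge0 ?mulr_ge0 ?pa//; exact: ltW.
(* d K = (e/8)^2 makes |v - J_d v| <= e/8; the summand 1 in K keeps it positive. *)
pose d := (e / 8) ^+ 2 / K.
have d0 : 0 < d by rewrite divr_gt0// exprn_gt0.
have vJ : `|v - J d v| <= e / 8.
  rewrite -(@ler_pXn2r _ 2)// ?nnegrE//; last exact: ltW.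
  apply: (le_trans (resolvent_form_near d0 Vv)).
  by rewrite /d mulrAC ler_pdivrMr// ler_wpM2l ?sqr_ge0// /K; lra.
have xJ : `|x - J d x| <= 3 * (e / 8).
  have -> : x - J d x = (x - v) + (v - J d v) - J d (x - v).
    by rewrite resolventB//; lmod_in R X; ring.
  apply: (le_trans (ler_normB _ _)).
  have := ler_normD (x - v) (v - J d v).
  have := resolvent_contr (x - v) d0; lra.
have gx := resolventP x d0; have [gJ _] := graph_resolvent d0 gx.
have [gy] := graph_resolvent d0 gx.
exists (J d (J d x)), (J d (d^-1 *: (x - J d x))).
have := resolventP (d^-1 *: (x - J d x)) d0.
move=> gz; exists (d^-1 *: (d^-1 *: (x - J d x) - J d (d^-1 *: (x - J d x)))).
split; first by [].
have -> : x - J d (J d x) = (x - J d x) + J d (x - J d x).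
  by rewrite resolventB// addrA subrK.
have := ler_normD (x - J d x) (J d (x - J d x)).
have := resolvent_contr (x - J d x) d0; lra.
Qed.

(* the two-step and one-step implicit Euler schemes differ by second order *)
Lemma resolvent_half (h : R) x y z : 0 < h -> graph2 x y z ->
  `|J h (J h x) - J (2 * h) x| <= h ^+ 2 * `|z|.
Proof.
move=> h0 [gx gy]; have h20 : 0 < 2 * h by lra.
have [gQx xQ] := graph_resolvent h20 gx; have [gQy yQ] := graph_resolvent h20 gy.
set q := J _ x in gQx xQ *; set q1 := J _ y in gQx xQ gQy yQ.
set q2 := J _ z in gQy yQ.
have [gPy Py] := graph_resolvent h0 gQy; have [_ Pq] := graph_resolvent h0 gQx.
have [_ PPy] := graph_resolvent h0 gPy.
have Px : J h x = q + h *: J h q1.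
  have -> : x = h *: q1 + (q + h *: q1).
    have /eqP := xQ; rewrite subr_eq => /eqP ->.
    by lmod_in R X; ring.
  by rewrite resolvent_lin// (resolvent_graph h0 gQx) addrC.
(* (1 + hL)^2 = (1 + 2hL) + h^2 L^2, so the difference of the two schemes is exactly - h^2 J_h J_h
   L^2 J_2h x. *)
have -> : J h (J h x) - q = - (h ^+ 2 *: J h (J h q2)).
  rewrite Px addrC [q + _]addrC resolvent_lin//.
  have -> : J h q = q - h *: J h q1 by rewrite -Pq subKr.
  have -> : J h (J h q1) = J h q1 - h *: J h (J h q2) by rewrite -PPy subKr.
  by lmod_in R X; ring.
rewrite normrN normrZ ger0_norm ?sqr_ge0// ler_wpM2l ?sqr_ge0//.
by do 3 (apply: (le_trans (resolvent_contr _ _)) => //).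
Qed.

Lemma iter_resolvent_contr (e : R) k x : 0 < e -> `|iter k (J e) x| <= `|x|.
Proof.
move=> e0; elim: k => [|k IH] //=.
exact: le_trans (resolvent_contr _ e0) IH.
Qed.

Lemma iter_resolvent_lin (e : R) k c x y : 0 < e ->
  iter k (J e) (c *: x + y) = c *: iter k (J e) x + iter k (J e) y.
Proof. by move=> e0; elim: k => [|k IH] //=; rewrite IH resolvent_lin. Qed.

Lemma iter_resolventB (e : R) k x y : 0 < e ->
  iter k (J e) (x - y) = iter k (J e) x - iter k (J e) y.
Proof.
by move=> e0; rewrite addrC -scaleN1r iter_resolvent_lin// scaleN1r addrC.
Qed.

Lemma graph_iter (e : R) k x y : 0 < e -> graph x y ->
  graph (iter k (J e) x) (iter k (J e) y).
Proof.
move=> e0 gx; elim: k => [|k IH] //=.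
by have [] := graph_resolvent e0 IH.
Qed.

Lemma iter_resolvent_near (e : R) k x y : 0 < e -> graph x y ->
  `|x - iter k (J e) x| <= k%:R * e * `|y|.
Proof.
move=> e0 gx; elim: k => [|k IH]; first by rewrite subrr normr0 !mul0r.
rewrite -(subrKA (iter k (J e) x)) iterS.
have := resolvent_near e0 (graph_iter k e0 gx).
have := ler_normD (x - iter k (J e) x) (iter k (J e) x - J e (iter k (J e) x)).
have := ler_wpM2l (ltW e0) (iter_resolvent_contr k y e0).
rewrite -[k.+1]addn1 natrD; lra.
Qed.

(** The steps of length 2h are replaced one at a time. Each replacement makes a local error of at
    most h^2 |z|, which the remaining contractions do not enlarge; L^2 commutes with the steps
    already made. *)
Lemma iter_resolvent_half (h : R) k x y z : 0 < h -> graph2 x y z ->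
  `|iter k.*2 (J h) x - iter k (J (2 * h)) x| <= k%:R * h ^+ 2 * `|z|.
Proof.
move=> h0; have h20 : 0 < 2 * h by lra.
elim: k x y z => [|k IH] x y z gx; first by rewrite subrr normr0 !mul0r.
rewrite doubleS !iterSr.
rewrite -(subrKA (iter k.*2 (J h) (J (2 * h) x))) -iter_resolventB//.
have := IH _ _ _ (graph2_resolvent h20 gx).
have := le_trans (iter_resolvent_contr k.*2 _ h0) (resolvent_half h0 gx).
set p := iter _ _ (_ - _); set r := _ - _.
have := ler_normD p r; have := resolvent_contr z h20.
have kh : 0 <= k%:R * h ^+ 2 by rewrite mulr_ge0// sqr_ge0.
move=> h1 h2 h3 h4; have := ler_wpM2l kh h1.
rewrite -[k.+1]addn1 natrD; lra.
Qed.

(** The error obeys w_(k+1) = J w_k + (k+1) e (y - J y) with |y - J y| <= e |z|, and these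
    increments add up to at most (k e)^2 |z|. *)
Lemma iter_resolvent_taylor (e : R) k x y z : 0 < e -> graph2 x y z ->
  `|iter k (J e) x - x + (k%:R * e) *: y| <= (k%:R * e) ^+ 2 * `|z|.
Proof.
move=> e0 [gx gy]; have [gJx xJ] := graph_resolvent e0 gx.
elim: k => [|k IH].
  by rewrite subrr mul0r scale0r addr0 normr0 expr2 !mul0r.
have yJ := resolvent_near e0 gy.
set w := iter k (J e) x - x + _ in IH.
have -> : iter k.+1 (J e) x - x + (k.+1%:R * e) *: y =
    J e w + (k.+1%:R * e) *: (y - J e y).
  rewrite /w addrC [iter k _ _ - x + _]addrC resolvent_lin// resolventB// -iterS.
  have -> : J e x = x - e *: J e y by rewrite -xJ subKr.
  by rewrite -[k.+1]addn1 natrD; lmod_in R X; ring.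
apply: (le_trans (ler_normD _ _)).
have ke : 0 <= k.+1%:R * e by rewrite mulr_ge0// ltW.
have := resolvent_contr w e0; rewrite normrZ ger0_norm//.
have := ler_wpM2l ke yJ.
have z0 := normr_ge0 z.
have ee : 0 <= e ^+ 2 * `|z| by rewrite mulr_ge0 ?sqr_ge0.
have kk : 0 <= k%:R * (e ^+ 2 * `|z|) by rewrite mulr_ge0.
rewrite -[k.+1]addn1 natrD.
move: (`|J e w|) (`|w|) (`|y - J e y|) IH kk => p p' r IH kk h1 h2; nra.
Qed.

(** * Dyadic Euler schemes and their limit *)

Definition euler (n : nat) (t : R) x := iter (Num.truncn (2 ^+ n * t)) (J (2^-1 ^+ n)) x.

Let e0 n : 0 < (2^-1 : R) ^+ n.
Proof. by apply: exprn_gt0; lra. Qed.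

Lemma truncn_dyadic n (t : R) : 0 <= t ->
  let k := (Num.truncn (2 ^+ n * t))%:R * 2^-1 ^+ n in
  [/\ 0 <= k, k <= t & t <= k + 2^-1 ^+ n].
Proof.
move=> t0 k.
have p0 : 0 < (2 : R) ^+ n by exact: exprn_gt0.
have /andP[h1 h2] := truncn_itv (mulr_ge0 (ltW p0) t0).
rewrite /k exprVn; split; first by rewrite mulr_ge0// invr_ge0 ltW.
  by rewrite ler_pdivrMr// [t * _]mulrC.
rewrite -[X in _ + X]mul1r -mulrDl ler_pdivlMr// [t * _]mulrC natr1; exact: ltW.
Qed.

(** Halving the step turns k steps into 2k or 2k + 1, since floor(2x) is 2 floor(x) or one more.
    Passing to 2k steps is [iter_resolvent_half]; the odd step costs 2^-(n+1) |y|. *)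
Lemma euler_step n (t : R) x y z : 0 <= t -> graph2 x y z ->
  `|euler n.+1 t x - euler n t x| <= 2^-1 ^+ n * (t * `|z| + `|y|).
Proof.
move=> t0 gx; rewrite /euler.
have [k0 kt tk] := truncn_dyadic n t0.
set k := Num.truncn _ in k0 kt tk *; set h : R := 2^-1 ^+ n.+1.
have h0 : 0 < h by exact: e0.
have hE : 2^-1 ^+ n = 2 * h by rewrite /h exprS; lra.
have hk : `|iter k.*2 (J h) x - iter k (J (2^-1 ^+ n)) x| <= h * (t * `|z|).
  rewrite hE; apply: (le_trans (iter_resolvent_half k h0 gx)).
  rewrite mulrA ler_wpM2r// expr2 mulrA mulrC; apply: ler_wpM2l; first exact: ltW.
  by apply: le_trans kt; rewrite hE ler_wpM2l//; lra.
have /orP[] : (Num.truncn (2 ^+ n.+1 * t) == k.*2) ||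
              (Num.truncn (2 ^+ n.+1 * t) == k.*2.+1).
  have p0 : 0 < (2 : R) ^+ n by exact: exprn_gt0.
  have pt : 0 <= 2 ^+ n.+1 * t by rewrite mulr_ge0// exprn_ge0.
  have /andP[h1 h2] := truncn_itv (mulr_ge0 (ltW p0) t0).
  rewrite -/k in h1 h2.
  have a1 : (k.*2 <= Num.truncn (2 ^+ n.+1 * t))%N.
    by rewrite truncn_ge_nat// -mul2n natrM exprS -mulrA ler_wpM2l.
  have : (Num.truncn (2 ^+ n.+1 * t) < k.*2.+2)%N.
    by rewrite truncn_lt_nat// -doubleS -mul2n natrM exprS -mulrA ltr_pM2l.
  rewrite ltnS leq_eqVlt => /orP[/eqP ->|]; first by rewrite eqxx orbT.
  by rewrite ltnS => a2; rewrite eqn_leq a1 a2.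
- move=> /eqP ->; apply: (le_trans hk); rewrite hE.
  have : 0 <= t * `|z| by rewrite mulr_ge0.
  have := normr_ge0 y; nra.
- move=> /eqP ->; rewrite iterS hE.
  have := resolvent_near h0 (graph_iter k.*2 h0 gx.1).
  have := iter_resolvent_contr k.*2 y h0.
  rewrite hE in hk; set w := iter k.*2 _ x in hk *.
  move: hk; set v := iter k _ x => hk h1 h2.
  have := ler_distD w (J h w) v; rewrite (distrC (J h w) w).
  have : 0 <= t * `|z| by rewrite mulr_ge0.
  have : h * `|iter k.*2 (J h) y| <= h * `|y| by rewrite ler_wpM2l// ltW.
  have : 0 <= h * `|y| by rewrite mulr_ge0// ltW.
  move=> h3 h4 h5 h6; have : 0 <= h * (t * `|z|) by rewrite mulr_ge0// ltW.
  lra.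
Qed.

(** Keeping the subtracted remainder of the geometric series makes the estimate close by induction
    on m. *)
Lemma euler_tail n m (t : R) x y z : 0 <= t -> graph2 x y z ->
  `|euler (m + n) t x - euler n t x| <=
    (2 * 2^-1 ^+ n - 2 * 2^-1 ^+ (m + n)) * (t * `|z| + `|y|).
Proof.
move=> t0 gx; elim: m => [|m IH]; first by rewrite !subrr normr0 mul0r.
have := euler_step (m + n) t0 gx; rewrite addSn [in X in _ -> X]exprS.
have := ler_distD (euler (m + n) t x) (euler (m + n).+1 t x) (euler n t x).
lra.
Qed.

Lemma euler_lin n t c x y : euler n t (c *: x + y) = c *: euler n t x + euler n t y.
Proof. exact: iter_resolvent_lin. Qed.

Lemma eulerB n t x y : euler n t (x - y) = euler n t x - euler n t y.
Proof. exact: iter_resolventB. Qed.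

Lemma euler_contr n t x : `|euler n t x| <= `|x|.
Proof. exact: iter_resolvent_contr. Qed.

(** On the domain of L^2 the schemes are Cauchy by [euler_tail]; for general x an approximation x'
    costs twice |x - x'| by contractivity, uniformly in n. *)
Lemma euler_cvg (t : R) x : 0 <= t -> exists l : X, euler n t x @[n --> \oo] --> l.
Proof.
move=> t0; apply: Xc => e ep.
have e4 : 0 < e / 4 by lra.
have [x' [y [z [gx xx']]]] := graph2_dense x e4.
set C := t * `|z| + `|y|.
have e44 : 0 < e / 4 / 4 by lra.
have C0 : 0 <= C by rewrite addr_ge0// mulr_ge0.
have [n0 hn0] := geometric_small C e44; exists n0 => m n hm hn.
have tail k : (n0 <= k)%N -> `|euler k t x' - euler n0 t x'| <= e / 8.
  move=> hk; have := euler_tail n0 (k - n0) t0 gx; rewrite subnK// -/C => h.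
  apply: (le_trans h); have := hn0 n0 (leqnn _); have := e0 k.
  move=> h1 h2; have : 0 <= 2^-1 ^+ k * C by rewrite mulr_ge0// ltW.
  lra.
have -> : euler m t x - euler n t x = euler m t (x - x') - euler n t (x - x') +
   ((euler m t x' - euler n0 t x') - (euler n t x' - euler n0 t x')).
  by rewrite !eulerB; lmod_in R X; ring.
have := tail m hm; have := tail n hn.
have := euler_contr m t (x - x'); have := euler_contr n t (x - x').
set p := euler m t (_ - _); set q := euler n t (_ - _).
set r := euler m _ _ - _; set s := _ - euler n0 _ _.
have := ler_normD (p - q) (r - s); have := ler_normB p q; have := ler_normB r s.
lra.
Qed.

Definition sgroup (t : R) x := lim (euler n t x @[n --> \oo]).
Local Notation S := sgroup.

Lemma sgroup_cvg (t : R) x : 0 <= t -> euler n t x @[n --> \oo] --> S t x.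
Proof. by move=> t0; have [l h] := euler_cvg x t0; apply/cvg_ex; exists l. Qed.
Arguments sgroup_cvg : clear implicits.

Lemma sgroup_lin (t c : R) x y : 0 <= t -> S t (c *: x + y) = c *: S t x + S t y.
Proof.
move=> t0; apply: cvg_lim => //.
under eq_fun do rewrite euler_lin.
by apply: cvgD; [apply: cvgZ; [exact: cvg_cst|]|]; exact: sgroup_cvg.
Qed.

Lemma sgroupB (t : R) x y : 0 <= t -> S t (x - y) = S t x - S t y.
Proof.
by move=> t0; rewrite addrC -scaleN1r sgroup_lin// scaleN1r addrC.
Qed.

Lemma sgroupZ (t c : R) x : 0 <= t -> S t (c *: x) = c *: S t x.
Proof.
move=> t0; have := sgroupB x x t0; rewrite !subrr => S0.
by rewrite -[c *: x]addr0 sgroup_lin// S0 addr0.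
Qed.

Lemma sgroup_contr (t : R) x : 0 <= t -> `|S t x| <= `|x|.
Proof.
move=> t0; apply: (ler_norm_cvg (sgroup_cvg t x t0) (@cvg_cst _ _ _ _ _)) => n.
exact: euler_contr.
Qed.

Lemma sgroup_near (t : R) x y : 0 <= t -> graph x y -> `|x - S t x| <= t * `|y|.
Proof.
move=> t0 gx.
have h : x - euler n t x @[n --> \oo] --> x - S t x.
  by apply: cvgB; [exact: cvg_cst|exact: sgroup_cvg].
apply: (ler_norm_cvg h (@cvg_cst _ _ _ _ _)) => n.
apply: (le_trans (iter_resolvent_near _ (e0 n) gx)); rewrite ler_wpM2r//.
by have [] := truncn_dyadic n t0.
Qed.

Lemma dyadic_cvg (t : R) : 0 <= t ->
  (Num.truncn (2 ^+ n * t))%:R * 2^-1 ^+ n @[n --> \oo] --> t.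
Proof.
move=> t0; apply/cvgn_dist0 => e ep.
have [n0 hn0] := geometric_small 1 ep; exists n0 => n /hn0; rewrite mulr1.
have [_ h1 h2] := truncn_dyadic n t0; rewrite ger0_norm; lra.
Qed.

Arguments dyadic_cvg : clear implicits.

Lemma sgroup_taylor (t : R) x y z : 0 <= t -> graph2 x y z ->
  `|S t x - x + t *: y| <= t ^+ 2 * `|z|.
Proof.
move=> t0 gx.
have h : euler n t x - x + ((Num.truncn (2 ^+ n * t))%:R * 2^-1 ^+ n) *: y
    @[n --> \oo] --> S t x - x + t *: y.
  apply: cvgD; first by apply: cvgB; [exact: sgroup_cvg|exact: cvg_cst].
  by apply: cvgZ; [exact: dyadic_cvg|exact: cvg_cst].
apply: (ler_norm_cvg h (@cvg_cst _ _ _ _ _)) => n.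
apply: (le_trans (iter_resolvent_taylor _ (e0 n) gx)); rewrite ler_wpM2r//.
have [h1 h2 _] := truncn_dyadic n t0.
by apply: lerXn2r; rewrite ?nnegrE.
Qed.

(** floor(2^n s) + floor(2^n t) and floor(2^n (s + t)) differ by at most one, and one step costs at
    most 2^-n |y|: the schemes compose up to a vanishing error. *)
Lemma sgroup_add_graph2 (s t : R) x y z : 0 <= s -> 0 <= t -> graph2 x y z ->
  S (s + t) x = S s (S t x).
Proof.
move=> s0 t0 gx; have st0 : 0 <= s + t by rewrite addr_ge0.
apply/eqP; rewrite -subr_eq0 -normr_le0.
have h1 : 2^-1 ^+ n * `|y| + `|S t x - euler n t x| @[n --> \oo] --> (0 : R).
  rewrite -[0]addr0; apply: cvgD.
    by apply/cvgn_dist0 => e ep; have [n0 hn] := geometric_small `|y| ep;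
      exists n0 => n /hn; rewrite sub0r normrN ger0_norm// mulr_ge0// ltW.
  by apply: cvgn_dist; exact: sgroup_cvg.
have h : euler n (s + t) x - euler n s (S t x) @[n --> \oo] -->
    S (s + t) x - S s (S t x) by apply: cvgB; exact: sgroup_cvg.
apply: (ler_norm_cvg h h1) => n.
rewrite -(subrKA (euler n s (euler n t x))) -eulerB.
apply: (le_trans (ler_normD _ _)); apply: lerD; last first.
  by rewrite [leRHS]distrC; exact: euler_contr.
rewrite /euler -iterD; set k := Num.truncn (_ * t); set l := Num.truncn (_ * s).
have p0 : 0 < (2 : R) ^+ n by exact: exprn_gt0.
have /andP[a1 a2] := truncn_itv (mulr_ge0 (ltW p0) t0).
have /andP[b1 b2] := truncn_itv (mulr_ge0 (ltW p0) s0).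
have pst : 0 <= 2 ^+ n * (s + t) by rewrite mulr_ge0// ltW.
have c1 : (l + k <= Num.truncn (2 ^+ n * (s + t)))%N.
  by rewrite truncn_ge_nat// natrD mulrDr lerD.
have : (Num.truncn (2 ^+ n * (s + t)) < (l + k).+2)%N.
  by rewrite truncn_lt_nat// -addnS -addSn natrD mulrDr ltrD.
rewrite ltnS leq_eqVlt => /orP[/eqP ->|]; last first.
  rewrite ltnS => c2; rewrite (_ : Num.truncn _ = l + k)%N; last first.
    by apply/eqP; rewrite eqn_leq c1 c2.
  by rewrite subrr normr0 mulr_ge0// ltW.
rewrite iterS distrC; apply: (le_trans (resolvent_near (e0 n) (graph_iter _ (e0 n) gx.1))).
by rewrite ler_wpM2l ?iter_resolvent_contr// ltW.
Qed.

Lemma norm_le_eps (C : R) (x : X) : (forall e : R, 0 < e -> `|x| <= C * e) -> x = 0.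
Proof.
move=> h; apply/eqP; rewrite -normr_le0.
apply: (@ler_all_eps _ _ _ `|C|) => // e ep; rewrite add0r.
by apply: (le_trans (h e ep)); rewrite ler_wpM2r ?ler_norm// ltW.
Qed.

Lemma sgroup_add (s t : R) x : 0 <= s -> 0 <= t -> S (s + t) x = S s (S t x).
Proof.
move=> s0 t0; apply/eqP; rewrite -subr_eq0; apply/eqP.
apply: (@norm_le_eps 2) => e ep; have [x' [y [z [gx xx']]]] := graph2_dense x ep.
have st0 : 0 <= s + t by rewrite addr_ge0.
have -> : S (s + t) x - S s (S t x) = S (s + t) (x - x') - S s (S t (x - x')).
  by rewrite !sgroupB// (sgroup_add_graph2 s0 t0 gx); lmod_in R X; ring.
have := sgroup_contr (x - x') st0.
have := le_trans (sgroup_contr (S t (x - x')) s0) (sgroup_contr (x - x') t0).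
have := ler_normB (S (s + t) (x - x')) (S s (S t (x - x'))); lra.
Qed.

Lemma sgroup_right_cvg x : S t x @[t --> 0^'+] --> x.
Proof.
apply/cvgrPdist_le => e ep; have e3 : 0 < e / 3 by lra.
have [x' [y [z [[gx _] xx']]]] := graph2_dense x e3.
near=> t.
have t0 : 0 < t by near: t; exact: nbhs_right_gt.
have ty : t * (`|y| + 1) <= e / 3.
  rewrite -ler_pdivlMr; last by rewrite ltr_wpDl.
  near: t; apply: nbhs_right_le; rewrite divr_gt0// ltr_wpDl//.
have -> : x - S t x = (x - x') + (x' - S t x') - S t (x - x').
  by rewrite sgroupB ?ltW//; lmod_in R X; ring.
have := sgroup_near (ltW t0) gx; have := sgroup_contr (x - x') (ltW t0).
have := ler_normB (x - x' + (x' - S t x')) (S t (x - x')).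
have := ler_normD (x - x') (x' - S t x'); nra.
Unshelve. all: by end_near. Qed.

(** L u = y is equivalent to J_1 (u + y) = u, an equation between continuous maps. *)
Lemma graph_closed (u y : nat -> X) (l m : X) : (forall n, graph (u n) (y n)) ->
  u n @[n --> \oo] --> l -> y n @[n --> \oo] --> m -> graph l m.
Proof.
move=> g ul ym.
suff JE : J 1 (l + m) = l.
  by have := resolventP (l + m) ltr01; rewrite JE invr1 scale1r addrAC subrr add0r.
have h1 : u n - J 1 (l + m) @[n --> \oo] --> l - J 1 (l + m).
  by apply: cvgB => //; exact: cvg_cst.
have h2 : `|u n - l| + `|y n - m| @[n --> \oo] --> (0 : R).
  rewrite -[0]addr0; apply: cvgD.
    by under eq_fun do rewrite distrC; exact: cvgn_dist.
  by under eq_fun do rewrite distrC; exact: cvgn_dist.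
apply/eqP; rewrite eq_sym -subr_eq0 -normr_le0.
apply: (ler_norm_cvg h1 h2) => n.
rewrite -{1}(resolvent_graph ltr01 (g n)) scale1r -resolventB//.
apply: (le_trans (resolvent_contr _ ltr01)).
by rewrite opprD addrACA; exact: ler_normD.
Qed.

Lemma graph_sgroup (t : R) x y : 0 <= t -> graph x y -> graph (S t x) (S t y).
Proof.
move=> t0 gx; apply: (graph_closed _ (sgroup_cvg t x t0) (sgroup_cvg t y t0)) => n.
exact: graph_iter.
Qed.

(** * Smoothing and differentiability of the semigroup *)

Let A := M / (2 * alpha ^+ 2).

(** u - J u = e L J u is tested with J u, and |u - J u|^2 >= 0 gives 2 ip(u - J u, J u) <= |u|^2 -
    |J u|^2. *)
Lemma resolvent_energy (e : R) u : 0 < e ->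
  `|J e u| ^+ 2 + 2 * (e * B (J e u) (J e u)) <= `|u| ^+ 2.
Proof.
move=> ep; have [VJ JP] := resolventP u ep.
have -> : e * B (J e u) (J e u) = ip (u - J e u) (J e u).
  by rewrite JP// ipZl mulrA mulfV ?gt_eqF// mul1r.
have := sqr_ge0 `|u - J e u|; rewrite !ip_norm !ipBl !ipBr (ipC (J e u) u); lra.
Qed.

(* discrete Lyapunov function: the factor k(k+1) produces the decay in 1/(k e) *)
Lemma lyapunov_step (e : R) k u y : 0 < e -> (1 <= k)%N -> graph u y ->
  A * `|J e u| ^+ 2 + e ^+ 2 * (k.+1%:R * k.+2%:R) * `|J e y| ^+ 2 <=
  A * `|u| ^+ 2 + e ^+ 2 * (k%:R * k.+1%:R) * `|y| ^+ 2.
Proof.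
move=> ep k1 gu; have [[VJ JP] _] := graph_resolvent ep gu.
have [VJy _] := resolventP y ep; have [_ _ pa] := aP.
have h1 := resolvent_energy u ep; have h2 := resolvent_energy y ep.
have h3 := Bal VJ; have h4 := Bal VJy; have h5 := BM VJ VJy.
rewrite JP// -ip_norm in h5.
have h6 := pa _ VJ; have h7 := pa _ VJy.
have K1 : 1 <= (k%:R : R) by rewrite ler1n.
rewrite -[k.+2]addn2 -[k.+1]addn1 !natrD.
have A0 : 0 <= A by rewrite divr_ge0// mulr_ge0// sqr_ge0.
have AE : A * alpha ^+ 2 * 2 = M by rewrite /A; field; rewrite gt_eqF.
move: (k%:R : R) K1 => K K1.
move: (`|J e u| ^+ 2) (`|J e y| ^+ 2) (`|u| ^+ 2) (`|y| ^+ 2)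
  (B (J e u) _) (B (J e y) _) (a (J e u) _) (a (J e y) _)
  (sqr_ge0 `|J e y|) h1 h2 h3 h4 h5 h6 h7.
move=> U Y U0 Y0 b b' p q Yge h1 h2 h3 h4 h5 h6 h7.
pose P := e * A * alpha * p; pose Q := e * alpha * q * (e ^+ 2 * (K * (K + 1))).
have K0 : 0 <= K * (K + 1) by nra.
have ep' := ltW ep; have al' := ltW al0.
have P0 : 0 <= P by rewrite /P; do 3 apply: mulr_ge0 => //.
have Q0 : 0 <= Q by rewrite /Q; apply: mulr_ge0; [rewrite !mulr_ge0|rewrite mulr_ge0 ?sqr_ge0].
(* Raising k(k+1) to (k+1)(k+2) costs 2 e^2 (k+1) |J y|^2, to be paid by twice the dissipations P
   and Q of the two energy inequalities. As |J y|^2 = B(J u, J y), its square is at most M p q. With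
   2 A alpha^2 = M, the inequality (e^2 (k+1) |J y|^2)^2 <= 4 P Q reduces to (k+1)^2 <= 2 k (k+1),
   which is where 1 <= k enters. *)
have key : e ^+ 2 * (K + 1) * Y <= P + Q.
  rewrite -[leRHS]ger0_norm; last lra.
  apply: le_trans (ler_norm _) _.
  rewrite -(@ler_pXn2r _ 2)// ?nnegrE// !real_normK ?num_real//.
  apply: (@le_trans _ _ (4 * P * Q)); last by have := sqr_ge0 (P - Q); nra.
  have -> : 4 * P * Q = (e ^+ 2) ^+ 2 * ((A * alpha ^+ 2 * 2) * p * q) * (2 * (K * (K + 1))).
    by rewrite /P /Q; ring.
  rewrite AE; have -> : (e ^+ 2 * (K + 1) * Y) ^+ 2 = (e ^+ 2) ^+ 2 * Y ^+ 2 * (K + 1) ^+ 2 by ring.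
  have h12 : 0 <= (e ^+ 2) ^+ 2 * Y ^+ 2 by rewrite mulr_ge0 ?sqr_ge0.
  apply: ler_pM => //; first exact: sqr_ge0; last nra.
  by apply: ler_wpM2l => //; exact: sqr_ge0.
have h8 : A * (U + 2 * (e * b)) <= A * U0 by rewrite ler_wpM2l.
have h9 : A * (2 * (e * (alpha * p))) <= A * (2 * (e * b)).
  by do 3 apply: ler_wpM2l => //.
have c0 : 0 <= e ^+ 2 * (K * (K + 1)) by rewrite mulr_ge0 ?sqr_ge0.
have h10 : (e ^+ 2 * (K * (K + 1))) * (Y + 2 * (e * b')) <= e ^+ 2 * (K * (K + 1)) * Y0.
  by rewrite ler_wpM2l.
have h11 : (e ^+ 2 * (K * (K + 1))) * (2 * (e * (alpha * q))) <=
           (e ^+ 2 * (K * (K + 1))) * (2 * (e * b')).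
  by do 3 apply: ler_wpM2l => //.
move: key; rewrite /P /Q => key.
lra.
Qed.

(** The Lyapunov function does not increase from k = 1 on. Its value there is controlled by e J y =
    x - J x, of norm at most 2 |x|, which gives 2 * 2^2 = 8; at the end k^2 <= k(k+1). *)
Lemma iter_smoothing (e : R) k x y : 0 < e -> graph x y ->
  (k%:R * e) ^+ 2 * `|iter k (J e) y| ^+ 2 <= (A + 8) * `|x| ^+ 2.
Proof.
move=> ep gx; have A0 : 0 <= A by rewrite divr_ge0// mulr_ge0// sqr_ge0.
case: k => [|k].
  by rewrite mul0r expr0n mul0r mulr_ge0 ?sqr_ge0//; lra.
have /(le_trans _) : A * `|iter k.+1 (J e) x| ^+ 2 +
    e ^+ 2 * (k.+1%:R * k.+2%:R) * `|iter k.+1 (J e) y| ^+ 2 <= (A + 8) * `|x| ^+ 2.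
  elim: k => [|k IH].
    rewrite /= mulrDl; have [_ xJ] := graph_resolvent ep gx.
    apply: lerD.
      rewrite ler_wpM2l//; apply: lerXn2r; rewrite ?nnegrE//; exact: resolvent_contr.
    have : `|e *: J e y| ^+ 2 <= (2 * `|x|) ^+ 2.
      apply: lerXn2r; rewrite ?nnegrE ?mulr_ge0// -xJ.
      by have := ler_normB x (J e x); have := resolvent_contr x ep; lra.
    rewrite normrZ gtr0_norm// !exprMn; lra.
  exact: le_trans (lyapunov_step ep _ (graph_iter k.+1 ep gx)) IH.
apply; rewrite -[leLHS]add0r; apply: lerD.
  by rewrite mulr_ge0 ?sqr_ge0.
rewrite ler_wpM2r ?sqr_ge0// exprMn mulrC ler_wpM2l ?sqr_ge0//.
by rewrite expr2 ler_wpM2l// ler_nat.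
Qed.

Let K := Num.sqrt (A + 8).

Lemma sgroup_smoothing (t : R) x y : 0 <= t -> graph x y -> t * `|S t y| <= K * `|x|.
Proof.
move=> t0 gx; have A0 : 0 <= A by rewrite divr_ge0// mulr_ge0// sqr_ge0.
have h : ((Num.truncn (2 ^+ n * t))%:R * 2^-1 ^+ n) *: euler n t y
    @[n --> \oo] --> t *: S t y.
  by apply: cvgZ; [exact: dyadic_cvg|exact: sgroup_cvg].
have -> : t * `|S t y| = `|t *: S t y| by rewrite normrZ ger0_norm.
apply: (ler_norm_cvg h (@cvg_cst _ _ _ _ _)) => n.
rewrite -(@ler_pXn2r _ 2)// ?nnegrE ?mulr_ge0 ?sqrtr_ge0//.
rewrite normrZ !exprMn sqr_sqrtr; last lra.
rewrite real_normK ?num_real//.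
exact: iter_smoothing.
Qed.

(** For u_n in the domain of L tending to x, [sgroup_smoothing] bounds L S_t (u_m - u_n) by a
    constant times |u_m - u_n| / t; hence L S_t u_n converges, and the graph is closed. *)
Lemma sgroup_graph (t : R) x : 0 < t -> exists y, graph (S t x) y.
Proof.
move=> t0; have t1 := ltW t0.
have /choice[f fP] : forall n : nat, exists p : X * X * X,
    graph2 p.1.1 p.1.2 p.2 /\ `|x - p.1.1| < 2^-1 ^+ n.
  by move=> n; have [x' [y [z h]]] := graph2_dense x (e0 n); exists (x', y, z).
pose u n := (f n).1.1; pose v n := (f n).1.2.
have g n : graph (u n) (v n) by have [[]] := fP n.
have xu n : `|x - u n| < 2^-1 ^+ n by have [] := fP n.
have uv m n : `|S t (v m) - S t (v n)| <= t^-1 * (K * `|u m - u n|).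
  rewrite -sgroupB// ler_pdivlMl//; apply: sgroup_smoothing => //; exact: graphB.
have [l hl] : exists l : X, S t (v n) @[n --> \oo] --> l.
  apply: Xc => e ep.
  have [n0 hn0] := geometric_small (t^-1 * (K * 2)) ep; exists n0 => m n hm hn.
  apply: le_lt_trans (uv m n) _; apply: le_lt_trans (hn0 n0 (leqnn _)).
  rewrite [leRHS]mulrCA ler_wpM2l ?invr_ge0// [leRHS]mulrCA ler_wpM2l ?sqrtr_ge0//.
  have mono k : (n0 <= k)%N -> (2^-1 : R) ^+ k <= 2^-1 ^+ n0.
    by move=> hk; apply: ler_wiXn2l => //; lra.
  have -> : u m - u n = (x - u n) - (x - u m) by lmod_in R X; ring.
  have := ler_normB (x - u n) (x - u m).
  have := xu m; have := xu n; have := mono m hm; have := mono n hn; lra.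
exists l; apply: (graph_closed (fun n => graph_sgroup t1 (g n)) _ hl).
apply/cvgn_dist0 => e ep; have [n0 hn0] := geometric_small 1 ep.
exists n0 => n /hn0; rewrite mulr1 => h; rewrite -sgroupB//.
by apply: le_lt_trans (sgroup_contr _ t1) _; apply: lt_trans h.
Qed.

Lemma sgroup_graph2 (t : R) x : 0 < t -> exists y z, graph2 (S t x) y z.
Proof.
move=> t0; have t2 : 0 < t / 2 by lra.
have [y gy] := sgroup_graph x t2; have [z gz] := sgroup_graph y t2.
exists (S (t / 2) y), z; split=> //.
rewrite (_ : S t x = S (t / 2) (S (t / 2) x)); last first.
  by rewrite -sgroup_add; [congr (S _ x); lra|lra|lra].
by apply: graph_sgroup => //; lra.
Qed.

(** For h < 0 the expansion is made at the earlier time, through S_t = S_(t+h) S_(-h). Exchanging y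
    for S_(-h) y adds a second h^2 |z|, whence the factor 2. *)
Lemma sgroup_quadratic (t h : R) x y z : 0 <= t -> graph2 x y z -> 0 <= t + h ->
  `|S (t + h) x - S t x - h *: - S t y| <= 2 * `|z| * h ^+ 2.
Proof.
move=> t0 gx th.
have zh : 0 <= `|z| * h ^+ 2 by rewrite mulr_ge0 ?sqr_ge0.
have [h0|h0] := leP 0 h.
  have -> : S (t + h) x - S t x - h *: - S t y = S t (S h x - x + h *: y).
    rewrite sgroup_add// -[S h x - x + _]addrC sgroup_lin// sgroupB//.
    by lmod_in R X; ring.
  apply: (le_trans (sgroup_contr _ t0)); apply: (le_trans (sgroup_taylor h0 gx)).
  lra.
have k0 : 0 <= - h by rewrite oppr_ge0 ltW.
have St v : S t v = S (t + h) (S (- h) v) by rewrite -sgroup_add// addrK.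
have -> : S (t + h) x - S t x - h *: - S t y =
   S (t + h) (- (S (- h) x - x + (- h) *: y)) + (- h) *: S (t + h) (y - S (- h) y).
  rewrite -[- (S (- h) x - x + - h *: y)]scaleN1r sgroupZ//.
  rewrite -[S (- h) x - x + _]addrC sgroup_lin// !sgroupB// -!St.
  by lmod_in R X; ring.
apply: (le_trans (ler_normD _ _)).
have := sgroup_contr (- (S (- h) x - x + (- h) *: y)) th; rewrite normrN.
have := sgroup_taylor k0 gx; have := sgroup_near k0 gx.2.
have := sgroup_contr (y - S (- h) y) th.
rewrite normrZ ger0_norm// sqrrN.
set p := `|S _ (y - _)|; set q := `|y - _| => h1 h2 h3 h4.
have h5 : - h * p <= - h * (- h * `|z|) by apply: ler_wpM2l => //; exact: le_trans h1 h2.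
move: h5 h3 h4; rewrite expr2; lra.
Qed.

Lemma cvg_ip (T : Type) (F : set_system T) (FF : Filter F) (f g : T -> X) (u v : X) :
  f x @[x --> F] --> u -> g x @[x --> F] --> v ->
  ip (f x) (g x) @[x --> F] --> ip u v.
Proof.
move=> fu gv.
have h : `|f x - u| * `|g x - v| + `|f x - u| * `|v| + `|u| * `|g x - v| @[x --> F] --> (0 : R).
  have f0 : `|f x - u| @[x --> F] --> (0 : R).
    rewrite -(normr0 X) -(subrr u); apply: cvg_norm; apply: cvgB => //; exact: cvg_cst.
  have g0 : `|g x - v| @[x --> F] --> (0 : R).
    rewrite -(normr0 X) -(subrr v); apply: cvg_norm; apply: cvgB => //; exact: cvg_cst.
  have -> : 0 = 0 * 0 + 0 * `|v| + `|u| * 0 :> R by ring.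
  by apply: cvgD; [apply: cvgD; apply: cvgM|apply: cvgM] => //; exact: cvg_cst.
apply/cvgrPdist_lt => e ep; move/cvgrPdist_lt: h => /(_ e ep).
apply: filterS => x; rewrite sub0r normrN; apply: le_lt_trans; rewrite distrC.
apply: le_trans (ler_norm _).
have -> : ip (f x) (g x) - ip u v = ip (f x - u) (g x - v) + ip (f x - u) v + ip u (g x - v).
  by rewrite !ipBl !ipBr; lra.
apply: le_trans (ler_normD _ _) _; apply: lerD; last exact: ip_cauchy_schwarz.
by apply: le_trans (ler_normD _ _) _; apply: lerD; exact: ip_cauchy_schwarz.
Qed.

Lemma is_derive1_ip (f : R -> X) (t : R) (D w : X) :
  is_derive t 1 f D -> is_derive t 1 (fun s => ip (f s) w : R) (ip D w).
Proof.
move=> df; apply/is_derive1P.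
have : ip (h^-1 *: (f (t + h) - f t)) w @[h --> 0^'] --> ip D w.
  by apply: cvg_ip; [exact/is_derive1P|exact: cvg_cst].
apply: cvg_trans; apply: near_eq_cvg; near=> h.
by rewrite ipZl ipBl.
Unshelve. all: by end_near. Qed.

Lemma is_derive1_sqr_norm (f : R -> X) (t : R) (D : X) :
  is_derive t 1 f D -> is_derive t 1 (fun s => `|f s| ^+ 2 : R) (2 * ip D (f t)).
Proof.
move=> df; apply/is_derive1P.
have h : f (t + h) + f t @[h --> 0^'] --> f t + f t.
  by apply: cvgD; [exact: is_derive1_cvg df|exact: cvg_cst].
have := cvg_ip _ ((is_derive1P _ _ _).1 df) h.
have -> : ip D (f t + f t) = 2 * ip D (f t) by rewrite (linear_onD (ipr _))//; lra.
move=> /(_ _); apply: cvg_trans; apply: near_eq_cvg; near=> k.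
rewrite ipZl ipBl !(linear_onD (ipr _))// !ip_norm (ipC (f t) (f (t + k))).
rewrite [RHS]/(_ * _); congr (_ * _); lra.
Unshelve. all: by end_near. Qed.

(** At time t/2 the orbit already lies in the domain of L^2, so the quadratic remainder holds on
    both sides of t, for |h| < t/2. *)
Lemma sgroup_derive (t : R) x y : 0 < t -> graph (S t x) y ->
  is_derive t 1 (S ^~ x) (- y).
Proof.
move=> t0 gy; have t2 : 0 < t / 2 by lra.
have [y1 [z1 gx1]] := sgroup_graph2 x t2.
have yE : y = S (t / 2) y1.
  apply: (graph_fun gy); have := graph_sgroup (ltW t2) gx1.1.
  rewrite -sgroup_add ?(ltW t2)//; congr (graph (S _ _) _); lra.
apply: (is_derive1_quadratic t2 (C := 2 * `|z1|)) => h ht.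
have : - (t / 2) < h < t / 2 by rewrite -ltr_norml.
move=> /andP[h1 h2]; have th : 0 <= t / 2 + h by lra.
rewrite (_ : t + h = (t / 2 + h) + t / 2); last lra.
have -> : S t x = S (t / 2) (S (t / 2) x).
  by rewrite -sgroup_add ?(ltW t2)//; congr (S _ _); lra.
rewrite sgroup_add ?(ltW t2)// yE.
exact: sgroup_quadratic (ltW t2) gx1 th.
Qed.

Lemma sgroup_C0 : C0_contraction_semigroup S.
Proof.
split.
- by move=> t t0 c x y; rewrite sgroup_lin ?ltW.
- by move=> s t s0 t0; apply/funext => x /=; rewrite sgroup_add ?ltW.
- exact: sgroup_right_cvg.
- by move=> t x t0; apply: sgroup_contr; exact: ltW.
Qed.

Lemma is_derive1_near (f g : R -> X) (t : R) (D : X) :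
  (\forall s \near t, f s = g s) -> is_derive t 1 f D -> is_derive t 1 g D.
Proof.
move=> fg /is_derive1P df; apply/is_derive1P; apply: cvg_trans df.
apply: near_eq_cvg; near=> h.
have -> : f t = g t by exact: nbhs_singleton fg.
suff -> : f (t + h) = g (t + h) by [].
near: h; apply: nbhs_dnbhs.
have : t + h @[h --> (0 : R)] --> t.
  by rewrite -[X in _ --> X]addr0; apply: cvgD; [exact: cvg_cst|exact: cvg_id].
by move=> /(_ _ fg).
Unshelve. all: by end_near. Qed.

Variables (gamma : R) (x0 : X) (u : R -> X).
Hypothesis uE : forall t : R, 0 < t -> u t = expR (gamma * t) *: S t x0.

Lemma is_derive1_expS (t : R) x y : 0 < t -> graph (S t x) y ->
  is_derive t 1 (fun s => expR (gamma * s) *: S s x)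
    (expR (gamma * t) *: (gamma *: S t x - y)).
Proof.
move=> t0 gy.
have de : is_derive t 1 (fun s : R => expR (gamma * s)) (gamma * expR (gamma * t)).
  have h : is_derive t 1 ( *%R gamma) gamma.
    by apply: is_derive_eq; rewrite /GRing.scale /= mulr1 ?mul0r ?addr0.
  rewrite mulrC.
  exact: (@is_derive1_comp _ expR ( *%R gamma) t _ _ (is_derive_expR (gamma * t)) h).
have := is_derive1_scale de (sgroup_derive t0 gy).
by move=> h; apply: (is_derive_eq h); lmod_in R X; ring.
Qed.

(** Each derivative spends half of the time lag. On s > t0/2 the k-th derivative is an orbit issued
    from y; after a further t0/2 its base point S (t0/2) y is in the domain of L, so that gamma - L
    applies to it and gives the base point of the next derivative. *)
Lemma sgroup_derive1n k (t0 : R) : 0 < t0 -> exists y,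
  forall s, t0 < s -> derive1n k u s = expR (gamma * s) *: S (s - t0) y.
Proof.
elim: k t0 => [|k IH] t0 tp.
  exists (S t0 x0) => s st; have s0 : 0 < s by lra.
  rewrite /derive1n /= uE// -sgroup_add ?subrK// ?(ltW tp)//; lra.
have t2 : 0 < t0 / 2 by lra.
have [y yP] := IH _ t2.
have [y1 [z1 [gy1 gz1]]] := sgroup_graph2 y t2.
exists (gamma *: S (t0 / 2) y - y1) => s st.
rewrite derive1nS derive1E.
have sr : 0 <= s - t0 by lra.
have gs : graph (S (s - t0 / 2) y) (S (s - t0) y1).
  have -> : s - t0 / 2 = (s - t0) + t0 / 2 by lra.
  by rewrite sgroup_add ?(ltW t2)//; apply: graph_sgroup.
have ss : 0 < s - t0 / 2 by lra.
have d1 := is_derive1_expS ss gs.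
have d2 : is_derive s 1 (fun r => expR (gamma * (t0 / 2)) *:
    (expR (gamma * (r - t0 / 2)) *: S (r - t0 / 2) y))
   (expR (gamma * (t0 / 2)) *: (expR (gamma * (s - t0 / 2)) *:
     (gamma *: S (s - t0 / 2) y - S (s - t0) y1))).
  by apply: (is_derive1_shiftZ (f := fun r => expR (gamma * r) *: S r y)).
have SE : S (s - t0 / 2) y = S (s - t0) (S (t0 / 2) y).
  by rewrite -sgroup_add ?(ltW t2)//; congr (S _ y); lra.
have {}d2 := is_derive_eq d2 (erefl _).
rewrite [X in gamma *: X - _]SE -sgroupZ// -sgroupB// scalerA -expRD in d2.
rewrite -mulrDr (_ : t0 / 2 + _ = s) in d2; last lra.
have d3 := is_derive1_near _ d2; rewrite (@derive_val _ _ _ _ _ _ _ (d3 _ _))//.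
near=> r; rewrite yP; last by near: r; apply: lt_nbhsr; lra.
by rewrite scalerA -expRD -mulrDr addrC subrK.
Unshelve. all: by end_near. Qed.

Lemma sgroup_smooth : smooth_on_pos u.
Proof.
move=> k t tp; have t2 : 0 < t / 2 by lra.
have [y yP] := sgroup_derive1n k t2.
have t4 : 0 < t / 4 by lra.
have ttp : 0 < t - t / 2 by lra.
have [z gz] := sgroup_graph y ttp.
suff [D dD] : exists D, is_derive t 1 (derive1n k u) D.
  by split; [exact: ex_derive|exact: is_derive1_continuous dD].
have d1 := is_derive1_expS ttp gz.
exists (expR (gamma * (t / 2)) *: (expR (gamma * (t - t / 2)) *:
  (gamma *: S (t - t / 2) y - z))).
apply: (@is_derive1_near (fun r => expR (gamma * (t / 2)) *:
    (expR (gamma * (r - t / 2)) *: S (r - t / 2) y))).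
  near=> r; rewrite yP; last by near: r; apply: lt_nbhsr; lra.
  by rewrite scalerA -expRD -mulrDr addrC subrK.
by apply: (is_derive1_shiftZ (f := fun r => expR (gamma * r) *: S r y)).
Unshelve. all: by end_near. Qed.

(** The factor exp(gamma t) undoes the shift: B minus gamma times [ip] is the form before it was
    made coercive. *)
Lemma sgroup_equation (t : R) v : 0 < t -> V v ->
  V (u t) /\ B (u t) v - gamma * ip (u t) v = - ip (derive1 u t) v.
Proof.
move=> tp Vv; have [y gy] := sgroup_graph x0 tp; have [Vu uP] := gy.
have d1 := is_derive1_expS tp gy.
have d2 : is_derive t 1 u (expR (gamma * t) *: (gamma *: S t x0 - y)).
  apply: is_derive1_near d1; near=> r; rewrite uE//.
  by near: r; apply: lt_nbhsr.
rewrite derive1E (@derive_val _ _ _ _ _ _ _ d2) uE//.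
split; first exact: subspaceZ.
by rewrite (linear_onZ sV (BP.1 _ Vv))// uP// !ipZl ipBl ipZl; ring.
Unshelve. all: by end_near. Qed.

End semigroup.

(** * Hoelder's inequality and L2 spaces *)

Section weighted_hoelder.
Local Open Scope ereal_scope.
Context d (T : measurableType d) (R : realType).
Variable mu : {measure set T -> \bar R}.

Lemma prode_gt0 (I : Type) (s : seq I) (P : pred I) (F : I -> \bar R) :
  (forall i, P i -> 0 < F i) -> 0 < \prod_(i <- s | P i) F i.
Proof. by move=> F0; apply: (big_ind (fun x => 0 < x)) => // x y; exact: mule_gt0. Qed.

Lemma lee_prod (I : Type) (s : seq I) (F G : I -> \bar R) :
  (forall i, 0 <= F i) -> (forall i, F i <= G i) ->
  \prod_(i <- s) F i <= \prod_(i <- s) G i.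
Proof.
move=> F0 FG; suff : 0 <= \prod_(i <- s) F i <= \prod_(i <- s) G i by move=> /andP[].
elim: s => [|i s IH]; first by rewrite !big_nil lexx lee01.
rewrite !big_cons; have /andP[h1 h2] := IH.
by rewrite mule_ge0//= lee_pmul.
Qed.

(** a_i = S (a_i/S) <= S exp(a_i/S - 1). After raising to the powers w_i and multiplying, the
    exponents add up to 0 because S is the weighted mean. *)
Lemma ler_amgm_powR (I : finType) (w a : I -> R) : (forall i, 0 < w i)%R ->
  (\sum_i w i = 1)%R -> (forall i, 0 <= a i)%R ->
  (\prod_i (a i `^ w i) <= \sum_i w i * a i)%R.
Proof.
move=> w0 w1 a0; set S := (\sum_i w i * a i)%R.
have S0 : (0 <= S)%R by apply: sumr_ge0 => i _; rewrite mulr_ge0// ltW.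
have [i0 _] : exists i0 : I, true.
  apply: contrapT => h; move: w1; rewrite big1 => [/eqP|i _]; first by rewrite eq_sym oner_eq0.
  by exfalso; apply: h; exists i.
have [S_eq0|Sn0] := eqVneq S 0%R.
  have ai0 : a i0 = 0%R.
    apply/eqP; rewrite -(mulrI_eq0 _ (lregP (lt0r_neq0 (w0 i0)))) eq_le.
    rewrite -{1}S_eq0 /S (bigD1 i0)//= lerDl mulr_ge0 ?a0 ?(ltW (w0 i0))// andbT.
    by apply: sumr_ge0 => i _; rewrite mulr_ge0// ltW.
  by rewrite (bigD1 i0)//= ai0 powR0 ?mul0r// gt_eqF.
have Sp : (0 < S)%R by rewrite lt0r Sn0.
have aE i : (a i `^ w i <= S `^ w i * expR (w i * (a i / S - 1)))%R.
  have -> : (a i = S * (a i / S))%R by rewrite mulrCA mulfV// mulr1.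
  rewrite [in leRHS](mulrC S (a i / S)%R) mulfVK//.
  rewrite powRM// ?divr_ge0// ler_wpM2l ?powR_ge0//.
  rewrite [in leRHS](mulrC (w i)) expRM ge0_ler_powR// ?nnegrE ?divr_ge0 ?expR_ge0//; first exact: ltW.
  by have := expR_ge1Dx (a i / S - 1)%R; rewrite addrC subrK.
have : (\prod_i (a i `^ w i) <= \prod_i (S `^ w i * expR (w i * (a i / S - 1))))%R.
  by apply: ler_prod => i _; rewrite powR_ge0 /=; exact: aE.
move=> /le_trans; apply; rewrite big_split/= -expR_sum -[X in (_ * expR X)%R](_ : 0 = _)%R; last first.
  under eq_bigr do rewrite mulrBr mulr1 mulrA.
  by rewrite sumrB w1 -mulr_suml divff// subrr.
rewrite expR0 mulr1.
suff -> : (\prod_i S `^ w i = S `^ (\sum_i w i))%R by rewrite w1 powRr1.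
elim/big_rec2 : _ => [|i x y _ ->]; first by rewrite powRr0.
by rewrite -powRD// Sn0 implybT.
Qed.

Lemma measurable_poweR_fun (D : set T) (f : T -> \bar R) (r : R) :
  measurable D -> measurable_fun D f -> measurable_fun D (fun x => f x `^ r).
Proof. by move=> mD mf; exact: (measurableT_comp (measurable_poweR r)). Qed.

Lemma measurable_prode (D : set T) (I : Type) (s : seq I) (f : I -> T -> \bar R) :
  (forall i, measurable_fun D (f i)) ->
  measurable_fun D (fun x => \prod_(i <- s) f i x).
Proof.
move=> mf; elim: s => [|i s IH].
  by under eq_fun do rewrite big_nil; exact: measurable_cst.
by under eq_fun do rewrite big_cons; exact: emeasurable_funM.
Qed.

(** The weighted AM-GM inequality applied pointwise to f_i divided by its integral, then integrated.
    This requires positive finite integrals: a zero integral makes the left side vanish, and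
    otherwise an infinite one makes the right side infinite. *)
Lemma hoelder_prod (D : set T) (I : finType) (w : I -> R) (f : I -> T -> \bar R) :
  measurable D -> (forall i, 0 < w i)%R -> (\sum_i w i = 1)%R ->
  (forall i, measurable_fun D (f i)) -> (forall i x, D x -> 0 <= f i x) ->
  \int[mu]_(x in D) \prod_i (f i x `^ w i) <=
  \prod_i (\int[mu]_(x in D) f i x) `^ w i.
Proof.
move=> mD w0 w1 mf f0.
have mP : measurable_fun D (fun x => \prod_i (f i x `^ w i)).
  by apply: measurable_prode => i; exact: measurable_poweR_fun.
have P0 x : 0 <= \prod_i (f i x `^ w i) by apply: prode_ge0 => i _; exact: poweR_ge0.
have I0 i : 0 <= \int[mu]_(x in D) f i x by apply: integral_ge0 => x; exact: f0.
have [[i0 i0E]|nz] := pselect (exists i0, \int[mu]_(x in D) f i0 x = 0).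
  rewrite (ge0_ae_eq_integral (g := cst 0))//=.
    by rewrite integral0; apply: prode_ge0 => i _; exact: poweR_ge0.
  have : ae_eq mu D (f i0) (cst 0).
    apply/ae_eq_integral_abs => //; rewrite -[RHS]i0E; apply: eq_integral => x xD.
    by rewrite gee0_abs// f0// -in_setE.
  apply: filterS => x h /h; rewrite (bigD1 i0)//= => ->.
  by rewrite poweR0r ?mul0e// gt_eqF.
have pos i : 0 < \int[mu]_(x in D) f i x.
  rewrite lt_neqAle I0 andbT eq_sym; apply/eqP => h; apply: nz; by exists i.
have [[i0 i0E]|fin] := pselect (exists i0, \int[mu]_(x in D) f i0 x = +oo).
  rewrite [leRHS](bigD1 i0)//= i0E poweRyr ?gt_eqF// gt0_mulye ?leey//.
  by apply: prode_gt0 => i _; exact: poweR_gt0.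
have finI i : \int[mu]_(x in D) f i x \is a fin_num.
  by rewrite ge0_fin_numE// ltey; apply/eqP => h; apply: fin; exists i.
pose a i := fine (\int[mu]_(x in D) f i x).
have aE i : \int[mu]_(x in D) f i x = (a i)%:E by rewrite fineK.
have a0 i : (0 < a i)%R by rewrite -lte_fin -aE.
pose C := (\prod_i (a i `^ w i))%R.
have C0 : (0 <= C)%R by apply: prodr_ge0 => i _; exact: powR_ge0.
have RE : \prod_i (\int[mu]_(x in D) f i x) `^ w i = C%:E.
  by rewrite -prodEFin; apply: eq_bigr => i _; rewrite aE poweR_EFin.
rewrite RE.
have Cp : (0 < C)%R.
  rewrite -lte_fin -RE; apply: prode_gt0 => i _; exact: poweR_gt0.
apply: (@le_trans _ _ (\int[mu]_(x in D) (C%:E * \sum_i ((w i / a i)%:E * f i x)))).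
  apply: ge0_le_integral => //.
  - apply: measurable_funeM; apply: emeasurable_sum => i; exact: measurable_funeM.
  - move=> x Dx.
    have [[i0 i0E]|finx] := pselect (exists i0, f i0 x = +oo).
      rewrite [X in _ * X](bigD1 i0)//= i0E gt0_muley ?lte_fin ?divr_gt0//.
      rewrite addye; last first.
        rewrite gt_eqF// (@lt_le_trans _ _ 0)//.
        by apply: sume_ge0 => i _; rewrite mule_ge0 ?f0// lee_fin divr_ge0// ltW.
      by rewrite gt0_muley ?lte_fin// leey.
    have fxE i : f i x = (fine (f i x))%:E.
      rewrite fineK// ge0_fin_numE ?f0// ltey; apply/eqP => h.
      by apply: finx; exists i.
    have fx0 i : (0 <= fine (f i x))%R by rewrite fine_ge0// f0.
    under eq_bigr do rewrite fxE poweR_EFin.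
    under [in leRHS]eq_bigr do rewrite fxE -EFinM.
    rewrite prodEFin sumEFin -EFinM lee_fin.
    have /(ler_wpM2l C0) := @ler_amgm_powR I w (fun i => fine (f i x) / a i)%R w0 w1
      (fun i => divr_ge0 (fx0 i) (ltW (a0 i))).
    rewrite -big_split/= => h; apply: le_trans (le_trans _ h) _.
      rewrite le_eqVlt; apply/orP; left; apply/eqP.
      apply: eq_bigr => i _; rewrite -powRM ?divr_ge0 ?(ltW (a0 i))//.
      by rewrite mulrCA mulfV ?mulr1// gt_eqF.
    by apply: ler_wpM2l => //; apply: ler_sum => i _; rewrite mulrA mulrAC.
rewrite ge0_integralZl//; last 2 first.
- by apply: emeasurable_sum => i; exact: measurable_funeM.
- by move=> x Dx; apply: sume_ge0 => i _; rewrite mule_ge0 ?f0// lee_fin divr_ge0// ltW.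
rewrite ge0_integral_sum//; last 2 first.
- by move=> i; exact: measurable_funeM.
- by move=> i x Dx; rewrite mule_ge0 ?f0// lee_fin divr_ge0// ltW.
rewrite (eq_bigr (fun i => (w i)%:E)) => [|i _]; first by rewrite sumEFin w1 mule1.
rewrite ge0_integralZl// ?lee_fin ?divr_ge0 ?ltW//; last by move=> x; exact: f0.
by rewrite aE -EFinM mulfVK// gt_eqF.
Qed.

Lemma hoelder2e (D : set T) (p q : R) (f g : T -> \bar R) : measurable D ->
  (0 < p)%R -> (0 < q)%R -> (p + q = 1)%R ->
  measurable_fun D f -> measurable_fun D g ->
  (forall x, D x -> 0 <= f x) -> (forall x, D x -> 0 <= g x) ->
  \int[mu]_(x in D) (f x `^ p * g x `^ q) <=
  (\int[mu]_(x in D) f x) `^ p * (\int[mu]_(x in D) g x) `^ q.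
Proof.
move=> mD p0 q0 pq mf mg f0 g0.
have := @hoelder_prod D bool (fun b => if b then p else q) (fun b => if b then f else g) mD.
rewrite !big_bool/=; under eq_integral do rewrite big_bool/=.
by apply => //; [case|case|case].
Qed.

Lemma hoelder3e (D : set T) (p q r : R) (f g h : T -> \bar R) : measurable D ->
  (0 < p)%R -> (0 < q)%R -> (0 < r)%R -> (p + q + r = 1)%R ->
  measurable_fun D f -> measurable_fun D g -> measurable_fun D h ->
  (forall x, D x -> 0 <= f x) -> (forall x, D x -> 0 <= g x) ->
  (forall x, D x -> 0 <= h x) ->
  \int[mu]_(x in D) (f x `^ p * g x `^ q * h x `^ r) <=
  (\int[mu]_(x in D) f x) `^ p * (\int[mu]_(x in D) g x) `^ q *
  (\int[mu]_(x in D) h x) `^ r.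
Proof.
move=> mD p0 q0 r0 pqr mf mg mh f0 g0 h0.
pose sel A (a b c : A) (i : 'I_3) := nth a [:: a; b; c] i.
have := @hoelder_prod D 'I_3 (sel _ p q r) (sel _ f g h) mD.
rewrite !big_ord_recl !big_ord0 /sel/= mule1 addr0 addrA muleA.
under eq_integral do rewrite !big_ord_recl !big_ord0 /= mule1 muleA.
apply => //.
- by case=> -[|[|[|]]].
- by case=> -[|[|[|]]].
- by case=> -[|[|[|]]].
Qed.
End weighted_hoelder.

(** * The Hilbert space L2 *)

Section L2_hilbert.
Context d (T : measurableType d) (R : realType).
Variable mu : {measure set T -> \bar R}.
Local Notation X := (L2space mu).
Implicit Types u v w : X.

Lemma L2fun_Lfun u : L2fun u \in Lfun mu 2%:E.
Proof. exact: LfunP. Qed.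

Lemma measurable_L2fun u : measurable_fun [set: T] (L2fun u).
Proof. by have := L2fun_Lfun u; rewrite inE => /andP[/[!inE]]. Qed.

Lemma integrable_L2fun u v :
  mu.-integrable setT (EFin \o (fun x => L2fun u x * L2fun v x)).
Proof. by apply/Lfun1_integrable; apply: Lfun2_mul_Lfun1; exact: L2fun_Lfun. Qed.

Lemma pi_L2fun (f : LfunType mu (lee1n 2)) :
  {ae mu, forall x, L2fun (\pi_(L2space mu) f)%qT x = f x}.
Proof.
have /L2_piP/asboolP h : (repr (\pi_(L2space mu) f)%qT = f %[mod L2space mu])%qT.
  by rewrite reprK.
by apply: filterS h => x /(_ I) /= /eqP; rewrite subr_eq0 => /eqP.
Qed.

Lemma L2fun_inj u v : {ae mu, forall x, L2fun u x = L2fun v x} -> u = v.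
Proof.
move=> uv; rewrite -(reprK u) -(reprK v); apply/L2_piP/asboolP.
apply: filterS uv => x h _; have -> : cst 0 x = 0 :> R by [].
by apply/eqP; rewrite subr_eq0; apply/eqP; exact: h.
Qed.

Lemma L2_of_fun (f : T -> R) : measurable_fun setT f ->
  (\int[mu]_x (f x ^+ 2)%:E < +oo)%E ->
  exists u : X, {ae mu, forall x, L2fun u x = f x}.
Proof.
move=> mf fi.
have fL : f \in Lfun mu 2%:E.
  rewrite inE; apply/andP; split; first by rewrite inE.
  rewrite inE /= /finite_norm unlock /Lnorm.
  rewrite poweR_lty//; under eq_integral do rewrite poweR_EFin powR_mulrn// real_normK ?num_real//.
  exact: fi.
exists (\pi_(L2space mu) (Lfun_Sub (lee1n 2) fL))%qT; exact: pi_L2fun.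
Qed.

Lemma L2fun_lin (c : R) u v :
  {ae mu, forall x, L2fun (c *: u + v) x = c * L2fun u x + L2fun v x}.
Proof.
have -> : c *: u + v = (\pi_(L2space mu) (c *: (repr u : LfunType mu (lee1n 2)) + repr v))%qT.
  by rewrite L2_piD -L2_piZ !reprK.
by apply: filterS (pi_L2fun (c *: (repr u : LfunType mu (lee1n 2)) + repr v)) => x ->.
Qed.

Lemma L2fun0 : {ae mu, forall x, L2fun (0 : X) x = 0}.
Proof.
have := L2fun_lin (-1) (0 : X) 0; rewrite scaler0 addr0.
by apply: filterS => x; rewrite mulN1r => /eqP; rewrite -subr_eq0 opprD opprK; lra.
Qed.

Lemma L2funB u v : {ae mu, forall x, L2fun (u - v) x = L2fun u x - L2fun v x}.
Proof.
have := L2fun_lin (-1) v u; rewrite scaleN1r addrC.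
by apply: filterS => x ->; rewrite mulN1r addrC.
Qed.

Definition L2ip u v : R := \int[mu]_x (L2fun u x * L2fun v x).

Lemma L2ipE u v : (L2ip u v)%:E = (\int[mu]_x (L2fun u x * L2fun v x)%:E)%E.
Proof. by rewrite fineK//; exact: integrable_fin_num (integrable_L2fun u v). Qed.

Lemma L2norm_sqr u : `|u| ^+ 2 = L2ip u u.
Proof.
rewrite [`|u|]/(L2norm u) /L2norm unlock /Lnorm fine_poweR.
rewrite -powR_mulrn ?powR_ge0// -powRrM mulVf// powRr1; last first.
  by apply: fine_ge0; apply: integral_ge0 => x _; exact: poweR_ge0.
rewrite /L2ip /Rintegral; congr fine; apply: eq_integral => x _.
by rewrite poweR_EFin powR_mulrn// real_normK ?num_real// expr2.
Qed.

Lemma L2norm_sqrE u : (`|u| ^+ 2)%:E = (\int[mu]_x (L2fun u x ^+ 2)%:E)%E.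
Proof. by rewrite L2norm_sqr L2ipE; apply: eq_integral => x _; rewrite expr2. Qed.

Lemma ae_eq_Rintegral (f g : T -> R) : measurable_fun setT f ->
  measurable_fun setT g -> {ae mu, forall x, f x = g x} ->
  \int[mu]_x f x = \int[mu]_x g x.
Proof.
move=> mf mg fg; rewrite /Rintegral; congr fine; apply: ae_eq_integral => //.
- exact/measurable_EFinP.
- exact/measurable_EFinP.
- by apply: filterS fg => x -> _.
Qed.

Lemma L2ip_lin w : linear_on setT (L2ip ^~ w).
Proof.
move=> c u v _ _; rewrite /L2ip.
have mw := measurable_L2fun w; have mu' := measurable_L2fun u; have mv := measurable_L2fun v.
rewrite (@ae_eq_Rintegral _ (fun x => c * (L2fun u x * L2fun w x) + L2fun v x * L2fun w x)).
- rewrite RintegralD//; last 2 first.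
  + have := integrableZl measurableT c (integrable_L2fun u w).
    by apply: eq_integrable => // x _.
  + exact: integrable_L2fun.
  by rewrite RintegralZl//; exact: integrable_L2fun.
- by apply: measurable_funM => //; exact: measurable_L2fun.
- apply: measurable_funD; last exact: measurable_funM.
  by apply: measurable_funM => //; exact: measurable_funM.
- by apply: filterS (L2fun_lin c u v) => x ->; rewrite mulrDl mulrA.
Qed.

Lemma L2ipC u v : L2ip u v = L2ip v u.
Proof. by rewrite /L2ip; under eq_Rintegral do rewrite mulrC. Qed.

Lemma L2ipP : sym_psd_on setT L2ip.
Proof.
split; last by move=> u _; rewrite -L2norm_sqr sqr_ge0.
- split=> w _; first exact: L2ip_lin.
  by move=> c u v _ _; rewrite !(L2ipC w) L2ip_lin.
- by move=> u v _ _; exact: L2ipC.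
Qed.

(* Chebyshev plus Borel-Cantelli, packaged as the a.e. finiteness of
   [\sum_k 4^k g_k^2] *)
Lemma ae_geometric_bound (g : nat -> T -> R) : (forall k, measurable_fun setT (g k)) ->
  (forall k, (\int[mu]_x (g k x ^+ 2)%:E <= (8^-1 ^+ k.+1)%:E)%E) ->
  {ae mu, forall x, exists C : R, forall k, `|g k x| <= C * 2^-1 ^+ k}.
Proof.
move=> mg gi.
pose h k x := ((4 ^+ k * g k x ^+ 2)%:E : \bar R).
have p4 k : 0 <= (4 : R) ^+ k by rewrite exprn_ge0.
have h0 k x : (0 <= h k x)%E by rewrite lee_fin; apply: mulr_ge0 => //; exact: sqr_ge0.
have mh k : measurable_fun setT (h k).
  apply/measurable_EFinP; apply: measurable_funM => //; exact: measurable_funX.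
have hi k : (\int[mu]_x h k x <= (1 / (2 ^ (k + 1))%:R)%:E)%E.
  rewrite /h; under eq_integral do rewrite EFinM.
  rewrite ge0_integralZl//.
  - apply: (@le_trans _ _ ((4 ^+ k)%:E * (8^-1 ^+ k.+1)%:E)%E).
      by apply: lee_wpmul2l => //; rewrite lee_fin exprn_ge0.
    rewrite -EFinM lee_fin addn1 div1r natrX -exprVn.
    apply: (@le_trans _ _ (4 ^+ k.+1 * 8^-1 ^+ k.+1)).
      by apply: ler_wpM2r; [rewrite exprn_ge0// invr_ge0|rewrite ler_eXn2l//; lra].
    rewrite -exprMn; apply: lerXn2r; rewrite ?nnegrE; lra.
  - by apply/measurable_EFinP; exact: measurable_funX.
  - by move=> x _; rewrite lee_fin sqr_ge0.
have Si : (\int[mu]_x (\sum_(k <oo) h k x) < +oo)%E.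
  rewrite integral_nneseries//.
  apply: (@le_lt_trans _ _ (\sum_(k <oo) (1 / (2 ^ (k + 1))%:R)%:E)%E).
    by apply: lee_nneseries => // k _ _; exact: integral_ge0.
  rewrite (cvg_lim _ (@cvg_geometric_eseries_half R 1 0))//.
  exact: ltry.
have : {ae mu, forall x, setT x -> (\sum_(k <oo) h k x)%E \is a fin_num}.
  apply: (@integrable_ae _ _ _ _ setT measurableT).
  apply/integrableP; split.
    by apply: (@ge0_emeasurable_sum _ _ _ setT h xpredT).
  by under eq_integral do rewrite gee0_abs ?nneseries_ge0//.
apply: filterS => x /(_ I) Sf.
exists (Num.sqrt (fine (\sum_(k <oo) h k x)%E)) => k.
have hk : (h k x <= \sum_(k <oo) h k x)%E.
  apply: le_trans (@nneseries_lim_ge R (fun k => h k x) xpredT 0 k.+1 _) => //.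
  by rewrite big_nat_recr//= leeDr// sume_ge0.
have s0 : 0 <= fine (\sum_(k <oo) h k x)%E by rewrite fine_ge0// nneseries_ge0.
move: hk; rewrite -(fineK Sf) lee_fin => hk.
rewrite -(@ler_pXn2r _ 2)// ?nnegrE ?mulr_ge0 ?sqrtr_ge0 ?exprn_ge0// ?invr_ge0//.
rewrite real_normK ?num_real// exprMn sqr_sqrtr// -exprM mulnC exprM.
rewrite (_ : 2^-1 ^+ 2 = 4^-1 :> R); last by field.
by rewrite exprVn ler_pdivlMr ?exprn_gt0// mulrC.
Qed.

Lemma cvgn_geometric_steps (a : nat -> R) (C : R) :
  (forall k, `|a k.+1 - a k| <= C * 2^-1 ^+ k) -> cvgn a.
Proof.
move=> h.
have -> : a = cst (a 0%N) \+ series (telescope a).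
  by apply/funext => n /=; rewrite eq_sum_telescope.
apply: is_cvgD; first exact: is_cvg_cst.
apply: normed_cvg; apply: (@series_le_cvg _ _ (geometric C 2^-1)).
- by move=> n /=; exact: normr_ge0.
- by move=> n; apply: le_trans (normr_ge0 _) (h n).
- by move=> n; exact: h.
- by apply: is_cvg_geometric_series; rewrite ger0_norm; lra.
Qed.

Lemma limn_einf_le (s : nat -> \bar R) (e : \bar R) :
  (\forall n \near \oo, (s n <= e)%E) -> (limn_einf s <= e)%E.
Proof.
move=> [n0 _ hn0]; rewrite limn_einf_lim; apply: lime_le; first exact: is_cvg_einfs.
apply: nearW => n; apply: ereal_inf_le; exists (s (maxn n n0)); last exact/hn0/leq_maxr.
by exists (maxn n n0) => //=; exact: leq_maxl.
Qed.

Lemma limn_einf_ge (s : nat -> \bar R) (e : \bar R) :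
  (forall n, (e <= s n)%E) -> (e <= limn_einf s)%E.
Proof.
move=> h; rewrite limn_einf_lim; apply: lime_ge; first exact: is_cvg_einfs.
by apply: nearW => n; apply: le_ereal_inf_tmp => _ [m _ <-].
Qed.

Lemma measurable_fun_limn_einf (D : set T) (f : nat -> T -> \bar R) :
  (forall n, measurable_fun D (f n)) ->
  measurable_fun D (fun x => limn_einf (f ^~ x)).
Proof.
move=> mf; apply: (@measurableT_comp _ _ _ _ _ _ (@oppe R)) => //.
by apply: measurable_fun_limn_esup => n; apply: measurableT_comp.
Qed.

(** Riesz-Fischer: a fast subsequence converges a.e., its upper limit F is measurable, and Fatou
    bounds F - u_n. As F is not yet known to be square integrable, the limit is built as the class
    of F - u_(n1) plus u_(n1). *)
Lemma L2_complete (u : nat -> X) :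
  (forall e : R, 0 < e -> exists n0 : nat, forall m n : nat,
    (n0 <= m)%N -> (n0 <= n)%N -> `|u m - u n| < e) ->
  exists l : X, u n @[n --> \oo] --> l.
Proof.
move=> cu.
(* The rate required by [ae_geometric_bound]: multiplied by 4^k it remains summable, so that the
   increments are O(2^-k) a.e. *)
have /choice[N NP] : forall k : nat, exists n0 : nat, forall m n : nat,
    (n0 <= m)%N -> (n0 <= n)%N -> `|u m - u n| ^+ 2 <= 8^-1 ^+ k.+1.
  move=> k; have e0 : 0 < Num.sqrt (8^-1 ^+ k.+1 : R).
    by rewrite sqrtr_gt0 exprn_gt0// invr_gt0.
  have [n0 hn0] := cu _ e0; exists n0 => m n hm hn.
  rewrite -[leRHS]sqr_sqrtr ?exprn_ge0 ?invr_ge0//.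
  by apply: lerXn2r; rewrite ?nnegrE ?sqrtr_ge0// ltW// hn0.
(* Partial sums of the thresholds are monotone in k and at least [N k]. *)
pose I k := (\sum_(j < k.+1) N j)%N.
have NI k : (N k <= I k)%N by rewrite /I big_ord_recr/= leq_addl.
have II k m : (k <= m)%N -> (I k <= I m)%N.
  move=> /subnKC <-; elim: (m - k)%N => [|j IH]; first by rewrite addn0.
  by apply: leq_trans IH _; rewrite addnS /I [X in (_ <= X)%N]big_ord_recr/= leq_addr.
pose f k := L2fun (u (I k)).
have mf k : measurable_fun setT (f k) by exact: measurable_L2fun.
have steps : {ae mu, forall x, exists C : R, forall k, `|L2fun (u (I k.+1) - u (I k)) x| <= C * 2^-1 ^+ k}.
  apply: (@ae_geometric_bound (fun k => L2fun (u (I k.+1) - u (I k)))).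
    by move=> k; exact: measurable_L2fun.
  move=> k; rewrite -L2norm_sqrE lee_fin; apply: NP => //.
  exact: leq_trans (NI k) (II _ _ (leqnSn _)).
have subs : {ae mu, forall x, forall k, L2fun (u (I k.+1) - u (I k)) x = f k.+1 x - f k x}.
  by apply: ae_foralln => k; exact: L2funB.
pose F x := fine (limn_esup (fun k => (f k x)%:E)).
have mF : measurable_fun setT F.
  apply: measurableT_comp => //; apply: measurable_fun_limn_esup => k.
  exact/measurable_EFinP.
have fF : {ae mu, forall x, f k x @[k --> \oo] --> F x}.
  apply: filterS2 steps subs => x [C hC] hs.
  have ca : cvgn (fun k => f k x).
    by apply: (@cvgn_geometric_steps _ C) => k; rewrite -hs.
  have h : (f k x)%:E @[k --> \oo] --> (limn (fun k => f k x))%:E.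
    by apply: cvg_EFin => //; exact: nearW.
  rewrite /F; have [_ ->] := cvg_limn_einf_sup h; exact: ca.
have FI n : (\int[mu]_x ((F x - L2fun (u n) x) ^+ 2)%:E <=
    limn_einf (fun k => (`|u (I k) - u n| ^+ 2)%:E))%E.
  have mFn : measurable_fun setT (fun x => ((F x - L2fun (u n) x) ^+ 2)%:E).
    apply/measurable_EFinP; apply: measurable_funX.
    by apply: measurable_funB; [exact: mF|exact: measurable_L2fun].
  pose s k x := ((L2fun (u (I k) - u n) x) ^+ 2)%:E : \bar R.
  have ms k : measurable_fun setT (s k).
    by apply/measurable_EFinP; apply: measurable_funX; exact: measurable_L2fun.
  have s0 k x : (0 <= s k x)%E by rewrite lee_fin sqr_ge0.
  have := @fatou _ _ _ mu setT measurableT s ms (fun k x _ => s0 k x).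
  have -> : (fun k => (`|u (I k) - u n| ^+ 2)%:E) = (fun k => \int[mu]_x s k x)%E.
    by apply/funext => k; rewrite L2norm_sqrE.
  apply: le_trans; apply: ae_ge0_le_integral => //.
  - by move=> x _; rewrite lee_fin sqr_ge0.
  - by move=> x _; exact: limn_einf_ge.
  - by apply: measurable_fun_limn_einf.
  have sub2 : {ae mu, forall x, forall k, L2fun (u (I k) - u n) x = f k x - L2fun (u n) x}.
    by apply: ae_foralln => k; exact: L2funB.
  apply: filterS2 fF sub2 => x hx h2 _.
  have -> : (fun k => s k x) = (fun k => ((f k x - L2fun (u n) x) ^+ 2)%:E).
    by apply/funext => k; rewrite /s h2.
  have h : ((f k x - L2fun (u n) x) ^+ 2)%:E @[k --> \oo] --> ((F x - L2fun (u n) x) ^+ 2)%:E.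
    apply: cvg_EFin; first exact: nearW.
    by rewrite !expr2; apply: cvgM; apply: cvgB => //; exact: cvg_cst.
  by have [-> _] := cvg_limn_einf_sup h.
have FIe (e : R) : 0 < e -> exists n0 : nat, forall n : nat, (n0 <= n)%N ->
    (\int[mu]_x ((F x - L2fun (u n) x) ^+ 2)%:E <= (e ^+ 2)%:E)%E.
  move=> e0.
  have [k0 hk0] : exists k0, 8^-1 ^+ k0.+1 <= e ^+ 2.
    have : (8^-1 : R) ^+ k @[k --> \oo] --> 0 by apply: cvg_expr; rewrite ger0_norm; lra.
    move=> /cvgrPdist_lt/(_ (e ^+ 2)); rewrite exprn_gt0// => /(_ isT)[k0 _ hk].
    exists k0; have := hk k0.+1 (leqnSn _); rewrite /= sub0r normrN => /ltW.
    exact: le_trans (ler_norm _).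
  exists (N k0) => n hn.
  apply: le_trans (FI n) _; apply: limn_einf_le.
  exists k0 => // k /= hk; rewrite lee_fin; apply: le_trans hk0.
  by apply: NP => //; exact: leq_trans (NI k0) (II _ _ hk).
have [n1 hn1] := FIe 1 ltr01.
have [v vP] : exists v : X, {ae mu, forall x, L2fun v x = F x - L2fun (u n1) x}.
  apply: L2_of_fun; last by apply: le_lt_trans (hn1 n1 (leqnn _)) _; rewrite ltry.
  by apply: measurable_funB; [exact: mF|exact: measurable_L2fun].
exists (v + u n1); apply/cvgn_dist0 => e e0.
have e2 : 0 < e / 2 by lra.
have [n0 hn0] := FIe _ e2; exists n0 => n /hn0 hn.
apply: (@le_lt_trans _ _ (e / 2)); last lra.
rewrite -(@ler_pXn2r _ 2)// ?nnegrE ?normr_ge0 ?(ltW e2)//.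
rewrite -lee_fin L2norm_sqrE; apply: le_trans hn; rewrite le_eqVlt; apply/orP; left; apply/eqP.
apply: ae_eq_integral => //.
- by apply/measurable_EFinP; apply: measurable_funX; exact: measurable_L2fun.
- apply/measurable_EFinP; apply: measurable_funX.
  by apply: measurable_funB; [exact: mF|exact: measurable_L2fun].
- have h1 := L2funB (v + u n1) (u n); have h2 := L2fun_lin 1 v (u n1).
  rewrite scale1r in h2; apply: filterS3 h1 h2 vP => x -> -> -> _.
  by rewrite mul1r subrK.
Qed.
End L2_hilbert.

(** * Completed measures and slices of integrals *)

Section measurable_hull.
Local Open Scope ereal_scope.
Context d (T : semiRingOfSetsType d) (R : realType).
Variable mu : {measure set T -> \bar R}.
Local Notation I := (caratheodory_type (mu^*)%mu).
Local Notation cmu := (@completed_measure_extension _ _ _ mu).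

(** Intersection of countable covers of E by generators whose total mass is below that of E plus
    1/(n+1). The hull belongs to the sigma-algebra generated by the semiring, before completion. *)
Lemma measurable_hull (E : set I) : measurable E -> cmu E < +oo ->
  exists B : set T, [/\ (d.-measurable).-sigma.-measurable B, E `<=` B,
    measurable (B `\` E : set I) & cmu (B `\` E) = 0].
Proof.
move=> mE Efin.
have coverE n : exists A : nat -> set T, @measurable_cover _ T E A /\
   \sum_(k <oo) mu (A k) < cmu E + n.+1%:R^-1%:E.
  have Ef : cmu E \is a fin_num by rewrite ge0_fin_numE.
  have n0 : (0 < n.+1%:R^-1 :> R)%R by rewrite invr_gt0.
  have [_ [A EA <-] h] := lb_ereal_inf_adherent n0 Ef.
  by exists A.
have /choice[A AP] := coverE.
pose F n := \bigcup_m (A n m).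
have sF n : (d.-measurable).-sigma.-measurable (F n).
  apply: bigcupT_measurable => i.
  by apply: sub_sigma_algebra; have [[/(_ i)]] := AP n.
pose B := \bigcap_n (F n).
have sB : (d.-measurable).-sigma.-measurable B by exact: bigcapT_measurable.
have EB : E `<=` B by move=> x Ex n _; have [[_ +] _] := AP n; apply.
have mB : measurable (B : set I) by apply: sub_caratheodory.
exists B; split=> //; first exact: measurableD.
have BE : cmu B <= cmu E.
  apply/lee_addgt0Pr => e e0.
  have [n _ /(_ _ (leqnn n)) /= ne] := near_infty_natSinv_lt (PosNum e0).
  apply: (@le_trans _ _ (cmu (F n))).
    by apply: le_mu_ext; exact: bigcap_inf.
  have [[mA _] An] := AP n.
  apply: (@le_trans _ _ (\sum_(k <oo) mu (A n k))).
    apply: le_trans (outer_measure_sigma_subadditive (mu^*)%mu (A n)) _.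
    apply: lee_nneseries => [m _ _|m _]; first exact: outer_measure_ge0.
    by rewrite le_eqVlt; apply/orP; left; apply/eqP; exact: measurable_mu_extE.
  by apply: le_trans (ltW An) _; rewrite leeD2l// lee_fin ltW.
rewrite measureD//; last exact: le_lt_trans BE Efin.
rewrite setIidr//; apply/eqP; rewrite eq_le sube_le0 BE/= sube_ge0.
  by apply: le_mu_ext.
by apply/orP; left; rewrite ge0_fin_numE//; exact: Efin.
Qed.

(** A measurable set of the completion differs from its hull by a null set, so integrals over the
    generated sigma-algebra determine the function a.e. *)
Lemma completed_ae_eq0 (D : set I) (f : I -> \bar R) :
  measurable D -> cmu D < +oo -> cmu.-integrable D f ->
  (forall B : set T, (d.-measurable).-sigma.-measurable B -> \int[cmu]_(x in D `&` B) f x = 0) ->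
  ae_eq cmu D f (cst 0).
Proof.
move=> mD Dfin fi f0; apply: integral_ae_eq => // E ED mE.
have Efin : cmu E < +oo by apply: le_lt_trans Dfin; exact: le_mu_ext.
have [B [sB EB mBE BE0]] := measurable_hull mE Efin.
rewrite integral0 -(f0 _ sB).
have mB : measurable (B : set I) by apply: sub_caratheodory.
have mDB : measurable (D `&` B : set I) by exact: measurableI.
have fDB : cmu.-integrable (D `&` B) f by exact: integrableS fi.
rewrite (negligible_integral mBE mDB fDB BE0).
congr (\int[_]_(x in _) f x); apply/seteqP; split=> x.
  by move=> Ex; split; [split; [exact: ED|exact: EB]|case].
by move=> [[Dx Bx] h]; apply: contrapT => nE; exact: h.
Qed.
End measurable_hull.

Section restricted_measure.
Local Open Scope ereal_scope.
Context d (T : measurableType d) (R : realType).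
Variables (mu : {measure set T -> \bar R}) (D : set T) (mD : measurable D).

Lemma ge0_integral_mrestr (f : T -> \bar R) : measurable_fun setT f ->
  (forall x, 0 <= f x) -> \int[mrestr mu mD]_x f x = \int[mu]_(x in D) f x.
Proof.
move=> mf f0; rewrite (@ge0_negligible_integral _ _ _ _ setT (~` D))//; last 2 first.
- exact: measurableC.
- by rewrite /= /mrestr setICl measure0.
rewrite setTD setCK; apply: eq_measure_integral => A mA AD.
by rewrite /= /mrestr setIidl.
Qed.

Lemma integral_mrestr (f : T -> \bar R) : measurable_fun setT f ->
  \int[mrestr mu mD]_x f x = \int[mu]_(x in D) f x.
Proof.
move=> mf; rewrite [LHS]integralE [RHS]integralE !ge0_integral_mrestr//.
- exact: measurable_funeneg.
- exact: measurable_funepos.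
Qed.

Lemma ae_mrestr (P : T -> Prop) :
  {ae mrestr mu mD, forall x, P x} <-> {ae mu, forall x, D x -> P x}.
Proof.
split=> [[N [mN N0 h]]|[N [mN N0 h]]].
  exists (N `&` D); split; [exact: measurableI|exact: N0|].
  move=> x /= /not_implyP[Dx nP]; split=> //; exact: h.
exists (N `|` ~` D); split; first by apply: measurableU => //; exact: measurableC.
  rewrite /= /mrestr setIUl setICl setU0; apply/eqP; rewrite -measure_le0 -N0.
  by apply: le_measure; rewrite ?inE//; exact: measurableI.
move=> x /= nP; have [Dx|] := pselect (D x); last by right.
by left; apply: h => /= /(_ Dx).
Qed.
End restricted_measure.

(** * Tonelli on tuples and the Loomis-Whitney inequality *)

Section tuple_integrals.
Local Open Scope ereal_scope.
Variable R : realType.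
Local Notation mR := (measurableTypeR R).
Local Notation leb := (@lebesgue_measure R).
Local Notation lebT n := (lebesgue_tuple R n).

Definition consT n (x : mR) (t : n.-tuple mR) : n.+1.-tuple mR :=
  [the n.+1.-tuple mR of x :: t].

Definition updT n (t : n.-tuple mR) (i : 'I_n) (y : mR) : n.-tuple mR :=
  [tuple (if j == i then y else tnth t j) | j < n].

Lemma updT_cons0 n x (t : n.-tuple mR) y : updT (consT x t) ord0 y = consT y t.
Proof.
apply: eq_from_tnth => j; rewrite tnth_mktuple.
by case: (unliftP ord0 j) => [k ->|->] //; rewrite /consT !tnthS.
Qed.

Lemma updT_consS n x (t : n.-tuple mR) i y :
  updT (consT x t) (lift ord0 i) y = consT x (updT t i y).
Proof.
apply: eq_from_tnth => j; rewrite tnth_mktuple.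
case: (unliftP ord0 j) => [k ->|->] //; rewrite /consT !tnthS tnth_mktuple.
by rewrite (inj_eq lift_inj).
Qed.

Lemma measurable_consT n : measurable_fun [set: mR * n.-tuple mR]
  (fun p => consT p.1 p.2).
Proof. exact: measurable_cons. Qed.

Lemma measurable_consT1 n x : measurable_fun [set: n.-tuple mR] (consT x).
Proof. by apply: measurable_cons. Qed.

Section tonelli.
Variables (n : nat) (f : n.+1.-tuple mR -> \bar R).
Hypotheses (mf : measurable_fun setT f) (f0 : forall t, 0 <= f t).

Let mfc : measurable_fun setT (fun p : mR * n.-tuple mR => f (consT p.1 p.2)).
Proof. by apply: measurableT_comp => //; exact: measurable_consT. Qed.

Lemma integral_consT : \int[lebT n.+1]_t f t =
  \int[leb \x lebT n]_p f (consT p.1 p.2).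
Proof.
by rewrite /= /lebesgue_tuple_step ge0_integral_pushforward//; exact: measurable_consT.
Qed.

Lemma measurable_tonelliT1 : measurable_fun setT (fun x => \int[lebT n]_t f (consT x t)).
Proof. exact: (measurable_fun_fubini_tonelli_F _ mfc). Qed.

Lemma measurable_tonelliT2 : measurable_fun setT (fun t => \int[leb]_x f (consT x t)).
Proof. exact: (measurable_fun_fubini_tonelli_G _ mfc). Qed.

Lemma tonelliT1 : \int[lebT n.+1]_t f t = \int[leb]_x \int[lebT n]_t f (consT x t).
Proof. by rewrite integral_consT (fubini_tonelli1 _ mfc). Qed.

Lemma tonelliT2 : \int[lebT n.+1]_t f t = \int[lebT n]_t \int[leb]_x f (consT x t).
Proof.
by rewrite tonelliT1; apply: (@fubini_tonelli _ _ _ _ R leb (lebT n) _ mfc).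
Qed.
End tonelli.

(** Tonelli in the i-th coordinate after peeling off the preceding ones. It concerns nonnegative
    functions; signed integrands are later compared through their positive and negative parts. *)
Lemma eq_integral_slices n (i : 'I_n) (f g : n.-tuple mR -> \bar R) :
  measurable_fun setT f -> measurable_fun setT g ->
  (forall t, 0 <= f t) -> (forall t, 0 <= g t) ->
  (forall t, \int[leb]_y f (updT t i y) = \int[leb]_y g (updT t i y)) ->
  \int[lebT n]_t f t = \int[lebT n]_t g t.
Proof.
elim: n i f g => [[]//|n IH] i f g mf mg f0 g0 fg.
case: (unliftP ord0 i) => [j ij|i0]; last first.
  rewrite (tonelliT2 mf f0) (tonelliT2 mg g0); apply: eq_integral => t _.
  have := fg (consT 0%R t); rewrite i0.
  by under eq_integral do rewrite updT_cons0; under [X in _ = X -> _]eq_integral do rewrite updT_cons0.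
rewrite (tonelliT1 mf f0) (tonelliT1 mg g0); apply: eq_integral => x _; apply: (IH j).
- exact: measurableT_comp mf (measurable_consT1 x).
- exact: measurableT_comp mg (measurable_consT1 x).
- by move=> t; exact: f0.
- by move=> t; exact: g0.
- move=> t; have := fg (consT x t); rewrite ij.
  by under eq_integral do rewrite updT_consS; under [X in _ = X -> _]eq_integral do rewrite updT_consS.
Qed.

Lemma poweR_prod (I : Type) (s : seq I) (F : I -> \bar R) (r : R) : (forall i, 0 <= F i) ->
  (\prod_(i <- s) F i) `^ r = \prod_(i <- s) F i `^ r.
Proof.
move=> F0; elim: s => [|i s IH]; first by rewrite !big_nil poweR1r.
by rewrite !big_cons poweRM ?IH//; exact: prode_ge0.
Qed.

(* Loomis-Whitney in dimension [k.+2] *)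
Lemma gagliardo k (f : k.+2.-tuple mR -> \bar R) (g : 'I_k.+2 -> k.+2.-tuple mR -> \bar R) :
  measurable_fun setT f -> (forall i, measurable_fun setT (g i)) ->
  (forall t, 0 <= f t) -> (forall i t, 0 <= g i t) ->
  (forall i t, f t <= \int[leb]_y g i (updT t i y)) ->
  \int[lebT k.+2]_t f t `^ (k.+2%:R / k.+1%:R) <=
  \prod_i (\int[lebT k.+2]_t g i t) `^ k.+1%:R^-1.
Proof.
elim: k f g => [|k IH] f g mf mg f0 g0 fg.
  (* In dimension 2, f is bounded by [G0], which depends on the second variable only, and by [G1],
     which depends on the first only; f^2 is dominated by a product with separated variables. *)
  pose G0 t := \int[leb]_y g ord0 (consT y t).
  pose G1 x := \int[lebT 1]_t g (lift ord0 ord0) (consT x t).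
  have G00 t : 0 <= G0 t by exact: integral_ge0.
  have G10 t : 0 <= G1 t by exact: integral_ge0.
  have mG0 : measurable_fun setT G0 by exact: measurable_tonelliT2.
  have mG1 : measurable_fun setT G1 by exact: measurable_tonelliT1.
  have mf2 : measurable_fun setT (fun t => f t `^ 2) by exact: measurable_poweR_fun.
  have GE x : \int[lebT 1]_t (G0 t * G1 x) = (\int[lebT 2]_t g ord0 t) * G1 x.
    by rewrite ge0_integralZr// tonelliT2.
  have -> : \prod_i (\int[lebT 2]_t g i t) `^ 1^-1 = \int[leb]_x \int[lebT 1]_t (G0 t * G1 x).
    under eq_integral do rewrite GE.
    rewrite ge0_integralZl//; last exact: integral_ge0.
    rewrite big_ord_recl big_ord1 invr1 !poweRe1; try exact: integral_ge0.
    by congr (_ * _); rewrite tonelliT1.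
  rewrite divr1 (tonelliT1 mf2); last by move=> t; exact: poweR_ge0.
  apply: ge0_le_integral => //.
  - by move=> x _; apply: integral_ge0 => t _; exact: poweR_ge0.
  - by apply: (measurable_tonelliT1 mf2) => t; exact: poweR_ge0.
  - by under eq_fun do rewrite GE; exact: measurable_funeM.
  move=> x _; apply: ge0_le_integral => //.
  - by move=> t _; exact: poweR_ge0.
  - by apply: measurable_poweR_fun => //; apply: measurableT_comp => //; exact: measurable_consT1.
  - by apply: emeasurable_funM.
  move=> t _.
  have h0 : f (consT x t) <= G0 t.
    by have := fg ord0 (consT x t); under eq_integral do rewrite updT_cons0.
  have h1 : f (consT x t) <= G1 x.
    apply: le_trans (fg (lift ord0 ord0) (consT x t)) _.
    under eq_integral do rewrite updT_consS.
    rewrite /G1 tonelliT1//; last by apply: measurableT_comp => //; exact: measurable_consT1.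
    rewrite le_eqVlt; apply/orP; left; apply/eqP; apply: eq_integral => y _.
    rewrite /= integral_dirac//; last first.
      apply: measurableT_comp => //; apply: measurableT_comp; first exact: measurable_consT1.
      exact: measurable_consT1.
    rewrite diracT mul1e; congr (g _ _); congr consT; apply: eq_from_tnth => j.
    by rewrite tnth_mktuple !ord1.
  rewrite -[2%R]/(1 + 1)%R poweRD ?poweRe1//; last first.
    by apply: add_neq0_poweRD_def; rewrite -[(1 + 1)%R]/(2%:R) pnatr_eq0.
  exact: lee_pmul.
set m := k.+2 in IH f g mf mg f0 g0 fg *.
pose F x t := f (consT x t).
have F0 x t : 0 <= F x t by exact: f0.
have mF x : measurable_fun setT (F x).
  by apply: measurableT_comp => //; exact: measurable_consT1.
pose G0 t := \int[leb]_y g ord0 (consT y t).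
pose h i x := \int[lebT m]_t g (lift ord0 i) (consT x t).
have G00 t : 0 <= G0 t by exact: integral_ge0.
have h0 i x : 0 <= h i x by exact: integral_ge0.
have mG0 : measurable_fun setT G0 by exact: measurable_tonelliT2.
have mh i : measurable_fun setT (h i) by exact: measurable_tonelliT1.
have m0 : (0 < m%:R :> R)%R by rewrite ltr0n.
have m1 : (0 < k.+1%:R :> R)%R by rewrite ltr0n.
have mE : (m%:R = k.+1%:R + 1 :> R)%R by rewrite /m -natr1.
have slice x : \int[lebT m]_t F x t `^ (m%:R / k.+1%:R) <= \prod_i h i x `^ k.+1%:R^-1.
  apply: (IH (F x) (fun i t => g (lift ord0 i) (consT x t))) => //.
    by move=> i; apply: measurableT_comp => //; exact: measurable_consT1.
  move=> i t; apply: le_trans (fg (lift ord0 i) (consT x t)) _.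
  by under eq_integral do rewrite updT_consS.
(* (m+1)/m = 1 + 1/m: one factor f is kept for the slice inequality, and the power 1/m is bounded by
   the line integral in the first coordinate. *)
have Ff x t : F x t `^ (m.+1%:R / m%:R) <= F x t * G0 t `^ m%:R^-1.
  have -> : (m.+1%:R / m%:R = 1 + m%:R^-1 :> R)%R.
    by rewrite -natr1 mulrDl mulfV ?gt_eqF// mul1r.
  rewrite poweRD; last first.
    by apply: add_neq0_poweRD_def; rewrite gt_eqF// addr_gt0// invr_gt0.
  rewrite poweRe1//; apply: lee_pmul => //; first exact: poweR_ge0.
  apply: gt0_ler_poweR; rewrite ?in_itv/= ?leey ?F0 ?G00//.
  by have := fg ord0 (consT x t); under eq_integral do rewrite updT_cons0.
(* Hoelder with weights 1/m and (k+1)/m, whose second factor is the power m/(k+1) of f controlled on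
   slices. *)
have inner x : \int[lebT m]_t (F x t * G0 t `^ m%:R^-1) <=
    (\int[lebT m]_t G0 t) `^ m%:R^-1 * \prod_i h i x `^ m%:R^-1.
  have H := @hoelder2e _ _ R (lebT m) setT m%:R^-1%R (k.+1%:R / m%:R)%R G0
    (fun t => F x t `^ (m%:R / k.+1%:R)) measurableT.
  have FE t : F x t * G0 t `^ m%:R^-1 =
      G0 t `^ m%:R^-1 * (F x t `^ (m%:R / k.+1%:R)) `^ (k.+1%:R / m%:R).
    rewrite -poweRrM.
    rewrite (_ : m%:R / k.+1%:R * (k.+1%:R / m%:R) = 1)%R; last first.
      by field; rewrite !gt_eqF.
    by rewrite poweRe1// muleC.
  under eq_integral do rewrite FE.
  apply: le_trans (H _ _ _ _ _ _ _) _ => //.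
  - by rewrite invr_gt0.
  - by rewrite divr_gt0.
  - by rewrite -[X in (X + _)%R]mul1r -mulrDl addrC -mE divff// gt_eqF.
  - exact: measurable_poweR_fun.
  - by move=> t _; exact: poweR_ge0.
  apply: lee_pmul => //; try exact: poweR_ge0.
  apply: (@le_trans _ _ ((\prod_i h i x `^ k.+1%:R^-1) `^ (k.+1%:R / m%:R))).
    apply: gt0_ler_poweR => //; rewrite ?in_itv/= ?leey.
    - by rewrite integral_ge0// => t _; exact: poweR_ge0.
    - by rewrite prode_ge0// => i _; exact: poweR_ge0.
  rewrite poweR_prod; last by move=> i; exact: poweR_ge0.
  rewrite le_eqVlt; apply/orP; left; apply/eqP; apply: eq_bigr => i _.
  by rewrite -poweRrM mulrA mulVf ?gt_eqF// mul1r.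
have mfp : measurable_fun setT (fun t => f t `^ (m.+1%:R / m%:R)) by exact: measurable_poweR_fun.
rewrite (tonelliT1 mfp); last by move=> t; exact: poweR_ge0.
have mprod : measurable_fun setT (fun x => \prod_i h i x `^ m%:R^-1).
  by apply: measurable_prode => i; exact: measurable_poweR_fun.
apply: (@le_trans _ _ (\int[leb]_x ((\int[lebT m]_t G0 t) `^ m%:R^-1 * \prod_i h i x `^ m%:R^-1))).
  apply: ge0_le_integral => //.
  - by move=> x _; apply: integral_ge0 => t _; exact: poweR_ge0.
  - by apply: (measurable_tonelliT1 mfp) => t; exact: poweR_ge0.
  - exact: measurable_funeM.
  move=> x _; apply: le_trans (inner x); apply: ge0_le_integral => //.
  - by move=> t _; exact: poweR_ge0.
  - exact: (@measurable_poweR_fun _ _ _ _ (F x) _ measurableT (mF x)).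
  - by apply: emeasurable_funM => //; exact: measurable_poweR_fun.
  - by move=> t _; exact: Ff.
rewrite ge0_integralZl//; last 2 first.
- by move=> x _; rewrite prode_ge0// => i _; exact: poweR_ge0.
- exact: poweR_ge0.
rewrite [leRHS]big_ord_recl; apply: lee_pmul => //.
- exact: poweR_ge0.
- by apply: integral_ge0 => x _; rewrite prode_ge0// => i _; exact: poweR_ge0.
- by rewrite tonelliT2.
(* Hoelder in the first coordinate with m equal weights reassembles the slice integrals. *)
apply: le_trans (@hoelder_prod _ _ R leb setT 'I_m (fun=> m%:R^-1%R) h measurableT _ _ _ _) _ => //.
- by move=> i; rewrite invr_gt0.
- by rewrite sumr_const card_ord -[LHS]mulr_natr mulVf// gt_eqF.
- rewrite le_eqVlt; apply/orP; left; apply/eqP; apply: eq_bigr => i _.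
  by rewrite [in RHS]tonelliT1.
Qed.
End tuple_integrals.

Lemma measurable_normr_powR d (T : measurableType d) (R : realType) (D : set T)
    (f : T -> R) (p : R) : measurable_fun D f -> measurable_fun D (fun x => `|f x| `^ p).
Proof.
move=> mf; apply: (@measurableT_comp _ _ _ _ _ _ (@powR R ^~ p)) => //.
exact: measurableT_comp.
Qed.

Section ae_sub.
Context d (T : measurableType d) (R : realType) (mu : {measure set T -> \bar R}).
Variable D : set T.
Implicit Types P Q S V : T -> Prop.

Lemma ae_sub1 P V : (forall x, D x -> P x -> V x) ->
  {ae mu, forall x, D x -> P x} -> {ae mu, forall x, D x -> V x}.
Proof. by move=> h; apply: filterS => x hP Dx; apply: h => //; exact: hP. Qed.

Lemma ae_sub2 P Q V : (forall x, D x -> P x -> Q x -> V x) ->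
  {ae mu, forall x, D x -> P x} -> {ae mu, forall x, D x -> Q x} ->
  {ae mu, forall x, D x -> V x}.
Proof. by move=> h; apply: filterS2 => x hP hQ Dx; apply: h => //; [exact: hP|exact: hQ]. Qed.

Lemma ae_sub3 P Q S V : (forall x, D x -> P x -> Q x -> S x -> V x) ->
  {ae mu, forall x, D x -> P x} -> {ae mu, forall x, D x -> Q x} ->
  {ae mu, forall x, D x -> S x} -> {ae mu, forall x, D x -> V x}.
Proof.
move=> h; apply: filterS3 => x hP hQ hS Dx; apply: h => //; [exact: hP|exact: hQ|exact: hS].
Qed.
End ae_sub.

Lemma integrable_bounded_support d (T : measurableType d) (R : realType)
    (mu : {measure set T -> \bar R}) (f : T -> R) (B : set T) (C : R) :
  measurable B -> (mu B < +oo)%E -> measurable_fun setT f -> (forall x, `|f x| <= C) ->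
  (forall x, f x != 0 -> B x) -> mu.-integrable setT (EFin \o f).
Proof.
move=> mB Bfin mf fC fB.
have -> : EFin \o f = (EFin \o f) \_ B.
  apply/funext => x; rewrite patchE; case: ifPn => //; rewrite notin_setE => nBx.
  by have [/= ->|/fB] := eqVneq (f x) 0.
apply/integrable_restrict => //; rewrite setTI.
apply: measurable_bounded_integrable => //; first exact: measurable_funTS.
by exists C; split=> [|M CM x _] /=; [exact: num_real|exact: le_trans (fC x) (ltW CM)].
Qed.

Section L2_restricted.
Context d (T : measurableType d) (R : realType).
Variables (mu : {measure set T -> \bar R}) (D : set T) (mD : measurable D).
Local Notation muD := (mrestr mu mD).
Local Notation X := (L2space muD).
Implicit Types (f g : T -> R) (u v w : X).

Lemma L2ip_restr u v : L2ip u v = \int[mu]_(x in D) (L2fun u x * L2fun v x).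
Proof.
rewrite /L2ip /Rintegral integral_mrestr//; apply/measurable_EFinP.
by apply: measurable_funM; exact: measurable_L2fun.
Qed.

Lemma integrable_mrestr f : measurable_fun setT f ->
  muD.-integrable setT (EFin \o f) <-> mu.-integrable D (EFin \o f).
Proof.
move=> mf; have E : (\int[muD]_x `|(EFin \o f) x| = \int[mu]_(x in D) `|(EFin \o f) x|)%E.
  by apply: ge0_integral_mrestr => //; apply/measurableT_comp => //; exact/measurable_EFinP.
split=> /integrableP[_ h]; apply/integrableP.
  by rewrite -E; split=> //; apply/measurable_EFinP; exact: measurable_funTS.
by rewrite E; split=> //; apply/measurable_EFinP.
Qed.

Lemma integrable_L2M_restr u v : mu.-integrable D (fun x => (L2fun u x * L2fun v x)%:E).
Proof.
apply/(@integrable_mrestr (fun x => L2fun u x * L2fun v x)); last exact: integrable_L2fun.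
by apply: measurable_funM; exact: measurable_L2fun.
Qed.

Lemma L2norm_sqr_restr u : (`|u| ^+ 2)%:E = (\int[mu]_(x in D) (L2fun u x ^+ 2)%:E)%E.
Proof.
rewrite L2norm_sqrE ge0_integral_mrestr// => [|x]; last by rewrite lee_fin sqr_ge0.
by apply/measurable_EFinP/measurable_funX; exact: measurable_L2fun.
Qed.

Lemma L2_of_fun_restr f : measurable_fun D f ->
  (\int[mu]_(x in D) (f x ^+ 2)%:E < +oo)%E ->
  exists u, {ae mu, forall x, D x -> L2fun u x = f x}.
Proof.
move=> mf fi.
have mf' : measurable_fun setT (f \_ D).
  by apply/(measurable_restrictT f mD).
have [u uE] : exists u : X, {ae muD, forall x, L2fun u x = (f \_ D) x}.
  apply: L2_of_fun => //; rewrite ge0_integral_mrestr//.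
  - rewrite (eq_integral (fun x => (f x ^+ 2)%:E))// => x xD.
    by rewrite patchE xD.
  - by apply/measurable_EFinP; exact: measurable_funX.
  - by move=> x; rewrite lee_fin sqr_ge0.
exists u; move/ae_mrestr: uE; apply: filterS => x h Dx.
by rewrite h// patchE mem_set.
Qed.

Lemma L2_restr_inj u v : {ae mu, forall x, D x -> L2fun u x = L2fun v x} -> u = v.
Proof. by move=> /(ae_mrestr mu mD) h; exact: L2fun_inj. Qed.

Lemma L2_restr_lin (c : R) u v :
  {ae mu, forall x, D x -> L2fun (c *: u + v) x = c * L2fun u x + L2fun v x}.
Proof. by apply/ae_mrestr; exact: L2fun_lin. Qed.

Lemma ae_eq_Rintegral_restr f g : measurable_fun D f -> measurable_fun D g ->
  {ae mu, forall x, D x -> f x = g x} -> \int[mu]_(x in D) f x = \int[mu]_(x in D) g x.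
Proof.
move=> mf mg fg; rewrite /Rintegral; congr fine; apply: ae_eq_integral => //.
- exact/measurable_EFinP.
- exact/measurable_EFinP.
- by apply: filterS fg => x h Dx; rewrite h.
Qed.

Section finite.
Hypothesis Dfin : (mu D < +oo)%E.

Lemma integrable_bounded_fun f (C : R) : measurable_fun D f ->
  (forall x, `|f x| <= C) -> mu.-integrable D (EFin \o f).
Proof.
move=> mf fC; apply: measurable_bounded_integrable => //.
by exists C; split=> [|M CM x _] /=; [exact: num_real|exact: le_trans (fC x) (ltW CM)].
Qed.

Lemma L2_of_bounded f (C : R) : measurable_fun D f ->
  (forall x, `|f x| <= C) -> exists u, {ae mu, forall x, D x -> L2fun u x = f x}.
Proof.
move=> mf fC; apply: L2_of_fun_restr => //.
have : mu.-integrable D (EFin \o (fun x => f x ^+ 2)).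
  apply: (@integrable_bounded_fun _ (C ^+ 2)); first exact: measurable_funX.
  by move=> x; rewrite normrX ler_sqr ?nnegrE// (le_trans _ (fC x)).
move=> /integrableP[_]; apply: le_lt_trans.
rewrite le_eqVlt; apply/orP; left; apply/eqP; apply: eq_integral => x _ /=.
by rewrite ger0_norm ?sqr_ge0.
Qed.

Lemma integrable_L2_restr u : mu.-integrable D (fun x => (L2fun u x)%:E).
Proof.
have i1 : mu.-integrable D (EFin \o cst 1).
  by apply: (@integrable_bounded_fun _ 1) => // x; rewrite normr1.
apply: (@le_integrable _ _ _ _ _ mD _ (fun x => 1%:E + (L2fun u x * L2fun u x)%:E)%E).
- by apply/measurable_EFinP; apply: measurable_funTS; exact: measurable_L2fun.
- move=> x Dx; rewrite /= lee_fin [in leRHS]ger0_norm ?addr_ge0 -?expr2 ?sqr_ge0//.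
  by rewrite -[L2fun u x ^+ 2]real_normK ?num_real//; nra.
- exact: (integrableD mD i1 (integrable_L2M_restr u u)).
Qed.
End finite.

Lemma cvg_L2ipl (w_ : nat -> X) w v : w_ @ \oo --> w -> L2ip (w_ k) v @[k --> \oo] --> L2ip w v.
Proof.
by move=> cw; apply: (cvg_ip (L2ipP muD) (@L2norm_sqr _ _ _ muD) _ cw); exact: cvg_cst.
Qed.

(** Dominated convergence with majorant |w|: orthogonality to the functions phi_k passes to the
    indicator they approximate. *)
Lemma integral_indic_limit0 (w : T -> R) (phi : nat -> T -> R) (E : set T) :
  measurable_fun D w -> mu.-integrable D (EFin \o w) -> (forall k, measurable_fun D (phi k)) ->
  measurable E -> (forall k x, 0 <= phi k x <= 1) ->
  (forall x, phi ^~ x @ \oo --> (\1_E x : R)) ->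
  (forall k, \int[mu]_(x in D) (w x * phi k x) = 0) ->
  (\int[mu]_(x in D `&` E) (w x)%:E = 0)%E.
Proof.
move=> mw iw mphi mE p01 pcv p0.
have -> : (\int[mu]_(x in D `&` E) (w x)%:E = \int[mu]_(x in D) (w x * \1_E x)%:E)%E.
  rewrite [RHS]integral_mkcond [LHS]integral_mkcond; apply: eq_integral => x _.
  rewrite !patchE indicE in_setI; case: (x \in D) => //=.
  by case: (x \in E); rewrite ?mulr1 ?mulr0.
have mf k : measurable_fun D (fun x => (w x * phi k x)%:E).
  by apply/measurable_EFinP; exact: measurable_funM.
have mf' : measurable_fun D (fun x => (w x * \1_E x)%:E).
  by apply/measurable_EFinP; apply: measurable_funM => //; exact: measurable_indic.
have cv : {ae mu, forall x, D x -> (w x * phi k x)%:E @[k --> \oo] --> (w x * \1_E x)%:E}.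
  apply: aeW => x _; apply: cvg_EFin; first exact: nearW.
  by apply: cvgM; [exact: cvg_cst|exact: pcv].
have bd k x : (`|(w x * phi k x)%:E| <= `|w x|%:E)%E.
  rewrite /= lee_fin normrM ler_piMr//; have /andP[h1 h2] := p01 k x.
  by rewrite ger0_norm.
have ibd : mu.-integrable D (fun x => `|w x|%:E) by exact: integrable_norm iw.
have [_ _ h] := dominated_convergence mD mf mf' cv ibd (aeW _ (fun x k _ => bd k x)).
apply/esym; apply: (@cvg_unique _ _ _ _ _ _ _ h) => //.
have E0 k : (\int[mu]_(x in D) (w x * phi k x)%:E = 0)%E.
  rewrite -[LHS]fineK ?[fine _]p0//; apply: integrable_fin_num => //.
  by apply: le_integrable iw => // x Dx; exact: (bd k x).
rewrite (_ : [sequence _]_k = cst 0%E); first exact: cvg_cst.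
by apply/funext => k; exact: E0.
Qed.

(** The sets over which the integral vanishes form a Dynkin class. The map [phi] changes the
    sigma-algebra: taken as the identity, it lets Borel generators be used under a completed
    measure. *)
Lemma integral_dynkin0 d' (T' : measurableType d') (phi : T -> T') (G : set (set T'))
    (f : T -> \bar R) :
  @measurable _ T' = <<s G >> -> setI_closed G -> measurable_fun setT phi ->
  mu.-integrable D f -> (\int[mu]_(x in D) f x = 0)%E ->
  (forall B, G B -> (\int[mu]_(x in D `&` phi @^-1` B) f x = 0)%E) ->
  forall B, measurable B -> (\int[mu]_(x in D `&` phi @^-1` B) f x = 0)%E.
Proof.
move=> GE GI mphi fi f0 fG B mB.
have mpre S : measurable S -> measurable (D `&` phi @^-1` S).
  by move=> mS; apply: measurableI => //; rewrite -[_ @^-1` _]setTI; exact: mphi.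
have mf S : measurable S -> measurable_fun (D `&` phi @^-1` S) f.
  move=> mS; apply: measurable_funS (measurable_int _ fi) => //; exact: subIsetl.
pose P S := (\int[mu]_(x in D `&` phi @^-1` S) f x = 0)%E.
apply: (dynkin_induction (P := P) GE GI _ _ _ _); rewrite /P -?GE//.
- by rewrite preimage_setT setIT.
- move=> S mS S0; move: f0; rewrite -{1}(setIT D) -(preimage_setT phi) -(setUv S).
  rewrite preimage_setU setIUr integral_setU//.
  + by rewrite S0 add0e.
  + exact: mpre.
  + by apply: mpre; exact: measurableC.
  + rewrite -setIUr -preimage_setU setUv; exact: mf.
  + by apply/disj_setPS => x [[_ h] [_]] /=.
- move=> F mF tF F0; rewrite preimage_bigcup setI_bigcupr integral_bigcup//.
  + by rewrite eseries0// => i _ _; exact: F0.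
  + apply/trivIsetP => i j _ _ ij; apply/seteqP; split=> // x [[_ /= xi] [_ /= xj]].
    by have /trivIsetP /(_ i j I I ij) := tF; rewrite -subset0 => /(_ (phi x)); apply.
  + by move=> k; exact: mpre.
  + apply: integrableS fi => //; last by move=> x [k _ []].
    by apply: bigcupT_measurable => k; exact: mpre.
Qed.
End L2_restricted.

Section Rintegral_facts.
Context d (T : measurableType d) (R : realType).
Variables (mu : {measure set T -> \bar R}) (D : set T) (mD : measurable D).
Implicit Types f g : T -> R.

Lemma integrable_sum_fun (I : Type) (s : seq I) (F : I -> T -> R) :
  (forall i, mu.-integrable D (EFin \o F i)) ->
  mu.-integrable D (EFin \o (fun x => \sum_(i <- s) F i x)) /\
  \int[mu]_(x in D) (\sum_(i <- s) F i x) = \sum_(i <- s) \int[mu]_(x in D) F i x.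
Proof.
move=> iF; elim: s => [|i s [IH1 IH2]].
  split; last first.
    rewrite big_nil; under eq_Rintegral do rewrite big_nil.
    by rewrite Rintegral_cst// mul0r.
  by under [EFin \o _]funext do rewrite /= big_nil; exact: integrable0.
split.
  have := integrableD mD (iF i) IH1; apply: eq_integrable => // x _.
  by rewrite /= big_cons EFinD.
under eq_Rintegral do rewrite big_cons.
by rewrite RintegralD// IH2 big_cons.
Qed.

Lemma integrableD_fun f g : mu.-integrable D (EFin \o f) -> mu.-integrable D (EFin \o g) ->
  mu.-integrable D (EFin \o (fun x => f x + g x)).
Proof. by move=> jf jg; have := integrableD mD jf jg; apply: eq_integrable. Qed.

Lemma integrableZ_fun (c : R) f : mu.-integrable D (EFin \o f) ->
  mu.-integrable D (EFin \o (fun x => c * f x)).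
Proof. by move=> jf; have := integrableZl mD c jf; apply: eq_integrable. Qed.

Lemma integrableB_fun f g : mu.-integrable D (EFin \o f) -> mu.-integrable D (EFin \o g) ->
  mu.-integrable D (EFin \o (fun x => f x - g x)).
Proof. by move=> jf jg; have := integrableB mD jf jg; apply: eq_integrable. Qed.

Lemma ae_restrict_dom (P : T -> Prop) : {ae mu, forall x, P x} -> {ae mu, forall x, D x -> P x}.
Proof. by apply: filterS => x h _. Qed.

(** The set {|h| >= N} involves values of h outside [D], of which nothing is known; writing the
    truncation as a Borel function of |h| keeps the statement on [D]. *)
Lemma measurable_truncation (h : T -> R) (N : R) : measurable_fun D h ->
  measurable_fun D (fun x => \1_[set y | N <= `|h y|] x * `|h x|).
Proof.
move=> mh; pose phi (t : R) : R := \1_(`[N, +oo[%classic : set R) t * t.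
have mphi : measurable_fun setT phi.
  by apply: measurable_funM => //; exact: measurable_indic.
have -> : (fun x => \1_[set y | N <= `|h y|] x * `|h x|) = phi \o (fun x => `|h x|).
  apply/funext => x; rewrite /phi/= !indicE; congr (_%:R * _).
  have [Nh|hN] := leP N `|h x|; first by rewrite !mem_set//= in_itv/= Nh.
  by rewrite !memNset//= ?in_itv/= leNgt hN.
by apply: measurableT_comp => //; exact: measurableT_comp.
Qed.

Lemma measurable_sqrt_fun f : measurable_fun D f -> (forall x, 0 <= f x) ->
  measurable_fun D (fun x => Num.sqrt (f x)).
Proof.
move=> mf f0; rewrite (_ : (fun x => Num.sqrt (f x)) = (@powR R ^~ 2^-1) \o f).
  exact: measurableT_comp.
by apply/funext => x; rewrite /= powR12_sqrt.
Qed.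

Lemma ae_le_Rintegral f g : mu.-integrable D (EFin \o f) -> mu.-integrable D (EFin \o g) ->
  {ae mu, forall x, D x -> f x <= g x} ->
  \int[mu]_(x in D) f x <= \int[mu]_(x in D) g x.
Proof.
move=> jf jg fg; rewrite -subr_ge0 -RintegralB//.
have jgf := integrableB_fun jg jf.
have mgf : measurable_fun D (fun x => g x - f x).
  by apply/measurable_EFinP; exact: measurable_int jgf.
rewrite (@ae_eq_Rintegral_restr _ _ _ mu D mD _ (fun x => Num.max (g x - f x) 0))//.
- by apply: Rintegral_ge0 => x _; rewrite le_max lexx orbT.
- exact: measurable_maxr.
- by apply: ae_sub1 fg => x _ h; rewrite max_l// subr_ge0.
Qed.
End Rintegral_facts.

(** * Calculus on the line *)

Section normr_powR.
Variable R : realType.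
Implicit Types r m t : R.

(** The derivative of |t|^(r+1) divided by r + 1; the sign makes it continuous at 0 for r > 0. *)
Definition sgn_powR r t : R := `|t| `^ r * Num.sg t.

Lemma normr_powR_small r (e : R) : 0 < r -> 0 < e ->
  exists2 dlt : R, 0 < dlt & forall t, `|t| < dlt -> `|t| `^ r < e.
Proof.
move=> r0 e0; exists (e `^ r^-1); first exact: powR_gt0.
move=> t te; have -> : e = (e `^ r^-1) `^ r by rewrite -powRrM mulVf ?gt_eqF// powRr1// ltW.
by apply: gt0_ltr_powR; rewrite ?nnegrE// powR_ge0.
Qed.

Lemma sgn_powR_continuous r : 0 < r -> continuous (sgn_powR r).
Proof.
move=> r0 t; have [t0|t0|->] := ltgtP t 0; last first.
- apply/cvgrPdist_lt => e e0; have [d d0 dP] := normr_powR_small r0 e0.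
  rewrite /sgn_powR sgr0 mulr0; near=> x.
  rewrite sub0r normrN normrM ger0_norm ?powR_ge0//.
  have [->|x0] := eqVneq x 0; first by rewrite sgr0 normr0 mulr0.
  rewrite normr_sg x0 mulr1; apply: dP.
  by near: x; apply: (@nbhs0_lt _ R^o).
- have : {for t, continuous (fun x : R => x `^ r)}.
    apply/differentiable_continuous/derivable1_diffP/derivable_powR.
    by rewrite in_itv/= andbT.
  move=> h; rewrite /continuous_at/prop_for; have -> : sgn_powR r t = t `^ r.
    by rewrite /sgn_powR gtr0_norm// gtr0_sg// mulr1.
  apply: cvg_trans h; apply: near_eq_cvg; near=> x.
  have x0 : 0 < x by near: x; exact: lt_nbhsr.
  by rewrite /sgn_powR gtr0_norm// gtr0_sg// mulr1.
- have h : {for - t, continuous (fun x : R => x `^ r)}.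
    apply/differentiable_continuous/derivable1_diffP/derivable_powR.
    by rewrite in_itv/= andbT oppr_gt0.
  have : - ((- x) `^ r) @[x --> t] --> - ((- t) `^ r).
    apply: cvgN; apply: (@cvg_comp _ _ _ -%R (fun x : R => x `^ r) _ (nbhs (- t))) => //.
    by apply: cvgN; exact: cvg_id.
  move=> {}h; rewrite /continuous_at/prop_for; have -> : sgn_powR r t = - ((- t) `^ r).
    by rewrite /sgn_powR ltr0_norm// ltr0_sg// mulrN1.
  apply: cvg_trans h; apply: near_eq_cvg; near=> x.
  have x0 : x < 0 by near: x; exact: lt_nbhsl.
  by rewrite /sgn_powR ltr0_norm// ltr0_sg// mulrN1.
Unshelve. all: by end_near. Qed.

Lemma is_derive_normr_powR m t : 1 < m ->
  is_derive t 1 (fun x : R => `|x| `^ m) (m * sgn_powR (m - 1) t).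
Proof.
move=> m1; have [t0|t0|->] := ltgtP t 0; last first.
- apply/is_derive1P; rewrite /sgn_powR sgr0 !mulr0.
  apply/cvgrPdist_lt => e e0.
  have [d d0 dP] := @normr_powR_small (m - 1) e (ltac:(by rewrite subr_gt0)) e0.
  near=> h.
  have h0 : h != 0 by near: h; exact: nbhs_dnbhs_neq.
  have hd : `|h| < d by near: h; apply: dnbhs0_lt.
  have hp : 0 < `|h| by rewrite normr_gt0.
  rewrite sub0r normrN add0r normr0 powR0 ?gt_eqF ?(lt_trans _ m1)// subr0.
  rewrite -[_ *: _]/(_ * _) normrM normfV (@ger0_norm _ (_ `^ _)) ?powR_ge0//.
  by rewrite -(@mulr_powRB1 _ `|h| m) ?(lt_trans _ m1)// mulKf ?gt_eqF//; exact: dP.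
- have -> : m * sgn_powR (m - 1) t = m * t `^ (m - 1).
    by rewrite /sgn_powR gtr0_norm// gtr0_sg// mulr1.
  apply: (@near_eq_is_derive _ _ _ (fun x : R => x `^ m)); last exact: is_derive1_powR.
  by near=> x; rewrite gtr0_norm//; near: x; exact: lt_nbhsr.
- have -> : m * sgn_powR (m - 1) t = (m * (- t) `^ (m - 1)) * -1.
    by rewrite /sgn_powR ltr0_norm// ltr0_sg// mulrA.
  apply: (@near_eq_is_derive _ _ _ ((fun x : R => x `^ m) \o -%R)); last first.
    by apply: is_derive1_comp; apply: is_derive1_powR; rewrite oppr_gt0.
  by near=> x; rewrite /= ltr0_norm//; near: x; exact: lt_nbhsl.
Unshelve. all: by end_near. Qed.
End normr_powR.

Section line_FTC.
Local Open Scope ereal_scope.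
Variable R : realType.
Local Notation leb := (@lebesgue_measure R).

Lemma FTC_itv (F f : R -> R) (a b : R) : (a < b)%R ->
  (forall y : R, is_derive y 1%R F (f y)) -> continuous f ->
  \int[leb]_(x in `[a, b]) (f x)%:E = (F b - F a)%:E.
Proof.
move=> ab dF cf; have cF : continuous F.
  move=> y; apply/differentiable_continuous/derivable1_diffP.
  by have [] := dF y.
rewrite EFinB; apply: (continuous_FTC2 ab (F := F)).
- exact: continuous_subspaceT.
- split=> [y _||]; first by have [] := dF y.
  + by apply: cvg_within_filter; exact: cF.
  + by apply: cvg_within_filter; exact: cF.
- by move=> y _; rewrite derive1E; have [_ ->] := dF y.
Qed.

Section compact_support.
Variables (F f : R -> R) (L : R).
Hypotheses (dF : forall y : R, is_derive y 1%R F (f y)) (cf : continuous f).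
Hypotheses (L0 : (0 < L)%R) (FL : forall y, (L <= `|y|)%R -> F y = 0%R).

Let mf (D : set R) : measurable D -> measurable_fun D (fun x => (f x)%:E).
Proof.
by move=> mD; apply/measurable_EFinP; apply: measurable_funTS; exact: continuous_measurable_fun.
Qed.

(** F y is an integral of f over the left side and minus an integral over the right side of y. Using
    both gains the factor 2 on which the explicit Sobolev constant depends. *)
Lemma FTC_compact_supp y : (2 * `|F y|)%:E <= \int[leb]_z `|f z|%:E.
Proof.
have pos : 0 <= \int[leb]_z `|f z|%:E by apply: integral_ge0 => z _; rewrite lee_fin.
have [/FL ->|yL] := leP L `|y|%R; first by rewrite normr0 mulr0.
have /andP[yL1 yL2] : (- L < y < L)%R by rewrite -ltr_norml.
have bnd (a b : R) : (a < b)%R -> (`|F b - F a|%R)%:E <= \int[leb]_(z in `[a, b]) `|f z|%:E.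
  move=> ab; rewrite -abse_EFin -(FTC_itv ab dF cf).
  by apply: le_abse_integral => //; exact: mf.
have nL : `|L|%R = L by rewrite gtr0_norm.
have h1 := bnd _ _ yL1; have h2 := bnd _ _ yL2.
rewrite (@FL (- L)%R) ?normrN ?nL// subr0 in h1.
rewrite (@FL L) ?nL// sub0r normrN in h2.
have mabs (D : set R) : measurable D -> measurable_fun D (fun z => `|f z|%:E).
  by move=> mD; apply/measurable_EFinP; apply: measurableT_comp => //; by apply/measurable_EFinP; exact: mf.
have h2' : `|F y|%:E <= \int[leb]_(z in `]y, L]) `|f z|%:E.
  rewrite (@integral_itv_obnd_cbnd _ y (BRight L) (fun z => `|f z|%:E))//.
  by apply: mabs; exact: measurable_itv.
rewrite mulr_natl mulr2n EFinD; apply: le_trans (leeD h1 h2') _.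
rewrite -ge0_integral_setU//=; last 2 first.
- by apply: mabs; exact: measurableU.
- apply/disj_setPS => x [] /=; rewrite !in_itv/= => /andP[_ xy] /andP[yx _].
  by move: (lt_le_trans yx xy); rewrite ltxx.
by apply: ge0_subset_integral => //; [exact: measurableU|exact: mabs].
Qed.

Let fL y : (L < `|y|)%R -> f y = 0%R.
Proof.
move=> Ly; have [_ <-] := dF y.
suff : is_derive y 1%R F 0%R by move=> [_ ->].
apply: (@near_eq_is_derive _ _ _ (cst (0 : R)%R)).
have : \forall z \near y, (L < `|z|)%R by exact: (cvgr_gt _ (@norm_continuous _ _ y)).
by apply: filterS => z /ltW /FL ->.
Qed.

(** f has integral 0. The equality of positive and negative parts is the form that Tonelli on slices
    can use. *)
Lemma FTC_compact_supp0 : \int[leb]_z (Num.max (f z) 0)%:E = \int[leb]_z (Num.max (- f z) 0)%:E.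
Proof.
pose a : R := (- (L + 1))%R; pose b : R := (L + 1)%R.
have L1 : (0 < L + 1)%R by rewrite addr_gt0.
have ab : (a < b)%R by rewrite /a /b gtrN.
have red (g : R -> R) : (forall z, (L < `|z|)%R -> g z = 0%R) ->
    \int[leb]_z (g z)%:E = \int[leb]_(z in `[a, b]) (g z)%:E.
  move=> g0; rewrite [RHS]integral_mkcond; apply: eq_integral => z _.
  rewrite patchE; case: ifPn => //; rewrite notin_setE/= in_itv/= -ler_norml => /negP.
  by rewrite -ltNge => h; rewrite g0// (lt_trans _ h)// /b ltrDl.
have h : \int[leb]_(z in `[a, b]) (f z)%:E = 0.
  by rewrite (FTC_itv ab dF cf) !FL ?subrr// /a/b ?normrN gtr0_norm// lerDl.
rewrite (red (fun z => Num.max (f z) 0)%R) => [|z Lz]; last by rewrite fL// maxxx.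
rewrite (red (fun z => Num.max (- f z) 0)%R) => [|z Lz]; last by rewrite fL// oppr0 maxxx.
have int : leb.-integrable `[a, b] (EFin \o f).
  apply: continuous_compact_integrable; [exact: segment_compact|exact: continuous_subspaceT].
have -> : (fun z => (Num.max (f z) 0)%:E) = (EFin \o f)^\+.
  by apply/funext => z; rewrite funeposE/= EFin_max.
have -> : (fun z => (Num.max (- f z) 0)%:E) = (EFin \o f)^\-.
  by apply/funext => z; rewrite funenegE/= EFin_max.
have fp : \int[leb]_(z in `[a, b]) (EFin \o f)^\+ z \is a fin_num.
  by apply: integrable_fin_num => //; exact: integrable_funepos.
have fn : \int[leb]_(z in `[a, b]) (EFin \o f)^\- z \is a fin_num.
  by apply: integrable_fin_num => //; exact: integrable_funeneg.
move: h; rewrite integralE -(fineK fp) -(fineK fn) -EFinB => -[] /eqP.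
by rewrite subr_eq0 => /eqP ->.
Qed.
End compact_support.
End line_FTC.

Section L2_fatou.
Context d (T : measurableType d) (R : realType).
Variables (mu : {measure set T -> \bar R}) (D : set T) (mD : measurable D).
Local Notation muD := (mrestr mu mD).
Local Notation X := (L2space muD).

Lemma ae_cvg_L2fun (v_ : nat -> X) (u : X) :
  (forall k, `|u - v_ k| ^+ 2 <= 8^-1 ^+ k.+1) ->
  {ae mu, forall x, D x -> L2fun (v_ k) x @[k --> \oo] --> L2fun u x}.
Proof.
move=> uv; apply/ae_mrestr.
have bd : {ae muD, forall x, exists C : R, forall k, `|L2fun (u - v_ k) x| <= C * 2^-1 ^+ k}.
  apply: (@ae_geometric_bound _ _ _ muD (fun k => L2fun (u - v_ k))).
    by move=> k; exact: measurable_L2fun.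
  by move=> k; rewrite -L2norm_sqrE lee_fin; exact: uv.
have sub : {ae muD, forall x, forall k, L2fun (u - v_ k) x = L2fun u x - L2fun (v_ k) x}.
  by apply: ae_foralln => k; exact: L2funB.
apply: filterS2 bd sub => x [C hC] hs.
apply/cvgrPdist_le => e e0.
have g0 : (C * 2^-1 ^+ k : R) @[k --> \oo] --> C * 0.
  by apply: cvgM; [exact: cvg_cst|apply: cvg_expr; rewrite ger0_norm; lra].
rewrite mulr0 in g0; have /cvgrPdist_le/(_ e e0) := g0.
apply: filterS => k /=; rewrite sub0r normrN -hs; apply: le_trans.
by apply: le_trans (hC k) _; exact: ler_norm.
Qed.

(** The fast rate gives a.e. convergence, and Fatou then lets bounds on p-th powers pass to an L2
    limit. *)
Lemma L2_fatou (v_ : nat -> X) (u : X) (p : R) (c : \bar R) : 1 < p ->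
  (forall k, `|u - v_ k| ^+ 2 <= 8^-1 ^+ k.+1) ->
  (forall k, (\int[mu]_(x in D) (`|L2fun (v_ k) x| `^ p)%:E <= c)%E) ->
  (\int[mu]_(x in D) (`|L2fun u x| `^ p)%:E <= c)%E.
Proof.
move=> p1 uv vc; have cv := ae_cvg_L2fun uv.
pose s k x := (`|L2fun (v_ k) x| `^ p)%:E : \bar R.
have mv w : measurable_fun D (fun x => (`|L2fun (w : X) x| `^ p)%:E).
  apply/measurable_EFinP; apply: measurable_normr_powR; apply: measurable_funTS.
  exact: measurable_L2fun.
have ms k : measurable_fun D (s k) by exact: mv.
have s0 k x : (0 <= s k x)%E by rewrite lee_fin powR_ge0.
have := @fatou _ _ _ mu D mD s ms (fun k x _ => s0 k x).
have le2 : (limn_einf (fun k => \int[mu]_(x in D) s k x) <= c)%E.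
  by apply: limn_einf_le; apply: nearW => k; exact: vc.
move=> /le_trans /(_ le2); apply: le_trans; apply: ae_ge0_le_integral => //.
- by move=> x _; exact: limn_einf_ge.
- exact: measurable_fun_limn_einf.
apply: filterS cv => x h Dx; have {}h := h Dx.
have cp : {for L2fun u x, continuous (fun t : R => `|t| `^ p)}.
  apply/differentiable_continuous/derivable1_diffP.
  by have [] := is_derive_normr_powR (L2fun u x) p1.
have hE : s k x @[k --> \oo] --> (`|L2fun u x| `^ p)%:E.
  apply: cvg_EFin; first exact: nearW.
  by apply: (@cvg_comp _ _ _ _ (fun t : R => `|t| `^ p) _ _ _ h).
by have [-> _] := cvg_limn_einf_sup hE.
Qed.
End L2_fatou.

Section integral_preserving.
Local Open Scope ereal_scope.
Context d1 d2 (T1 : measurableType d1) (T2 : measurableType d2) (R : realType).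
Variables (m1 : {measure set T1 -> \bar R}) (m2 : {measure set T2 -> \bar R}) (phi : T1 -> T2).

Lemma ge0_integral_preserving (f : T2 -> \bar R) : measurable_fun setT phi ->
  (forall B, measurable B -> m1 (phi @^-1` B) = m2 B) ->
  measurable_fun setT f -> (forall x, 0 <= f x) ->
  \int[m1]_x f (phi x) = \int[m2]_y f y.
Proof.
move=> mphi m12 mf f0.
rewrite -[RHS](@eq_measure_integral _ _ _ setT m2 (pushforward m1 phi)); last first.
  by move=> B mB _; exact: m12.
by rewrite (ge0_integral_pushforward mphi).
Qed.
End integral_preserving.

(** * Lebesgue measure on row vectors in coordinates *)

Section Rn_measure.
Local Open Scope ereal_scope.
Context (R : realType) (n : nat).
Local Notation mR := (measurableTypeR R).
Local Notation leb := (@lebesgue_rV R n).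
Local Notation leb1 := (@lebesgue_measure R).
Local Notation Bn := (borel_rV R n).

Definition row_tuple (t : n.-tuple mR) : Bn := (\row_i tnth t i)%R.
Definition obox (a b : 'rV[R]_n) : set 'rV[R]_n := [set x | forall i, (a 0 i < x 0 i < b 0 i)%R].
Definition cbox (a b : 'rV[R]_n) : set 'rV[R]_n := [set x | forall i, (a 0 i <= x 0 i <= b 0 i)%R].
Definition rat_box (p : 'rV[rat]_n * 'rV[rat]_n) : 'rV[R]_n * 'rV[R]_n :=
  (map_mx (@ratr R) p.1, map_mx (@ratr R) p.2).

(** The closed boxes are required to lie inside [A] while the open ones cover it: a closed box will
    carry the compact support of a bump that is positive on the open box. *)
Lemma open_rat_boxes (A : set 'rV[R]_n) : open A ->
  A = \bigcup_(p in [set p | cbox (rat_box p).1 (rat_box p).2 `<=` A])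
        obox (rat_box p).1 (rat_box p).2.
Proof.
move=> oA; apply/seteqP; split=> [x Ax|x [p/= pA xp]]; last first.
  by apply: pA => i; have /andP[/ltW -> /ltW ->] := xp i.
have /nbhs_ballP[e /= e0 eA] : nbhs x A by apply: open_nbhs_nbhs.
have /choice[f xf] : forall i : 'I_n, exists q : rat * rat,
    (x 0 i - e < ratr q.1 < x 0 i /\ x 0 i < ratr q.2 < x 0 i + e)%R.
  move=> i.
  have [|q1] := @rat_in_itvoo R (x 0 i - e)%R (x 0%R i); first by rewrite ltrBlDr ltrDl.
  have [|q2] := @rat_in_itvoo R (x 0%R i) (x 0 i + e)%R; first by rewrite ltrDl.
  by rewrite !in_itv/= => h2 h1; exists (q1, q2).
exists (\row_i (f i).1, \row_i (f i).2)%R => [y yf|i] /=; last first.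
  by rewrite !mxE; have [/andP[_ ->] /andP[->]] := xf i.
apply: eA; split=> // i j; rewrite ord1 /ball/= ltr_norml.
have := yf j; rewrite !mxE => /andP[y1 y2]; have [/andP[h1 h2] /andP[h3 h4]] := xf j.
by rewrite ltrBlDr ltrBrDr; apply/andP; split; lra.
Qed.

Lemma measurable_row_tuple : measurable_fun [set: n.-tuple mR] row_tuple.
Proof.
apply: (@measurability _ _ _ Bn _ _ (@open 'rV[R]_n)) => //.
move=> _ [A oA <-]; rewrite setTI (open_rat_boxes oA) preimage_bigcup bigcup_mkcond.
apply: countable_bigcupT_measurable => // p; case: ifPn => // _.
rewrite (_ : _ @^-1` _ = \bigcap_(i in [set: 'I_n]) ((fun t : n.-tuple mR => tnth t i) @^-1`
   `]((rat_box p).1 0 i)%R, ((rat_box p).2 0 i)%R[%classic)).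
  apply: fin_bigcap_measurable => // i _.
  rewrite -[X in measurable X]setTI; apply: measurable_tnth => //.
by apply/seteqP; split=> [t tp i _|t tp i]; [have := tp i|have := tp i I]; rewrite /= !mxE in_itv.
Qed.

Lemma continuous_measurable_rV (f : 'rV[R]_n -> R) : continuous f ->
  measurable_fun [set: Bn] f.
Proof.
move=> /continuousP cf; apply: (measurability _ (RGenOpens.measurableE R)).
by move=> _ [_ [a [b ->] <-]]; rewrite setTI; apply: sub_sigma_algebra; exact/cf/interval_open.
Qed.

Lemma measurable_borel_Rn d' (T' : measurableType d') (f : 'rV[R]_n -> T') :
  measurable_fun [set: Bn] f -> measurable_fun [set: Rn R n] (f : Rn R n -> T').
Proof.
move=> mf _ B mB; have := mf measurableT _ mB; rewrite !setTI.
by move=> h; apply: caratheodory_measurable_mu_ext.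
Qed.

Lemma lebesgue_rV_borel (B : set Bn) : measurable B -> leb B = lebesgue_borel_rV B.
Proof. by move=> mB; exact: measurable_mu_extE. Qed.

Lemma ge0_integral_borel_rV (f : Bn -> \bar R) : measurable_fun setT f ->
  (forall x, 0 <= f x) -> \int[leb]_x f x = \int[@lebesgue_borel_rV R n]_x f x.
Proof.
move=> mf f0; apply: (@ge0_integral_preserving _ _ _ _ _ leb (@lebesgue_borel_rV R n) id f).
- exact: (@measurable_borel_Rn _ Bn id).
- by move=> B mB; exact: lebesgue_rV_borel.
- exact: mf.
- exact: f0.
Qed.

Lemma ge0_integral_rV (f : Bn -> \bar R) : measurable_fun setT f ->
  (forall x, 0 <= f x) -> \int[leb]_x f x = \int[lebesgue_tuple R n]_t f (row_tuple t).
Proof.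
move=> mf f0; rewrite ge0_integral_borel_rV//; apply/esym.
by apply: ge0_integral_preserving => //; exact: measurable_row_tuple.
Qed.

(** The i-th coordinate is set to y. The translation along a basis vector makes derivatives in y
    directional derivatives. *)
Definition upd_rV (x : 'rV[R]_n) (i : 'I_n) (y : R) : 'rV[R]_n :=
  (x + (y - x 0 i) *: delta_mx 0 i)%R.

Lemma row_updT t i y : row_tuple (updT t i y) = upd_rV (row_tuple t) i y.
Proof.
apply/rowP => j; rewrite !mxE tnth_mktuple eqxx/=.
by case: eqVneq => [->|_]; rewrite ?mulr1 ?mulr0 ?addr0// addrC subrK.
Qed.

Lemma eq_integral_rV_slices (i : 'I_n) (f g : Bn -> \bar R) :
  measurable_fun setT f -> measurable_fun setT g ->
  (forall x, 0 <= f x) -> (forall x, 0 <= g x) ->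
  (forall x, \int[leb1]_y f (upd_rV x i y) = \int[leb1]_y g (upd_rV x i y)) ->
  \int[leb]_x f x = \int[leb]_x g x.
Proof.
move=> mf mg f0 g0 fg; rewrite !ge0_integral_rV//.
apply: (eq_integral_slices (i := i)) => //.
- by apply: measurableT_comp => //; exact: measurable_row_tuple.
- by apply: measurableT_comp => //; exact: measurable_row_tuple.
move=> t; under eq_integral do rewrite row_updT.
by under [RHS]eq_integral do rewrite row_updT.
Qed.

Lemma lebesgue_rV_fin (U : set 'rV[R]_n) : open U -> bounded_set U -> leb U < +oo.
Proof.
move=> oU [M [Mr UM]]; pose r : R := (M + 1)%R.
have UB : U `<=` [set x : 'rV[R]_n | forall i, `](- r)%R, r[%classic (x 0%R i)].
  move=> x Ux i /=; rewrite in_itv/= -ltr_norml.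
  have : (`|x| <= M + 2^-1)%R by apply: UM => //; rewrite ltrDl.
  have : (`|x 0 i| <= `|x|)%R by rewrite /Num.norm/= mx_normrE; apply: (le_bigmax _ _ (0%R, i)).
  by rewrite /r; lra.
have bo : forall i : 'I_n, open (`](- r)%R, r[%classic : set R) by move=> _; exact: interval_open.
apply: (@le_lt_trans _ _ (leb [set x : 'rV[R]_n | forall i, `](- r)%R, r[%classic (x 0%R i)])).
  apply: le_measure => //; rewrite inE; first exact: open_measurable_rV.
  apply: open_measurable_rV; rewrite openE => x /= Ax; rewrite /interior.
  apply: (@filter_forall _ _ (fun i (y : 'rV[R]_n) => `](- r)%R, r[%classic (y 0%R i)) (nbhs x)) => i.
  apply: (@coord_continuous _ _ _ 0%R i x); apply: open_nbhs_nbhs; split => //.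
  exact: Ax.
rewrite (lebesgue_rV_box bo).
have -> : leb1 `](- r)%R, r[%classic = (if (- r < r)%R then r - - r else 0)%R%:E.
  by rewrite lebesgue_measure_itv/= lte_fin; case: ifPn.
by rewrite prodEFin ltry.
Qed.
End Rn_measure.

Section gagliardo_rV.
Local Open Scope ereal_scope.
Context (R : realType) (k : nat).
Local Notation leb := (@lebesgue_rV R k.+2).
Local Notation leb1 := (@lebesgue_measure R).
Local Notation Bn := (borel_rV R k.+2).

Lemma gagliardo_rV (f : Bn -> \bar R) (g : 'I_k.+2 -> Bn -> \bar R) :
  measurable_fun setT f -> (forall i, measurable_fun setT (g i)) ->
  (forall x, 0 <= f x) -> (forall i x, 0 <= g i x) ->
  (forall i x, f x <= \int[leb1]_y g i (upd_rV x i y)) ->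
  \int[leb]_x f x `^ (k.+2%:R / k.+1%:R) <=
  \prod_i (\int[leb]_x g i x) `^ k.+1%:R^-1.
Proof.
move=> mf mg f0 g0 fg; rewrite ge0_integral_rV//; last 2 first.
- exact: measurable_poweR_fun.
- by move=> x; exact: poweR_ge0.
under [leRHS]eq_bigr do rewrite ge0_integral_rV//.
apply: (@gagliardo R k (fun t => f (row_tuple t)) (fun i t => g i (row_tuple t))) => //.
- by apply: measurableT_comp => //; exact: measurable_row_tuple.
- by move=> i; apply: measurableT_comp => //; exact: measurable_row_tuple.
move=> i t; apply: le_trans (fg i _) _.
by under eq_integral do rewrite -row_updT.
Qed.
End gagliardo_rV.

Lemma is_derive_dirP (R : realType) (V W : normedModType R) (f : V -> W) (x v : V) (D : W) :
  is_derive x v f D <-> h^-1 *: (f (h *: v + x) - f x) @[h --> 0^'] --> D.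
Proof.
split=> [[]|h]; first by rewrite /derivable /derive => h1 <-.
split; first by rewrite /derivable; apply/cvg_ex; exists D.
by rewrite /derive; apply: cvg_lim.
Qed.

(** * Smooth functions and test functions *)

Section bump_exp.
Variable R : realType.

(* [x^-k exp(-1/x)] extended by zero; the family is stable under derivation *)
Definition bump_exp (k : nat) (x : R) : R := if 0 < x then x^-1 ^+ k * expR (- x^-1) else 0.

Lemma bump_exp_ge0 k x : 0 <= bump_exp k x.
Proof.
by rewrite /bump_exp; case: ifPn => // x0; rewrite mulr_ge0 ?expR_ge0// exprn_ge0// invr_ge0 ltW.
Qed.

Lemma bump_exp0_le1 x : bump_exp 0 x <= 1.
Proof.
by rewrite /bump_exp; case: ifPn => // x0; rewrite expr0 mul1r expR_le1 oppr_le0 invr_ge0 ltW.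
Qed.

Lemma bump_exp0_gt0 x : 0 < x -> 0 < bump_exp 0 x.
Proof. by move=> x0; rewrite /bump_exp x0 expr0 mul1r expR_gt0. Qed.

Lemma bump_exp_le0 k x : x <= 0 -> bump_exp k x = 0.
Proof. by move=> x0; rewrite /bump_exp ltNge x0. Qed.

(** One term of the exponential series, exp y >= y^(k+1)/(k+1)! at y = 1/x. The factor |x| gained
    gives the derivative at 0, as dividing by x raises k by one. *)
Lemma bump_exp_le k x : bump_exp k x <= k.+1`!%:R * `|x|.
Proof.
rewrite /bump_exp; case: ifPn => [x0|_]; last by rewrite mulr_ge0.
have y0 : 0 < x^-1 by rewrite invr_gt0.
have f0 : 0 < k.+1`!%:R :> R by rewrite ltr0n fact_gt0.
have := @expR_ge1Dxn R _ k (ltW y0) => /(le_trans _) h.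
have {h} : x^-1 ^+ k.+1 / k.+1`!%:R <= expR x^-1 by apply: h; rewrite lerDr.
rewrite ler_pdivrMr// => h; rewrite gtr0_norm// expRN ler_pdivrMr ?expR_gt0//.
have -> : x^-1 ^+ k = x * x^-1 ^+ k.+1 by rewrite exprS mulrA mulfV ?mul1r// gt_eqF.
by rewrite mulrAC [leRHS]mulrC ler_pM2l// mulrC.
Qed.

Lemma is_derive_bump_exp k (x : R) :
  is_derive x 1 (bump_exp k) (bump_exp k.+2 x - k%:R * bump_exp k.+1 x).
Proof.
have [x0|x0|x0] := ltgtP 0 x; last rewrite -x0.
- apply: (@near_eq_is_derive _ _ _ ((@GRing.inv R) ^+ k * (expR \o (- (@GRing.inv R))))).
    near=> z; have z0 : 0 < z by near: z; exact: lt_nbhsr.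
    by rewrite /bump_exp z0 /= exprfctE.
  have dinv : is_derive x 1 (@GRing.inv R) (- (x ^- 2)).
    have := @is_deriveV R id x 1 1 (lt0r_neq0 x0) (is_derive_id x 1).
    by rewrite -[_ *: _]/(_ * _) mulr1.
  have dN := is_deriveN dinv.
  have dE := @is_derive1_comp R expR (- (@GRing.inv R)) x _ _ (is_derive_expR _) dN.
  apply: is_derive_eq (is_deriveM (is_deriveX k dinv) dE) _.
  rewrite /bump_exp x0 -![_ *: _]/(_ * _) !exprfctE /= opprK -exprVn.
  case: k => [|k]; first by rewrite !mul0r mulr0 addr0 subr0 !expr0 !mul1r mulrC.
  rewrite -[k.+1.-1]/k -[(- _) x]/(- x^-1) !exprS.
  by move: (x^-1 ^+ k) (expR _) => u v; ring.
- rewrite !bump_exp_le0 ?(ltW x0)// mulr0 subr0.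
  apply: (@near_eq_is_derive _ _ _ (cst (0 : R))).
  near=> z; rewrite bump_exp_le0//; apply: ltW; near: z; exact: lt_nbhsl.
- rewrite !bump_exp_le0// mulr0 subr0; apply/is_derive1P.
  rewrite bump_exp_le0//; apply/cvgrPdist_lt => e e0.
  have f0 : 0 < k.+2`!%:R :> R by rewrite ltr0n fact_gt0.
  near=> h; have h0 : h != 0 by near: h; exact: nbhs_dnbhs_neq.
  have hd : `|h| < e / k.+2`!%:R by near: h; apply: dnbhs0_lt; rewrite divr_gt0.
  rewrite sub0r normrN add0r subr0 -[_ *: _]/(_ * _).
  have -> : h^-1 * bump_exp k h = bump_exp k.+1 h.
    by rewrite /bump_exp; case: ifPn; rewrite ?mulr0// exprS mulrA.
  rewrite ger0_norm ?bump_exp_ge0//; apply: le_lt_trans (bump_exp_le _ _) _.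
  by rewrite mulrC -ltr_pdivlMr.
Unshelve. all: by end_near. Qed.
End bump_exp.

Section smooth_functions.
Context (R : realType) (n : nat).
Local Notation rV := 'rV[R]_n.
Local Notation e_ i := (delta_mx 0 i : 'rV[R]_n).
Implicit Types f g : rV -> R.

Definition smooth f : Prop :=
  (forall s x, {for x, continuous (iter_partial s f)}) /\
  (forall s i x, derivable (iter_partial s f) x (e_ i)).

(** Coinduction: a class of continuous functions with partial derivatives in the same class contains
    only smooth functions. Higher-order product formulas are thereby reduced to first-order ones. *)
Lemma smooth_coind (P : (rV -> R) -> Prop) :
  (forall f, P f -> [/\ continuous f, forall i x, derivable f x (e_ i) &
                       forall i, P (partial i f)]) ->
  forall f, P f -> smooth f.
Proof.
move=> HP f Pf.
have Ps s : P (iter_partial s f) by elim: s => //= i s /HP[].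
by split=> [s x|s i x]; have [c d _] := HP _ (Ps s); [exact: c|exact: d].
Qed.

Lemma smooth_unfold f : smooth f ->
  [/\ continuous f, forall i x, derivable f x (e_ i) & forall i, smooth (partial i f)].
Proof.
move=> [cf df]; split=> [|i x|i]; [exact: (cf [::])|exact: (df [::])|].
have E s : iter_partial s (partial i f) = iter_partial (rcons s i) f.
  by rewrite /iter_partial foldr_rcons.
by split=> *; rewrite E; [exact: cf|exact: df].
Qed.

Lemma is_derive_coord (c : R -> R) (i j : 'I_n) (x : rV) (D : R) :
  is_derive (x 0 i) 1 c D -> is_derive x (e_ j) (fun x => c (x 0 i)) (if i == j then D else 0).
Proof.
move=> /is_derive1P cD; apply/is_derive_dirP; case: eqVneq => [<-|ij].
  have -> // : (fun h : R => h^-1 *: (c ((h *: e_ i + x) 0 i) - c (x 0 i))) =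
     fun h => h^-1 *: (c (x 0 i + h) - c (x 0 i)).
  by apply/funext => h; rewrite !mxE !eqxx mulr1 addrC.
have -> : (fun h : R => h^-1 *: (c ((h *: e_ j + x) 0 i) - c (x 0 i))) = cst 0.
  by apply/funext => h; rewrite !mxE eqxx (negbTE ij) mulr0 add0r subrr scaler0.
exact: cvg_cst.
Qed.

(** The class to which the coinduction is applied: an algebra stable under [partial], because the
    product rule and the rule for [bump_exp] stay inside it. *)
Inductive smooth_alg : (rV -> R) -> Prop :=
| smooth_alg_base f : smooth f -> smooth_alg f
| smooth_alg_bump k s a i : smooth_alg (fun x => bump_exp k (s * x 0 i + a))
| smooth_alg_cst c : smooth_alg (cst c)
| smooth_alg_add f g : smooth_alg f -> smooth_alg g -> smooth_alg (f + g)
| smooth_alg_mul f g : smooth_alg f -> smooth_alg g -> smooth_alg (f * g).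

Lemma smooth_algP f : smooth_alg f -> smooth f.
Proof.
apply: smooth_coind => {}f; elim=> {f}.
- move=> f /smooth_unfold[cf df Sf]; split => // i; exact: smooth_alg_base.
- move=> k s a i.
  pose c (y : R) := bump_exp k (s * y + a).
  pose b (y : R) := bump_exp k.+2 y - k%:R * bump_exp k.+1 y.
  have dc (y : R) : is_derive y 1 c (b (s * y + a) * s).
    apply: (@is_derive1_comp R (bump_exp k) (fun y => s * y + a)).
      exact: is_derive_bump_exp.
    have : is_derive y 1 (s *: (id : R -> R) + cst a) (s *: 1 + 0).
      by apply: is_deriveD.
    by move=> /is_derive_eq; apply; rewrite addr0; exact: mulr1.
  have cc : continuous c.
    by move=> y; apply/differentiable_continuous/derivable1_diffP; have [] := dc y.
  split.
  + move=> x; apply: (@continuous_comp _ _ _ (fun x : rV => x 0 i) c); last exact: cc.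
    exact: coord_continuous.
  + by move=> j x; have [] := is_derive_coord (i := i) j (dc (x 0 i)).
  move=> j; have -> : partial j (fun x : rV => bump_exp k (s * x 0 i + a)) =
      cst ((i == j)%:R * s) * ((fun x : rV => bump_exp k.+2 (s * x 0 i + a)) +
                      cst (- k%:R) * (fun x : rV => bump_exp k.+1 (s * x 0 i + a))).
    apply/funext => x; rewrite /partial; have [_ ->] := is_derive_coord (i := i) j (dc (x 0 i)).
    by rewrite /b/cst !fctE; case: eqVneq => _; rewrite ?mul0r// mulNr mul1r mulrC.
  apply: smooth_alg_mul; first exact: smooth_alg_cst.
  apply: smooth_alg_add; first exact: smooth_alg_bump.
  by apply: smooth_alg_mul; [exact: smooth_alg_cst|exact: smooth_alg_bump].
- move=> c; split.
  + exact: cst_continuous.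
  + by move=> i x; exact: derivable_cst.
  + move=> i; have -> : partial i (cst c) = cst 0.
      by apply/funext => x; rewrite /partial derive_cst.
    exact: smooth_alg_cst.
- move=> f g sf [cf df pf] sg [cg dg pg]; split.
  + by move=> x; apply: (@continuousD _ _ _ f g x); [exact: cf|exact: cg].
  + by move=> i x; apply: derivableD; [exact: df|exact: dg].
  + move=> i; have -> : partial i (f + g) = partial i f + partial i g.
      by apply/funext => x; rewrite /partial deriveD.
    exact: smooth_alg_add.
- move=> f g sf [cf df pf] sg [cg dg pg]; split.
  + by move=> x; apply: (@continuousM _ _ f g x); [exact: cf|exact: cg].
  + by move=> i x; apply: derivableM; [exact: df|exact: dg].
  + move=> i; have -> : partial i (f * g) = f * partial i g + g * partial i f.
      by apply/funext => x; rewrite /partial deriveM.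
    by apply: smooth_alg_add; exact: smooth_alg_mul.
Qed.

Lemma smoothD f g : smooth f -> smooth g -> smooth (f + g).
Proof. by move=> sf sg; apply/smooth_algP/smooth_alg_add; exact: smooth_alg_base. Qed.

Lemma smoothM f g : smooth f -> smooth g -> smooth (f * g).
Proof. by move=> sf sg; apply/smooth_algP/smooth_alg_mul; exact: smooth_alg_base. Qed.

Lemma smooth_cst c : smooth (cst c).
Proof. exact/smooth_algP/smooth_alg_cst. Qed.

Lemma partialD i f g x : smooth f -> smooth g -> partial i (f + g) x = partial i f x + partial i g x.
Proof.
by move=> /smooth_unfold[_ df _] /smooth_unfold[_ dg _]; rewrite /partial deriveD.
Qed.

Lemma partialM i f g x : smooth f -> smooth g ->
  partial i (f * g) x = f x * partial i g x + g x * partial i f x.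
Proof.
by move=> /smooth_unfold[_ df _] /smooth_unfold[_ dg _]; rewrite /partial deriveM.
Qed.

(** An arbitrary compact superset of the nonvanishing set is easier to carry through sums and
    products than its closure. *)
Lemma test_functionP (U : set rV) f :
  test_function U f <-> smooth f /\
    exists K, [/\ compact K, K `<=` U & forall x, f x != 0 -> K x].
Proof.
split=> [[h1 h2 h3 h4]|[[h1 h2] [K [cK KU fK]]]].
  split=> //; exists (closure [set x | f x != 0]); split=> // x fx.
  exact: subset_closure.
have clK : closed K by apply: compact_closed => //; exact: norm_hausdorff.
have sub : closure [set x | f x != 0] `<=` K.
  by rewrite (closure_id K).1//; apply: closure_subset => x; exact: fK.
split=> //; last exact: subset_trans KU.
apply: subclosed_compact cK sub; exact: closed_closure.
Qed.

Section algebra.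
Variable U : set rV.

Lemma test_smooth f : test_function U f -> smooth f.
Proof. by move=> /test_functionP[]. Qed.

Lemma test_out f x : test_function U f -> ~ U x -> f x = 0.
Proof.
move=> /test_functionP[_ [K [_ KU fK]]] nU; apply/eqP; apply: contrapT => /negP /fK /KU.
exact: nU.
Qed.

Lemma test_cst0 : test_function U (cst 0).
Proof.
apply/test_functionP; split; first exact: smooth_cst.
by exists set0; split=> [| |x]; [exact: compact0|exact: sub0set|rewrite eqxx].
Qed.

Lemma testD f g : test_function U f -> test_function U g -> test_function U (f + g).
Proof.
move=> /test_functionP[sf [K [cK KU fK]]] /test_functionP[sg [L [cL LU gL]]].
apply/test_functionP; split; first exact: smoothD.
exists (K `|` L); split; first exact: compactU.
  by move=> x []; [exact: KU|exact: LU].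
move=> x; rewrite fctE => fgx; have [fx|] := eqVneq (f x) 0; last by move=> /fK; left.
by right; apply: gL; move: fgx; rewrite fx add0r.
Qed.

Lemma testMl f g : smooth f -> test_function U g -> test_function U (f * g).
Proof.
move=> sf /test_functionP[sg [L [cL LU gL]]]; apply/test_functionP; split; first exact: smoothM.
by exists L; split=> // x; rewrite fctE mulf_eq0 negb_or => /andP[_ /gL].
Qed.

Lemma testM f g : test_function U f -> test_function U g -> test_function U (f * g).
Proof. by move=> /test_smooth; exact: testMl. Qed.

Lemma testZ (c : R) f : test_function U f -> test_function U (c *: f).
Proof.
move=> tf; have -> : c *: f = cst c * f by apply/funext => x.
by apply: testMl => //; exact: smooth_cst.
Qed.

Lemma test_partial i f : test_function U f -> test_function U (partial i f).
Proof.
move=> /test_functionP[sf [K [cK KU fK]]]; apply/test_functionP.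
have [_ _ spf] := smooth_unfold sf; split; first exact: spf.
exists K; split=> // x.
have [//|nKx] := pselect (K x) => /eqP; case.
have oK : open (~` K) by rewrite openC; apply: compact_closed => //; exact: norm_hausdorff.
rewrite /partial -(derive_cst (0 : R) x (e_ i)); apply: near_eq_derive.
have : nbhs x (~` K) by apply: open_nbhs_nbhs.
apply: filterS => z nKz; apply/eqP; apply: contrapT => /negP /fK; exact: nKz.
Qed.
End algebra.

Lemma test_subset (U V : set rV) f : U `<=` V -> test_function U f -> test_function V f.
Proof.
move=> UV /test_functionP[sf [K [cK KU fK]]]; apply/test_functionP; split=> //.
by exists K; split=> //; exact: subset_trans UV.
Qed.

Definition box_bump (a b x : rV) : R :=
  \prod_(i < n) (bump_exp 0 (x 0 i - a 0 i) * bump_exp 0 (b 0 i - x 0 i)).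

Lemma box_bump_itv a b x : 0 <= box_bump a b x <= 1.
Proof.
rewrite prodr_ge0 => [|i _]; last by rewrite mulr_ge0 ?bump_exp_ge0.
apply: prodr_ile1 => i _; rewrite mulr_ge0 ?bump_exp_ge0//=.
by rewrite mulr_ile1 ?bump_exp_ge0 ?bump_exp0_le1.
Qed.

Lemma box_bump_gt0 a b x : obox a b x -> 0 < box_bump a b x.
Proof.
move=> xab; apply: prodr_gt0 => i _; have /andP[h1 h2] := xab i.
by rewrite mulr_gt0// bump_exp0_gt0// subr_gt0.
Qed.

Lemma compact_cbox (a b : rV) : compact (cbox a b).
Proof.
have -> : cbox a b = [set x : rV | forall i, `[a 0 i, b 0 i]%classic (x 0 i)].
  by apply/seteqP; split=> x h i; have := h i; rewrite /= in_itv.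
by apply: (@rV_compact _ n (fun i => `[a 0 i, b 0 i]%classic)) => i; exact: segment_compact.
Qed.

Lemma test_box_bump (U : set rV) a b : cbox a b `<=` U -> test_function U (box_bump a b).
Proof.
move=> abU; apply/test_functionP; split.
  apply: smooth_algP; rewrite /box_bump.
  have -> : (fun x : rV => \prod_(i < n) (bump_exp 0 (x 0 i - a 0 i) * bump_exp 0 (b 0 i - x 0 i))) =
     \prod_(i < n) ((fun x : rV => bump_exp 0 (1 * x 0 i + (- a 0 i))) *
        (fun x : rV => bump_exp 0 (-1 * x 0 i + b 0 i))).
    apply/funext => x; rewrite fct_prodE; apply: eq_bigr => i _.
    by rewrite fctE mul1r mulN1r addrC (addrC (- x 0 i)).
  apply: (big_ind smooth_alg) => [|f g|i _]; first exact: smooth_alg_cst.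
  - exact: smooth_alg_mul.
  - by apply: smooth_alg_mul; exact: smooth_alg_bump.
exists (cbox a b); split=> //; first exact: compact_cbox.
move=> x /prodf_neq0 h i; have := h i isT; rewrite mulf_eq0 negb_or => /andP[h1 h2].
rewrite !leNgt; apply/andP; split; apply/negP => hx.
  by move: h1; rewrite bump_exp_le0 ?eqxx// subr_le0 ltW.
by move: h2; rewrite bump_exp_le0 ?eqxx// subr_le0 ltW.
Qed.

(** phi_k = 1 - prod_(j<k) (1 - c_j)^k, where c_j enumerates bumps on rational boxes inside O. Where
    some c_j is positive, its k-th power drives the product to 0; outside O every c_j vanishes. *)
Lemma open_indicator_approx (O : set rV) : open O ->
  exists phi : nat -> rV -> R, [/\ forall k, test_function O (phi k),
    forall k x, 0 <= phi k x <= 1 & forall x, phi ^~ x @ \oo --> (\1_O x : R)].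
Proof.
move=> oO.
(* Indices that decode to no pair of corners, or to a closed box not contained in O, receive the
   zero function. *)
pose c (j : nat) : rV -> R := if unpickle j is Some p then
  (if `[< cbox (rat_box R p).1 (rat_box R p).2 `<=` O >]
   then box_bump (rat_box R p).1 (rat_box R p).2 else cst 0) else cst 0.
have tc j : test_function O (c j).
  rewrite /c; case: unpickle => [p|]; last exact: test_cst0.
  by case: asboolP => h; [exact: test_box_bump|exact: test_cst0].
have c01 j x : 0 <= c j x <= 1.
  rewrite /c; case: unpickle => [p|]; last by rewrite /cst lexx ler01.
  by case: asboolP => h; [exact: box_bump_itv|rewrite /cst lexx ler01].
have cpos x : O x -> exists j, 0 < c j x.
  rewrite {1}(open_rat_boxes oO) => -[p /= pO xp]; exists (pickle p).
  by rewrite /c pickleK; case: asboolP => // _; exact: box_bump_gt0.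
(* [Q] is stable under products because 1 - fg = (1-f) + (1-g) - (1-f)(1-g). *)
pose Q f := test_function O (cst 1 - f) /\ forall x, 0 <= f x <= 1.
have Q1 : Q (cst 1).
  split; first by rewrite subrr; exact: test_cst0.
  by move=> x; rewrite /cst ler01 lexx.
have QM f g : Q f -> Q g -> Q (f * g).
  move=> [tf f01] [tg g01]; split; last first.
    move=> x; have /andP[f0 f1] := f01 x; have /andP[g0 g1] := g01 x.
    by rewrite !fctE mulr_ge0//= mulr_ile1.
  have -> : cst 1 - f * g = (cst 1 - f) + ((cst 1 - g) + (-1) *: ((cst 1 - f) * (cst 1 - g))).
    by apply/funext => x; rewrite /cst !fctE -[_ *: _]/(_ * _); ring.
  by apply: testD => //; apply: testD => //; apply: testZ; exact: testM.
have Qc j : Q (cst 1 - c j).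
  split; first by rewrite opprB addrC subrK.
  by move=> x; have := c01 j x; rewrite /cst !fctE; lra.
have Qp k : Q (\prod_(j < k) (cst 1 - c j) ^+ k).
  apply: (big_ind Q) => // j _; elim: k j => [|k IH] j; first by rewrite expr0.
  case: j => j /= _; elim: k.+1 => [|m IHm]; first by rewrite expr0.
  by rewrite exprS; exact: QM.
exists (fun k => cst 1 - \prod_(j < k) (cst 1 - c j) ^+ k); split.
- by move=> k; have [] := Qp k.
- by move=> k x; have [_ /(_ x)] := Qp k; rewrite /cst !fctE; lra.
move=> x; rewrite indicE; case: (boolP (x \in O)) => [/set_mem /cpos[j cj]|]; last first.
  rewrite notin_setE => nO; apply: (@cvg_trans _ ((fun=> 0 : R) @ \oo)); last exact: cvg_cst.
  apply: near_eq_cvg; apply: nearW => k; apply/esym.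
  by have [t _] := Qp k; exact: (test_out t nO).
have z1 : `|1 - c j x| < 1 by have /andP[_ cj1] := c01 j x; rewrite ger0_norm ?subr_ge0// gtrBl.
have h : (fun k : nat => (1 - c j x) ^+ k) @ \oo --> (0 : R) by exact: cvg_expr.
apply/cvgrPdist_lt => e e0.
have [k0 _ hk] := (cvgrPdist_lt _ _).1 h e e0.
exists (maxn k0 j.+1) => // k /=; rewrite geq_max => /andP[k0k jk].
have /= := hk k k0k; rewrite sub0r normrN; apply: le_lt_trans.
rewrite /cst !fctE opprB addrC subrK fct_prodE.
rewrite [in leLHS](bigD1 (Ordinal jk))//= normrM.
have -> : ((cst 1 - c j) ^+ k) x = (1 - c j x) ^+ k by rewrite exprfctE.
rewrite ler_piMr//.
rewrite ger0_norm; last first.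
  by apply: prodr_ge0 => i _; rewrite exprfctE exprn_ge0//; have := c01 i x; rewrite /cst !fctE; lra.
apply: prodr_ile1 => i _; rewrite exprfctE.
have := c01 i x; rewrite /cst !fctE => /andP[h0 h1].
by rewrite exprn_ge0 ?exprn_ile1//; lra.
Qed.
End smooth_functions.

Section test_analysis.
Context (R : realType) (n : nat).
Local Notation leb := (@lebesgue_rV R n).
Local Notation rV := 'rV[R]_n.
Local Notation e_ i := (delta_mx 0 i : 'rV[R]_n).
Implicit Types f g : rV -> R.

Lemma test_supp U f : test_function U f ->
  exists2 L : R, 0 < L & forall x, f x != 0 -> `|x| < L.
Proof.
move=> /test_functionP[sf [K [cK KU fK]]].
have [M [Mr MK]] := compact_bounded cK.
exists (`|M| + 2) => [|x /fK Kx]; first by rewrite ltr_wpDl.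
have := MK (`|M| + 1); rewrite (le_lt_trans (ler_norm M)) ?ltrDl// => /(_ isT x Kx).
by move=> h; apply: le_lt_trans h _; rewrite ltrD2l ltr1n.
Qed.

Lemma test_supp_coord U f : test_function U f ->
  exists2 L : R, 0 < L & forall (x : rV) i, L <= `|x 0 i| -> f x = 0.
Proof.
move=> /test_supp[L L0 h]; exists L => // x i Lx; apply/eqP; apply: contraT => /h xL.
have : `|x 0 i| <= `|x| by rewrite /Num.norm/= mx_normrE; apply: (le_bigmax _ _ (0, i)).
by move=> /(le_trans Lx); rewrite leNgt xL.
Qed.

Lemma test_bounded U f : test_function U f -> exists2 C : R, 0 <= C & forall x, `|f x| <= C.
Proof.
move=> /test_functionP[/smooth_unfold[cf _ _] [K [cK KU fK]]].
have [M [Mr MK]] := compact_bounded (continuous_compact (continuous_subspaceT cf) cK).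
exists (`|M| + 1) => [|x]; first by rewrite addr_ge0.
have [->|/fK Kx] := eqVneq (f x) 0; first by rewrite normr0 addr_ge0.
by apply: MK; [rewrite (le_lt_trans (ler_norm M))// ltrDl|exists x].
Qed.

Lemma measurable_smooth_borel f : smooth f -> measurable_fun [set: borel_rV R n] f.
Proof. by move=> /smooth_unfold[cf _ _]; exact: continuous_measurable_rV. Qed.

Lemma measurable_smooth f : smooth f -> measurable_fun [set: Rn R n] (f : Rn R n -> R).
Proof. by move=> sf; apply: measurable_borel_Rn; exact: measurable_smooth_borel. Qed.

Lemma test_bounded_integrable U f g (C : R) : test_function U f ->
  measurable_fun [set: Rn R n] (g : Rn R n -> R) -> (forall x, `|g x| <= C) ->
  (forall x, f x = 0 -> g x = 0) -> leb.-integrable setT (EFin \o (g : Rn R n -> R)).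
Proof.
move=> tf mg gC fg; have [L L0 fL] := test_supp tf.
have oB : open (ball (0 : rV) L) by exact: ball_open.
have Bfin : (leb (ball (0%R : rV) L) < +oo)%E.
  apply: lebesgue_rV_fin => //; exists L; split=> [|M LM x]; first exact: num_real.
  by rewrite -ball_normE/= sub0r normrN => /ltW /le_trans; apply; exact: ltW.
have mB := open_measurable_rV oB.
apply: (integrable_bounded_support mB Bfin mg gC) => x gx.
rewrite -ball_normE/= sub0r normrN; apply: fL.
by apply/eqP => /fg /eqP; exact/negP.
Qed.

Lemma test_integrable U f : test_function U f -> leb.-integrable setT (EFin \o (f : Rn R n -> R)).
Proof.
move=> tf; have [C C0 fC] := test_bounded tf.
by apply: (test_bounded_integrable tf _ fC) => //; exact: measurable_smooth (test_smooth tf).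
Qed.

Lemma is_derive_upd_rV f (x : rV) i (y : R) : (forall z, derivable f z (e_ i)) ->
  is_derive y 1 (fun y => f (upd_rV x i y)) (partial i f (upd_rV x i y)).
Proof.
move=> df; apply/is_derive1P.
have /is_derive_dirP : is_derive (upd_rV x i y) (e_ i) f (partial i f (upd_rV x i y)).
  by apply: DeriveDef => //; exact: df.
suff E h : upd_rV x i (y + h) = h *: e_ i + upd_rV x i y.
  by under eq_fun do rewrite -E.
by rewrite /upd_rV addrCA -scalerDl addrCA addrA.
Qed.

Lemma continuous_upd_rV (x : rV) i : continuous (upd_rV x i).
Proof.
move=> y; apply: cvgD; first exact: cvg_cst.
apply: cvgZr_tmp; apply: cvgB; [exact: cvg_id|exact: cvg_cst].
Qed.

Lemma upd_rV_coord (x : rV) i (y : R) : upd_rV x i y 0 i = y.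
Proof. by rewrite !mxE !eqxx mulr1 addrC subrK. Qed.

(** On each line in direction i the positive and negative parts of the partial derivative have the
    same integral, hence also on the whole space. *)
Lemma integral_test_partial U i f : test_function U f -> \int[leb]_x partial i f x = 0.
Proof.
move=> tf; have [L L0 fL] := test_supp_coord tf.
have tpf := test_partial i tf; have sp := test_smooth tpf.
have [_ df _] := smooth_unfold (test_smooth tf).
have [cp _ _] := smooth_unfold sp.
have mp := measurable_smooth_borel sp.
have mE (s : R) : measurable_fun [set: borel_rV R n] (fun x => (Num.max (s * partial i f x) 0)%:E).
  apply/measurable_EFinP; apply: measurable_maxr => //; exact: measurable_funM.
have : (\int[leb]_x (Num.max (1 * partial i f x) 0)%:E =
        \int[leb]_x (Num.max (-1 * partial i f x) 0)%:E)%E.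
  apply: (eq_integral_rV_slices (i := i)) => [||x|x|x].
  - exact: mE.
  - exact: mE.
  - by rewrite lee_fin le_max lexx orbT.
  - by rewrite lee_fin le_max lexx orbT.
  under eq_integral do rewrite mul1r.
  under [RHS]eq_integral do rewrite mulN1r.
  apply: (@FTC_compact_supp0 R (fun y => f (upd_rV x i y)) (fun y => partial i f (upd_rV x i y)) L).
  - by move=> y; apply: is_derive_upd_rV => z; exact: df.
  - by move=> y; apply: (@continuous_comp _ _ _ (upd_rV x i) (partial i f));
      [exact: continuous_upd_rV|exact: cp].
  - exact: L0.
  - by move=> y Ly; apply: (fL _ i); rewrite upd_rV_coord.
under eq_integral do rewrite mul1r.
under [X in _ = X -> _]eq_integral do rewrite mulN1r.
have int := test_integrable tpf.
have pE : (fun x : Rn R n => (Num.max (partial i f x) 0)%:E) = ((EFin \o (partial i f : Rn R n -> R))^\+)%E.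
  by apply/funext => z; rewrite funeposE/= EFin_max.
have nE : (fun x : Rn R n => (Num.max (- partial i f x) 0)%:E) = ((EFin \o (partial i f : Rn R n -> R))^\-)%E.
  by apply/funext => z; rewrite funenegE/= EFin_max.
rewrite pE nE => h; rewrite /Rintegral integralE h subee//.
by apply: integrable_fin_num => //; exact: integrable_funeneg.
Qed.

Lemma integral_test_parts U i f g : test_function U f -> test_function U g ->
  \int[leb]_x (f x * partial i g x) = - \int[leb]_x (partial i f x * g x).
Proof.
move=> tf tg; have := integral_test_partial i (testM tf tg).
have -> : partial i (f * g) = (fun x => f x * partial i g x + partial i f x * g x).
  apply/funext => x; rewrite partialM; [|exact: test_smooth tf|exact: test_smooth tg].
  by rewrite (mulrC (g x)).
rewrite RintegralD//; last 2 first.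
- exact: test_integrable (testM tf (test_partial i tg)).
- exact: test_integrable (testM (test_partial i tf) tg).
by move=> /eqP; rewrite addr_eq0 => /eqP.
Qed.
End test_analysis.

(** * Weak derivatives *)

Section L2_domain.
Context (R : realType) (n : nat) (U : set 'rV[R]_n) (oU : open U) (bU : bounded_set U).
Local Notation leb := (@lebesgue_rV R n).
Local Notation rV := 'rV[R]_n.
Local Notation X := (L2 oU).
Local Notation mU := (open_measurable_rV oU).
Local Notation muU := (mrestr leb mU).
Implicit Types (f g : rV -> R) (u v w : X).

Lemma measurable_L2_val u : measurable_fun [set: Rn R n] (L2_val u : Rn R n -> R).
Proof. exact: measurable_L2fun. Qed.

Lemma measurable_L2_valU u : measurable_fun (U : set (Rn R n)) (L2_val u : Rn R n -> R).
Proof. exact: measurable_funTS (measurable_L2_val u). Qed.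

Lemma L2ip_intU u v : L2ip u v = intU U (fun x => L2_val u x * L2_val v x).
Proof. exact: L2ip_restr. Qed.

(** The class of f in L^2(U), meaningful under the existence hypothesis of [toL2E]; the default
    value is 0. *)
Definition toL2 f : X := xget 0 [set u : X | {ae leb, forall x, U x -> L2_val u x = f x}].

Lemma toL2E f : (exists u : X, {ae leb, forall x, U x -> L2_val u x = f x}) ->
  {ae leb, forall x, U x -> L2_val (toL2 f) x = f x}.
Proof. by move=> /(xgetPex (0 : X)). Qed.

Lemma L2_val_inj u v : {ae leb, forall x, U x -> L2_val u x = L2_val v x} -> u = v.
Proof. exact: L2_restr_inj. Qed.

Lemma toL2_val f u : {ae leb, forall x, U x -> L2_val u x = f x} -> toL2 f = u.
Proof.
move=> uf; have h : {ae leb, forall x, U x -> L2_val (toL2 f) x = f x}.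
  by apply: toL2E; exists u.
by apply: L2_val_inj; apply: (ae_sub2 _ h uf) => x _ -> ->.
Qed.

Lemma L2_val_lin (c : R) u v :
  {ae leb, forall x, U x -> L2_val (c *: u + v) x = c * L2_val u x + L2_val v x}.
Proof. exact: L2_restr_lin. Qed.

Lemma ae_eq_intU f g : measurable_fun (U : set (Rn R n)) (f : Rn R n -> R) ->
  measurable_fun (U : set (Rn R n)) (g : Rn R n -> R) ->
  {ae leb, forall x, U x -> f x = g x} -> intU U f = intU U g.
Proof. exact: (ae_eq_Rintegral_restr mU). Qed.

Lemma test_measurableU V f : test_function V f ->
  measurable_fun (U : set (Rn R n)) (f : Rn R n -> R).
Proof. by move=> tf; apply: measurable_funTS; exact: measurable_smooth (test_smooth tf). Qed.

Lemma Ufin : (leb U < +oo)%E.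
Proof. exact: lebesgue_rV_fin. Qed.

Lemma toL2_test f V : test_function V f -> {ae leb, forall x, U x -> L2_val (toL2 f) x = f x}.
Proof.
move=> tf; have [C C0 fC] := test_bounded tf.
apply: toL2E; exact: (L2_of_bounded mU Ufin (test_measurableU tf) fC).
Qed.

Lemma toL2_test_lin f g V (c : R) : test_function V f -> test_function V g ->
  toL2 (c *: f + g) = c *: toL2 f + toL2 g.
Proof.
move=> tf tg; apply: toL2_val.
have h := L2_val_lin c (toL2 f) (toL2 g).
by apply: (ae_sub3 _ h (toL2_test tf) (toL2_test tg)) => x _ -> -> ->.
Qed.

Lemma intU_test u f V : test_function V f ->
  intU U (fun x => L2_val u x * f x) = L2ip u (toL2 f).
Proof.
move=> tf; rewrite L2ip_intU; apply: ae_eq_intU.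
- apply: measurable_funM; [exact: measurable_L2_valU|exact: test_measurableU tf].
- by apply: measurable_funM; exact: measurable_L2_valU.
- by have := toL2_test tf; apply: ae_sub1 => x _ ->.
Qed.

(** Weak differentiability becomes a family of linear conditions tested against fixed elements of
    L^2(U); linearity, uniqueness and closedness are then Hilbert space facts. *)
Lemma is_weak_partialP i u w : is_weak_partial i u w <->
  forall f, test_function U f -> L2ip u (toL2 (partial i f)) = - L2ip w (toL2 f).
Proof.
split=> h f tf; have := h f tf.
  by rewrite (intU_test _ (test_partial i tf)) (intU_test _ tf).
by rewrite (intU_test _ (test_partial i tf)) (intU_test _ tf).
Qed.

(* it is enough to integrate over open sets, on which the indicator function is
   a limit of test functions *)
Lemma test_orthogonal w : (forall f, test_function U f -> L2ip w (toL2 f) = 0) -> w = 0.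
Proof.
move=> w0.
have iw : leb.-integrable U (EFin \o (L2_val w : Rn R n -> R)) by exact: (integrable_L2_restr Ufin w).
have openw (O : set rV) : open O -> (\int[leb]_(x in (U : set (Rn R n)) `&` O) (L2_val w x)%:E = 0)%E.
  move=> oO; have oUO : open (U `&` O) by exact: openI.
  have [phi [tp p01 pcv]] := open_indicator_approx oUO.
  have tpU k : test_function U (phi k) by apply: test_subset (tp k); exact: subIsetl.
  have := @integral_indic_limit0 _ _ R leb _ mU (L2_val w) phi (U `&` O)
    (measurable_L2_valU w) iw (fun k => test_measurableU (tp k)) (open_measurable_rV oUO) p01 pcv.
  rewrite setIA setIid; apply => k.
  by have := w0 _ (tpU k); rewrite -(intU_test _ (tpU k)).
have int0 : (\int[leb]_(x in (U : set (Rn R n))) (L2_val w x)%:E = 0)%E.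
  by have := openw _ openT; rewrite setIT.
have borelw := @integral_dynkin0 _ _ R leb _ mU _ (borel_rV R n) id (@open rV) _ erefl _
  _ iw int0 openw.
have h : ae_eq leb U (EFin \o (L2_val w : Rn R n -> R)) (cst 0%E).
  apply: (completed_ae_eq0 mU Ufin iw) => B sB; apply: borelw.
  - by move=> A B' oA oB; exact: openI.
  - exact: (@measurable_borel_Rn _ _ _ (borel_rV R n) id).
  - exact: (smallest_sub (sigma_algebra_measurable _) (@subset_refl _ _) sB).
apply: L2_val_inj.
have h0 : {ae leb, forall x, U x -> L2_val (0 : X) x = 0}.
  by have := L2fun0 muU; move/ae_mrestr.
by apply: (ae_sub2 _ h h0) => x _ [] -> ->.
Qed.

Lemma L2ip_linl (c : R) u v w : L2ip (c *: u + v) w = c * L2ip u w + L2ip v w.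
Proof. exact: L2ip_lin. Qed.

Lemma L2ip_linr (c : R) u v w : L2ip w (c *: u + v) = c * L2ip w u + L2ip w v.
Proof. by rewrite !(L2ipC w) L2ip_linl. Qed.

Lemma L2ipBl u v w : L2ip (u - v) w = L2ip u w - L2ip v w.
Proof. by rewrite addrC -scaleN1r L2ip_linl mulN1r addrC. Qed.

Lemma weak_partial_uniq i u v w : is_weak_partial i u v -> is_weak_partial i u w -> v = w.
Proof.
move=> /is_weak_partialP uv /is_weak_partialP uw.
apply/eqP; rewrite -subr_eq0; apply/eqP; apply: test_orthogonal => f tf.
by rewrite L2ipBl; have := uv f tf; rewrite uw// => /oppr_inj ->; rewrite subrr.
Qed.

Lemma weak_partialE i u w : is_weak_partial i u w -> weak_partial i u = w.
Proof.
move=> uw; apply: (@weak_partial_uniq i u) => //.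
by apply: (xgetPex (0 : X)); exists w.
Qed.

Lemma H12_weak_partial i u : H12 u -> is_weak_partial i u (weak_partial i u).
Proof. by move=> /(_ i) /(xgetPex (0 : X)). Qed.

Lemma is_weak_partial_lin i (c : R) u v w z : is_weak_partial i u w ->
  is_weak_partial i v z -> is_weak_partial i (c *: u + v) (c *: w + z).
Proof.
move=> /is_weak_partialP uw /is_weak_partialP vz; apply/is_weak_partialP => f tf.
by rewrite !L2ip_linl uw// vz//; ring.
Qed.

Lemma is_weak_partialB i u v w z : is_weak_partial i u w ->
  is_weak_partial i v z -> is_weak_partial i (u - v) (w - z).
Proof.
move=> uw vz; have := is_weak_partial_lin (-1) vz uw.
by rewrite !scaleN1r (addrC (- v)) (addrC (- z)).
Qed.

(** The factor g and its derivatives vanish outside U, so the integrals over U are integrals over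
    the whole space, where the parts formula holds. *)
Lemma is_weak_partial_test i V f : test_function V f ->
  is_weak_partial i (toL2 f) (toL2 (partial i f)).
Proof.
move=> tf g tg; rewrite (intU_test _ (test_partial i tg)) (intU_test _ tg).
have tfT : test_function setT f by apply: test_subset tf.
have tgT : test_function setT g by apply: test_subset tg.
have E (a b : rV -> R) : test_function setT a -> test_function U b ->
    L2ip (toL2 a) (toL2 b) = \int[leb]_x (a x * b x).
  move=> ta tb; rewrite -(intU_test _ tb).
  rewrite (@ae_eq_intU _ (fun x => a x * b x)); last 3 first.
  - by apply: measurable_funM; [exact: measurable_L2_valU|exact: test_measurableU tb].
  - by apply: measurable_funM; [exact: test_measurableU ta|exact: test_measurableU tb].
  - by have := toL2_test ta; apply: ae_sub1 => x _ ->.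
  rewrite /intU Rintegral_mkcond; apply: eq_Rintegral => x _; rewrite patchE.
  by case: ifPn => //; rewrite notin_setE => nUx; rewrite (test_out tb nUx) mulr0.
rewrite !E//; [exact: integral_test_parts tfT tgT|exact: test_partial|exact: test_partial].
Qed.

Lemma is_weak_partial_closed i (u_ w_ : nat -> X) u w : (forall k, is_weak_partial i (u_ k) (w_ k)) ->
  u_ @ \oo --> u -> w_ @ \oo --> w -> is_weak_partial i u w.
Proof.
move=> uw cu cw; apply/is_weak_partialP => f tf.
have c1 := @cvg_L2ipl _ _ _ _ _ mU _ _ (toL2 (partial i f)) cu.
have c2 := cvgN (@cvg_L2ipl _ _ _ _ _ mU _ _ (toL2 f) cw).
have E : (fun k => L2ip (u_ k) (toL2 (partial i f))) = - (fun k => L2ip (w_ k) (toL2 f)).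
  by apply/funext => k; have /is_weak_partialP -> := uw k.
rewrite E in c1.
rewrite -(cvg_lim (@norm_hausdorff _ _) c1); apply: cvg_lim; first exact: norm_hausdorff.
exact: c2.
Qed.
End L2_domain.

Lemma powR_absorb (R : realType) (P C a : R) : 0 <= P -> 0 <= C -> a < 1 ->
  P <= C * P `^ a -> P `^ (1 - a) <= C.
Proof.
move=> P0 C0 a1 h; have [->|Pn0] := eqVneq P 0; first by rewrite powR0// gt_eqF// subr_gt0.
have Pp : 0 < P by rewrite lt0r Pn0.
rewrite powRB ?Pn0 ?implybT// powRr1// ler_pdivrMr// powR_gt0//.
Qed.

Lemma half_half (R : realType) : 2^-1 + 2^-1 = 1 :> R.
Proof. lra. Qed.

Lemma prode_poweR_const (R : realType) (n : nat) (C : \bar R) (r : R) : (0 <= C)%E -> 0 < r ->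
  (\prod_(i < n) C `^ r = C `^ (n%:R * r))%E.
Proof.
move=> C0 r0; elim: n => [|n IH]; first by rewrite big_ord0 mul0r poweRe0.
rewrite big_ord_recl IH -poweRD; first by rewrite -add1n natrD mulrDl mul1r.
by apply: add_neq0_poweRD_def; rewrite gt_eqF// ltr_pwDl// mulr_ge0// ltW.
Qed.

(** * Sobolev inequalities *)

Section sobolev_core.
Context (R : realType) (k : nat).
Local Notation d := k.+2.
Local Notation leb := (@lebesgue_rV R d).
Local Notation leb1 := (@lebesgue_measure R).
Local Notation rV := 'rV[R]_d.
Implicit Types f : rV -> R.

Definition grad_sqr f (x : rV) : R := \sum_i partial i f x ^+ 2.

Lemma grad_sqr_ge0 f x : 0 <= grad_sqr f x.
Proof. by apply: sumr_ge0 => i _; exact: sqr_ge0. Qed.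

(** Loomis-Whitney for |f|^m, whose i-th derivative has absolute value m |f|^(m-1) |d_i f|. The
    two-sided fundamental theorem replaces m by m/2; Cauchy-Schwarz separates |f|^(m-1) from the
    derivative, which is bounded by the full gradient. *)
Lemma smooth_gagliardo (m : R) f V : 1 < m -> test_function V f ->
  (\int[leb]_x (`|f x| `^ (m * (d%:R / k.+1%:R)))%:E <=
   ((m / 2)%:E * (\int[leb]_x (`|f x| `^ (2 * (m - 1)))%:E) `^ 2^-1 *
    (\int[leb]_x (grad_sqr f x)%:E) `^ 2^-1) `^ (d%:R / k.+1%:R))%E.
Proof.
move=> m1 tf.
have [L L0 fL] := test_supp_coord tf.
have sf := test_smooth tf; have [cf df sp] := smooth_unfold sf.
have mf := measurable_smooth_borel sf.
have mpf i := measurable_smooth_borel (sp i).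
have m0 : 0 < m by apply: lt_trans m1.
have r0 : 0 < m - 1 by rewrite subr_gt0.
have m20 : 0 <= m / 2 by rewrite divr_ge0// ltW.
have m2E : (0 <= (m / 2)%:E)%E by rewrite lee_fin.
pose F (x : borel_rV R d) := (`|f x| `^ m)%:E.
pose G i (x : borel_rV R d) := (m / 2 * (`|f x| `^ (m - 1) * `|partial i f x|))%:E.
have mpow (s : R) : measurable_fun [set: borel_rV R d] (fun x => `|f x| `^ s).
  apply: (@measurableT_comp _ _ _ _ _ _ (@powR R ^~ s)) => //; exact: measurableT_comp.
have mF : measurable_fun setT F by exact/measurable_EFinP.
have mG i : measurable_fun setT (G i).
  apply/measurable_EFinP; apply: measurable_funM => //; apply: measurable_funM => //.
  exact: measurableT_comp.
have F0 x : (0 <= F x)%E by rewrite lee_fin powR_ge0.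
have G0 i x : (0 <= G i x)%E.
  by rewrite lee_fin; apply: mulr_ge0 => //; apply: mulr_ge0 => //; exact: powR_ge0.
have FG i x : (F x <= \int[leb1]_y G i (upd_rV x i y))%E.

  pose psi y := f (upd_rV x i y); pose dpsi y := partial i f (upd_rV x i y).
  have dps (y : R) : is_derive y 1 psi (dpsi y) by apply: is_derive_upd_rV => z; exact: df.
  have cps : continuous psi.
    by move=> y; apply: (@continuous_comp _ _ _ (upd_rV x i) f);
      [exact: continuous_upd_rV|exact: cf].
  have cdps : continuous dpsi.
    have [cpf _ _] := smooth_unfold (sp i).
    by move=> y; apply: (@continuous_comp _ _ _ (upd_rV x i) (partial i f));
      [exact: continuous_upd_rV|exact: cpf].
  have := @FTC_compact_supp R (fun y => `|psi y| `^ m)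
    (fun y => m * sgn_powR (m - 1) (psi y) * dpsi y) L _ _ L0 _ (x 0 i).
  have xE : upd_rV x i (x 0 i) = x by rewrite /upd_rV subrr scale0r addr0.
  have fE : (`| `|psi (x 0 i)| `^ m | = `|f x| `^ m) by rewrite ger0_norm ?powR_ge0// /psi xE.
  have GE y : (`|m * sgn_powR (m - 1) (psi y) * dpsi y|%:E = 2%:E * G i (upd_rV x i y))%E.
    rewrite -EFinM; congr EFin; rewrite /sgn_powR !normrM (gtr0_norm m0).
    rewrite (ger0_norm (powR_ge0 _ _)) -/(psi y) -/(dpsi y) normr_sg.
    have [->|_] := eqVneq (psi y) 0; last by rewrite mulr1; lra.
    by rewrite normr0 powR0 ?gt_eqF// !(mul0r, mulr0).
  rewrite fE; under eq_integral do rewrite GE.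
  rewrite ge0_integralZl//; last first.
    apply: measurable_funTS; apply/measurable_EFinP.
    apply: measurable_funM => //; apply: measurable_funM.
      apply: (@measurableT_comp _ _ _ _ _ _ (@powR R ^~ (m - 1))) => //.
      by apply: measurableT_comp => //; exact: continuous_measurable_fun.
    by apply: measurableT_comp => //; exact: continuous_measurable_fun.
  rewrite EFinM lee_pmul2l ?ltry ?lte_fin//; apply.
  - move=> y; apply: (@is_derive1_comp R (fun z : R => `|z| `^ m) psi).
    exact: is_derive_normr_powR.
  - move=> y; apply: cvgM; last exact: cdps.
    apply: cvgM; first exact: cvg_cst.
    by apply: (@continuous_comp _ _ _ psi (sgn_powR (m - 1))); [exact: cps|exact: sgn_powR_continuous].
  - move=> y Ly; rewrite /psi (fL _ i) ?upd_rV_coord// normr0 powR0// gt_eqF//.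
have dk : 0 < (d%:R / k.+1%:R : R) by rewrite divr_gt0.
have := gagliardo_rV mF mG F0 G0 FG.
under eq_integral do rewrite /F poweR_EFin -powRrM.
move=> /le_trans; apply.
have mpR (s : R) : measurable_fun setT (fun x : Rn R d => (`|f x| `^ s)%:E).
  apply: measurable_borel_Rn; apply/measurable_EFinP; exact: mpow.
have mgR : measurable_fun setT (fun x : Rn R d => (grad_sqr f x)%:E).
  apply: measurable_borel_Rn; apply/measurable_EFinP.
  by apply: measurable_sum => i; exact: measurable_funX.
set C := (_ * _ * _)%E.
have C0 : (0 <= C)%E.
  by rewrite /C !mule_ge0 ?poweR_ge0// lee_fin divr_ge0// ltW.
have GC i : (\int[leb]_x G i x <= C)%E.
  rewrite /G; under eq_integral do rewrite EFinM.
  have mH : measurable_fun [set: Rn R d] (fun x => (`|f x| `^ (m - 1) * `|partial i f x|)%:E).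
    apply: measurable_borel_Rn; apply/measurable_EFinP; apply: measurable_funM; first exact: mpow.
    exact: measurableT_comp.
  have H0 (x : Rn R d) : [set: Rn R d] x -> (0 <= (`|f x| `^ (m - 1) * `|partial i f x|)%:E)%E.
    by move=> _; rewrite lee_fin mulr_ge0 ?powR_ge0.
  rewrite (ge0_integralZl leb measurableT mH H0 m2E) /C -muleA lee_wpmul2l//.
  have h2 : 0 < 2^-1 :> R by rewrite invr_gt0.
  have h21 := @half_half R.
  have g1 (x : Rn R d) : [set: Rn R d] x -> (0 <= (`|f x| `^ (2 * (m - 1)))%:E)%E.
    by move=> _; rewrite lee_fin powR_ge0.
  have g2 (x : Rn R d) : [set: Rn R d] x -> (0 <= (grad_sqr f x)%:E)%E.
    by move=> _; rewrite lee_fin grad_sqr_ge0.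
  apply: le_trans (hoelder2e leb measurableT h2 h2 h21 (mpR _) mgR g1 g2).
  apply: (ge0_le_integral _ measurableT H0 mH).
    by apply: emeasurable_funM; apply: measurable_poweR_fun; [|exact: mpR| |exact: mgR].
  move=> x _; rewrite !poweR_EFin -EFinM lee_fin -powRrM.
  have -> : 2 * (m - 1) * 2^-1 = m - 1 by rewrite mulrAC mulfV// mul1r.
  apply: ler_wpM2l; first exact: powR_ge0.
  have -> : `|partial i f x| = (partial i f x ^+ 2) `^ 2^-1.
    by rewrite powR12_sqrt ?sqr_ge0// sqrtr_sqr.
  apply: ge0_ler_powR; rewrite ?nnegrE ?sqr_ge0 ?grad_sqr_ge0 ?invr_ge0//.
  by rewrite /grad_sqr (bigD1 i)//= lerDl sumr_ge0// => j _; exact: sqr_ge0.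
apply: (@le_trans _ _ (\prod_(i < d) C `^ k.+1%:R^-1)%E).
  apply: lee_prod => i; first exact: poweR_ge0.
  apply: (gt0_ler_poweR _ _ _ (GC i)); rewrite ?in_itv/= ?leey ?C0 ?andbT ?invr_ge0//.
  by apply: integral_ge0 => x _; exact: G0.
by rewrite prode_poweR_const// invr_gt0.
Qed.
End sobolev_core.

(** With z = d - 2 these concern m = 2(d-1)/(d-2), the Loomis-Whitney power e = d/(d-1), and the
    identity 2/e - 1 = 2/p for p = 2d/(d-2). *)
Lemma critical_exponent (R : realType) (z : R) : 0 < z ->
  [/\ 1 < 2 * ((z + 1) / z), 0 < (z + 2) / (z + 1) < 2 &
      2 / ((z + 2) / (z + 1)) - 1 = 2 / (2 * ((z + 2) / z))].
Proof.
move=> z0; have z1 : 0 < z + 1 by rewrite addr_gt0.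
have z2 : 0 < z + 2 by rewrite addr_gt0.
split; [|apply/andP; split|].
- by rewrite mulrA ltr_pdivlMr//; lra.
- exact: divr_gt0.
- by rewrite ltr_pdivrMr//; lra.
- by field; rewrite !gt_eqF.
Qed.

Lemma powR_half_sqr (R : realType) (x : R) : 0 <= x -> (x `^ 2^-1) ^+ 2 = x.
Proof. by move=> x0; rewrite -powR_mulrn ?powR_ge0// -powRrM mulVf// powRr1. Qed.

(** P appears on the right with the power e/2 < 1. Dividing it out and raising to 2/e leaves the
    square of a times the integral G of the squared gradient. *)
Lemma gagliardo_absorb (R : realType) (P G a e : R) : 0 <= P -> 0 <= G -> 0 <= a ->
  0 < e < 2 -> P <= (a * P `^ 2^-1 * G `^ 2^-1) `^ e -> P `^ (2 / e - 1) <= a ^+ 2 * G.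
Proof.
move=> P0 G0 a0 /andP[e0 e2] h.
have h1 : P <= (a * G `^ 2^-1) `^ e * P `^ (2^-1 * e).
  have ag : 0 <= a * G `^ 2^-1 by rewrite mulr_ge0// powR_ge0.
  by rewrite (powRrM P 2^-1 e) -(powRM e ag (powR_ge0 P 2^-1)) mulrAC.
have a1 : 2^-1 * e < 1 by lra.
have h2 := powR_absorb P0 (powR_ge0 _ _) a1 h1.
have r0 : 0 <= 2 / e by rewrite divr_ge0// ltW.
have : (P `^ (1 - 2^-1 * e)) `^ (2 / e) <= ((a * G `^ 2^-1) `^ e) `^ (2 / e).
  by apply: ge0_ler_powR => //; rewrite nnegrE powR_ge0.
rewrite -!powRrM.
have -> : (1 - 2^-1 * e) * (2 / e) = 2 / e - 1 by field; rewrite gt_eqF.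
have -> : e * (2 / e) = 2%:R by rewrite mulrCA mulfV ?mulr1// gt_eqF.
by rewrite powR_mulrn ?mulr_ge0 ?powR_ge0// exprMn powR_half_sqr.
Qed.

(** The planar variant, in which the integral X on the right has a lower power of f and is first
    bounded by a power of P. *)
Lemma gagliardo_absorb2 (R : realType) (P X G w a r : R) : 0 <= P -> 0 <= X -> 0 <= G ->
  0 <= a -> 0 <= w -> r < 1 -> X <= P `^ r * w -> P <= (a * X `^ 2^-1 * G `^ 2^-1) `^ 2 ->
  P `^ (1 - r) <= a ^+ 2 * w * G.
Proof.
move=> P0 X0 G0 a0 w0 r1 XP h.
have C0 : 0 <= a ^+ 2 * w * G by rewrite !mulr_ge0.
apply: (powR_absorb P0 C0 r1); apply: le_trans h _.
rewrite (powR_mulrn 2) ?mulr_ge0 ?powR_ge0// 2!exprMn !powR_half_sqr//.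
have -> : a ^+ 2 * w * G * P `^ r = a ^+ 2 * (P `^ r * w) * G by ring.
by apply: ler_wpM2r => //; apply: ler_wpM2l => //; exact: sqr_ge0.
Qed.

Section sobolev_test.
Context (R : realType) (k : nat) (U : set 'rV[R]_k.+2) (oU : open U) (bU : bounded_set U).
Local Notation d := k.+2.
Local Notation leb := (@lebesgue_rV R d).
Local Notation rV := 'rV[R]_d.
Implicit Types f : rV -> R.

Lemma test_grad_sqr f V : test_function V f -> test_function V (grad_sqr f).
Proof.
move=> tf; have -> : grad_sqr f = \sum_i (partial i f * partial i f).
  by apply/funext => x; rewrite fct_sumE; apply: eq_bigr => i _; rewrite expr2.
apply: (big_ind (test_function V)) => [|g h|i _]; [exact: test_cst0|exact: testD|].
by apply: testM; exact: test_partial.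
Qed.

Lemma measurable_test_powR f V (p : R) : test_function V f ->
  measurable_fun [set: Rn R d] (fun x => `|f x| `^ p).
Proof.
by move=> tf; apply: measurable_normr_powR; exact: measurable_smooth (test_smooth tf).
Qed.

Lemma test_powR_fin f V (p : R) : 0 < p -> test_function V f ->
  (\int[leb]_x (`|f x| `^ p)%:E \is a fin_num)%E.
Proof.
move=> p0 tf; have [C C0 fC] := test_bounded tf.
apply: integrable_fin_num => //.
apply: (@test_bounded_integrable _ _ _ f (fun x => `|f x| `^ p) (C `^ p) tf).
- exact: measurable_test_powR tf.
- move=> x; rewrite ger0_norm ?powR_ge0//.
  by apply: ge0_ler_powR; rewrite ?nnegrE// ltW.
- by move=> x ->; rewrite normr0 powR0// gt_eqF.
Qed.

Lemma integral_test_restrict (g : rV -> R) : (forall x, ~ U x -> g x = 0) ->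
  (\int[leb]_x (g x)%:E = \int[leb]_(x in (U : set (Rn R d))) (g x)%:E)%E.
Proof.
move=> gU; rewrite [RHS]integral_mkcond; apply: eq_integral => x _.
by rewrite patchE; case: ifPn => //; rewrite notin_setE => /gU ->.
Qed.

(** m = 2(d-1)/(d-2) is the exponent for which both integrals of powers of |f| in [smooth_gagliardo]
    coincide: m d/(d-1) = 2(m-1) = p. The constant (m/2)^2 = ((d-1)/(d-2))^2 is the reciprocal of
    the dimensional factor in the threshold on [N]. *)
Lemma sobolev_test_ge3 f V (p : R) : (0 < k)%N -> test_function V f ->
  p = 2 * (d%:R / k%:R) ->
  ((\int[leb]_x (`|f x| `^ p)%:E) `^ (2 / p) <=
   (((k.+1%:R / k%:R) ^+ 2)%:E * \int[leb]_x (grad_sqr f x)%:E))%E.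
Proof.
move=> k0 tf pE.
have kp : 0 < k%:R :> R by rewrite ltr0n.
have k1E : k.+1%:R = k%:R + 1 :> R by rewrite -natr1.
have dE : d%:R = k%:R + 2 :> R by rewrite -addn2 natrD.
have k1p : 0 < k.+1%:R :> R by rewrite ltr0n.
have dp : 0 < d%:R :> R by rewrite ltr0n.
have p0 : 0 < p by rewrite pE mulr_gt0// divr_gt0.
pose m : R := 2 * (k.+1%:R / k%:R).
have [m1 e12 e3] := critical_exponent kp.
rewrite -k1E -/m in m1; rewrite -k1E -dE in e12; rewrite -k1E -dE -pE in e3.
have e1 : m * (d%:R / k.+1%:R) = p.
  by rewrite /m pE; field; rewrite !gt_eqF.
have m2E : m / 2 = k.+1%:R / k%:R by rewrite /m mulrC mulKf.
have e2 : 2 * (m - 1) = p.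
  by rewrite /m pE k1E dE; field; rewrite gt_eqF.
have := smooth_gagliardo m1 tf; rewrite e1 e2.
rewrite -(fineK (test_powR_fin p0 tf)).
have Gfin : (\int[leb]_x (grad_sqr f x)%:E \is a fin_num)%E.
  by apply: integrable_fin_num => //; exact: test_integrable (test_grad_sqr tf).
rewrite -(fineK Gfin); set P := fine _; set G := fine _.
have P0 : 0 <= P by apply: fine_ge0; apply: integral_ge0 => x _; rewrite lee_fin powR_ge0.
have G0 : 0 <= G by apply: fine_ge0; apply: integral_ge0 => x _; rewrite lee_fin grad_sqr_ge0.
rewrite !poweR_EFin -?EFinM ?poweR_EFin -?EFinM !lee_fin.
have m20 : 0 <= m / 2 by rewrite m2E; apply: divr_ge0; exact: ltW.
move=> /(gagliardo_absorb P0 G0 m20 e12); rewrite m2E.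
by rewrite e3.
Qed.
End sobolev_test.

Section sobolev_test2.
Context (R : realType) (U : set 'rV[R]_2) (oU : open U) (bU : bounded_set U).
Local Notation leb := (@lebesgue_rV R 2).
Local Notation rV := 'rV[R]_2.

(** With m = p/2 the power on the left is 2m = p but the one on the right is 2(m-1) < p; Hoelder on
    U closes the gap and introduces |U|^(2/p), while (m/2)^2 = (p/4)^2. *)
Lemma sobolev_test_2 (f : rV -> R) (p : R) : 2 < p -> test_function U f ->
  ((\int[leb]_x (`|f x| `^ p)%:E) `^ (2 / p) <=
   (((p / 4) ^+ 2 * fine (leb U) `^ (2 / p))%:E * \int[leb]_x (grad_sqr f x)%:E))%E.
Proof.
move=> p2 tf.
have p0 : 0 < p by apply: lt_trans p2.
pose m : R := p / 2.
have m1 : 1 < m by rewrite /m ltr_pdivlMr// mul1r.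
have mp : 0 < m by apply: lt_trans m1.
have e1 : m * (2%:R / 1%:R) = p by rewrite divr1 /m mulfVK.
have := smooth_gagliardo m1 tf; rewrite e1.
have X0 : 0 < 2 * (m - 1) by rewrite mulr_gt0// subr_gt0.
have Ufin : (leb U < +oo)%E by exact: lebesgue_rV_fin.
have mU := open_measurable_rV oU.
have XP : (\int[leb]_x (`|f x| `^ (2 * (m - 1)))%:E <=
    (\int[leb]_x (`|f x| `^ p)%:E) `^ ((m - 1) / m) * (leb U) `^ m^-1)%E.
  have zU (s : R) : 0 < s -> forall x, ~ U x -> `|f x| `^ s = 0.
    by move=> s0 x nUx; rewrite (test_out tf nUx) normr0 powR0// gt_eqF.
  rewrite !(@integral_test_restrict _ _ U)//; [|exact: zU|exact: zU].
  have mi0 : 0 < m^-1 by rewrite invr_gt0.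
  have r0 : 0 < (m - 1) / m by rewrite divr_gt0// subr_gt0.
  have r1 : (m - 1) / m + m^-1 = 1.
    by rewrite -[X in _ + X]mul1r -mulrDl subrK divff// gt_eqF.
  have mf : measurable_fun (U : set (Rn R 2)) (fun x => (`|f x| `^ p)%:E).
    by apply: measurable_funTS; apply/measurable_EFinP; exact: measurable_test_powR tf.
  have f0 (x : Rn R 2) : U x -> (0 <= (`|f x| `^ p)%:E)%E by rewrite lee_fin powR_ge0.
  have m1' : measurable_fun (U : set (Rn R 2)) (cst 1%E : Rn R 2 -> \bar R) by exact: measurable_cst.
  have f1 (x : Rn R 2) : U x -> (0 <= (cst 1%E x : \bar R))%E by [].
  have := hoelder2e leb mU r0 mi0 r1 mf m1' f0 f1.
  rewrite integral_cst// mul1e; apply: le_trans.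
  rewrite le_eqVlt; apply/orP; left; apply/eqP; apply: eq_integral => x _.
  rewrite poweR1r mule1 poweR_EFin -powRrM; congr ((_ `^ _)%:E).
  by rewrite /m; field; rewrite gt_eqF.
move: XP.
rewrite -(fineK (test_powR_fin p0 tf)) -(fineK (test_powR_fin X0 tf)).
have Gfin : (\int[leb]_x (grad_sqr f x)%:E \is a fin_num)%E.
  by apply: integrable_fin_num => //; exact: test_integrable (test_grad_sqr tf).
have lebE : leb U = (fine (leb U))%:E by rewrite fineK// ge0_fin_numE.
rewrite -(fineK Gfin) lebE /=.
set X := fine _; set P := fine _; set G := fine (\int[leb]_x (grad_sqr f x)%:E)%E; set u := fine (leb U).
have P0 : 0 <= P by apply: fine_ge0; apply: integral_ge0 => x _; rewrite lee_fin powR_ge0.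
have XX0 : 0 <= X by apply: fine_ge0; apply: integral_ge0 => x _; rewrite lee_fin powR_ge0.
have G0 : 0 <= G by apply: fine_ge0; apply: integral_ge0 => x _; rewrite lee_fin grad_sqr_ge0.
have u0 : 0 <= u by exact: fine_ge0.
rewrite -!EFinM !lee_fin divr1 => XP h.
have m20 : 0 <= m / 2 by rewrite divr_ge0// ltW.
have a1 : (m - 1) / m < 1 by rewrite ltr_pdivrMr// mul1r gtrBl.
have := gagliardo_absorb2 P0 XX0 G0 m20 (powR_ge0 _ _) a1 XP h.
have -> : 1 - (m - 1) / m = 2 / p by rewrite /m; field; rewrite gt_eqF.
have -> : m^-1 = 2 / p by rewrite /m invf_div.
by have -> : m / 2 = p / 4 by rewrite /m; field.
Qed.
End sobolev_test2.

Lemma norm_tri_half (R : realType) (X : normedModType R) (a b c : X) (e : R) :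
  `|a - b| < e / 2 -> `|b - c| < e / 2 -> `|a - c| < e.
Proof.
move=> h1 h2; rewrite -(subrK b a) -addrA; apply: le_lt_trans (ler_normD _ _) _.
by move: h1 h2; move: (`|_|) (`|_|) => x y; lra.
Qed.

Lemma norm_lin_half (R : realType) (X : normedModType R) (c : R) (a a' b b' : X) (e : R) :
  `|a - a'| < e / (2 * (`|c| + 1)) -> `|b - b'| < e / 2 ->
  `|c *: a + b - (c *: a' + b')| < e.
Proof.
move=> h1 h2; have -> : c *: a + b - (c *: a' + b') = c *: (a - a') + (b - b').
  by rewrite scalerBr opprD addrACA.
apply: le_lt_trans (ler_normD _ _) _; rewrite normrZ.
have k0 : 0 < `|c| + 1 by rewrite ltr_wpDl.
have : `|c| * `|a - a'| <= (`|c| + 1) * (e / (2 * (`|c| + 1))).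
  by apply: ler_pM => //; [rewrite lerDl|exact: ltW].
have -> : (`|c| + 1) * (e / (2 * (`|c| + 1))) = e / 2 by field; rewrite gt_eqF.
by move: h2; move: (`|b - b'|) (`|c| * _) => x y; lra.
Qed.

Lemma sqr_lt (R : realType) (a d : R) : 0 <= a -> 0 < d -> (a ^+ 2 < d ^+ 2) = (a < d).
Proof. by move=> a0 d0; rewrite ltr_sqr// nnegrE ltW. Qed.

Lemma le_sqrt_lt (R : realType) (a b e : R) : 0 <= a -> a ^+ 2 <= b -> Num.sqrt b < e -> a < e.
Proof.
move=> a0 ab; apply: le_lt_trans.
by rewrite -(ger0_norm a0) -sqrtr_sqr; exact: ler_wsqrtr.
Qed.

(** * The space H10 *)

Section H10_space.
Context (R : realType) (n : nat) (U : set 'rV[R]_n) (oU : open U) (bU : bounded_set U).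
Local Notation leb := (@lebesgue_rV R n).
Local Notation rV := 'rV[R]_n.
Local Notation X := (L2 oU).
Local Notation V := (@H10 R n U oU).
Implicit Types (f g : rV -> R) (u v w : X).

Definition dirichlet u v : R := \sum_i L2ip (weak_partial i u) (weak_partial i v).

Lemma dirichletE u : dirichlet u u = \sum_i `|weak_partial i u| ^+ 2.
Proof. by apply: eq_bigr => i _; rewrite L2norm_sqr. Qed.

Lemma dirichlet_ge0 u : 0 <= dirichlet u u.
Proof. by rewrite dirichletE; apply: sumr_ge0 => i _; exact: sqr_ge0. Qed.

Lemma H10_normE u : H10_norm u = Num.sqrt (dirichlet u u).
Proof. by rewrite /H10_norm dirichletE. Qed.

Lemma H10_H12 u : V u -> H12 u. Proof. by case. Qed.

Lemma H10_weak_partial i u : V u -> is_weak_partial i u (weak_partial i u).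
Proof. by move=> Vu; apply: H12_weak_partial; exact: H10_H12. Qed.

Lemma H10_approx u (e : R) : V u -> 0 < e -> exists f, [/\ test_function U f,
  `|u - toL2 oU f| < e & forall i, `|weak_partial i u - toL2 oU (partial i f)| < e].
Proof.
move=> Vu e0; have [_ /(_ e e0)[v [f tf vf] uv]] := Vu; exists f.
have vE : v = toL2 oU f by apply/esym/toL2_val.
have wE i : weak_partial i (u - v) = weak_partial i u - toL2 oU (partial i f).
  rewrite vE; apply: (weak_partialE bU); apply: (is_weak_partialB bU (H10_weak_partial i Vu)).
  exact: is_weak_partial_test tf.
move: uv; rewrite /H12_norm => uv; split => //.
  apply: le_sqrt_lt uv => //; rewrite -vE lerDl; apply: sumr_ge0 => i _; exact: sqr_ge0.
move=> i; rewrite -wE; apply: le_sqrt_lt uv => //.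
rewrite (bigD1 i)//= addrCA lerDl addr_ge0 ?sqr_ge0//.
by apply: sumr_ge0 => j _; exact: sqr_ge0.
Qed.

(** Membership by simultaneous approximation of u and its derivatives. The norm collects n + 1
    squares of at most (e/(n+2))^2, and n + 1 < (n+2)^2. *)
Lemma H10I u (w : 'I_n -> X) : (forall i, is_weak_partial i u (w i)) ->
  (forall e : R, 0 < e -> exists f, [/\ test_function U f,
     `|u - toL2 oU f| < e & forall i, `|w i - toL2 oU (partial i f)| < e]) -> V u.
Proof.
move=> uw h; split=> [i|e e0]; first by exists (w i).
have n0 : 0 < n.+2%:R :> R by rewrite ltr0n.
have d0 : 0 < e / n.+2%:R by rewrite divr_gt0.
have [f [tf uf wf]] := h _ d0; exists (toL2 oU f).
  by exists f => //; exact: (toL2_test oU bU tf).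
have wE i : weak_partial i (u - toL2 oU f) = w i - toL2 oU (partial i f).
  apply: (weak_partialE bU); apply: (is_weak_partialB bU (uw i)).
  exact: is_weak_partial_test tf.
have sq (a : R) : 0 <= a -> a < e / n.+2%:R -> a ^+ 2 <= (e / n.+2%:R) ^+ 2.
  by move=> a0 /ltW ae; rewrite ler_sqr// nnegrE ltW.
rewrite /H12_norm -[ltRHS](ger0_norm (ltW e0)) -sqrtr_sqr ltr_sqrt ?exprn_gt0//.
apply: (@le_lt_trans _ _ (n.+1%:R * (e / n.+2%:R) ^+ 2)).
  rewrite -natr1 mulrDl mul1r addrC lerD//; last exact: sq.
  apply: (@le_trans _ _ (\sum_(i < n) (e / n.+2%:R) ^+ 2)).
    by apply: ler_sum => i _; rewrite wE; exact: sq.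
  by rewrite sumr_const card_ord -[leLHS]mulr_natl.
rewrite expr_div_n mulrCA -[ltRHS]mulr1 ltr_pM2l ?exprn_gt0//.
rewrite ltr_pdivrMr ?exprn_gt0// mul1r expr2.
rewrite -[ltLHS]mulr1 ltr_pM// ?ltr_nat// ?ltr1n//.
Qed.

Lemma H10_test f : test_function U f -> V (toL2 oU f).
Proof.
move=> tf; apply: (@H10I _ (fun i => toL2 oU (partial i f))).
  by move=> i; exact: (is_weak_partial_test oU bU i tf).
by move=> e e0; exists f; split=> // [|i]; rewrite subrr normr0.
Qed.

Lemma weak_partial_lin i (c : R) u v : V u -> V v ->
  weak_partial i (c *: u + v) = c *: weak_partial i u + weak_partial i v.
Proof.
move=> Vu Vv; apply: (weak_partialE bU).
exact: (is_weak_partial_lin bU c (H10_weak_partial i Vu) (H10_weak_partial i Vv)).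
Qed.

Lemma weak_partialB i u v : V u -> V v ->
  weak_partial i (u - v) = weak_partial i u - weak_partial i v.
Proof.
move=> Vu Vv; apply: (weak_partialE bU).
exact: (is_weak_partialB bU (H10_weak_partial i Vu) (H10_weak_partial i Vv)).
Qed.

Lemma H10_subspace : subspace V.
Proof.
split.
  have -> : (0 : X) = toL2 oU (cst 0).
    have := toL2_test_lin oU bU (-1) (test_cst0 setT) (test_cst0 setT).
    have -> : -1 *: toL2 oU (cst 0) + toL2 oU (cst 0) = 0 by rewrite scaleN1r addNr.
    move=> <-; congr toL2; apply/funext => x.
    by rewrite /cst -[LHS]/(-1 * 0 + 0) mulr0 addr0.
  by apply: H10_test; exact: test_cst0.
move=> c u v Vu Vv.
apply: (@H10I _ (fun i => c *: weak_partial i u + weak_partial i v)).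
  move=> i.
  exact: (is_weak_partial_lin bU c (H10_weak_partial i Vu) (H10_weak_partial i Vv)).
move=> e e0.
have d1 : 0 < e / (2 * (`|c| + 1)) by rewrite divr_gt0// mulr_gt0// ltr_wpDl.
have d2 : 0 < e / 2 by rewrite divr_gt0.
have [f [tf uf pf]] := H10_approx Vu d1; have [g [tg vg pg]] := H10_approx Vv d2.
have tfg : test_function U (c *: f + g) by apply: testD => //; exact: testZ.
exists (c *: f + g); split => // [|i].
  by rewrite (toL2_test_lin oU bU c tf tg); exact: norm_lin_half.
have -> : partial i (c *: f + g) = c *: partial i f + partial i g.
  apply/funext => x; rewrite partialD; [|exact: test_smooth (testZ c tf)|exact: test_smooth tg].
  congr (_ + _); have -> : c *: f = cst c * f by apply/funext.
  rewrite partialM; [|exact: smooth_cst|exact: test_smooth tf].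
  by rewrite {2}/partial derive_cst mulr0 addr0.
by rewrite (toL2_test_lin oU bU c (test_partial i tf) (test_partial i tg)); exact: norm_lin_half.
Qed.

Lemma dirichlet_sym_psd : sym_psd_on V dirichlet.
Proof.
have lin w : linear_on V (dirichlet ^~ w).
  move=> c u v Vu Vv; rewrite /dirichlet mulr_sumr -big_split/=; apply: eq_bigr => i _.
  by rewrite weak_partial_lin// L2ip_linl.
have sym u v : dirichlet u v = dirichlet v u by apply: eq_bigr => i _; exact: L2ipC.
split=> [|u v _ _|u _]; [|exact: sym|exact: dirichlet_ge0].
split=> w _; first exact: lin.
by move=> c u v Vu Vv; rewrite !(sym w); exact: lin.
Qed.

Lemma dirichletB i u v : V u -> V v ->
  `|weak_partial i u - weak_partial i v| ^+ 2 <= dirichlet (u - v) (u - v).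
Proof.
move=> Vu Vv; rewrite dirichletE (bigD1 i)//=.
rewrite (weak_partialB i Vu Vv).
by rewrite lerDl; apply: sumr_ge0 => j _; exact: sqr_ge0.
Qed.

(** The Poincare inequality makes u_k Cauchy in L2, the weak partials are Cauchy directly, and weak
    differentiation is closed. *)
Lemma H10_complete (Cp : R) : 0 <= Cp -> (forall u, V u -> `|u| ^+ 2 <= Cp * dirichlet u u) ->
  complete_on V (fun u => dirichlet u u).
Proof.
move=> Cp0 PC u_ Vu cu.
have sV := H10_subspace.
have cau (C : R) (w_ : nat -> X) : 0 <= C ->
    (forall k l, `|w_ k - w_ l| ^+ 2 <= C * dirichlet (u_ k - u_ l) (u_ k - u_ l)) ->
    exists l : X, w_ k @[k --> \oo] --> l.
  move=> C0 h; apply: L2_complete => e e0.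
  have d0 : 0 < e ^+ 2 / (C + 1) by rewrite divr_gt0// ?exprn_gt0// ltr_wpDl.
  have [n0 hn0] := cu _ d0; exists n0 => k l hk hl.
  rewrite -sqr_lt//; apply: le_lt_trans (h k l) _.
  have := hn0 k l hk hl; rewrite ltr_pdivlMr ?ltr_wpDl//; apply: le_lt_trans.
  by rewrite mulrC ler_wpM2l ?dirichlet_ge0// lerDl.
have [l ul] : exists l : X, u_ k @[k --> \oo] --> l.
  by apply: (cau Cp) => // k m; apply: PC; exact: subspaceB.
have /choice[w wP] : forall i, exists wi : X, weak_partial i (u_ k) @[k --> \oo] --> wi.
  by move=> i; apply: (cau 1) => // k m; rewrite mul1r; exact: dirichletB.
have lw i : is_weak_partial i l (w i).
  apply: (is_weak_partial_closed bU _ ul (wP i)) => k; exact: H10_weak_partial.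
have near_w (e : R) : 0 < e -> exists n0 : nat, forall k : nat, (n0 <= k)%N ->
    forall i, `|weak_partial i (u_ k) - w i| < e.
  move=> e0; have /choice[N NP] : forall i, exists n0 : nat, forall k : nat, (n0 <= k)%N ->
      `|weak_partial i (u_ k) - w i| < e.
    move=> i; have [n0 h] := (cvgn_dist0 _ _).1 (wP i) e e0; exists n0 => k hk.
    by rewrite distrC; exact: h.
  exists (\max_i N i)%N => k hk i; apply: NP; apply: leq_trans hk; exact: leq_bigmax.
have Vl : V l.
  apply: (H10I lw) => e e0; have e20 : 0 < e / 2 by rewrite divr_gt0.
  have [n1 hn1] := near_w _ e20.
  have [n2 hn2] := (cvgn_dist0 _ _).1 ul _ e20.
  pose k := maxn n1 n2.
  have [f [tf uf pf]] := H10_approx (Vu k) e20.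
  exists f; split=> // [|i].
    by apply: norm_tri_half uf; apply: hn2; exact: leq_maxr.
  by apply: norm_tri_half (pf i); rewrite distrC; apply: hn1; exact: leq_maxl.
exists l => // e e0.
have wE i : weak_partial i l = w i by exact: weak_partialE.
have d0 : 0 < Num.sqrt (e / n.+1%:R) by rewrite sqrtr_gt0 divr_gt0.
have [n0 hn0] := near_w _ d0; exists n0 => k hk; rewrite dirichletE.
apply: (@le_lt_trans _ _ (\sum_(i < n) e / n.+1%:R)).
  apply: ler_sum => i _.
  rewrite (weak_partialB i (Vu k) Vl) wE.
  rewrite -[leRHS]sqr_sqrtr ?divr_ge0// ?(ltW e0)// ler_sqr ?nnegrE ?sqrtr_ge0// ltW//.
  exact: hn0.
rewrite sumr_const card_ord -[ltLHS]mulr_natl mulrCA -[ltRHS]mulr1 ltr_pM2l//.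
by rewrite ltr_pdivrMr// mul1r ltr_nat.
Qed.

(** Projection of x on the closure of [V], by Riesz: the residual is orthogonal to all test
    functions and vanishes by [test_orthogonal]. *)
Lemma H10_dense x (e : R) : 0 < e -> exists2 v, V v & `|x - v| < e.
Proof.
move=> e0; have sV := H10_subspace.
pose W : set X := closure V.
have WP z : W z <-> forall e : R, 0 < e -> exists2 v, V v & `|z - v| < e.
  split=> [Wz d d0|h B /nbhs_ballP[d /= d0 dB]].
    have /Wz[v [Vv zv]] : nbhs z (ball z d) by exact: nbhsx_ballx.
    by exists v => //; move: zv; rewrite -ball_normE.
  by have [v Vv zv] := h d d0; exists v; split=> //; apply: dB; rewrite -ball_normE.
have VW : V `<=` W by exact: subset_closure.
have sW : subspace W.
  split; first exact/VW/(proj1 sV).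
  move=> c u v /WP Wu /WP Wv; apply/WP => d d0.
  have d1 : 0 < d / (2 * (`|c| + 1)) by rewrite divr_gt0// mulr_gt0// ltr_wpDl.
  have d2 : 0 < d / 2 by rewrite divr_gt0.
  have [a Va ua] := Wu _ d1; have [b Vb vb] := Wv _ d2.
  exists (c *: a + b); first exact: (proj2 sV).
  exact: norm_lin_half.
have ipW : sym_psd_on W (@L2ip _ _ _ (mrestr leb (open_measurable_rV oU))).
  have [[h1 h2] h3 h4] := L2ipP (mrestr leb (open_measurable_rV oU)).
  split=> [|a b _ _|a _]; [split=> a _ c u v _ _|exact: h3|exact: h4].
    exact: h1.
  exact: h2.
have cW : complete_on W (fun u => L2ip u u).
  move=> u_ Wu cu.
  have sq (a : X) (d : R) : 0 < d -> L2ip a a < d ^+ 2 <-> `|a| < d.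
    by move=> d0; rewrite -L2norm_sqr sqr_lt.
  have [l ul] : exists l : X, u_ k @[k --> \oo] --> l.
    apply: L2_complete => d d0; have [n0 h] := cu (d ^+ 2) (exprn_gt0 2 d0).
    by exists n0 => k m hk hm; apply/sq => //; exact: h.
  exists l.
    apply/WP => d d0; have d2 : 0 < d / 2 by rewrite divr_gt0.
    have [n0 h] := (cvgn_dist0 _ _).1 ul _ d2.
    have [v Vv uv] := (WP _).1 (Wu n0) _ d2; exists v => //.
    by apply: norm_tri_half uv; exact: h.
  move=> d d0; have sd0 : 0 < Num.sqrt d by rewrite sqrtr_gt0.
  have [n0 h] := (cvgn_dist0 _ _).1 ul _ sd0; exists n0 => k hk.
  by rewrite -[ltRHS](sqr_sqrtr (ltW d0)); apply/sq => //; rewrite distrC; exact: h.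
have lF : linear_on W (L2ip x) by move=> c u v _ _; exact: L2ip_linr.
have bF v : W v -> L2ip x v ^+ 2 <= L2ip x x * L2ip v v.
  move=> _; apply: (@form_cauchy_schwarz _ _ setT) => //; exact: L2ipP.
have [w Ww wP] := riesz sW ipW cW lF bF.
have /eqP : x - w = 0.
  apply: (test_orthogonal bU) => f tf; rewrite L2ipBl wP ?subrr//.
  by apply: VW; exact: H10_test.
by rewrite subr_eq0 => /eqP xw; rewrite xw in e0 *; have /WP /(_ e e0) := Ww.
Qed.
End H10_space.

(** * The energy form *)

Section trilinear.
Context d (T : measurableType d) (R : realType).
Variables (mu : {measure set T -> \bar R}) (D : set T) (mD : measurable D).
Local Notation X := (L2space (mrestr mu mD)).
Implicit Types (f g k : T -> R) (w z : X).

(** An inequality in the extended reals, so that for a > 0 it includes finiteness of the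
    integral. *)
Definition Lpnorm_le (a : R) f (C : R) :=
  ((\int[mu]_(x in D) (`|f x| `^ a)%:E) `^ a^-1 <= C%:E)%E.

Lemma Lpnorm_le_half (p : R) f (C : R) :
  ((\int[mu]_(x in D) (`|f x| `^ p)%:E) `^ (2 / p) <= C%:E)%E -> Lpnorm_le p f (Num.sqrt C).
Proof.
move=> h; rewrite /Lpnorm_le.
have C0 : 0 <= C by rewrite -lee_fin; apply: le_trans h; exact: poweR_ge0.
have -> : (p^-1 = 2 / p * 2^-1)%R by rewrite mulrAC mulfV// mul1r.
rewrite poweRrM -powR12_sqrt// -poweR_EFin.
by apply: (gt0_ler_poweR _ _ _ h); rewrite ?in_itv/= ?leey ?andbT ?poweR_ge0 ?lee_fin.
Qed.

Lemma Lpnorm_le_ge0 (a : R) f C : Lpnorm_le a f C -> 0 <= C.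
Proof. by move=> h; rewrite -lee_fin; apply: le_trans h; exact: poweR_ge0. Qed.

Lemma Lpnorm_le_fin (a : R) f : (\int[mu]_(x in D) (`|f x| `^ a)%:E < +oo)%E ->
  exists C, Lpnorm_le a f C.
Proof.
move=> h; exists (fine ((\int[mu]_(x in D) (`|f x| `^ a)%:E) `^ a^-1)%E).
rewrite /Lpnorm_le fineK// ge0_fin_numE ?poweR_ge0//; exact: poweR_lty.
Qed.

Lemma L2fun_Lpnorm w : Lpnorm_le 2 (L2fun w) `|w|.
Proof.
rewrite /Lpnorm_le; have -> : (\int[mu]_(x in D) (`|L2fun w x| `^ 2)%:E = (`|w| ^+ 2)%:E)%E.
  rewrite L2norm_sqr_restr; apply: eq_integral => x _.
  by rewrite powR_mulrn// real_normK// num_real.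
by rewrite poweR_EFin lee_fin powR12_sqrt ?sqr_ge0// sqrtr_sqr normr_id.
Qed.

Lemma hoelder_tri (a b c F G K : R) f g k : 0 < a -> 0 < b -> 0 < c ->
  a^-1 + b^-1 + c^-1 = 1 ->
  measurable_fun D f -> measurable_fun D g -> measurable_fun D k ->
  Lpnorm_le a f F -> Lpnorm_le b g G -> Lpnorm_le c k K ->
  (\int[mu]_(x in D) `|f x * g x * k x|%:E <= (F * G * K)%:E)%E.
Proof.
move=> a0 b0 c0 abc mf mg mk hF hG hK.
have mp (e : R) (u : T -> R) : measurable_fun D u -> measurable_fun D (fun x => (`|u x| `^ e)%:E).
  by move=> mu0; apply/measurable_EFinP; exact: measurable_normr_powR.
have p0 (e : R) (u : T -> R) x : D x -> (0 <= (`|u x| `^ e)%:E)%E.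
  by move=> _; rewrite lee_fin powR_ge0.
have inv0 (e : R) : 0 < e -> 0 < e^-1 by rewrite invr_gt0.
have := hoelder3e mu mD (inv0 _ a0) (inv0 _ b0) (inv0 _ c0) abc
  (mp a _ mf) (mp b _ mg) (mp c _ mk) (p0 a f) (p0 b g) (p0 c k).
have E (e : R) (u : T -> R) x : 0 < e -> ((`|u x| `^ e)%:E `^ e^-1 = `|u x|%:E)%E.
  by move=> e0; rewrite poweR_EFin -powRrM mulfV ?powRr1// gt_eqF.
under eq_integral do rewrite !E// -!EFinM -!normrM.
move=> /le_trans; apply; rewrite !EFinM.
by apply: lee_pmul; rewrite ?mule_ge0 ?poweR_ge0//; apply: lee_pmul; rewrite ?poweR_ge0.
Qed.

Lemma integrable_bound g (C : R) : measurable_fun D g ->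
  (\int[mu]_(x in D) `|g x|%:E <= C%:E)%E ->
  mu.-integrable D (EFin \o g) /\ `|\int[mu]_(x in D) g x| <= C.
Proof.
move=> mg h; have ig : mu.-integrable D (EFin \o g).
  by apply/integrableP; split; [exact/measurable_EFinP|exact: le_lt_trans h (ltry _)].
split=> //; apply: le_trans (le_normr_Rintegral mD ig) _.
by rewrite -lee_fin /Rintegral fineK//; exact: integrable_fin_num (integrable_norm ig).
Qed.

(** The common shape of the terms of the energy form: a coefficient (an entry of A, a component of
    H, or c) times two L2 functions. *)
Definition tri f w z : R := \int[mu]_(x in D) (f x * L2fun w x * L2fun z x).

Definition tri_integrable f w z :=
  mu.-integrable D (EFin \o (fun x => f x * L2fun w x * L2fun z x)).

Lemma measurable_L2fun_restr w : measurable_fun D (L2fun w).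
Proof. by apply: measurable_funTS; exact: measurable_L2fun. Qed.

Lemma measurable_tri f w z : measurable_fun D f ->
  measurable_fun D (fun x => f x * L2fun w x * L2fun z x).
Proof.
by move=> mf; apply: measurable_funM; [apply: measurable_funM|] => //; exact: measurable_L2fun_restr.
Qed.

Lemma triC f w z : tri f w z = tri f z w.
Proof. by apply: eq_Rintegral => x _; rewrite mulrAC. Qed.

Lemma tri_integrableC f w z : tri_integrable f w z -> tri_integrable f z w.
Proof.
rewrite /tri_integrable; congr (_.-integrable _ _); apply/funext => x /=.
by rewrite mulrAC.
Qed.

Lemma tri_linl f (c : R) (u v z : X) : measurable_fun D f ->
  tri_integrable f u z -> tri_integrable f v z ->
  tri f (c *: u + v) z = c * tri f u z + tri f v z.
Proof.
move=> mf iu iv; rewrite /tri.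
have iu' : mu.-integrable D (EFin \o (fun x => c * (f x * L2fun u x * L2fun z x))).
  by have := integrableZl mD c iu; apply: eq_integrable => // x _; rewrite /= EFinM.
rewrite (@ae_eq_Rintegral_restr _ _ _ mu D mD _
   (fun x => c * (f x * L2fun u x * L2fun z x) + f x * L2fun v x * L2fun z x)).
- by rewrite RintegralD// RintegralZl.
- exact: measurable_tri.
- apply: measurable_funD; last exact: measurable_tri.
  by apply: measurable_funM => //; exact: measurable_tri.
- by have := @L2_restr_lin _ _ _ mu D mD c u v; apply: ae_sub1 => x _ ->; ring.
Qed.

Lemma tri_linr f (c : R) (u v z : X) : measurable_fun D f ->
  tri_integrable f z u -> tri_integrable f z v ->
  tri f z (c *: u + v) = c * tri f z u + tri f z v.
Proof.
by move=> mf iu iv; rewrite !(triC f z) tri_linl//; exact: tri_integrableC.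
Qed.

Lemma tri_bound f w z (C : R) : measurable_fun D f ->
  (\int[mu]_(x in D) `|f x * L2fun w x * L2fun z x|%:E <= C%:E)%E ->
  tri_integrable f w z /\ `|tri f w z| <= C.
Proof. by move=> mf; apply: integrable_bound; exact: measurable_tri. Qed.

Lemma hoelder_L2 w z : (\int[mu]_(x in D) (`|L2fun w x| * `|L2fun z x|)%:E <= (`|w| * `|z|)%:E)%E.
Proof.
have m2 (v : X) : measurable_fun D (fun x => (L2fun v x ^+ 2)%:E).
  by apply/measurable_EFinP; apply: measurable_funX; exact: measurable_L2fun_restr.
have g2 (v : X) x : D x -> (0 <= (L2fun v x ^+ 2)%:E)%E by rewrite lee_fin sqr_ge0.
have h2 : (0 < 2^-1 :> R) by rewrite invr_gt0.
have h := hoelder2e mu mD h2 h2 (@half_half R) (m2 w) (m2 z) (g2 w) (g2 z).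
have sq (a : R) : ((a ^+ 2)%:E `^ 2^-1 = `|a|%:E)%E.
  by rewrite poweR_EFin powR12_sqrt ?sqr_ge0// sqrtr_sqr.
move: h; rewrite -!L2norm_sqr_restr !sq !normr_id -EFinM; apply: le_trans.
by rewrite le_eqVlt; apply/orP; left; apply/eqP; apply: eq_integral => x _; rewrite !sq EFinM.
Qed.

Lemma tri_bounded f w z (M : R) : measurable_fun D f -> 0 <= M ->
  {ae mu, forall x, D x -> `|f x| <= M} ->
  tri_integrable f w z /\ `|tri f w z| <= M * (`|w| * `|z|).
Proof.
move=> mf M0 fM; apply: tri_bound => //.
have mwz : measurable_fun D (fun x => (`|L2fun w x| * `|L2fun z x|)%:E).
  apply/measurable_EFinP; apply: measurable_funM.
    by apply: measurableT_comp => //; exact: measurable_L2fun_restr.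
  by apply: measurableT_comp => //; exact: measurable_L2fun_restr.
have wz0 x : D x -> (0 <= (`|L2fun w x| * `|L2fun z x|)%:E)%E by rewrite lee_fin mulr_ge0.
apply: (@le_trans _ _ (\int[mu]_(x in D) (M%:E * (`|L2fun w x| * `|L2fun z x|)%:E))%E).
  apply: ae_ge0_le_integral => //.
  - by apply/measurable_EFinP; apply: measurableT_comp => //; exact: measurable_tri.
  - by move=> x Dx; rewrite mule_ge0 ?lee_fin// mulr_ge0.
  - exact: measurable_funeM.
  - apply: filterS fM => x h Dx; rewrite -EFinM lee_fin !normrM -mulrA.
    by apply: ler_wpM2r; [rewrite mulr_ge0|exact: h].
rewrite ge0_integralZl// EFinM lee_wpmul2l ?lee_fin//; exact: hoelder_L2.
Qed.
End trilinear.

Lemma sqrD_ler (R : realType) (y d : R) : d * d <= d * 1 -> (y + d) ^+ 2 <= y ^+ 2 + d * (2 * y + 1).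
Proof. by move=> h; rewrite sqrrD; lra. Qed.

(** * Sobolev and Poincare inequalities on H10 *)

Section sobolev_H10.
Context (R : realType) (n : nat) (U : set 'rV[R]_n) (oU : open U) (bU : bounded_set U).
Local Notation leb := (@lebesgue_rV R n).
Local Notation rV := 'rV[R]_n.
Local Notation X := (L2 oU).
Local Notation V := (@H10 R n U oU).
Local Notation mU := (open_measurable_rV oU).
Implicit Types (f g : rV -> R) (u v w : X).

Definition sobolev_on (p K : R) := forall f, test_function U f ->
  ((\int[leb]_(x in (U : set (Rn R n))) (`|f x| `^ p)%:E) `^ (2 / p) <=
   (K * \sum_i `|toL2 oU (partial i f)| ^+ 2)%:E)%E.

Variables (p K : R).
Hypotheses (p2 : 2 < p) (K0 : 0 <= K) (HS : sobolev_on p K).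

Let p0 : 0 < p. Proof. exact: lt_trans p2. Qed.

Lemma toL2_test_norm f i : test_function U f ->
  (\int[leb]_(x in (U : set (Rn R n))) (partial i f x ^+ 2)%:E = (`|toL2 oU (partial i f)| ^+ 2)%:E)%E.
Proof.
move=> tf; rewrite (L2norm_sqr_restr (mD := mU)).
have tp := test_partial i tf.
apply: ae_eq_integral.
- exact: mU.
- by apply/measurable_EFinP; apply: measurable_funX; exact: (test_measurableU tp).
- by apply/measurable_EFinP; apply: measurable_funX; exact: measurable_L2_valU.
- by have := toL2_test oU bU tp; apply: ae_sub1 => x _; rewrite /L2_val => ->.
Qed.

(** Test functions converging to u are chosen with derivatives within [dl] of those of u, so that
    their Dirichlet sums exceed that of u by at most e. Fatou passes to the limit, and then e goes
    to 0. *)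
Lemma sobolev_H10 u : V u -> Lpnorm_le leb U p (L2_val u) (Num.sqrt (K * dirichlet u u)).
Proof.
move=> Vu; apply: Lpnorm_le_half.
set B := (\int[leb]_(x in _) _)%E.
have B0 : (0 <= B)%E by apply: integral_ge0 => x _; rewrite lee_fin powR_ge0.
have d0 := dirichlet_ge0 u.
have step (e : R) : 0 < e -> (B `^ (2 / p) <= (K * (dirichlet u u + e))%:E)%E.
  move=> e0.
  pose S : R := \sum_i `|weak_partial i u|.
  have S0 : 0 <= S by apply: sumr_ge0.
  (* dl <= 1 gives (y + dl)^2 <= y^2 + dl (2y + 1); summed over the n derivatives the excess is at
     most dl (2S + n + 1) <= e. *)
  pose dl : R := Num.min 1 (e / (2 * S + n.+1%:R)).
  have den : 0 < 2 * S + n.+1%:R by rewrite ltr_wpDl ?mulr_ge0.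
  have dl0 : 0 < dl by rewrite lt_min ltr01 divr_gt0.
  have dl1 : dl <= 1 by rewrite ge_min lexx.
  have dle : dl * (2 * S + n.+1%:R) <= e by rewrite -ler_pdivlMr// ge_min lexx orbT.
  have /choice[f fP] : forall k : nat, exists f, [/\ test_function U f,
      `|u - toL2 oU f| ^+ 2 <= 8^-1 ^+ k.+1 &
      forall i, `|weak_partial i u - toL2 oU (partial i f)| <= dl].
    move=> k; pose r : R := Num.min dl (Num.sqrt (8^-1 ^+ k.+1)).
    have s0 : 0 <= (8^-1 ^+ k.+1 : R) by rewrite exprn_ge0 ?invr_ge0.
    have r0 : 0 < r by rewrite lt_min dl0 sqrtr_gt0 exprn_gt0 ?invr_gt0.
    have [f [tf uf pf]] := H10_approx bU Vu r0; exists f; split=> // [|i].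
      rewrite -[leRHS](sqr_sqrtr s0) ler_sqr ?nnegrE ?sqrtr_ge0//.
      by apply: le_trans (ltW uf) _; rewrite ge_min lexx orbT.
    by apply: le_trans (ltW (pf i)) _; rewrite ge_min lexx.
  pose c := ((K * (dirichlet u u + e))%:E `^ (p / 2))%E.
  have C0 : 0 <= K * (dirichlet u u + e) by rewrite mulr_ge0// addr_ge0// ltW.
  have p20 : 0 <= p / 2 by rewrite divr_ge0// ltW.
  have p2p : 0 <= 2 / p by rewrite divr_ge0// ltW.
  have fc k : (\int[leb]_(x in (U : set (Rn R n))) (`|L2_val (toL2 oU (f k)) x| `^ p)%:E <= c)%E.
    have [tf _ pf] := fP k.
    have -> : (\int[leb]_(x in (U : set (Rn R n))) (`|L2_val (toL2 oU (f k)) x| `^ p)%:E =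
        \int[leb]_(x in (U : set (Rn R n))) (`|f k x| `^ p)%:E)%E.
      apply: ae_eq_integral.
      - exact: mU.
      - by apply/measurable_EFinP; apply: measurable_normr_powR; exact: measurable_L2_valU.
      - by apply/measurable_EFinP; apply: measurable_normr_powR; exact: (test_measurableU tf).
      - by have := toL2_test oU bU tf; apply: ae_sub1 => x _ /= ->.
    set I := (\int[leb]_(x in _) _)%E.
    have I0 : (0 <= I)%E by apply: integral_ge0 => x _; rewrite lee_fin powR_ge0.
    have IE : (I = (I `^ (2 / p)) `^ (p / 2))%E.
      rewrite -poweRrM; have -> : (2 / p * (p / 2) = 1)%R by field; rewrite gt_eqF.
      by rewrite poweRe1.
    rewrite IE; apply: gt0_ler_poweR => //; rewrite ?in_itv/= ?leey ?andbT ?poweR_ge0 ?lee_fin//.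
    apply: le_trans (HS tf) _; rewrite lee_fin; apply: ler_wpM2l => //.
    apply: le_trans _ (_ : dirichlet u u + dl * (2 * S + n.+1%:R) <= _); last by rewrite lerD2l.
    rewrite dirichletE.
    apply: (@le_trans _ _ (\sum_i (`|weak_partial i u| ^+ 2 + dl * (2 * `|weak_partial i u| + 1)))).
      apply: ler_sum => i _.
      have h : `|toL2 oU (partial i (f k))| <= `|weak_partial i u| + dl.
        rewrite -(subrK (weak_partial i u) (toL2 oU (partial i (f k)))) addrC.
        by apply: le_trans (ler_normD _ _) _; rewrite lerD2l distrC.
      apply: (@le_trans _ _ ((`|weak_partial i u| + dl) ^+ 2)).
        by rewrite ler_sqr ?nnegrE ?addr_ge0// ltW.
      by apply: sqrD_ler; rewrite ler_pM2l.
    rewrite big_split/= lerD2l -mulr_sumr ler_pM2l// big_split/= -mulr_sumr.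
    by rewrite lerD2l sumr_const card_ord ler_nat.
  have BL : (B <= c)%E.
    have p1 : 1 < p by apply: lt_trans p2; rewrite ltr1n.
    by apply: (L2_fatou (mD := mU) p1 (fun k => and3_rec (fun _ h _ => h) (fP k)) fc).
  have -> : ((K * (dirichlet u u + e))%:E = c `^ (2 / p))%E.
    rewrite /c -poweRrM; have -> : (p / 2 * (2 / p) = 1)%R by field; rewrite gt_eqF.
    by rewrite poweRe1.
  by apply: gt0_ler_poweR => //; rewrite ?in_itv/= ?leey ?andbT ?poweR_ge0.
apply/lee_addgt0Pr => e e0; have k0 : 0 < K + 1 by rewrite ltr_wpDl.
apply: le_trans (step (e / (K + 1)) _) _; first by rewrite divr_gt0.
rewrite mulrDr EFinD leeD2l// lee_fin mulrA ler_pdivrMr// mulrDr mulr1 mulrC lerDl ltW//.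
Qed.

(** Hoelder on U between |u|^p and 1, with weights 2/p and 1 - 2/p, followed by Sobolev. *)
Lemma poincare u : V u -> `|u| ^+ 2 <= (K * fine (leb U) `^ (1 - 2 / p)) * dirichlet u u.
Proof.
move=> Vu; have := sobolev_H10 Vu; rewrite /Lpnorm_le => h.
have p20 : 0 < 2 / p by rewrite divr_gt0.
have p21 : 0 < 1 - 2 / p by rewrite subr_gt0 ltr_pdivrMr// mul1r.
have r1 : 2 / p + (1 - 2 / p) = 1 by rewrite addrC subrK.
pose m := fine (leb U); rewrite -/m.
have uU : leb U = m%:E by rewrite /m fineK// ge0_fin_numE//; exact: Ufin.
have mu' : measurable_fun (U : set (Rn R n)) (fun x : Rn R n => (`|L2_val u x| `^ p)%:E).
  by apply/measurable_EFinP; apply: measurable_normr_powR; exact: measurable_L2_valU.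
have m1' : measurable_fun (U : set (Rn R n)) (cst 1%E : Rn R n -> \bar R) by exact: measurable_cst.
have f0 (x : Rn R n) : U x -> (0 <= (`|L2_val u x| `^ p)%:E)%E by rewrite lee_fin powR_ge0.
have f1 (x : Rn R n) : U x -> (0 <= (cst 1%E x : \bar R))%E by [].
have := hoelder2e leb mU p20 p21 r1 mu' m1' f0 f1.
have ic : (\int[leb]_(x in (U : set (Rn R n))) cst 1%E x = m%:E)%E.
  by rewrite (integral_cst leb mU) mul1e; exact: uU.
rewrite ic.
have E : (\int[leb]_(x in (U : set (Rn R n))) ((`|L2_val u x| `^ p)%:E `^ (2 / p) * cst 1%E x `^ (1 - 2 / p)) =
   (`|u| ^+ 2)%:E)%E.
  rewrite (L2norm_sqr_restr (mD := mU)); apply: eq_integral => x _.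
  rewrite poweR1r mule1 poweR_EFin -powRrM; have -> : (p * (2 / p) = 2%:R)%R by field; rewrite gt_eqF.
  by rewrite powR_mulrn// real_normK// num_real.
rewrite [X in (X <= _)%E -> _]E poweR_EFin => /le_trans H; rewrite -lee_fin; apply: H.
rewrite mulrAC EFinM; apply: lee_wpmul2r; first by rewrite lee_fin powR_ge0.
have Kd : 0 <= K * dirichlet u u by rewrite mulr_ge0// dirichlet_ge0.
have -> : (2 / p = p^-1 * 2%:R)%R by rewrite mulrC.
rewrite poweRrM -[leRHS](_ : ((Num.sqrt (K * dirichlet u u))%:E `^ 2%:R)%E = _); last first.
  by rewrite poweR_EFin powR_mulrn ?sqrtr_ge0// sqr_sqrtr.
by apply: (gt0_ler_poweR _ _ _ h); rewrite ?in_itv/= ?leey ?andbT ?poweR_ge0// lee_fin sqrtr_ge0.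
Qed.
End sobolev_H10.

Section sobolev_exponents.
Context (R : realType).

Lemma sobolev_on_bridge k (U : set 'rV[R]_k.+2) (oU : open U) (bU : bounded_set U) (p K : R) :
  0 < p -> (forall f, test_function U f ->
    ((\int[@lebesgue_rV R k.+2]_x (`|f x| `^ p)%:E) `^ (2 / p) <=
     (K%:E * \int[@lebesgue_rV R k.+2]_x (grad_sqr f x)%:E))%E) -> sobolev_on oU p K.
Proof.
move=> p0 h f tf; have := h f tf.
rewrite (@integral_test_restrict _ _ U (fun x => `|f x| `^ p)); last first.
  by move=> x nUx; rewrite (test_out tf nUx) normr0 powR0// gt_eqF.
rewrite (@integral_test_restrict _ _ U (grad_sqr f)); last first.
  by move=> x nUx; rewrite (test_out (test_grad_sqr tf) nUx).
have -> : (\int[@lebesgue_rV R k.+2]_(x in (U : set (Rn R k.+2))) (grad_sqr f x)%:E =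
    (\sum_i `|toL2 oU (partial i f)| ^+ 2)%:E)%E.
  rewrite -sumEFin; under [RHS]eq_bigr do rewrite -(toL2_test_norm oU bU _ tf).
  under eq_integral do rewrite /grad_sqr -sumEFin.
  rewrite (ge0_integral_sum _ (open_measurable_rV oU)).
  - exact: eq_bigr.
  - move=> i; apply/measurable_EFinP; apply: measurable_funX.
    exact: (test_measurableU (test_partial i tf)).
  - by move=> i x _; rewrite lee_fin sqr_ge0.
by rewrite -EFinM.
Qed.

Lemma sobolev_on_ge3 k (U : set 'rV[R]_k.+2) (oU : open U) (bU : bounded_set U) : (0 < k)%N ->
  sobolev_on oU (2 * (k.+2%:R / k%:R)) ((k.+1%:R / k%:R) ^+ 2).
Proof.
move=> k0; apply: sobolev_on_bridge => //.
  by rewrite mulr_gt0// divr_gt0 ?ltr0n.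
by move=> f tf; exact: (sobolev_test_ge3 k0 tf erefl).
Qed.

Lemma sobolev_on_2 (U : set 'rV[R]_2) (oU : open U) (bU : bounded_set U) (p : R) : 2 < p ->
  sobolev_on oU p ((p / 4) ^+ 2 * fine (@lebesgue_rV R 2 U) `^ (2 / p)).
Proof.
move=> p2; apply: sobolev_on_bridge => //; first exact: lt_trans p2.
by move=> f tf; exact: (sobolev_test_2 oU bU p2 tf).
Qed.
End sobolev_exponents.

Lemma coercive_combination (R : realType) (l a b y z : R) :
  a <= l / 4 * y -> 3 / 4 * l * y - (z + a) <= b -> l / 2 * y <= b + z.
Proof. by move=> h1 h2; lra. Qed.

Lemma dot_cauchy_schwarz (R : realType) (n : nat) (x y : 'rV[R]_n) :
  `|dot x y| <= enorm x * enorm y.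
Proof.
have dl (z : 'rV[R]_n) : linear_on setT (fun x => dot x z).
  move=> c u v _ _; rewrite /dot mulr_sumr -big_split/=; apply: eq_bigr => i _.
  by rewrite !mxE; ring.
have ds (a b : 'rV[R]_n) : dot a b = dot b a by apply: eq_bigr => i _; rewrite mulrC.
have dp (a : 'rV[R]_n) : 0 <= dot a a by apply: sumr_ge0 => i _; rewrite -expr2 sqr_ge0.
have psd : sym_psd_on setT (@dot R n).
  split=> [|a b _ _|a _]; [split=> z _; first exact: dl|exact: ds|exact: dp].
  by move=> c u v _ _; rewrite !(ds z); exact: dl.
have := form_cauchy_schwarz (V := setT) (conj I (fun _ _ _ _ _ => I)) psd (I : setT x) (I : setT y).
rewrite -sqrtr_sqr /enorm -sqrtrM//; exact: ler_wsqrtr.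
Qed.

(** [h1] carries the drift bound where it is at least N, and that part is kept as |h1 g w|. Where h
    < N, Young's inequality N g |w| <= (lambda/4) g^2 + (N^2/lambda) w^2 takes a quarter of the
    ellipticity and produces gamma. *)
Lemma energy_pointwise (R : realType) (lam N th c h h1 g w T1 T2 Hn : R) : 0 < lam -> 0 <= N ->
  0 <= th -> 0 <= c -> 0 <= g -> lam * g ^+ 2 <= T1 -> `|T2| <= Hn * g -> Hn <= h -> 0 <= Hn ->
  (N <= h -> h1 = h) -> (h < N -> 0 <= h1) ->
  3 / 4 * lam * g ^+ 2 - (N ^+ 2 / lam * (w * w) + `|h1 * g * w|) <=
  T1 + T2 * w + (c + th) * w * w.
Proof.
move=> lam0 N0 th0 c0 g0 hT1 hT2 Hh Hn0 hN1 hN2.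
have cw : 0 <= (c + th) * w * w by rewrite -mulrA mulr_ge0 ?addr_ge0// -expr2 sqr_ge0.
have gw : 0 <= g * `|w| by rewrite mulr_ge0.
have t2 : - (h * (g * `|w|)) <= T2 * w.
  rewrite lerNl; apply: le_trans (ler_norm _) _; rewrite normrN normrM mulrA.
  by apply: ler_wpM2r => //; apply: le_trans hT2 _; exact: ler_wpM2r.
have hle : h * (g * `|w|) <= N * (g * `|w|) + `|h1 * g * w|.
  have [Nh|hN] := leP N h.
    rewrite hN1// -mulrA 2!normrM (ger0_norm g0) (ger0_norm (le_trans N0 Nh)) lerDr.
    exact: mulr_ge0.
  by apply: ler_wpDr => //; apply: ler_wpM2r => //; exact: ltW.
have young : N * (g * `|w|) <= lam / 4 * g ^+ 2 + N ^+ 2 / lam * (w * w).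
  have -> : w * w = `|w| ^+ 2 by rewrite real_normK ?num_real// expr2.
  rewrite -subr_ge0.
  have -> : lam / 4 * g ^+ 2 + N ^+ 2 / lam * `|w| ^+ 2 - N * (g * `|w|) =
     (lam / 2 * g - N * `|w|) ^+ 2 / lam by field; rewrite gt_eqF.
  by rewrite divr_ge0 ?sqr_ge0// ltW.
have -> : 3 / 4 * lam * g ^+ 2 = lam * g ^+ 2 - lam / 4 * g ^+ 2 by field.
move: young hle t2 cw hT1; move: (lam * g ^+ 2) (lam / 4 * g ^+ 2) (N * _) (h * _) (T2 * w) => a b e f k.
by move: (`|h1 * g * w|) ((c + th) * w * w) (N ^+ 2 / lam * (w * w)) => l m o; lra.
Qed.

Lemma sqr_norm_le (R : realType) (x C a b : R) : 0 <= a * b -> `|x| <= C * (a * b) ->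
  x ^+ 2 <= C ^+ 2 * a ^+ 2 * b ^+ 2.
Proof.
move=> ab h; have -> : C ^+ 2 * a ^+ 2 * b ^+ 2 = (C * (a * b)) ^+ 2 by ring.
rewrite -[x ^+ 2]real_normK ?num_real// ler_sqr ?nnegrE//.
exact: le_trans h.
Qed.

Lemma mul_le_sqr3 (R : realType) (x y C a b : R) : 0 <= x -> 0 <= y ->
  x <= C * a ^+ 2 -> y <= C * b ^+ 2 -> x * y <= (C * (a * b)) ^+ 2.
Proof.
move=> x0 y0 xa yb; have -> : (C * (a * b)) ^+ 2 = C * a ^+ 2 * (C * b ^+ 2) by ring.
exact: ler_pM.
Qed.

Lemma bound_split (R : realType) (a b c k l t x y : R) :
  (a + b * k + c * l * l + t) * (x * y) =
  (a * (x * y) + b * k * (x * y)) + (c * (l * x) * (l * y) + t * (x * y)).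
Proof. ring. Qed.

(** * Boundedness and coercivity of the energy form *)

Section energy.
Context (R : realType) (n : nat) (U : set 'rV[R]_n) (oU : open U) (bU : bounded_set U).
Local Notation leb := (@lebesgue_rV R n).
Local Notation rV := 'rV[R]_n.
Local Notation X := (L2 oU).
Local Notation V := (@H10 R n U oU).
Local Notation mU := (open_measurable_rV oU).
Local Notation UR := (U : set (Rn R n)).
Variables (p K r L : R).
Hypotheses (p2 : 2 < p) (K0 : 0 <= K) (HS : sobolev_on oU p K).
Hypotheses (r2 : 2 < r) (L0 : 0 <= L) (HL : sobolev_on oU r L).
Variables (q s : R).
Hypotheses (q0 : 0 < q) (s0 : 0 < s).
Hypotheses (qp : q^-1 + 2^-1 + p^-1 = 1) (sr : s^-1 + r^-1 + r^-1 = 1).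
Variables (H : rV -> rV) (h : rV -> R) (A : rV -> 'M[R]_n) (c : rV -> R).
Hypothesis hH : forall i, Lp_on U q (fun x => H x 0 i).
Hypothesis hh : Lp_on U q h.
Hypothesis hHh : {ae leb, forall x, U x -> enorm (H x) <= h x}.
Hypothesis mA : forall i j, measurable_fun [set: Rn R n] ((fun x => A x i j) : Rn R n -> R).
Variables (M lambda theta N B : R).
Hypotheses (M0 : 0 < M) (lambda0 : 0 < lambda) (theta0 : 0 <= theta) (N0 : 0 <= N).
Hypothesis hA : {ae leb, forall x, (forall i j, `|A x i j| <= M) /\
  (forall xi : rV, lambda * enorm xi ^+ 2 <= dot (xi *m (A x)^T) xi)}.
Hypothesis hc : Lp_on U s c.
Hypothesis c0 : {ae leb, forall x, U x -> 0 <= c x}.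
Hypothesis hB : Lpnorm_le leb UR q (fun x => \1_[set y | N <= `|h y|] x * `|h x|) B.
Hypothesis hBK : B * Num.sqrt K <= lambda / 4.
Local Notation E := (energy_form A H c theta).
Local Notation gradv u i x := (L2_val (weak_partial i u) x).
Implicit Types u v w : X.

Let mAU i j : measurable_fun UR (fun x => A x i j).
Proof. exact: measurable_funTS. Qed.

Let mHU i : measurable_fun UR (fun x => H x 0 i).
Proof. by have [] := hH i. Qed.

Let mcU : measurable_fun UR c. Proof. by have [] := hc. Qed.

Definition energy_fun u v (x : rV) : R :=
  (\sum_i \sum_j A x i j * gradv u j x * gradv v i x) +
  (\sum_i H x 0 i * gradv u i x * L2_val v x) +
  (c x * L2_val u x * L2_val v x + theta * (L2_val u x * L2_val v x)).

Lemma energy_funE u v x :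
  dot (grad u x *m (A x)^T) (grad v x) + dot (H x) (grad u x) * L2_val v x +
  (c x + theta) * L2_val u x * L2_val v x = energy_fun u v x.
Proof.
rewrite /energy_fun; congr (_ + _ + _); last ring.
- rewrite /dot; apply: eq_bigr => i _; rewrite !mxE mulr_suml; apply: eq_bigr => j _.
  by rewrite !mxE; congr (_ * _); rewrite mulrC.
- by rewrite /dot mulr_suml; apply: eq_bigr => i _; rewrite !mxE.
Qed.

(** Four contributions relative to the Dirichlet norm: A through M, H through its L^q norm and one
    Sobolev factor, c through its L^s norm and two Sobolev factors, theta through Poincare. [cid]
    extracts real bounds from finite norms. *)
Definition energy_bound : R :=
  let CH := \sum_i sval (cid (Lpnorm_le_fin (proj2 (hH i)))) in
  let Cc := sval (cid (Lpnorm_le_fin (proj2 hc))) in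
  n%:R * (n%:R * M) + CH * Num.sqrt K + Cc * Num.sqrt L * Num.sqrt L +
  theta * (K * fine (leb U) `^ (1 - 2 / p)).

Let Cp : R := K * fine (leb U) `^ (1 - 2 / p).

Let Cp0 : 0 <= Cp. Proof. by rewrite mulr_ge0// powR_ge0. Qed.

Let PC u : V u -> `|u| ^+ 2 <= Cp * dirichlet u u.
Proof. exact: (poincare bU p2 K0 HS). Qed.

Let nrm u : R := Num.sqrt (dirichlet u u).

Let nrm0 u : 0 <= nrm u. Proof. exact: sqrtr_ge0. Qed.

Let nrm_sqr u : nrm u ^+ 2 = dirichlet u u.
Proof. by rewrite sqr_sqrtr// dirichlet_ge0. Qed.

Let wp_nrm u i : `|weak_partial i u| <= nrm u.
Proof.
rewrite -[leLHS](ger0_norm (normr_ge0 _)) -sqrtr_sqr; apply: ler_wsqrtr.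
by rewrite dirichletE (bigD1 i)//= lerDl; apply: sumr_ge0 => j _; exact: sqr_ge0.
Qed.

Let p0 : 0 < p. Proof. exact: lt_trans p2. Qed.

Let r0 : 0 < r. Proof. exact: lt_trans r2. Qed.

Let sobV (p' K' : R) : 2 < p' -> 0 <= K' -> sobolev_on oU p' K' -> forall u, V u ->
  Lpnorm_le leb UR p' (L2_val u) (Num.sqrt K' * nrm u).
Proof.
move=> p'2 K'0 S u Vu; have := sobolev_H10 bU p'2 K'0 S Vu.
by rewrite sqrtrM.
Qed.

Let triA i j w z : tri_integrable (mD := mU) (fun x => A x i j) w z /\
  `|tri (mD := mU) (fun x => A x i j) w z| <= M * (`|w| * `|z|).
Proof.
apply: tri_bounded; [exact: mAU|exact: ltW|].
by have := ae_restrict_dom UR hA; apply: ae_sub1 => x _ [h1 _]; exact: h1.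
Qed.

Let CH i := sval (cid (Lpnorm_le_fin (proj2 (hH i)))).
Let Cc := sval (cid (Lpnorm_le_fin (proj2 hc))).

Let CHP i : Lpnorm_le leb UR q (fun x => H x 0 i) (CH i).
Proof. exact: svalP (cid (Lpnorm_le_fin (proj2 (hH i)))). Qed.

Let triH i w z : V z -> tri_integrable (mD := mU) (fun x => H x 0 i) w z /\
  `|tri (mD := mU) (fun x => H x 0 i) w z| <= CH i * `|w| * (Num.sqrt K * nrm z).
Proof.
move=> Vz; apply: tri_bound; first exact: mHU.
apply: (@hoelder_tri _ _ _ leb UR mU q 2 p (CH i) `|w| (Num.sqrt K * nrm z) (fun x => H x 0 i) (L2fun w) (L2fun z)).
- exact: q0.
- by [].
- exact: p0.
- exact: qp.
- exact: mHU.
- exact: measurable_L2fun_restr.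
- exact: measurable_L2fun_restr.
- exact: CHP.
- exact: L2fun_Lpnorm.
- exact: sobV.
Qed.

Let tric w z : V w -> V z -> tri_integrable (mD := mU) c w z /\
  `|tri (mD := mU) c w z| <= Cc * (Num.sqrt L * nrm w) * (Num.sqrt L * nrm z).
Proof.
move=> Vw Vz; apply: tri_bound; first exact: mcU.
apply: (@hoelder_tri _ _ _ leb UR mU s r r Cc (Num.sqrt L * nrm w) (Num.sqrt L * nrm z) c (L2fun w) (L2fun z)).
- exact: s0.
- exact: r0.
- exact: r0.
- exact: sr.
- exact: mcU.
- exact: measurable_L2fun_restr.
- exact: measurable_L2fun_restr.
- exact: svalP (cid (Lpnorm_le_fin (proj2 hc))).
- exact: sobV.
- exact: sobV.
Qed.

Lemma energy_tri u v : V u -> V v ->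
  leb.-integrable UR (EFin \o (energy_fun u v : Rn R n -> R)) /\
  E u v = (\sum_i \sum_j tri (mD := mU) (fun x => A x i j) (weak_partial j u) (weak_partial i v)) +
    (\sum_i tri (mD := mU) (fun x => H x 0 i) (weak_partial i u) v) +
    (tri (mD := mU) c u v + theta * L2ip u v).
Proof.
move=> Vu Vv.
have i1 i j := proj1 (triA i j (weak_partial j u) (weak_partial i v)).
have s1 i := integrable_sum_fun mU (index_enum 'I_n) (i1 i).
have [j1 e1] := integrable_sum_fun mU (index_enum 'I_n) (fun i => proj1 (s1 i)).
have i2 i := proj1 (triH i (weak_partial i u) Vv).
have [j2 e2] := integrable_sum_fun mU (index_enum 'I_n) i2.
have j3 := proj1 (tric Vu Vv).
have i4 := integrable_L2M_restr (mD := mU) u v.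
have j4 := integrableZ_fun mU theta i4.
have j12 := integrableD_fun mU j1 j2; have j34 := integrableD_fun mU j3 j4.
have jE := integrableD_fun mU j12 j34.
split; first exact: jE.
have -> : E u v = intU U (energy_fun u v).
  by rewrite /energy_form /intU; apply: eq_Rintegral => x _; exact: energy_funE.
rewrite /intU /energy_fun (RintegralD mU j12 j34) (RintegralD mU j1 j2) (RintegralD mU j3 j4).
rewrite [X in X + _ + _]e1 [X in _ + X + _]e2 (RintegralZl theta mU i4).
congr (_ + _ + (_ + theta * _)); last exact/esym/L2ip_restr.
by apply: eq_bigr => i _; rewrite (proj2 (s1 i)).
Qed.

Lemma energy_bilinear : bilinear_on V E.
Proof.
have sV := @H10_subspace _ _ _ oU bU.
have lin4 (a x1 x2 x3 x4 y1 y2 y3 y4 : R) :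
  (a * x1 + y1) + (a * x2 + y2) + ((a * x3 + y3) + theta * (a * x4 + y4)) =
  a * (x1 + x2 + (x3 + theta * x4)) + (y1 + y2 + (y3 + theta * y4)) by ring.
split=> w Vw a u v Vu Vv; have Vauv : V (a *: u + v) by exact: (proj2 sV).
- rewrite (proj2 (energy_tri Vauv Vw)) (proj2 (energy_tri Vu Vw)) (proj2 (energy_tri Vv Vw)).
  rewrite -lin4; congr (_ + _ + (_ + theta * _)).
  + rewrite mulr_sumr -big_split/=; apply: eq_bigr => i _.
    rewrite mulr_sumr -big_split/=; apply: eq_bigr => j _.
    rewrite (weak_partial_lin bU j a Vu Vv); apply: tri_linl; first exact: mAU.
      exact: (proj1 (triA _ _ _ _)).
    exact: (proj1 (triA _ _ _ _)).
  + rewrite mulr_sumr -big_split/=; apply: eq_bigr => i _.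
    rewrite (weak_partial_lin bU i a Vu Vv); apply: tri_linl; first exact: mHU.
      exact: (proj1 (triH _ _ Vw)).
    exact: (proj1 (triH _ _ Vw)).
  + exact (tri_linl a mcU (proj1 (tric Vu Vw)) (proj1 (tric Vv Vw))).
  + exact: L2ip_linl.
- rewrite (proj2 (energy_tri Vw Vauv)) (proj2 (energy_tri Vw Vu)) (proj2 (energy_tri Vw Vv)).
  rewrite -lin4; congr (_ + _ + (_ + theta * _)).
  + rewrite mulr_sumr -big_split/=; apply: eq_bigr => i _.
    rewrite mulr_sumr -big_split/=; apply: eq_bigr => j _.
    rewrite (weak_partial_lin bU i a Vu Vv); apply: tri_linr; first exact: mAU.
      exact: (proj1 (triA _ _ _ _)).
    exact: (proj1 (triA _ _ _ _)).
  + rewrite mulr_sumr -big_split/=; apply: eq_bigr => i _.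
    exact (tri_linr a (mHU i) (proj1 (triH i _ Vu)) (proj1 (triH i _ Vv))).
  + exact (tri_linr a mcU (proj1 (tric Vw Vu)) (proj1 (tric Vw Vv))).
  + exact: L2ip_linr.
Qed.

Lemma energy_bounded u v : V u -> V v ->
  E u v ^+ 2 <= energy_bound ^+ 2 * dirichlet u u * dirichlet v v.
Proof.
move=> Vu Vv; suff hE : `|E u v| <= energy_bound * (nrm u * nrm v).
  by rewrite -!nrm_sqr; apply: sqr_norm_le hE; rewrite mulr_ge0.
rewrite (proj2 (energy_tri Vu Vv)).
have nn : 0 <= nrm u * nrm v by rewrite mulr_ge0.
have b1 : `|\sum_i \sum_j tri (mD := mU) (fun x => A x i j) (weak_partial j u) (weak_partial i v)| <=
    n%:R * (n%:R * M) * (nrm u * nrm v).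
  apply: le_trans (ler_norm_sum _ _ _) _.
  apply: (@le_trans _ _ (\sum_(i < n) n%:R * M * (nrm u * nrm v))); last first.
    by rewrite sumr_const card_ord -[leLHS]mulr_natl !mulrA.
  apply: ler_sum => i _; apply: le_trans (ler_norm_sum _ _ _) _.
  apply: (@le_trans _ _ (\sum_(j < n) M * (nrm u * nrm v))); last first.
    by rewrite sumr_const card_ord -[leLHS]mulr_natl !mulrA.
  apply: ler_sum => j _; apply: le_trans (proj2 (triA i j _ _)) _.
  by apply: ler_wpM2l; [exact: ltW|apply: ler_pM].
have CH0 i : 0 <= CH i := Lpnorm_le_ge0 (CHP i).
have b2 : `|\sum_i tri (mD := mU) (fun x => H x 0 i) (weak_partial i u) v| <=
    (\sum_i CH i) * Num.sqrt K * (nrm u * nrm v).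
  apply: le_trans (ler_norm_sum _ _ _) _; rewrite !mulr_suml.
  apply: ler_sum => i _; apply: le_trans (proj2 (triH i _ Vv)) _.
  rewrite (mulrACA (CH i) (Num.sqrt K) (nrm u) (nrm v)).
  apply: ler_wpM2r; first by rewrite mulr_ge0 ?sqrtr_ge0.
  by apply: ler_wpM2l.
have b3 := proj2 (tric Vu Vv).
have b4 : `|theta * L2ip u v| <= theta * Cp * (nrm u * nrm v).
  rewrite normrM (ger0_norm theta0) -mulrA; apply: ler_wpM2l => //.
  rewrite -(ger0_norm (mulr_ge0 Cp0 nn)) -ler_sqr ?nnegrE ?normr_ge0// !real_normK ?num_real//.
  apply: le_trans (form_cauchy_schwarz (V := setT) _ (L2ipP _) I I) _ => //.
  have ip0 w : 0 <= L2ip w w by rewrite -L2norm_sqr sqr_ge0.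
  have ipC w : V w -> L2ip w w <= Cp * nrm w ^+ 2 by rewrite nrm_sqr -L2norm_sqr; exact: PC.
  exact: (mul_le_sqr3 (ip0 u) (ip0 v) (ipC u Vu) (ipC v Vv)).
apply: le_trans (ler_normD _ _) _.
have -> : energy_bound * (nrm u * nrm v) =
  (n%:R * (n%:R * M) * (nrm u * nrm v) + (\sum_i CH i) * Num.sqrt K * (nrm u * nrm v)) +
  (Cc * (Num.sqrt L * nrm u) * (Num.sqrt L * nrm v) + theta * Cp * (nrm u * nrm v)).
  exact: bound_split.
apply: lerD; apply: le_trans (ler_normD _ _) _; exact: lerD.
Qed.

(** Integrates [energy_pointwise]. By Hoelder with 1/q + 1/2 + 1/p = 1 and Sobolev, the large drift
    costs at most B sqrt(K) <= lambda/4 times the Dirichlet form, so lambda/2 remains of 3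
    lambda/4. *)
Lemma energy_coercive u : V u ->
  lambda / 2 * dirichlet u u <= E u u + N ^+ 2 / lambda * L2ip u u.
Proof.
move=> Vu.
have [iE _] := energy_tri Vu Vu.
have EE : E u u = intU U (energy_fun u u).
  by rewrite /energy_form /intU; apply: eq_Rintegral => x _; exact: energy_funE.
pose h1 (x : rV) : R := \1_[set y | N <= `|h y|] x * `|h x|.
pose gu (x : rV) : R := enorm (grad u x).
have gu0 x : 0 <= gu x by exact: sqrtr_ge0.
have gu2 x : gu x ^+ 2 = \sum_i L2_val (weak_partial i u) x * L2_val (weak_partial i u) x.
  rewrite /gu /enorm sqr_sqrtr; last by apply: sumr_ge0 => i _; rewrite -expr2 sqr_ge0.
  by apply: eq_bigr => i _; rewrite !mxE.
have i1 i := integrable_L2M_restr (mD := mU) (weak_partial i u) (weak_partial i u).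
have [jg eg] := integrable_sum_fun mU (index_enum 'I_n) i1.
have ig : leb.-integrable UR (EFin \o (fun x : Rn R n => gu x ^+ 2)).
  by rewrite (_ : (fun x => _) = (fun x : Rn R n => \sum_i L2_val (weak_partial i u) x * L2_val (weak_partial i u) x));
    [exact: jg|apply/funext => x; exact: gu2].
have ga : intU U (fun x => gu x ^+ 2) = dirichlet u u.
  rewrite /intU; under eq_Rintegral do rewrite gu2.
  by rewrite [LHS]eg; apply: eq_bigr => i _; exact/esym/L2ip_restr.
have iu := integrable_L2M_restr (mD := mU) u u.
have mgu : measurable_fun UR gu.
  rewrite /gu /enorm (_ : (fun x => _) = (fun x => Num.sqrt (\sum_i L2_val (weak_partial i u) x * L2_val (weak_partial i u) x))); last first.
    by apply/funext => x; congr Num.sqrt; apply: eq_bigr => i _; rewrite !mxE.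
  apply: measurable_sqrt_fun; last first.
    by move=> x; apply: sumr_ge0 => i _; rewrite -expr2 sqr_ge0.
  by apply: measurable_sum => i; apply: measurable_funM; exact: measurable_L2_valU.
have mh1 : measurable_fun UR h1.
  by have [mh _] := hh; exact: (measurable_truncation N mh).
have ngu : Lpnorm_le leb UR 2 gu (nrm u).
  rewrite /Lpnorm_le.
  have -> : (\int[leb]_(x in UR) (`|gu x| `^ 2)%:E = (dirichlet u u)%:E)%E.
    rewrite -ga /intU /Rintegral fineK; last exact: (integrable_fin_num mU ig).
    by apply: eq_integral => x _; rewrite powR_mulrn// ger0_norm.
  by rewrite poweR_EFin lee_fin powR12_sqrt// dirichlet_ge0.
have H3 := hoelder_tri mU q0 (ltr0n R 2) p0 qp mh1 mgu (measurable_L2fun_restr (mD := mU) u)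
  hB ngu (sobV p2 K0 HS Vu).
have [jh nh] := integrable_bound mU (measurable_funM (measurable_funM mh1 mgu)
  (measurable_L2fun_restr (mD := mU) u)) H3.
have jh' : leb.-integrable UR (EFin \o (fun x => `|h1 x * gu x * L2_val u x|)).
  exact: integrable_norm jh.
have nh' : intU U (fun x => `|h1 x * gu x * L2_val u x|) <= lambda / 4 * dirichlet u u.
  rewrite /intU -lee_fin /Rintegral fineK; last exact: (integrable_fin_num mU jh').
  apply: le_trans H3 _; rewrite lee_fin -nrm_sqr.
  have -> : B * nrm u * (Num.sqrt K * nrm u) = B * Num.sqrt K * nrm u ^+ 2 by ring.
  by apply: ler_wpM2r => //; exact: sqr_ge0.
pose G (x : rV) := (3 / 4 * lambda) * gu x ^+ 2 -
   (N ^+ 2 / lambda * (L2_val u x * L2_val u x) + `|h1 x * gu x * L2_val u x|).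
have ja := integrableZ_fun mU (3 / 4 * lambda) ig.
have jb := integrableZ_fun mU (N ^+ 2 / lambda) iu.
have jbc := integrableD_fun mU jb jh'.
have jG := integrableB_fun mU ja jbc.
have Gle : intU U G <= intU U (energy_fun u u).
  apply: (ae_le_Rintegral mU jG iE).
  have hA' : {ae leb, forall x, U x -> (forall i j, `|A x i j| <= M) /\
    (forall xi : rV, lambda * enorm xi ^+ 2 <= dot (xi *m (A x)^T) xi)}.
    exact: ae_restrict_dom hA.
  apply: ae_sub3 hA' hHh c0 => x Ux [_ ell] Hhx cx.
  rewrite -energy_funE; apply: (@energy_pointwise _ lambda N theta (c x) (h x) (h1 x) (gu x) (L2_val u x) _ _
    (enorm (H x))) => //.
  - exact: ell.
  - exact: dot_cauchy_schwarz.
  - exact: sqrtr_ge0.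
  - move=> Nh; rewrite /h1 indicE mem_set/=; last by apply: le_trans (ler_norm _).
    by rewrite mul1r ger0_norm// (le_trans N0).
  - by move=> _; rewrite /h1 mulr_ge0.
rewrite EE; move: Gle; rewrite /intU /G (RintegralB mU ja jbc) (RintegralD mU jb jh').
rewrite (RintegralZl _ mU ig) (RintegralZl _ mU iu) -[X in _ * X - _]/(intU U _) ga.
rewrite -[X in _ - (_ * X + _)](L2ip_restr (mD := mU)).
move: nh'; rewrite /intU.
exact: coercive_combination.
Qed.
End energy.

(** * Bochner integrals in time *)

Section complete_measure.
Context d (T : measurableType d) (R : realType).
Variable mu : {measure set T -> \bar R}.

(** The integral of a nonnegative function is a supremum over simple functions below it, hence
    monotone for arbitrary functions. This covers dual norms of time-dependent functionals, which
    come without a measurability proof. *)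
Lemma ge0_le_integral_nonmeasurable (D : set T) (f g : T -> \bar R) :
  (forall x, D x -> (0 <= f x)%E) -> (forall x, D x -> (f x <= g x)%E) ->
  (\int[mu]_(x in D) f x <= \int[mu]_(x in D) g x)%E.
Proof.
move=> f0 fg.
rewrite ge0_integralE// [leRHS]ge0_integralE//; last first.
  by move=> x Dx; apply: le_trans (f0 x Dx) (fg x Dx).
apply: ub_ereal_sup => _ [h hf <-]; apply: ereal_sup_ubound; exists h => // x.
apply: le_trans (hf x) _; rewrite !patchE; case: ifPn => // /set_mem; exact: fg.
Qed.

Section complete.
Hypothesis mc : measure_is_complete mu.
Variables (D : set T) (mD : measurable D).

(** Every subset of the exceptional null set is measurable, by completeness; off that set the
    preimages under f and g agree. *)
Lemma ae_eq_measurable (f g : T -> R) : measurable_fun D g ->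
  {ae mu, forall x, D x -> f x = g x} -> measurable_fun D f.
Proof.
move=> mg [Z [mZ Z0 hZ]] _ B mB.
have negl (S : set T) : S `<=` Z -> measurable S.
  by move=> SZ; apply: mc; exists Z.
have -> : D `&` f @^-1` B = ((D `&` g @^-1` B) `\` Z) `|` (D `&` f @^-1` B `&` Z).
  apply/seteqP; split=> x.
    move=> [Dx fB]; have [Zx|nZx] := pselect (Z x); first by right.
    left; split=> //; split=> //; have E : f x = g x.
      by apply: contrapT => h; apply: nZx; apply: hZ => /= /(_ Dx).
    by move: fB; rewrite /preimage/= E.
  move=> [[[Dx gB] nZx]|[]//]; split=> //; have E : f x = g x.
    by apply: contrapT => h; apply: nZx; apply: hZ => /= /(_ Dx).
  by move: gB; rewrite /preimage/= E.
apply: measurableU.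
  by apply: measurableD => //; exact: mg.
by apply: negl => x [].
Qed.

Lemma ae_lim_measurable (f_ : nat -> T -> R) (f : T -> R) :
  (forall k, measurable_fun D (f_ k)) ->
  {ae mu, forall x, D x -> f_ k x @[k --> \oo] --> f x} -> measurable_fun D f.
Proof.
move=> mf cv; pose F x := fine (limn_esup (fun k => (f_ k x)%:E)).
have mF : measurable_fun D F.
  apply: measurableT_comp => //; apply: measurable_fun_limn_esup => k.
  exact/measurable_EFinP.
apply: (ae_eq_measurable mF); apply: ae_sub1 cv => x Dx h.
have hE : (f_ k x)%:E @[k --> \oo] --> (f x)%:E by apply: cvg_EFin => //; exact: nearW.
by rewrite /F; have [_ ->] := cvg_limn_einf_sup hE.
Qed.
End complete.

(** f is set to 0 on the exceptional null set, so that the bound holds everywhere and [g], possibly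
    nonmeasurable, is left untouched. *)
Lemma integrable_dominated (D : set T) (mD : measurable D) (f : T -> R) (g : T -> \bar R) :
  measurable_fun D f -> {ae mu, forall x, D x -> (`|f x|%:E <= g x)%E} ->
  (forall x, D x -> (0 <= g x)%E) ->
  (\int[mu]_(x in D) `|f x|%:E <= \int[mu]_(x in D) g x)%E.
Proof.
move=> mf [Z [mZ Z0 hZ]] g0.
pose f' := f \_ (~` Z).
have E x : D x -> ~ Z x -> (`|f x|%:E <= g x)%E.
  by move=> Dx nZ; apply: contrapT => h; apply: nZ; apply: hZ => /= /(_ Dx).
have mf' : measurable_fun D f'.
  apply: (measurable_restrict f (measurableC mZ) mD).1.
  by apply: measurable_funS mf => //; exact: subIsetl.
apply: (@le_trans _ _ (\int[mu]_(x in D) `|f' x|%:E)%E).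
  rewrite le_eqVlt; apply/orP; left; apply/eqP; apply: ae_eq_integral => //.
  - by apply/measurable_EFinP; exact: measurableT_comp.
  - by apply/measurable_EFinP; exact: measurableT_comp.
  - exists Z; split=> // x /= /not_implyP[Dx h]; apply: contrapT => nZ; apply: h.
    by rewrite /f' patchE mem_set.
apply: ge0_le_integral_nonmeasurable => [x Dx|x Dx]; first by rewrite lee_fin.
rewrite /f' patchE; case: ifPn => [/set_mem nZ|_]; first exact: E.
by rewrite normr0; exact: g0.
Qed.
End complete_measure.

Section completed_line.
Context (R : realType).
Local Notation cleb := (@completed_lebesgue_measure R).
Local Notation leb := (@lebesgue_measure R).
Local Notation cR := (caratheodory_type (R := R) (T := ocitv_type R) (wlength idfun)^*%mu).

Lemma borel_lebesgue_measurable (B : set R) : measurable (B : set (measurableTypeR R)) ->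
  lebesgue_measurable B.
Proof. by move=> mB; apply: sub_caratheodory. Qed.

Lemma measurable_completed d' (T' : measurableType d') (f : R -> T') :
  measurable_fun [set: measurableTypeR R] f -> measurable_fun [set: cR] (f : cR -> T').
Proof.
move=> mf _ B mB; have := mf measurableT _ mB; rewrite !setTI.
exact: borel_lebesgue_measurable.
Qed.

Lemma ge0_integral_completed (D : set R) (f : R -> \bar R) :
  measurable (D : set (measurableTypeR R)) ->
  measurable_fun (D : set (measurableTypeR R)) f -> (forall t, D t -> (0 <= f t)%E) ->
  (\int[cleb]_(t in D) f t = \int[leb]_(t in D) f t)%E.
Proof.
move=> mD mf f0; rewrite [LHS]integral_mkcond [RHS]integral_mkcond.
apply: (@ge0_integral_preserving _ _ cR (measurableTypeR R) _ cleb leb id).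
- exact: (@measurable_completed _ (measurableTypeR R) id).
- by move=> B _.
- exact/(measurable_restrictT f mD).
- by move=> t; rewrite patchE; case: ifPn => // /set_mem; exact: f0.
Qed.

Lemma integrable_completed (D : set R) (f : R -> R) :
  measurable (D : set (measurableTypeR R)) ->
  measurable_fun (D : set (measurableTypeR R)) f ->
  leb.-integrable D (EFin \o f) ->
  cleb.-integrable (D : set cR) (EFin \o (f : cR -> R)) /\
  \int[cleb]_(t in D) f t = \int[leb]_(t in D) f t.
Proof.
move=> mD mf /integrableP[mf' fi].
have mcf : measurable_fun (D : set cR) (f : cR -> R).
  have mD' : measurable (D : set cR) by exact: borel_lebesgue_measurable.
  apply: ((measurable_restrictT (f : cR -> R) mD').2).
  apply: measurable_completed.
  exact: ((measurable_restrictT (f : measurableTypeR R -> R) mD).1).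
split.
  apply/integrableP; split; first exact/measurable_EFinP.
  rewrite ge0_integral_completed//; apply: measurableT_comp => //.
rewrite /Rintegral [in LHS]integralE [in RHS]integralE; congr (fine (_ - _)).
  by apply: ge0_integral_completed => //; exact: measurable_funepos.
by apply: ge0_integral_completed => //; exact: measurable_funeneg.
Qed.
End completed_line.

Lemma linear_on_sum (R : realType) (V : lmodType R) (X : set V) (l : V -> R) (r : seq V)
    (a : V -> R) : subspace X -> linear_on X l -> (forall v, v \in r -> X v) ->
  X (\sum_(v <- r) a v *: v) /\ l (\sum_(v <- r) a v *: v) = \sum_(v <- r) a v * l v.
Proof.
move=> sX lX; elim: r => [|v r IH] rX.
  by rewrite !big_nil; split; [exact: sX.1|exact: linear_on0 sX lX].
have Xv : X v by apply: rX; rewrite mem_head.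
have [|h1 h2] := IH; first by move=> w wr; apply: rX; rewrite inE wr orbT.
rewrite !big_cons; split; first exact: sX.2.
by rewrite lX// h2.
Qed.

Lemma cvge0_lt (R : realType) (u : nat -> \bar R) (e : R) : u @ \oo --> 0%E -> 0 < e ->
  \forall k \near \oo, (u k < e%:E)%E.
Proof.
move=> /fine_cvgP[ufin /cvgrPdist_lt/(_ e)] /[apply]; move: ufin; apply: filterS2 => k uk /=.
rewrite sub0r normrN => /(le_lt_trans (ler_norm _)) h.
by rewrite -(fineK uk) lte_fin.
Qed.

Lemma cvge0_le (R : realType) (u : nat -> \bar R) : (forall k, (0 <= u k)%E) ->
  (forall e : R, 0 < e -> \forall k \near \oo, (u k <= e%:E)%E) -> u @ \oo --> 0%E.
Proof.
move=> u0 ue; have fin k (e : R) : (u k <= e%:E)%E -> u k \is a fin_num.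
  by move=> h; rewrite ge0_fin_numE//; apply: le_lt_trans h (ltry _).
apply/fine_cvgP; split; first by have := ue 1 ltr01; apply: filterS => k; exact: fin.
apply/cvgrPdist_le => e /ue; apply: filterS => k h /=.
rewrite sub0r normrN ger0_norm ?fine_ge0//.
by rewrite -lee_fin fineK//; exact: fin h.
Qed.

Section bochner_facts.
Context (R : realType) (V : lmodType R) (X : set V) (N : V -> R) (T : R).
Local Notation cleb := (@completed_lebesgue_measure R).
Local Notation cR := (caratheodory_type (R := R) (T := ocitv_type R) (wlength idfun)^*%mu).
Local Notation I := (`]0%R, T[%classic : set cR).
Hypothesis T0 : 0 < T.
Hypothesis sX : subspace X.
Hypothesis Nge0 : forall v, 0 <= N v.

Lemma measurable_time_interval : measurable I.
Proof. by apply: borel_lebesgue_measurable; exact: measurable_itv. Qed.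

Let mI := measurable_time_interval.

Lemma time_interval_length : cleb I = T%:E.
Proof.
have := @ge0_integral_completed R `]0, T[ (cst 1%E) (measurable_itv _) (measurable_cst _)
  (fun _ _ => lee01).
rewrite integral_cst//= mul1e => ->; rewrite integral_cst//= mul1e.
by rewrite lebesgue_measure_itv/= lte_fin T0 oppr0 adde0.
Qed.

Lemma time_interval_fin : (cleb I < +oo)%E.
Proof. by rewrite time_interval_length ltry. Qed.

Let Ifin := time_interval_fin.

Lemma time_itvP (t : R) : I t <-> 0 < t < T.
Proof. by rewrite /= in_itv. Qed.

Lemma time_ae (P Q : R -> Prop) : (forall t, 0 < t < T -> P t -> Q t) ->
  {ae cleb, forall t : R, 0 < t < T -> P t} -> {ae cleb, forall t : cR, I t -> Q t}.
Proof.
move=> PQ [Z [mZ Z0 hZ]]; exists Z; split=> // t /= nQ; apply: hZ => /= h.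
by apply: nQ => /time_itvP tT; exact: PQ (h tT).
Qed.

Section simple.
Variable s : R -> V.
Hypothesis sP : simple_function X s.

(** [phi] is arbitrary: finitely many values with measurable fibres suffice. *)
Lemma simple_comp_measurable d' (T' : measurableType d') (phi : V -> T') :
  measurable_fun [set: cR] (phi \o s : cR -> T').
Proof.
have [fs _ ms] := sP => _ B mB; rewrite setTI.
rewrite (_ : _ @^-1` B = \bigcup_(v in range s `&` phi @^-1` B) (s @^-1` [set v])).
  apply: fin_bigcup_measurable; first exact: finite_setIl.
  by move=> v _; exact: ms.
apply/seteqP; split=> [t Bt|t [v [_ Bv] /= ->]//].
by exists (s t) => //; split=> //; exists t.
Qed.

Lemma simple_integral_linear (l : V -> R) : linear_on X l ->
  [/\ X (simple_integral T s), cleb.-integrable I (EFin \o (l \o s : cR -> R)) &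
      l (simple_integral T s) = \int[cleb]_(t in I) l (s t)].
Proof.
move=> lX; have [fs sXs ms] := sP.
pose r : seq V := finmap.enum_fset (fset_set (range s)).
have rP v : (v \in r) = (v \in range s) by rewrite /r in_fset_set.
have [] := @linear_on_sum R V X l r (fun v => fine (cleb (I `&` s @^-1` [set v]))) sX lX.
  by move=> v; rewrite rP => /set_mem/sXs.
rewrite /simple_integral fsbig_finite// => Xs ls; split=> //.
  have mls : measurable_fun I (l \o s : cR -> R).
    by apply: measurable_funTS; exact: simple_comp_measurable.
  apply: (integrable_bounded_fun mI Ifin (C := \sum_(v <- r) `|l v|) mls) => t.
  have tr : s t \in r by rewrite rP; apply/mem_set; exists t.
  rewrite (perm_big _ (perm_to_rem tr)) big_cons lerDl.
  by apply: sumr_ge0 => v _; exact: normr_ge0.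
rewrite ls; pose F v (t : cR) : R := l v * \1_(s @^-1` [set v]) t.
have iF1 v : cleb.-integrable I (EFin \o (\1_(s @^-1` [set v]) : cR -> R)).
  apply: (integrable_bounded_fun mI Ifin (C := 1)).
    by apply: measurable_indic; exact: ms.
  by move=> t; rewrite indicE; case: (_ \in _); rewrite ?normr0 ?normr1.
have iF v := integrableZ_fun mI (l v) (iF1 v).
have [_ FE] := integrable_sum_fun mI r iF.
transitivity (\int[cleb]_(t in I) (\sum_(v <- r) F v t)).
  rewrite FE; apply: eq_bigr => v _.
  rewrite (RintegralZl (l v) mI (iF1 v)) mulrC; congr (_ * _).
  by rewrite setIC /Rintegral; congr fine; apply/esym; apply: integral_indic => //; exact: ms.
apply: eq_Rintegral => t _; have tr : s t \in r by rewrite rP; apply/mem_set; exists t.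
rewrite (bigD1_seq (s t))//=; last exact: finmap.fset_uniq.
rewrite big1 ?addr0; first by rewrite /F indicE mem_set// mulr1.
by move=> v vs; rewrite /F indicE memNset ?mulr0//= => e; rewrite -e eqxx in vs.
Qed.
End simple.

(** The compositions of phi with the approximating simple functions are measurable and converge
    a.e.; completeness of the measure gives measurability of the limit. *)
Lemma strongly_measurable_lip (f : R -> V) (phi : V -> R) (C : R) :
  strongly_measurable X N T f ->
  (forall x y, X x -> X y -> `|phi x - phi y| <= C * N (x - y)) ->
  measurable_fun I (phi \o f : cR -> R).
Proof.
move=> [s [ss sf]] lip.
apply: (@ae_lim_measurable _ cR R cleb (@completed_lebesgue_measure_is_complete R) I mI
  (fun k => phi \o s k)).
  by move=> k; apply: measurable_funTS; exact: simple_comp_measurable.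
apply: time_ae sf => t tT [Xf sf].
have Xs k : X (s k t) by have [_ Xs _] := ss k; apply: Xs; exists t.
apply/cvgrPdist_le => e e0.
have C1 : 0 < `|C| + 1 by rewrite ltr_wpDl.
have /cvgrPdist_le/(_ (e / (`|C| + 1)) (divr_gt0 e0 C1)) := sf.
apply: filterS => k; rewrite sub0r normrN (ger0_norm (Nge0 _)) => h1.
rewrite /= distrC; apply: le_trans (lip _ _ (Xs k) Xf) _.
apply: (@le_trans _ _ ((`|C| + 1) * N (s k t - f t))).
  by apply: ler_wpM2r => //; apply: le_trans (ler_norm _) _; rewrite lerDl.
by rewrite mulrC -ler_pdivlMr.
Qed.

(** A bounded linear functional commutes with the integral of simple functions, and both sides are
    continuous for the approximation that defines the Bochner integral. *)
Lemma bochner_integral_functional (f : R -> V) (y : V) (l : V -> R) (C : R) :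
  is_bochner_integral X N T f y -> linear_on X l -> 0 < C ->
  (forall x, X x -> `|l x| <= C * N x) ->
  cleb.-integrable I (EFin \o (l \o f : cR -> R)) /\ l y = \int[cleb]_(t in I) l (f t).
Proof.
move=> [Xy [s [[ss sf] sI sy]]] lX C0 lC.
have lip x z : X x -> X z -> `|l x - l z| <= C * N (x - z).
  by move=> Xx Xz; rewrite -(linear_onB sX lX Xx Xz); apply: lC; exact: subspaceB.
have mlf : measurable_fun I (l \o f : cR -> R).
  by apply: (@strongly_measurable_lip f l C) => //; exists s; split.
pose e k := (\int[cleb]_(t in I) (N (s k t - f t))%:E)%E.
have mls k : measurable_fun I (l \o s k : cR -> R).
  by apply: measurable_funTS; exact: simple_comp_measurable.
have mD k : measurable_fun I (fun t : cR => C^-1 * (l (s k t) - l (f t))).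
  by apply: measurable_funM; [exact: measurable_cst|apply: measurable_funB; [exact: mls|exact: mlf]].
have De k : (\int[cleb]_(t in I) `|C^-1 * (l (s k t) - l (f t))|%:E <= e k)%E.
  apply: (integrable_dominated mI (mD k)); last by move=> t _; rewrite lee_fin.
  apply: time_ae sf => t tT [Xf _].
  have Xs : X (s k t) by have [_ Xs _] := ss k; apply: Xs; exists t.
  rewrite lee_fin normrM (gtr0_norm (x := C^-1)) ?invr_gt0// ler_pdivrMl//.
  exact: lip.
have iDk k : (e k < +oo)%E -> cleb.-integrable I (EFin \o (fun t : cR => l (s k t) - l (f t))).
  move=> ek; have iD : cleb.-integrable I (EFin \o (fun t : cR => C^-1 * (l (s k t) - l (f t)))).
    apply/integrableP; split; first exact/measurable_EFinP.
    by apply: le_lt_trans ek; exact: De.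
  have := integrableZ_fun mI C iD; apply: eq_integrable => // t _ /=.
  by rewrite mulVKf// gt_eqF.
have [k0 _ ek0] : \forall k \near \oo, (e k < 1%:E)%E.
  exact: cvge0_lt.
have iss k : cleb.-integrable I (EFin \o (l \o s k : cR -> R)).
  by have [] := simple_integral_linear (ss k) lX.
have ilf : cleb.-integrable I (EFin \o (l \o f : cR -> R)).
  have h : (e k0 < +oo)%E by apply: lt_trans (ek0 _ (leqnn _)) _; exact: ltry.
  have := integrableB_fun mI (iss k0) (iDk _ h); apply: eq_integrable => // t _ /=.
  by rewrite opprB addrC subrK.
split=> //; apply/eqP; rewrite -subr_eq0 -normr_le0; apply/ler_addgt0Pl => d d0.
rewrite addr0; have dC : 0 < d / 2 / C by rewrite !divr_gt0.
have [k1 _ h1] : \forall k \near \oo, (e k < (d / 2 / C)%:E)%E.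
  exact: cvge0_lt.
have /cvgrPdist_lt/(_ _ dC)[k2 _ h2] := sy.
pose k := maxn k1 k2.
have ek := h1 k (leq_maxl _ _).
have := h2 k (leq_maxr _ _); rewrite /= sub0r normrN (ger0_norm (Nge0 _)) => yk.
have ekoo : (e k < +oo)%E by apply: lt_trans ek _; exact: ltry.
have [Xsi _ siE] := simple_integral_linear (ss k) lX.
have a1 : `|l y - l (simple_integral T (s k))| <= d / 2.
  rewrite distrC; apply: le_trans (lip _ _ Xsi Xy) _.
  by rewrite mulrC -ler_pdivlMr// ltW.
have a2 : `|l (simple_integral T (s k)) - \int[cleb]_(t in I) l (f t)| <= d / 2.
  rewrite siE -(RintegralB mI (iss k) ilf).
  apply: le_trans (le_normr_Rintegral mI (iDk k ekoo)) _.
  have -> : \int[cleb]_(t in I) `|l (s k t) - l (f t)| =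
      C * \int[cleb]_(t in I) `|C^-1 * (l (s k t) - l (f t))|.
    rewrite -RintegralZl//; last first.
      have := integrable_norm (integrableZ_fun mI C^-1 (iDk k ekoo)); exact: eq_integrable.
    apply: eq_Rintegral => t _; rewrite normrM (gtr0_norm (x := C^-1)) ?invr_gt0//.
    by rewrite mulVKf// gt_eqF.
  rewrite mulrC -ler_pdivlMr// -lee_fin /Rintegral fineK.
    by apply: le_trans (De k) _; exact: ltW.
  rewrite ge0_fin_numE; first exact: le_lt_trans (De k) ekoo.
  by apply: integral_ge0 => t _; rewrite lee_fin.
rewrite [leRHS](splitr d).
exact: le_trans (ler_distD (l (simple_integral T (s k))) _ _) (lerD a1 a2).
Qed.

(** Right end points of the cells: the samples are at positive times, where f is controlled, and the
    last one may exceed T. For this reason the hypotheses on f below cover all t > 0. *)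
Definition grid_point (n j : nat) : R := j.+1%:R / n.+1%:R.

Definition grid (f : R -> V) (n : nat) (t : R) : V :=
  if 0 < t < T then f (grid_point n (Num.truncn (n.+1%:R * t))) else 0.

Lemma grid_point_gt0 n j : 0 < grid_point n j.
Proof. by rewrite divr_gt0. Qed.

Lemma grid_point_near n (t : R) : 0 <= t ->
  `|grid_point n (Num.truncn (n.+1%:R * t)) - t| <= n.+1%:R^-1.
Proof.
move=> t0; have /andP[h1 h2] := truncn_itv (mulr_ge0 (ler0n R n.+1) t0).
set j := Num.truncn _ in h1 h2 *.
rewrite -(ler_pM2l (ltr0Sn R n)) divff ?pnatr_eq0// -[X in X * _](gtr0_norm (ltr0Sn R n)) -normrM.
rewrite mulrBr /grid_point mulrCA divff ?pnatr_eq0// mulr1 ler_norml.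
by move: h1 h2; rewrite -[j.+1]addn1 natrD => h1 h2; apply/andP; split; lra.
Qed.

Lemma grid_simple (f : R -> V) n : (forall t, 0 < t -> X (f t)) -> simple_function X (grid f n).
Proof.
move=> Xf; split.
- apply: (@sub_finite_set _ _ ([set 0] `|` (fun j => f (grid_point n j)) @`
    `I_(Num.truncn (n.+1%:R * T)).+1)).
    move=> _ [t _ <-]; rewrite /grid; case: ifPn => [/andP[t0 tT]|_]; last by left.
    right; exists (Num.truncn (n.+1%:R * t)) => //=; rewrite ltnS.
    by rewrite le_truncn// ler_wpM2l// ltW.
  by rewrite finite_setU; split=> //; exact: finite_image.
- move=> _ [t _ <-]; rewrite /grid; case: ifPn => _; last exact: sX.1.
  exact/Xf/grid_point_gt0.
move=> v; apply: borel_lebesgue_measurable.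
pose A (j : nat) : set (measurableTypeR R) := if f (grid_point n j) == v then
  `]0, T[ `&` `[j%:R / n.+1%:R, j.+1%:R / n.+1%:R[ else set0.
pose B : set (measurableTypeR R) := if v == 0 then ~` `]0, T[ else set0.
have -> : grid f n @^-1` [set v] = \bigcup_j A j `|` B.
  apply/seteqP; split=> t.
    rewrite /= /grid; case: ifPn => [/andP[t0 tT]|nt] fv.
      left; exists (Num.truncn (n.+1%:R * t)) => //; rewrite /A fv eqxx; split.
        by rewrite /= in_itv/= t0.
      have /andP[h1 h2] := truncn_itv (mulr_ge0 (ler0n R n.+1) (ltW t0)).
      by rewrite /= in_itv/= ler_pdivrMr// ltr_pdivlMr// (mulrC t) h1 h2.
    right; rewrite /B -fv eqxx /= in_itv/=; exact/negP.
  move=> [[j _]|]; rewrite /A /B; case: eqP => // e.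
    move=> [] /=; rewrite !in_itv/= => tT; rewrite ler_pdivrMr// ltr_pdivlMr// => hj.
    by rewrite /grid tT -e; congr (f (grid_point n _)); apply/truncn_def; rewrite mulrC.
  by rewrite /= in_itv/= => /negP/negPf nt; rewrite /grid nt e.
apply: measurableU.
  apply: bigcupT_measurable => j; rewrite /A; case: ifPn => // _.
  by apply: measurableI; exact: measurable_itv.
by rewrite /B; case: ifPn => // _; apply: measurableC; exact: measurable_itv.
Qed.

Lemma strongly_measurable_continuous (f : R -> V) : (forall t, 0 < t -> X (f t)) ->
  (forall t e : R, 0 < t -> 0 < e -> exists2 d, 0 < d &
     forall r, 0 < r -> `|r - t| < d -> N (f r - f t) < e) ->
  strongly_measurable X N T f.
Proof.
move=> Xf fc; exists (grid f); split=> [n|]; first exact: grid_simple.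
apply: nearW => t tT; have /andP[t0 _] := tT; split; first exact: Xf.
apply/cvgrPdist_lt => e e0; have [d d0 fd] := fc t e t0 e0.
have [n0 _ h] := near_infty_natSinv_lt (PosNum d0).
exists n0 => // n n0n; rewrite sub0r normrN (ger0_norm (Nge0 _)) /grid tT.
apply: fd; first exact: grid_point_gt0.
exact: le_lt_trans (grid_point_near n (ltW t0)) (h n n0n).
Qed.

Lemma grid_uniform (f : R -> V) :
  (forall e : R, 0 < e -> exists2 d, 0 < d &
     forall r t, 0 < r -> 0 < t -> `|r - t| < d -> N (f r - f t) < e) ->
  forall e : R, 0 < e -> exists n0 : nat, forall n t, (n0 <= n)%N -> 0 < t < T ->
    N (grid f n t - f t) <= e.
Proof.
move=> fu e e0; have [d d0 fd] := fu e e0.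
have [n0 _ h] := near_infty_natSinv_lt (PosNum d0).
exists n0 => n t n0n tT; have /andP[t0 _] := tT; rewrite /grid tT ltW//.
apply: fd => //; first exact: grid_point_gt0.
exact: le_lt_trans (grid_point_near n (ltW t0)) (h n n0n).
Qed.

(** The value y is verified rather than constructed: it comes with an error estimate against every
    simple function uniformly close to f, which is applied to the grid functions. *)
Lemma bochner_integral_continuous (f : R -> V) (y : V) :
  (forall t, 0 < t -> X (f t)) -> X y ->
  (forall e : R, 0 < e -> exists2 d, 0 < d &
     forall r t, 0 < r -> 0 < t -> `|r - t| < d -> N (f r - f t) < e) ->
  (forall s (e : R), simple_function X s -> 0 < e ->
     (forall t, 0 < t < T -> N (s t - f t) <= e) -> N (simple_integral T s - y) <= T * e) ->
  is_bochner_integral X N T f y.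
Proof.
move=> Xf Xy fu hy; split=> //; exists (grid f).
have near := grid_uniform fu.
split.
- split=> [n|]; first exact: grid_simple.
  apply: nearW => t tT; have /andP[t0 _] := tT; split; first exact: Xf.
  apply/cvgrPdist_le => e e0; have [n0 h] := near e e0.
  by exists n0 => // n n0n; rewrite sub0r normrN (ger0_norm (Nge0 _)); exact: h.
- apply: cvge0_le => [n|e e0]; first by apply: integral_ge0 => t _; rewrite lee_fin.
  have [n0 h] := near (e / T) (divr_gt0 e0 T0); exists n0 => // n n0n.
  apply: (@le_trans _ _ (\int[cleb]_(t in I) (e / T)%:E)%E).
    apply: ge0_le_integral_nonmeasurable => [t _|t /time_itvP tT]; rewrite lee_fin//.
    exact: h.
  by rewrite integral_cst//= time_interval_length -EFinM divfK// gt_eqF.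
- apply/cvgrPdist_le => e e0; have [n0 h] := near (e / T) (divr_gt0 e0 T0).
  exists n0 => // n n0n; rewrite sub0r normrN (ger0_norm (Nge0 _)).
  apply: le_trans (hy _ _ (grid_simple n Xf) (divr_gt0 e0 T0) (fun t => h n t n0n)) _.
  by rewrite mulrC divfK// gt_eqF.
Qed.
End bochner_facts.

Lemma integrable_cst_time (R : realType) (T k : R) : 0 < T ->
  (@completed_lebesgue_measure R).-integrable `]0%R, T[%classic (EFin \o cst k).
Proof.
move=> T0; apply: (integrable_bounded_fun (measurable_time_interval T)
  (time_interval_fin T0) (C := `|k|)) => //.
Qed.

(** * Cut-offs in time and the Laplace transform *)

Section time_smooth.
Variable R : realType.

(** A class of expressions closed under derivation, so that one computation of the first derivative
    yields derivatives of all orders. *)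
Inductive time_smooth : (R -> R) -> Prop :=
| time_smooth_cst c : time_smooth (fun=> c)
| time_smooth_id : time_smooth id
| time_smooth_bump k f : time_smooth f -> time_smooth (fun t => bump_exp k (f t))
| time_smooth_expR f : time_smooth f -> time_smooth (fun t => expR (f t))
| time_smoothD f g : time_smooth f -> time_smooth g -> time_smooth (fun t => f t + g t)
| time_smoothM f g : time_smooth f -> time_smooth g -> time_smooth (fun t => f t * g t).

Lemma time_smooth_derive f : time_smooth f ->
  exists2 g, time_smooth g & forall t : R, is_derive t 1 f (g t).
Proof.
elim=> {f}.
- by move=> c; exists (fun=> 0); [exact: time_smooth_cst|move=> t; exact: is_derive_cst].
- by exists (fun=> 1); [exact: time_smooth_cst|move=> t; exact: is_derive_id].
- move=> k f sf [g sg dg].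
  exists (fun t => (bump_exp k.+2 (f t) + (- k%:R) * bump_exp k.+1 (f t)) * g t).
    apply: time_smoothM => //; apply: time_smoothD; first exact: time_smooth_bump.
    by apply: time_smoothM; [exact: time_smooth_cst|exact: time_smooth_bump].
  move=> t; have := @is_derive1_comp R (bump_exp k) f t _ _ (is_derive_bump_exp k (f t)) (dg t).
  by move=> h; rewrite mulNr; exact: h.
- move=> f sf [g sg dg]; exists (fun t => expR (f t) * g t).
    by apply: time_smoothM => //; exact: time_smooth_expR.
  by move=> t; exact: (@is_derive1_comp R expR f t _ _ (is_derive_expR (f t)) (dg t)).
- move=> f1 f2 sf1 [g1 sg1 dg1] sf2 [g2 sg2 dg2].
  exists (fun t => g1 t + g2 t); first exact: time_smoothD.
  by move=> t; exact: (is_deriveD (dg1 t) (dg2 t)).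
- move=> f1 f2 sf1 [g1 sg1 dg1] sf2 [g2 sg2 dg2].
  exists (fun t => f1 t * g2 t + f2 t * g1 t).
    by apply: time_smoothD; exact: time_smoothM.
  by move=> t; exact: (is_deriveM (dg1 t) (dg2 t)).
Qed.

Lemma time_smooth_derive1 f : time_smooth f ->
  time_smooth (derive1 f) /\ forall t : R, is_derive t 1 f (derive1 f t).
Proof.
move=> /time_smooth_derive[g sg dg]; have E : derive1 f = g.
  by apply/funext => t; rewrite derive1E; have [_ ->] := dg t.
by rewrite E.
Qed.

Lemma time_smooth_continuous f : time_smooth f -> continuous f.
Proof.
move=> /time_smooth_derive[g _ dg] t; apply/differentiable_continuous/derivable1_diffP.
by have [] := dg t.
Qed.

Lemma continuous_bounded_itv (f : R -> R) (a b : R) : a <= b -> continuous f ->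
  exists C : R, 0 <= C /\ forall t, a <= t <= b -> `|f t| <= C.
Proof.
move=> ab cf; have ct : continuous (fun t : R => `|f t|).
  by move=> t; apply: continuous_comp; [exact: cf|exact: norm_continuous].
have cn : {within `[a, b], continuous (fun t => `|f t|)} by exact: continuous_subspaceT.
by have [c _ h] := EVT_max ab cn; exists `|f c|.
Qed.

Lemma time_smooth_bounded f (a b : R) : a <= b -> time_smooth f ->
  exists C : R, 0 <= C /\ forall t, a <= t <= b -> `|f t| <= C.
Proof. by move=> ab sf; apply: continuous_bounded_itv => //; exact: time_smooth_continuous. Qed.

Lemma time_smooth_test T f (a b : R) : time_smooth f -> 0 < a -> b < T ->
  (forall t, t < a -> f t = 0) -> (forall t, b < t -> f t = 0) -> time_test_function T f.
Proof.
move=> sf a0 bT fa fb.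
have sub : closure [set t | f t != 0] `<=` `[a, b].
  rewrite closureE; apply: smallest_sub; first exact: interval_closed.
  move=> t /=; rewrite in_itv/=; apply: contraNT; rewrite negb_and -!ltNge.
  by case/orP => h; apply/eqP; [exact: fa|exact: fb].
split.
- move=> k t; have sk : time_smooth (derive1n k f).
    elim: k => [//|k IH]; exact: (time_smooth_derive1 IH).1.
  by have [] := (time_smooth_derive1 sk).2 t.
- by apply: (subclosed_compact _ (@segment_compact _ a b)) => //; exact: closed_closure.
- move=> t /sub /=; rewrite !in_itv/= => /andP[at_ tb].
  by rewrite (lt_le_trans a0 at_) (le_lt_trans tb bT).
Qed.

Lemma bump_exp0_le (x y : R) : x <= y -> bump_exp 0 x <= bump_exp 0 y.
Proof.
move=> xy; have [x0|x0] := ltP 0 x; last by rewrite (bump_exp_le0 0 x0) bump_exp_ge0.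
have y0 := lt_le_trans x0 xy.
by rewrite /bump_exp x0 y0 !expr0 !mul1r ler_expR lerN2 lef_pV2.
Qed.

(** A smooth descending step. For a < b it equals exp(-1), and not 1, up to a, and 0 from b on; the
    nonzero constant is cancelled at the end. *)
Definition cutoff (a b t : R) := bump_exp 0 (1 - (bump_exp 0 (b - a))^-1 * bump_exp 0 (t - a)).

Lemma cutoff_smooth a b : time_smooth (cutoff a b).
Proof.
rewrite /cutoff; apply: time_smooth_bump.
rewrite (_ : (fun t => _) =
  (fun t => 1 + (- (bump_exp 0 (b - a))^-1) * bump_exp 0 (t + (- a)))); last first.
  by apply/funext => t; rewrite mulNr.
apply: time_smoothD; first exact: time_smooth_cst.
apply: time_smoothM; first exact: time_smooth_cst.
by apply: time_smooth_bump; apply: time_smoothD; [exact: time_smooth_id|exact: time_smooth_cst].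
Qed.

Lemma cutoff_left a b (t : R) : t <= a -> cutoff a b t = expR (- 1).
Proof.
move=> ta; rewrite /cutoff [X in _ * X]bump_exp_le0 ?subr_le0// mulr0 subr0.
by rewrite /bump_exp ltr01 expr0 mul1r invr1.
Qed.

Lemma cutoff_right a b (t : R) : a < b -> b <= t -> cutoff a b t = 0.
Proof.
move=> ab bt; apply: bump_exp_le0; rewrite subr_le0.
have h : 0 < bump_exp 0 (b - a) by rewrite bump_exp0_gt0// subr_gt0.
by rewrite ler_pdivlMl// mulr1; apply: bump_exp0_le; rewrite lerB.
Qed.

Lemma cutoff_derive_left a b (t : R) : t < a -> derive1 (cutoff a b) t = 0.
Proof.
move=> ta; rewrite derive1E; apply: derive_val.
apply: (@near_eq_is_derive _ _ _ (cst (expR (- 1)))).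
by near=> s; rewrite cutoff_left//; apply: ltW; near: s; exact: lt_nbhsl.
Unshelve. all: by end_near. Qed.

(** Zero up to time 1/(n+1) and tending to 1 at every positive time: it makes admissible a function
    that does not vanish near time 0. *)
Definition onset (n : nat) (t : R) := bump_exp 0 (n.+1%:R * t - 1).

Lemma onset_smooth n : time_smooth (onset n).
Proof.
rewrite /onset; apply: time_smooth_bump.
rewrite (_ : (fun t => _) = (fun t => n.+1%:R * t + (- 1)))//.
apply: time_smoothD; last exact: time_smooth_cst.
by apply: time_smoothM; [exact: time_smooth_cst|exact: time_smooth_id].
Qed.

Lemma onset_le0 n (t : R) : t <= n.+1%:R^-1 -> onset n t = 0.
Proof. by move=> h; rewrite /onset bump_exp_le0// subr_le0 -ler_pdivlMl// mulr1. Qed.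

Lemma near_succ_gt (x : R) : \forall n \near \oo, x < n.+1%:R.
Proof.
near=> n; apply: (@lt_trans _ _ n%:R); last by rewrite ltr_nat.
by near: n; exact: nbhs_infty_gtr.
Unshelve. all: by end_near. Qed.

Lemma onset_cvg (t : R) : 0 < t -> onset n t @[n --> \oo] --> (1 : R).
Proof.
move=> t0; apply/cvgrPdist_le => e e0; near=> n.
have h : t^-1 * (e^-1 + 1) < n.+1%:R by near: n; exact: near_succ_gt.
have e1 : e^-1 < n.+1%:R * t - 1 by rewrite ltrBrDr -ltr_pdivrMr// mulrC.
have y0 : 0 < n.+1%:R * t - 1 by apply: lt_trans e1; rewrite invr_gt0.
have le1 := bump_exp0_le1 (n.+1%:R * t - 1).
rewrite ger0_norm ?subr_ge0//; rewrite /onset /bump_exp y0 expr0 mul1r.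
have := expR_ge1Dx (- (n.+1%:R * t - 1)^-1).
have : (n.+1%:R * t - 1)^-1 <= e by rewrite -[e]invrK lef_pV2 ?posrE ?invr_gt0// ltW.
by move: ((n.+1%:R * t - 1)^-1) => b; move: (expR _) => a; lra.
Unshelve. all: by end_near. Qed.

Lemma derive1_onset n (t : R) : derive1 (onset n) t = n.+1%:R * bump_exp 2 (n.+1%:R * t - 1).
Proof.
have da : is_derive t 1 (fun t : R => n.+1%:R * t - 1) n.+1%:R.
  have := is_deriveB (is_deriveZ n.+1%:R (is_derive_id t (1 : R))) (is_derive_cst (1 : R) t 1).
  by rewrite subr0 -[_ *: _]/(_ * _) mulr1.
have := @is_derive1_comp R (bump_exp 0) _ t _ _ (is_derive_bump_exp 0 _) da.
rewrite mul0r subr0 mulrC derive1E => h; exact: derive_val.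
Qed.

Lemma derive1_onset_ge0 n (t : R) : 0 <= derive1 (onset n) t.
Proof. by rewrite derive1_onset mulr_ge0// bump_exp_ge0. Qed.

(** (n+1) r >= 2 gives (n+1) t - 1 >= (n+1) r / 2, so the factor x^-2 in the derivative outweighs n
    + 1 and leaves O(1/n). *)
Lemma derive1_onset_far n (r t : R) : 0 < r -> 2 <= n.+1%:R * r -> r <= t ->
  derive1 (onset n) t <= 4 / (n.+1%:R * r ^+ 2).
Proof.
move=> r0 nr rt; rewrite derive1_onset.
have m0 : 0 < n.+1%:R :> R by [].
have mt : n.+1%:R * r <= n.+1%:R * t by rewrite ler_pM2l.
have y0 : 0 < n.+1%:R * r / 2 by rewrite divr_gt0// mulr_gt0.
have xy : n.+1%:R * r / 2 <= n.+1%:R * t - 1 by lra.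
have x0 := lt_le_trans y0 xy.
have le1 : bump_exp 2 (n.+1%:R * t - 1) <= (n.+1%:R * r / 2)^-1 ^+ 2.
  rewrite /bump_exp x0; apply: (@le_trans _ _ ((n.+1%:R * t - 1)^-1 ^+ 2 * 1)).
    by rewrite ler_wpM2l ?exprn_ge0 ?invr_ge0 ?(ltW x0)// expR_le1 oppr_le0 invr_ge0 ltW.
  by rewrite mulr1 lerXn2r ?nnegrE ?invr_ge0 ?(ltW x0) ?(ltW y0)// lef_pV2.
apply: le_trans (ler_wpM2l (ltW m0) le1) _; rewrite le_eqVlt; apply/orP; left; apply/eqP.
by field; rewrite !gt_eqF.
Qed.

Lemma integral_derive1_onset n (T : R) : 0 < T ->
  (\int[lebesgue_measure]_(t in `[0%R, T]) (derive1 (onset n) t)%:E <= 1%:E)%E.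
Proof.
move=> T0; have [s d] := time_smooth_derive1 (onset_smooth n).
rewrite (FTC_itv T0 d (time_smooth_continuous s)) lee_fin (@onset_le0 n 0) ?invr_ge0// subr0.
exact: bump_exp0_le1.
Qed.
End time_smooth.

Section Rintegral_bounds.
Context d (T : measurableType d) (R : realType).
Variables (mu : {measure set T -> \bar R}) (D : set T) (mD : measurable D).
Implicit Types f g : T -> R.

Lemma dominated_Rintegral (f_ : nat -> T -> R) f g : (forall n, measurable_fun D (f_ n)) ->
  measurable_fun D f -> {ae mu, forall x, D x -> f_ n x @[n --> \oo] --> f x} ->
  mu.-integrable D (EFin \o g) -> (forall n x, D x -> `|f_ n x| <= g x) ->
  \int[mu]_(x in D) f_ n x @[n --> \oo] --> \int[mu]_(x in D) f x.
Proof.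
move=> mf_ mf cf ig fg.
have mEf n : measurable_fun D (EFin \o f_ n) by exact/measurable_EFinP.
have mE : measurable_fun D (EFin \o f) by exact/measurable_EFinP.
have cE : {ae mu, forall x, D x -> (EFin \o f_ n) x @[n --> \oo] --> (EFin \o f) x}.
  apply: ae_sub1 cf => x _ h.
  by apply: cvg_EFin; [exact: nearW|exact: h].
have dE : {ae mu, forall x n, D x -> (`|(EFin \o f_ n) x| <= (EFin \o g) x)%E}.
  by apply: aeW => x n Dx /=; rewrite lee_fin fg.
have [if_ _ c] := dominated_convergence mD mEf mE cE ig dE.
have := integrable_fin_num mD if_; rewrite -/(EFin \o f) => fn.
by move: c; rewrite -(fineK fn) => /fine_cvg.
Qed.

Lemma integrableM_bounded f g (C : R) : measurable_fun D f -> (forall x, D x -> `|f x| <= C) ->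
  mu.-integrable D (EFin \o g) -> mu.-integrable D (EFin \o (fun x => f x * g x)) /\
  `|\int[mu]_(x in D) (f x * g x)| <= C * \int[mu]_(x in D) `|g x|.
Proof.
move=> mf fC ig; have mg : measurable_fun D g by apply/measurable_EFinP; exact: measurable_int ig.
have igC := integrableZ_fun mD C (integrable_norm ig).
have fgC x : D x -> `|f x * g x| <= C * `|g x|.
  by move=> Dx; rewrite normrM; apply: ler_wpM2r => //; exact: fC.
have ifg : mu.-integrable D (EFin \o (fun x => f x * g x)).
  apply: (le_integrable mD _ _ igC); first by apply/measurable_EFinP; exact: measurable_funM.
  by move=> x Dx; rewrite lee_fin; apply: le_trans (fgC x Dx) (ler_norm _).
split=> //; apply: le_trans (le_normr_Rintegral mD ifg) _.
rewrite -(RintegralZl C mD (integrable_norm ig)).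
by apply: le_Rintegral => //; exact: integrable_norm ifg.
Qed.
End Rintegral_bounds.

Lemma onset_tail_small (R : realType) (C P x m y : R) : 0 < m -> 0 < y ->
  2 * C * 4 * P < m * (x * y) -> C * (4 / (m * y) * P) <= x / 2.
Proof.
move=> m0 y0 h; have -> : C * (4 / (m * y) * P) = (C * 4 * P) / (m * y).
  by field; rewrite !gt_eqF.
by rewrite ler_pdivrMr ?mulr_gt0//; lra.
Qed.

Section time_limits.
Context (R : realType) (T : R).
Local Notation cleb := (@completed_lebesgue_measure R).
Local Notation cR := (caratheodory_type (R := R) (T := ocitv_type R) (wlength idfun)^*%mu).
Local Notation I := (`]0%R, T[%classic : set cR).
Hypothesis T0 : 0 < T.
Let mI := measurable_time_interval T.

Lemma continuous_measurable_time (f : R -> R) : continuous f ->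
  measurable_fun I (f : cR -> R).
Proof.
move=> cf; apply: measurable_funTS; apply: measurable_completed.
exact: continuous_measurable_fun.
Qed.

Lemma continuous_integrable_time (f : R -> R) : continuous f ->
  cleb.-integrable I (EFin \o (f : cR -> R)).
Proof.
move=> cf; have [C [_ fC]] := continuous_bounded_itv (ltW T0) cf.
apply: measurable_bounded_integrable => //; first exact: time_interval_fin.
  exact: continuous_measurable_time.
exists C; split=> [|K CK t /time_itvP/andP[t0 tT]]; first exact: num_real.
by apply: le_trans (fC t _) (ltW CK); rewrite !ltW.
Qed.

Lemma time_smooth_integrableM (f : R -> R) (p : cR -> R) : time_smooth f ->
  cleb.-integrable I (EFin \o p) -> cleb.-integrable I (EFin \o (fun t => f t * p t)).
Proof.
move=> sf ip; have [C [_ fC]] := time_smooth_bounded (ltW T0) sf.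
apply: (integrableM_bounded mI (C := C) _ _ ip).1.
  exact: continuous_measurable_time (time_smooth_continuous sf).
by move=> t /time_itvP/andP[t0 tT]; apply: fC; rewrite !ltW.
Qed.

Lemma integral_derive1_onset_time n :
  cleb.-integrable I (EFin \o (derive1 (onset n) : cR -> R)) /\
  \int[cleb]_(t in I) derive1 (onset n) t <= 1.
Proof.
have [sb _] := time_smooth_derive1 (onset_smooth R n).
have ib := continuous_integrable_time (time_smooth_continuous sb).
split=> //; rewrite -lee_fin /Rintegral fineK; last exact: (integrable_fin_num mI ib).
have mb : measurable_fun setT (fun t : R => (derive1 (onset n) t)%:E).
  by apply/measurable_EFinP; apply: continuous_measurable_fun; exact: time_smooth_continuous.
rewrite ge0_integral_completed//; last first.
- by move=> t _; rewrite lee_fin derive1_onset_ge0.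
- exact: measurable_funTS.
apply: le_trans (integral_derive1_onset n T0).
apply: ge0_subset_integral => //; first exact: measurable_funTS.
- by move=> t _; rewrite lee_fin derive1_onset_ge0.
- by move=> t /=; rewrite !in_itv/= => /andP[t0 tT]; rewrite !ltW.
Qed.

Section vanishing.
Variables p e : cR -> R.
Hypotheses (ip : cleb.-integrable I (EFin \o p)) (ie : cleb.-integrable I (EFin \o e)).
Hypothesis W : forall eta, time_test_function T eta ->
  \int[cleb]_(t in I) (derive1 eta t * p t) = \int[cleb]_(t in I) (eta t * e t).
Hypothesis p0 : forall r : R, 0 < r -> exists2 dl, 0 < dl &
  forall t, 0 < t < T -> t < dl -> `|p t| <= r.

(** Integration by parts with no boundary term at time 0, because p tends to 0 there. Multiplying
    zeta by [onset n] adds the integral of zeta onset' p; onset' has mass at most 1 near 0, where p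
    is small, and is O(1/n) away from 0. *)
Lemma vanishing_parts (zeta : R -> R) (b : R) : time_smooth zeta -> b < T ->
  (forall t, b < t -> zeta t = 0) ->
  \int[cleb]_(t in I) (derive1 zeta t * p t) = \int[cleb]_(t in I) (zeta t * e t).
Proof.
move=> sz bT zb.
have [C [C0 zC]] := time_smooth_bounded (ltW T0) sz.
have zCI t : I t -> `|zeta t| <= C.
  by move=> /time_itvP/andP[t0 tT]; apply: zC; rewrite !ltW.
have [sz' dz] := time_smooth_derive1 sz.
have sb n := onset_smooth R n.
pose eta n (t : R) := zeta t * onset n t.
have seta n : time_smooth (eta n) by exact: time_smoothM.
have teta n : time_test_function T (eta n).
  apply: (@time_smooth_test _ T (eta n) n.+1%:R^-1 b) => // t h.
    by rewrite /eta onset_le0 ?mulr0// ltW.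
  by rewrite /eta zb// mul0r.
have deta n t : derive1 (eta n) t = zeta t * derive1 (onset n) t + onset n t * derive1 zeta t.
  rewrite derive1E; apply: derive_val.
  exact: (is_deriveM (dz t) ((time_smooth_derive1 (sb n)).2 t)).
have onset1 n t : `|onset n t : R| <= 1.
  by rewrite ger0_norm ?bump_exp_ge0//; exact: bump_exp0_le1.
have lim (f : R -> R) (k : cR -> R) : time_smooth f -> cleb.-integrable I (EFin \o k) ->
    \int[cleb]_(t in I) (onset n t * (f t * k t)) @[n --> \oo] -->
    \int[cleb]_(t in I) (f t * k t).
  move=> sf ik; have ifk := time_smooth_integrableM sf ik.
  have mfk : measurable_fun I (fun t => f t * k t).
    by apply/measurable_EFinP; exact: measurable_int ifk.
  apply: (dominated_Rintegral mI _ mfk _ (integrable_norm ifk)).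
  - move=> n; apply: measurable_funM => //.
    exact: continuous_measurable_time (time_smooth_continuous (sb n)).
  - apply: aeW => t /time_itvP/andP[t0 _].
    by rewrite -[X in _ --> X]mul1r; apply: cvgMl; exact: onset_cvg.
  - by move=> n t _; rewrite normrM ler_piMl.
pose P := \int[cleb]_(t in I) `|p t|.
have P0 : 0 <= P by apply: Rintegral_ge0.
pose r n := \int[cleb]_(t in I) (zeta t * (derive1 (onset n) t * p t)).
have ibp n := time_smooth_integrableM (time_smooth_derive1 (sb n)).1 ip.
have r0 : r n @[n --> \oo] --> (0 : R).
  apply/cvgrPdist_le => x x0.
  (* Half of the tolerance x is spent on times below dl, where |p| is at most this number, and half
     on the rest. *)
  have y0 : 0 < x / 2 / (C + 1) by rewrite !divr_gt0// ltr_wpDl.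
  have [dl dl0 pd] := p0 y0.
  near=> n; rewrite sub0r normrN.
  have n1 : 2 <= n.+1%:R * dl.
    rewrite -ler_pdivrMr// ltW//; near: n; exact: near_succ_gt.
  have n2 : C * (4 / (n.+1%:R * dl ^+ 2) * P) <= x / 2.
    have h : 2 * C * 4 * P / (x * dl ^+ 2) < n.+1%:R by near: n; exact: near_succ_gt.
    rewrite ltr_pdivrMr ?mulr_gt0// in h.
    by apply: onset_tail_small; rewrite ?exprn_gt0.
  have [ib b1] := integral_derive1_onset_time n.
  apply: le_trans (integrableM_bounded mI _ zCI (ibp n)).2 _.
    exact: continuous_measurable_time (time_smooth_continuous sz).
  pose kap := 4 / (n.+1%:R * dl ^+ 2).
  have kap0 : 0 <= kap by rewrite divr_ge0// mulr_ge0// sqr_ge0.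
  have i1 := integrableZ_fun mI (x / 2 / (C + 1)) ib.
  have i2 := integrableZ_fun mI kap (integrable_norm ip).
  have le1 : \int[cleb]_(t in I) `|derive1 (onset n) t * p t| <=
      x / 2 / (C + 1) * \int[cleb]_(t in I) derive1 (onset n) t + kap * P.
    rewrite -(RintegralZl _ mI ib) -(RintegralZl _ mI (integrable_norm ip)) -(RintegralD mI i1 i2).
    apply: le_Rintegral => //; first exact: integrable_norm (ibp n).
      exact: integrableD_fun.
    move=> t /time_itvP tT; rewrite normrM ger0_norm ?derive1_onset_ge0//.
    have [h|h] := ltP t dl.
      rewrite mulrC; apply: ler_wpDr; first by rewrite mulr_ge0//=.
      by apply: ler_wpM2r; [exact: derive1_onset_ge0|exact: pd].
    apply: ler_wpDl; first by rewrite mulr_ge0 ?derive1_onset_ge0// ltW.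
    by apply: ler_wpM2r => //; exact: derive1_onset_far.
  apply: le_trans (ler_wpM2l C0 le1) _; rewrite mulrDr -/kap in n2 *.
  have h1 : C * (x / 2 / (C + 1) * \int[cleb]_(t in I) derive1 (onset n) t) <= x / 2.
    apply: (@le_trans _ _ (C * (x / 2 / (C + 1)))).
      by apply: ler_wpM2l => //; rewrite ger_pMr.
    rewrite mulrA ler_pdivrMr ?ltr_wpDl//.
    by rewrite mulrC ler_wpM2l ?divr_ge0 ?(ltW x0)// lerDl.
  by rewrite [leRHS](splitr x); exact: lerD h1 n2.
have c1 := lim _ _ sz ie; have c2 := lim _ _ sz' ip.
have E n : \int[cleb]_(t in I) (onset n t * (zeta t * e t)) =
    r n + \int[cleb]_(t in I) (onset n t * (derive1 zeta t * p t)).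
  transitivity (\int[cleb]_(t in I) (eta n t * e t)).
    by apply: eq_Rintegral => t _; rewrite /eta mulrA (mulrC (onset n t)).
  rewrite -W// -(RintegralD mI).
  - by apply: eq_Rintegral => t _; rewrite deta mulrDl !mulrA.
  - exact: time_smooth_integrableM (ibp n).
  - exact: time_smooth_integrableM (sb n) (time_smooth_integrableM sz' ip).
have c3 : r n + \int[cleb]_(t in I) (onset n t * (derive1 zeta t * p t)) @[n --> \oo] -->
    0 + \int[cleb]_(t in I) (derive1 zeta t * p t) by exact: cvgD r0 c2.
rewrite add0r in c3; rewrite -(cvg_lim (@norm_hausdorff _ _) c3).
apply: cvg_lim; first exact: norm_hausdorff.
by move: c1; under eq_cvg do rewrite E.
Unshelve. all: by end_near. Qed.
End vanishing.

(** For zeta = exp(-lam t) chi the relation p' = -e turns the integral into that of exp(-lam t) chi'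
    p, and chi' vanishes before tau. [D] is a bound of chi' chosen before lam, p and e, since p and
    e will change with lam. *)
Lemma laplace_decay (tau b : R) : 0 < tau -> tau < b -> b < T -> exists D : R,
  forall (lam : R) (p e : cR -> R), 0 <= lam ->
  cleb.-integrable I (EFin \o p) -> cleb.-integrable I (EFin \o e) ->
  (forall eta, time_test_function T eta ->
    \int[cleb]_(t in I) (derive1 eta t * p t) = \int[cleb]_(t in I) (eta t * e t)) ->
  (forall r : R, 0 < r -> exists2 dl, 0 < dl &
    forall t, 0 < t < T -> t < dl -> `|p t| <= r) ->
  `|\int[cleb]_(t in I) (expR (- lam * t) * (cutoff tau b t * (e t + lam * p t)))| <=
  D * expR (- lam * tau) * \int[cleb]_(t in I) `|p t|.
Proof.
move=> tau0 taub bT; pose chi := @cutoff R tau b; have sc : time_smooth chi := cutoff_smooth tau b.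
have [sc' dc] := time_smooth_derive1 sc.
have [D [D0 cD]] := time_smooth_bounded (ltW T0) sc'.
exists D => lam p e lam0 ip ie W p0.
pose E (t : R) := expR (- lam * t).
have sE : time_smooth E.
  apply: time_smooth_expR; apply: time_smoothM; [exact: time_smooth_cst|exact: time_smooth_id].
have dE (t : R) : is_derive t 1 E (- lam * E t).
  have dl : is_derive t 1 (fun t : R => - lam * t) (- lam).
    have := is_deriveZ (- lam) (is_derive_id t (1 : R)); by rewrite -[_ *: _]/(_ * _) mulr1.
  have := @is_derive1_comp R expR _ t _ _ (is_derive_expR _) dl.
  by rewrite mulrC.
pose zeta (t : R) := E t * chi t.
have sz : time_smooth zeta by exact: time_smoothM.
have dz t : derive1 zeta t = E t * derive1 chi t + - lam * zeta t.
  rewrite derive1E; apply: derive_val.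
  apply: is_derive_eq (is_deriveM (dE t) (dc t)) _.
  by rewrite -![_ *: _]/(_ * _) /zeta; ring.
have zb t : b < t -> zeta t = 0 by move=> bt; rewrite /zeta /chi cutoff_right ?mulr0// ltW.
have h := vanishing_parts ip ie W p0 sz bT zb.
have i1 := time_smooth_integrableM sz ie.
have i2 := time_smooth_integrableM sz ip.
have sEc : time_smooth (fun t => E t * derive1 chi t) by exact: time_smoothM.
have i3 := time_smooth_integrableM sEc ip.
have -> : \int[cleb]_(t in I) (E t * (chi t * (e t + lam * p t))) =
    \int[cleb]_(t in I) (E t * derive1 chi t * p t).
  have j2 := integrableZ_fun mI lam i2.
  transitivity (\int[cleb]_(t in I) (zeta t * e t) + lam * \int[cleb]_(t in I) (zeta t * p t)).
    rewrite -(RintegralZl _ mI i2) -(RintegralD mI i1 j2).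
    by apply: eq_Rintegral => t _; rewrite /zeta; ring.
  rewrite -h -(RintegralZl _ mI i2) -(RintegralD mI (time_smooth_integrableM (time_smooth_derive1 sz).1 ip) j2).
  by apply: eq_Rintegral => t _; rewrite dz; ring.
apply: (integrableM_bounded mI _ _ ip).2.
  exact: continuous_measurable_time (time_smooth_continuous sEc).
move=> t /time_itvP/andP[t0 tT]; rewrite normrM mulrC.
have [h1|h1] := ltP t tau.
  by rewrite /chi cutoff_derive_left// normr0 mul0r mulr_ge0 ?expR_ge0.
apply: ler_pM => //; first by apply: cD; rewrite !ltW.
by rewrite ger0_norm ?expR_ge0// ler_expR !mulNr lerN2 ler_wpM2l.
Qed.
End time_limits.

Lemma completed_lebesgue_borel (R : realType) (D : set R) :
  measurable (D : set (measurableTypeR R)) ->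
  @completed_lebesgue_measure R D = lebesgue_measure D.
Proof.
move=> mD; have mD' := borel_lebesgue_measurable mD.
have := @ge0_integral_completed R D (cst 1%E) mD (measurable_cst _) (fun _ _ => lee01).
by rewrite integral_cst//= mul1e => ->; rewrite integral_cst//= mul1e.
Qed.

(** * Vanishing of a function from the decay of its Laplace transform *)

Section laplace_uniqueness.
Context (R : realType) (T : R).
Local Notation cleb := (@completed_lebesgue_measure R).
Local Notation cR := (caratheodory_type (R := R) (T := ocitv_type R) (wlength idfun)^*%mu).
Local Notation I := (`]0%R, T[%classic : set cR).
Hypothesis T0 : 0 < T.
Let mI := measurable_time_interval T.
Variables (F : cR -> R) (tau C : R) (m0 : nat).
Hypotheses (iF : cleb.-integrable I (EFin \o F)) (C0 : 0 <= C).
Hypothesis decay : forall m : nat, (m0 <= m)%N ->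
  `|\int[cleb]_(t in I) (expR (- (m%:R * t)) * F t)| <= C * expR (- (m%:R * tau)).

Let E (m : nat) (t : R) : R := expR (- (m%:R * t)).

Let E_ge0 m t : 0 <= E m t. Proof. exact: expR_ge0. Qed.

Let E_le1 m t : 0 <= t -> E m t <= 1.
Proof. by move=> t0; rewrite expR_le1 oppr_le0 mulr_ge0. Qed.

Let E_measurable m : measurable_fun I (E m : cR -> R).
Proof.
apply: continuous_measurable_time => t.
apply: (@continuous_comp _ _ _ (fun t : R => - (m%:R * t)) expR); last exact: continuous_expR.
by apply: cvgN; apply: cvgMr; exact: cvg_id.
Qed.

Let weight N j m (t : R) : R := E m t ^+ j * (1 - E m t) ^+ N.

Let weight_measurable N j m : measurable_fun I (weight N j m : cR -> R).
Proof.
apply: measurable_funM; apply: measurable_funX; first exact: E_measurable.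
by apply: measurable_funB => //; exact: E_measurable.
Qed.

Let weight_bound N j m t : I t -> `|weight N j m t| <= 1.
Proof.
move=> /time_itvP/andP[t0 _]; have e0 := E_ge0 m t; have e1 := E_le1 m (ltW t0).
rewrite ger0_norm; last by rewrite mulr_ge0// exprn_ge0// subr_ge0.
by rewrite mulr_ile1 ?exprn_ge0 ?exprn_ile1 ?subr_ge0// lerBlDr lerDl.
Qed.

Let weight_integrable N j m : cleb.-integrable I (EFin \o (fun t => weight N j m t * F t)).
Proof. exact: (integrableM_bounded mI (@weight_measurable N j m) (fun t => @weight_bound N j m t) iF).1. Qed.

(* [x^j (1-x)^(N+1) = x^j (1-x)^N - x^(j+1) (1-x)^N] at [x = exp(-m t)] *)
Let weight_decay N j m : (m0 <= m)%N -> (0 < m)%N ->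
  `|\int[cleb]_(t in I) (weight N j.+1 m t * F t)| <= C * E m tau ^+ j.+1 * (1 + E m tau) ^+ N.
Proof.
move=> m0m mp; elim: N j => [|N IH] j.
  rewrite expr0 mulr1; have := decay (leq_trans m0m (leq_pmulr m (ltn0Sn j))).
  have pw (t : R) : E m t ^+ j.+1 = expR (- ((m * j.+1)%:R * t)).
    by rewrite /E -expRM_natl natrM; congr expR; ring.
  rewrite pw; congr (`|_| <= _); apply: eq_Rintegral => t _.
  by rewrite /weight expr0 mulr1 pw.
have -> : \int[cleb]_(t in I) (weight N.+1 j.+1 m t * F t) =
   \int[cleb]_(t in I) (weight N j.+1 m t * F t) - \int[cleb]_(t in I) (weight N j.+2 m t * F t).
  rewrite -(RintegralB mI (weight_integrable N j.+1 m) (weight_integrable N j.+2 m)).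
  by apply: eq_Rintegral => t _; rewrite /weight !exprS; ring.
apply: le_trans (ler_normB _ _) _; apply: le_trans (lerD (IH j) (IH j.+1)) _.
by rewrite le_eqVlt; apply/orP; left; apply/eqP; rewrite !exprS; ring.
Qed.

(** With N about exp(m t), its value at time s tends to the indicator of s < t as m grows, because
    (1 - exp(-m s))^N is then close to exp(-exp(m (t - s))). *)
Let partial_weight N m (t : R) : R := 1 - (1 - E m t) ^+ N.

(** Telescoping in N: each increment is a [weight] with j = 1, controlled by the Laplace transform
    at integer multiples of m. *)
Let partial_weight_decay N m : (m0 <= m)%N -> (0 < m)%N ->
  `|\int[cleb]_(t in I) (partial_weight N m t * F t)| <=
  N%:R * (C * E m tau * (1 + E m tau) ^+ N).
Proof.
move=> m0m mp; elim: N => [|N IH].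
  rewrite mul0r (_ : \int[cleb]_(t in I) _ = 0) ?normr0//.
  under eq_Rintegral do rewrite /partial_weight expr0 subrr mul0r.
  by rewrite Rintegral_cst// mul0r.
have ip : cleb.-integrable I (EFin \o (fun t => partial_weight N m t * F t)).
  have := integrableB_fun mI iF (weight_integrable N 0 m); apply: eq_integrable => // t _ /=.
  by rewrite /weight /partial_weight expr0; congr EFin; ring.
have -> : \int[cleb]_(t in I) (partial_weight N.+1 m t * F t) =
   \int[cleb]_(t in I) (partial_weight N m t * F t) + \int[cleb]_(t in I) (weight N 1 m t * F t).
  rewrite -(RintegralD mI ip (weight_integrable N 1 m)).
  by apply: eq_Rintegral => t _; rewrite /weight /partial_weight exprS expr1; ring.
apply: le_trans (ler_normD _ _) _; apply: le_trans (lerD IH (weight_decay N 0 m0m mp)) _.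
have e0 := E_ge0 m tau; rewrite expr1 -[X in _ + X]mul1r -mulrDl natr1.
rewrite ler_wpM2l// ler_wpM2l ?mulr_ge0// exprS ler_peMl ?exprn_ge0 ?addr_ge0//.
by rewrite lerDl.
Qed.

Let exponent (t : R) (m : nat) := (Num.truncn (expR (m%:R * t))).+1.

Let exponent_bounds t m : expR (m%:R * t) < (exponent t m)%:R <= expR (m%:R * t) + 1.
Proof.
have /andP[h1 h2] := truncn_itv (expR_ge0 (m%:R * t)).
by rewrite h2 -natr1 lerD2r.
Qed.

Let near_nat (x : R) : \forall m \near \oo, x < m%:R.
Proof. exact: nbhs_infty_gtr. Qed.

Let expR_small (r e : R) : 0 < r -> 0 < e -> \forall m \near \oo, expR (- (m%:R * r)) < e.
Proof.
move=> r0 e0; near=> m; have h : e^-1 / r < m%:R by near: m; exact: near_nat.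
rewrite ltr_pdivrMr// in h; rewrite expRN -[e]invrK ltf_pV2 ?posrE ?expR_gt0 ?invr_gt0//.
by apply: lt_le_trans h _; apply: le_trans (expR_ge1Dx _); rewrite lerDr.
Unshelve. all: by end_near. Qed.

(** Tested against [partial_weight] with N about exp(m t), F gives a quantity of order N exp(-m
    tau), that is exp(-m (tau - t)), which tends to 0. By dominated convergence the same quantity
    tends to the integral of F over s < t; the point s = t is a null set. *)
Lemma laplace_primitive0 (t : R) : 0 < t -> t < tau ->
  \int[cleb]_(s in I) (\1_(`]-oo, t[%classic : set R) s * F s) = 0.
Proof.
move=> t0 ttau.
pose f_ m (s : cR) := partial_weight (exponent t m) m s * F s.
have mpw m : measurable_fun I (partial_weight (exponent t m) m : cR -> R).
  apply: measurable_funB; first exact: measurable_cst.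
  by apply: measurable_funX; apply: measurable_funB; [exact: measurable_cst|exact: E_measurable].
have mF : measurable_fun I F by apply/measurable_EFinP; exact: measurable_int iF.
have mind : measurable_fun I (\1_(`]-oo, t[%classic : set R) : cR -> R).
  by apply: measurable_funTS; apply: measurable_indic; apply: borel_lebesgue_measurable; exact: measurable_itv.
have c1 : \int[cleb]_(s in I) f_ m s @[m --> \oo] -->
    \int[cleb]_(s in I) (\1_(`]-oo, t[%classic : set R) s * F s).
  apply: (dominated_Rintegral mI _ _ _ (integrable_norm iF)).
  - by move=> m; apply: measurable_funM.
  - exact: measurable_funM.
  - exists [set t]; split.
    + by apply: borel_lebesgue_measurable; exact: measurable_set1.
    + apply: etrans (completed_lebesgue_borel (measurable_set1 t)) _.
      exact: lebesgue_measure_set1.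
    move=> s /= /not_implyP[/time_itvP/andP[s0 sT] nc]; apply: contrapT => st; apply: nc.
    apply: cvgMl; have [lts|gts|e] := ltgtP s t; last by case: st.
      rewrite indicE mem_set/= ?in_itv//=.
      apply/cvgrPdist_le => e e0; near=> m; have e1 := E_le1 m (ltW s0).
      rewrite /partial_weight opprB addrC subrK ger0_norm ?exprn_ge0 ?subr_ge0//.
      have /andP[n1 _] := exponent_bounds t m.
      (* For s < t and x = exp(-m s): (1 - x)^N <= exp(-N x), and N x >= exp(m (t - s)) >= m (t -
         s). *)
      apply: (@le_trans _ _ (expR (- ((exponent t m)%:R * E m s)))).
        rewrite -mulrN expRM_natl lerXn2r ?nnegrE ?subr_ge0 ?expR_ge0//.
        exact: expR_ge1Dx.
      apply: (@le_trans _ _ (expR (- (m%:R * (t - s))))); last first.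
        by apply: ltW; near: m; apply: expR_small => //; rewrite subr_gt0.
      rewrite ler_expR lerN2; apply: (@le_trans _ _ (expR (m%:R * t) * E m s)).
        by rewrite /E -expRD -mulrBr; apply: le_trans (expR_ge1Dx _); rewrite lerDr.
      by rewrite ler_wpM2r ?expR_ge0// ltW.
    rewrite indicE memNset/= ?in_itv/= ?ltNge ?(ltW gts)//.
    apply/cvgrPdist_le => e e0; near=> m; have e1 := E_le1 m (ltW s0).
    have e00 := E_ge0 m s.
    rewrite sub0r normrN /partial_weight ger0_norm; last first.
      by rewrite subr_ge0 exprn_ile1 ?subr_ge0// lerBlDr lerDl.
    have /andP[_ n1] := exponent_bounds t m.
    (* Bernoulli: for s > t the partial weight is at most N exp(-m s), of order exp(-m (s - t)). *)
    have b1 : 1 - (exponent t m)%:R * E m s <= (1 - E m s) ^+ exponent t m.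
      elim: (exponent t m) => [|N IH]; first by rewrite mul0r subr0 expr0.
      rewrite exprS; apply: (@le_trans _ _ ((1 - E m s) * (1 - N%:R * E m s))).
        by rewrite -natr1; have := mulr_ge0 (ler0n R N) (sqr_ge0 (E m s)); nra.
      by rewrite ler_wpM2l ?subr_ge0.
    have e2 : expR (- (m%:R * (s - t))) < e / 2.
      by near: m; apply: expR_small; rewrite ?subr_gt0 ?divr_gt0.
    have e3 : E m s < e / 2 by near: m; apply: expR_small; rewrite ?divr_gt0.
    apply: (@le_trans _ _ ((exponent t m)%:R * E m s)); first by rewrite lerBlDr -lerBlDl.
    apply: (@le_trans _ _ ((expR (m%:R * t) + 1) * E m s)); first by rewrite ler_wpM2r.
    rewrite mulrDl mul1r {1}/E -expRD -mulrBr -opprB mulrN.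
    by rewrite [leRHS](splitr e) lerD// ltW.
  - move=> m s Is; rewrite normrM ler_piMl//.
    have /andP[s0 _] : 0 < s < T by apply/time_itvP.
    have e1 := E_le1 m (ltW s0); have e0 := E_ge0 m s.
    rewrite /partial_weight ger0_norm.
      by rewrite lerBlDr lerDl exprn_ge0// subr_ge0.
    by rewrite subr_ge0 exprn_ile1 ?subr_ge0// lerBlDr lerDl.
have c2 : \int[cleb]_(s in I) f_ m s @[m --> \oo] --> (0 : R).
  apply/cvgrPdist_le => e e0; near=> m; rewrite sub0r normrN.
  have m1 : (m0 <= m)%N by near: m; exact: nbhs_infty_ge.
  have m2 : (0 < m)%N by near: m; exact: nbhs_infty_gt.
  apply: le_trans (partial_weight_decay _ m1 m2) _.
  have /andP[_ n1] := exponent_bounds t m.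
  pose x := expR (- (m%:R * (tau - t))).
  have x0 : 0 <= x := expR_ge0 _.
  have x1 : x <= 1 by rewrite expR_le1 oppr_le0 mulr_ge0// subr_ge0 ltW.
  have Nx : (exponent t m)%:R * E m tau <= 2 * x.
    apply: (@le_trans _ _ ((expR (m%:R * t) + 1) * E m tau)); first by rewrite ler_wpM2r.
    rewrite mulrDl mul1r {1}/E -expRD -mulrBr -(opprB tau) mulrN -/x mulr2n mulrDl mul1r.
    rewrite lerD2l ler_expR lerN2 ler_wpM2l// gerBl; exact: ltW.
  have p1 : (1 + E m tau) ^+ exponent t m <= expR 2.
    apply: (@le_trans _ _ (expR (E m tau) ^+ exponent t m)).
      by rewrite lerXn2r ?nnegrE ?expR_ge0 ?addr_ge0// expR_ge1Dx.
    by rewrite -expRM_natl ler_expR; apply: le_trans Nx _; rewrite ger_pMr.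
  have ex : x < e / (2 * C * expR 2 + 1).
    rewrite /x; near: m; apply: expR_small; rewrite ?subr_gt0// divr_gt0//.
    by rewrite ltr_wpDl// !mulr_ge0// expR_ge0.
  apply: (@le_trans _ _ (C * (2 * x) * expR 2)).
    rewrite mulrA; apply: ler_pM => //.
    - by rewrite !mulr_ge0.
    - by rewrite exprn_ge0// addr_ge0.
    by rewrite mulrCA ler_wpM2l.
  rewrite ltr_pdivlMr in ex; last by rewrite ltr_wpDl// !mulr_ge0// expR_ge0.
  by move: ex; move: (expR 2) => w; lra.
by rewrite -(cvg_lim (@norm_hausdorff _ _) c1); apply: cvg_lim; first exact: norm_hausdorff.
Unshelve. all: by end_near. Qed.

(** Open left rays generate the Borel sets and meet []0, tau1[] in intervals starting at 0, over
    which F has integral 0. *)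
Lemma laplace_ae0 (tau1 : R) : 0 < tau1 -> tau1 < tau -> tau1 < T ->
  {ae cleb, forall t : R, 0 < t < tau1 -> F t = 0}.
Proof.
move=> tau10 tau1t tau1T; pose D : set cR := `]0, tau1[%classic.
have DI : D `<=` I.
  move=> t /(@time_itvP R tau1 t)/andP[t0 h]; apply/time_itvP.
  by rewrite t0 (lt_trans h tau1T).
have mD : measurable D := measurable_time_interval tau1.
have iD : cleb.-integrable D (EFin \o F) by apply: integrableS iF.
have mray x : measurable (`]-oo, x[%classic : set cR).
  by apply: borel_lebesgue_measurable; exact: measurable_itv.
have ray0 t : 0 < t -> t < tau -> t <= tau1 ->
    (\int[cleb]_(s in `]0%R, t[%classic : set cR) (F s)%:E = 0)%E.
  move=> t0 ttau tt1; have := laplace_primitive0 t0 ttau.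
  have mt : measurable (`]0%R, t[%classic : set cR) := measurable_time_interval t.
  have i1 : cleb.-integrable (`]0%R, t[%classic : set cR) (EFin \o F).
    apply: integrableS iF => // s /(@time_itvP R t s)/andP[s0 h]; apply/time_itvP.
    by rewrite s0 (lt_trans h (le_lt_trans tt1 tau1T)).
  rewrite -[X in X = _](_ : fine (\int[cleb]_(s in `]0%R, t[%classic : set cR) (F s)%:E) = _).
    by move=> h; rewrite -(fineK (integrable_fin_num mt i1)) h.
  rewrite /Rintegral; congr fine; rewrite [LHS]integral_mkcond [RHS]integral_mkcond.
  apply: eq_integral => s _; rewrite !patchE.
  have [st|st] := boolP (s \in (`]0%R, t[%classic : set cR)).
    have /andP[s0 s1] : 0 < s < t by move: st; rewrite inE /= in_itv.
    rewrite mem_set/=; last by rewrite in_itv/= s0 (lt_trans s1 (le_lt_trans tt1 tau1T)).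
    by rewrite indicE mem_set ?mul1r//= in_itv.
  case: ifPn => // /set_mem /=; rewrite in_itv/= => /andP[s0 _].
  rewrite indicE memNset ?mul0r//= in_itv/= => s1; move/negP: st; apply.
  by rewrite inE /= in_itv/= s0.
have h := @completed_ae_eq0 _ (ocitv_type R) R _ D (EFin \o F) mD (time_interval_fin tau10) iD.
have {h} [Z [mZ Z0 hZ]] : ae_eq cleb D (EFin \o F) (cst 0%E).
  apply: h => B mB.
  have := @integral_dynkin0 _ cR R cleb D mD _ (measurableTypeR R) id (@RGenInftyO.G R) (EFin \o F) _ _ _ iD _ _ B mB.
  rewrite preimage_id; apply.
  - exact: RGenInftyO.measurableE.
  - move=> _ _ [x ->] [y ->]; exists (Num.min x y); apply/seteqP; split=> s /=.
      by rewrite !in_itv/= lt_min => -[-> ->].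
    by rewrite !in_itv/= lt_min => /andP[].
  - exact: (@measurable_completed _ _ (measurableTypeR R) id).
  - exact: ray0.
  - move=> _ [x ->]; have [x0|x0] := leP x 0.
      rewrite (_ : D `&` _ = set0) ?integral_set0//; apply/seteqP; split=> // s [] /=.
      by rewrite !in_itv/= => /andP[s0 _] sx; have := lt_trans s0 (lt_le_trans sx x0); rewrite ltxx.
    rewrite (_ : D `&` _ = `]0%R, (Num.min tau1 x)[%classic).
      apply: ray0; rewrite ?lt_min ?tau10 ?x0//; last by rewrite ge_min lexx.
      by rewrite gt_min tau1t.
    apply/seteqP; split=> s /=.
      by move=> [/(@time_itvP R tau1 s)/andP[s0 s1]]; rewrite !in_itv/= lt_min s0 s1 => ->.
    rewrite !in_itv/= lt_min => /and3P[s0 s1 sx]; split; last exact: sx.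
    by apply/time_itvP; rewrite s0.
exists Z; split=> // t /= nt; apply: hZ => /= ht; apply: nt => tt1.
by have [] : (F t)%:E = 0%E by apply: ht; rewrite /D /= in_itv.
Qed.
End laplace_uniqueness.

Lemma form_norm_lip (R : realType) (X : lmodType R) (V : set X) (a : X -> X -> R) x y :
  subspace V -> sym_psd_on V a -> V x -> V y ->
  `|Num.sqrt (a x x) - Num.sqrt (a y y)| <= Num.sqrt (a (x - y) (x - y)).
Proof.
move=> sV aP Vx Vy; have [ab asym a0] := aP.
rewrite -sqrtr_sqr; apply: ler_wsqrtr; rewrite (bilinear_onBB sV ab Vx Vy).
have h : a x y <= Num.sqrt (a x x) * Num.sqrt (a y y).
  rewrite -sqrtrM ?a0//; apply: le_trans (ler_norm _) _; rewrite -sqrtr_sqr.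
  by apply: ler_wsqrtr; exact: form_cauchy_schwarz aP Vx Vy.
rewrite sqrrB !sqr_sqrtr ?a0// (asym y x)//.
lra.
Qed.

Section bochner_L2_facts.
Context (R : realType) (V : lmodType R) (X : set V) (N : V -> R) (T : R).
Local Notation cleb := (@completed_lebesgue_measure R).
Local Notation cR := (caratheodory_type (R := R) (T := ocitv_type R) (wlength idfun)^*%mu).
Local Notation I := (`]0%R, T[%classic : set cR).
Hypothesis T0 : 0 < T.
Hypothesis sX : subspace X.
Hypothesis Nge0 : forall v, 0 <= N v.
Hypothesis Nlip : forall x y, X x -> X y -> `|N x - N y| <= N (x - y).
Let mI := measurable_time_interval T.

(** N is dominated by 1 + N^2, and the time interval has finite length. *)
Lemma bochner_L2_norm_integrable (f : R -> V) : bochner_L2 X N T f ->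
  cleb.-integrable I (EFin \o (N \o f : cR -> R)).
Proof.
move=> [fm fL]; have mN : measurable_fun I (N \o f : cR -> R).
  by apply: (strongly_measurable_lip Nge0 (C := 1) fm) => x y Xx Xy; rewrite mul1r; exact: Nlip.
have L2fin : (\int[cleb]_(t in I) ((N (f t)) ^+ 2)%:E < +oo)%E.
  have I0 : (0 <= \int[cleb]_(t in I) ((N (f t)) ^+ 2)%:E)%E.
    by apply: integral_ge0 => t _; rewrite lee_fin sqr_ge0.
  rewrite ltey; apply/eqP => e; move: fL; rewrite /bochner_norm2 e.
  by rewrite poweRyr ?ltxx// invr_neq0.
have i1 : cleb.-integrable I (EFin \o (cst 1 : cR -> R)).
  by apply: integrable_cst_time.
have i2 : cleb.-integrable I (EFin \o (fun t : cR => N (f t) ^+ 2)).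
  apply/integrableP; split; first by apply/measurable_EFinP; exact: measurable_funX.
  apply: le_lt_trans L2fin; rewrite le_eqVlt; apply/orP; left; apply/eqP.
  by apply: eq_integral => t _ /=; rewrite ger0_norm ?sqr_ge0.
apply: (le_integrable mI _ _ (integrableD_fun mI i1 i2)); first exact/measurable_EFinP.
move=> t _ /=; rewrite lee_fin !ger0_norm ?addr_ge0 ?sqr_ge0//.
by have := sqr_ge0 (N (f t) - 1); have := Nge0 (f t); move: (N (f t)) => x; nra.
Qed.

Lemma bochner_L2_integrable (f : R -> V) (phi : V -> R) (C : R) : bochner_L2 X N T f ->
  (forall x y, X x -> X y -> `|phi x - phi y| <= C * N (x - y)) ->
  (forall x, X x -> `|phi x| <= C * N x) ->
  cleb.-integrable I (EFin \o (phi \o f : cR -> R)).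
Proof.
move=> fL lip bnd; have [fm _] := fL.
have mphi := strongly_measurable_lip Nge0 fm lip.
have iN := bochner_L2_norm_integrable fL.
have iCN := integrableZ_fun mI `|C| iN.
apply/integrableP; split; first exact/measurable_EFinP.
move: iCN => /integrableP[_]; apply: le_lt_trans.
apply: (@integrable_dominated _ cR R cleb I mI (phi \o f)
  (fun t => `|(EFin \o (fun t0 : cR => (`|C| * (N \o f) t0)%R)) t|)%E mphi); last first.
  by move=> t _; exact: abse_ge0.
have [s [_ sf]] := fm; apply: time_ae (sf) => t tT [Xf _].
rewrite /= lee_fin normrM normr_id (ger0_norm (Nge0 _)).
by apply: le_trans (bnd _ Xf) _; apply: ler_wpM2r => //; exact: ler_norm.
Qed.
End bochner_L2_facts.

(** * The dual of a subspace with a seminorm *)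

Section dual_space.
Context (R : realType) (X : lmodType R) (V : set X) (N : X -> R).
Hypotheses (sV : subspace V) (Nge0 : forall u, 0 <= N u).
Hypothesis NZ : forall c u, V u -> N (c *: u) = `|c| * N u.

(** [Hm1] with [H10] and its norm abstracted, kept in the same shape so that the concrete space is
    an instance by conversion. *)
Definition dual_space : set (V -> R) :=
  [set F | (forall a (u v w : V), val w = a *: val u + val v -> F w = a * F u + F v) /\
           exists C, forall v : V, `|F v| <= C * N (val v)].

Definition dual_norm (F : V -> R) : R := sup [set `|F v| | v in [set v : V | N (val v) <= 1]].

Lemma seminorm0 : N 0 = 0.
Proof. by rewrite -(scale0r (0 : X)) NZ ?normr0 ?mul0r//; exact: sV.1. Qed.

Lemma dual_subspace : subspace dual_space.
Proof.
split=> [|a F G [lF [C hC]] [lG [D hD]]].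
  split=> [a u v w _|]; first by rewrite /= mulr0 addr0.
  by exists 0 => v; rewrite mul0r normr0.
have E z : (a *: F + G) z = a * F z + G z by [].
split=> [b u v w e|]; first by rewrite !E (lF b u v w e) (lG b u v w e); ring.
exists (`|a| * C + D) => v; apply: le_trans (ler_normD _ _) _; rewrite mulrDl; apply: lerD => //.
by rewrite normrM -mulrA; apply: ler_wpM2l.
Qed.

Lemma dual_spaceI (F : X -> R) (C : R) : linear_on V F -> (forall v, V v -> `|F v| <= C * N v) ->
  dual_space (fun z => F (val z)).
Proof.
move=> lF hC; split; last by exists C => v; apply: hC; exact: set_valP.
by move=> a u v w ->; apply: lF; exact: set_valP.
Qed.

Lemma dual_norm_ge0 F : 0 <= dual_norm F.
Proof.
rewrite /dual_norm; set S := (X in sup X).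
have [hs|hs] := pselect (has_sup S); last by rewrite sup_out.
have [[x Sx] _] := hs; apply: le_trans (sup_ubound hs.2 Sx).
by case: Sx => v _ <-.
Qed.

Lemma dual_normP F z : dual_space F -> `|F z| <= dual_norm F * N (val z).
Proof.
move=> [lF [C hC]]; have Vz : V (val z) by exact: set_valP.
have z0 : V 0 := sV.1; pose o : V := SigSub (mem_set z0).
have lFZ (a : R) (v w : V) : val w = a *: val v -> F w = a * F v.
  move=> e; have F0 : F o = 0.
    have := lF (-1) o o o; rewrite /= scaler0 addr0 => /(_ erefl) h; lra.
  by rewrite (lF a v o w) ?F0 ?addr0//= addr0.
have [N0|N0] := leP (N (val z)) 0.
  apply: (@le_trans _ _ 0); last by rewrite mulr_ge0 ?dual_norm_ge0.
  have e : N (val z) = 0 by apply/eqP; rewrite eq_le N0 Nge0.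
  by have := hC z; rewrite e mulr0.
pose w : V := SigSub (mem_set (subspaceZ (N (val z))^-1 sV Vz)).
have Nw : N (val w) = 1.
  by rewrite /= NZ// gtr0_norm ?invr_gt0// mulVf// gt_eqF.
have Fw : F w = (N (val z))^-1 * F z by exact: lFZ.
have : `|F w| <= dual_norm F.
  apply: sup_ubound; last by exists w => //=; rewrite Nw.
  exists `|C| => _ [v /= Nv <-]; apply: le_trans (hC v) _.
  apply: (@le_trans _ _ (`|C| * N (val v))).
    by apply: ler_wpM2r; [exact: Nge0|exact: ler_norm].
  by rewrite ler_piMr.
by rewrite Fw normrM gtr0_norm ?invr_gt0// mulrC ler_pdivrMr.
Qed.

Lemma dual_norm_le F (C : R) : 0 <= C -> (forall z : V, `|F z| <= C * N (val z)) ->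
  dual_norm F <= C.
Proof.
move=> C0 hC; have z0 : V 0 := sV.1; pose o : V := SigSub (mem_set z0).
apply: ge_sup; first by exists `|F o|; exists o => //=; rewrite seminorm0.
move=> _ [v /= Nv <-]; apply: le_trans (hC v) _; by rewrite ler_piMr.
Qed.
End dual_space.

Lemma ae_imply d (T : measurableType d) (R : realType) (mu : {measure set T -> \bar R})
    (P Q : T -> Prop) : (forall x, P x -> Q x) -> {ae mu, forall x, P x} -> {ae mu, forall x, Q x}.
Proof. by move=> PQ [Z [mZ Z0 h]]; exists Z; split=> // x /= nQ; apply: h => /= /PQ. Qed.

(** * Variational solutions *)

Section variational.
Context (R : realType) (X : normedModType R) (ip : X -> X -> R).
Local Notation cleb := (@completed_lebesgue_measure R).
Local Notation cR := (caratheodory_type (R := R) (T := ocitv_type R) (wlength idfun)^*%mu).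
Hypothesis ipP : sym_psd_on setT ip.
Hypothesis ip_norm : forall x, `|x| ^+ 2 = ip x x.
Variables (V : set X) (a E : X -> X -> R) (N : X -> R) (T Cp M alpha gam : R).
Local Notation I := (`]0%R, T[%classic : set cR).
Local Notation HM := (@dual_space R X V N).
Local Notation HN := (@dual_norm R X V N).
Hypotheses (T0 : 0 < T) (Cp0 : 0 <= Cp) (M0 : 0 <= M) (al0 : 0 < alpha).
Hypothesis sV : subspace V.
Hypothesis aP : sym_psd_on V a.
Hypothesis ac : complete_on V (fun u => a u u).
Hypothesis Nge0 : forall u, 0 <= N u.
Hypothesis N_sqr : forall u, V u -> N u ^+ 2 = a u u.
Hypothesis PC : forall u, V u -> `|u| ^+ 2 <= Cp * a u u.
Hypothesis Eb : bilinear_on V E.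
Hypothesis EM : forall u v, V u -> V v -> E u v ^+ 2 <= M ^+ 2 * a u u * a v v.
Hypothesis Ec : forall u, V u -> alpha * a u u <= E u u + gam * ip u u.
Let mI := measurable_time_interval T.

Definition variational_solution (g : X) (u : R -> X) : Prop :=
  exists u' : R -> V -> R,
  [/\ bochner_L2 V N T u,
      bochner_L2 HM HN T u',
      is_weak_time_derivative HM HN T (fun t z => ip (u t) (val z)) u',
      forall v : V, {ae cleb, forall t : R, 0 < t < T -> u' t v + E (u t) (val v) = 0} &
      u t @[t --> 0^'+] --> g].

Let ipC u v : ip u v = ip v u. Proof. by case: ipP => _ h _; exact: h. Qed.

Let ip_linl (c : R) u v w : ip (c *: u + v) w = c * ip u w + ip v w.
Proof. by case: ipP => -[h _] _ _; exact: h. Qed.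

Let ip_linr (c : R) u v w : ip w (c *: u + v) = c * ip w u + ip w v.
Proof. by rewrite !(ipC w) ip_linl. Qed.

Let ipBl u v w : ip (u - v) w = ip u w - ip v w.
Proof. by rewrite addrC -scaleN1r ip_linl; ring. Qed.

Let ip_cs u v : `|ip u v| <= `|u| * `|v|. Proof. exact: ip_cauchy_schwarz ipP ip_norm u v. Qed.

Let NE u : V u -> N u = Num.sqrt (a u u).
Proof. by move=> Vu; rewrite -N_sqr// sqrtr_sqr ger0_norm. Qed.

Let NZ (c : R) u : V u -> N (c *: u) = `|c| * N u.
Proof.
move=> Vu; have [[al ar] _ _] := aP; have Vcu := subspaceZ c sV Vu.
rewrite !NE// (linear_onZ sV (al _ Vcu) c Vu) (linear_onZ sV (ar _ Vu) c Vu).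
by rewrite mulrA -expr2 sqrtrM ?sqr_ge0// sqrtr_sqr.
Qed.

Let Nlip u v : V u -> V v -> `|N u - N v| <= N (u - v).
Proof.
move=> Vu Vv; rewrite (NE Vu) (NE Vv) (NE (subspaceB sV Vu Vv)).
exact: form_norm_lip sV aP Vu Vv.
Qed.

Let NX u : V u -> `|u| <= Num.sqrt Cp * N u.
Proof.
move=> Vu; rewrite -ler_sqr ?nnegrE ?mulr_ge0 ?sqrtr_ge0// exprMn N_sqr// sqr_sqrtr//.
exact: PC.
Qed.

Let ip_leN u v : V v -> `|ip u v| <= Num.sqrt Cp * `|u| * N v.
Proof.
move=> Vv; apply: le_trans (ip_cs u v) _.
by rewrite (mulrC (Num.sqrt Cp)) -mulrA; apply: ler_wpM2l => //; exact: NX.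
Qed.

Let E_le u v : V u -> V v -> `|E u v| <= M * N u * N v.
Proof.
move=> Vu Vv; have h := EM Vu Vv.
rewrite -(ger0_norm (mulr_ge0 (mulr_ge0 M0 (Nge0 u)) (Nge0 v))).
by rewrite -ler_sqr ?nnegrE ?normr_ge0// !real_normK ?num_real// !exprMn !N_sqr.
Qed.

Lemma shift_bilinear (lam : R) : bilinear_on V (fun u v => E u v + lam * ip u v).
Proof.
have [El Er] := Eb; split=> w Vw k u v Vu Vv.
  by rewrite (El _ Vw k u v Vu Vv) ip_linl; ring.
by rewrite (Er _ Vw k u v Vu Vv) ip_linr; ring.
Qed.

Lemma shift_bounded (lam : R) u v : V u -> V v ->
  (E u v + lam * ip u v) ^+ 2 <= (M + `|lam| * Cp) ^+ 2 * a u u * a v v.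
Proof.
move=> Vu Vv; rewrite -!N_sqr//.
have h : `|E u v + lam * ip u v| <= (M + `|lam| * Cp) * (N u * N v).
  apply: le_trans (ler_normD _ _) _; rewrite mulrDl; apply: lerD.
    by rewrite mulrA; exact: E_le.
  rewrite normrM -[X in _ <= X]mulrA; apply: ler_wpM2l => //.
  apply: le_trans (ip_leN u Vv) _.
  apply: (@le_trans _ _ (Num.sqrt Cp * (Num.sqrt Cp * N u) * N v)).
    by apply: ler_wpM2r => //; apply: ler_wpM2l; [exact: sqrtr_ge0|exact: NX].
  by rewrite mulrA -expr2 sqr_sqrtr// mulrA.
by apply: sqr_norm_le h; rewrite mulr_ge0.
Qed.

(** Evaluation at z is a bounded functional on the dual, so the Bochner identities become real ones:
    p = (v, z) satisfies p' = -E(v, z) in the weak sense. *)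
Lemma variational_test g v z : variational_solution g v -> V z ->
  [/\ cleb.-integrable I (EFin \o (fun t : cR => ip (v t) z)),
      cleb.-integrable I (EFin \o (fun t : cR => E (v t) z)) &
      forall eta, time_test_function T eta ->
        \int[cleb]_(t in I) (derive1 eta t * ip (v t) z) =
        \int[cleb]_(t in I) (eta t * E (v t) z)].
Proof.
move=> [v' [bv bv' wd eqn _]] Vz.
have i1 : cleb.-integrable I (EFin \o ((fun x : X => ip x z) \o v : cR -> R)).
  apply: (bochner_L2_integrable T0 Nge0 Nlip (C := Num.sqrt Cp * `|z|) bv) => [x y Vx Vy|x Vx].
    rewrite -ipBl ipC; apply: ip_leN => //; exact: subspaceB.
  by rewrite ipC; exact: ip_leN.
have [El _] := Eb.
have i2 : cleb.-integrable I (EFin \o ((fun x : X => E x z) \o v : cR -> R)).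
  apply: (bochner_L2_integrable T0 Nge0 Nlip (C := M * N z) bv) => [x y Vx Vy|x Vx].
    rewrite -(linear_onB sV (El _ Vz) Vx Vy) mulrAC; apply: E_le => //; exact: subspaceB.
  by rewrite mulrAC; exact: E_le.
split=> // eta teta; have [y [b1 b2]] := wd eta teta.
pose zz : V := SigSub (mem_set Vz).
have ev_lin : linear_on HM (fun F => F zz) by move=> k F G _ _.
have C1 : 0 < N z + 1 by rewrite ltr_wpDl.
have ev_le F : HM F -> `|F zz| <= (N z + 1) * HN F.
  move=> HF; apply: le_trans (dual_normP sV Nge0 NZ zz HF) _.
  by rewrite mulrC /=; apply: ler_wpM2r; [exact: dual_norm_ge0|rewrite lerDl].
have sH := @dual_subspace R X V N.
have [j1 e1] := bochner_integral_functional T0 sH (@dual_norm_ge0 R X V N) b1 ev_lin C1 ev_le.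
have [j2 e2] := bochner_integral_functional T0 sH (@dual_norm_ge0 R X V N) b2 ev_lin C1 ev_le.
have [deta _ _] := teta.
have ceta : continuous eta.
  by move=> t; apply/differentiable_continuous/derivable1_diffP; exact: (deta 0%N t).
have meE : measurable_fun I (fun t : cR => eta t * E (v t) z).
  apply: measurable_funM; first exact: continuous_measurable_time.
  by apply/measurable_EFinP; exact: measurable_int i2.
have h2 : \int[cleb]_(t in I) (derive1 eta t * ip (v t) z) = - y zz.
  rewrite -[RHS]/((- y) zz) e2; apply: eq_Rintegral => t _.
  by rewrite /GRing.scale.
have mv : measurable_fun I (fun t : cR => -1 * (eta t *: v' t) zz).
  apply: measurable_funM; first exact: measurable_cst.
  by apply/measurable_EFinP; exact: measurable_int j1.
rewrite h2 e1; transitivity (\int[cleb]_(t in I) (-1 * (eta t *: v' t) zz)).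
  by rewrite (RintegralZl (-1) mI j1) mulN1r.
apply: (ae_eq_Rintegral_restr mI mv meE).
apply: time_ae (eqn zz) => t tT /eqP; rewrite addrC addr_eq0 => /eqP -> /=.
by rewrite -[(eta t *: v' t) zz]/(eta t * v' t zz); ring.
Qed.

Lemma variational_near0 g v1 v2 (r : R) : variational_solution g v1 ->
  variational_solution g v2 -> 0 < r -> exists2 dl, 0 < dl &
  forall t, 0 < t -> t < dl -> `|v1 t - v2 t| <= r.
Proof.
move=> [_ [_ _ _ _ c1]] [_ [_ _ _ _ c2]] r0.
have c12 : v1 t - v2 t @[t --> 0^'+] --> (0 : X) by rewrite -(subrr g); exact: cvgB c1 c2.
have /cvgrPdist_le/(_ _ r0) := c12.
rewrite /at_right near_withinE => -[dl /= dl0 h]; exists dl => // t t0 tdl.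
have := h t; rewrite sub0r normrN; apply => //.
by rewrite /ball/= sub0r normrN gtr0_norm.
Qed.

(** Lax-Milgram with the arguments of E exchanged. The condition gam + 1 <= lam leaves at least
    |z|^2 after coercivity, whence a bound on z that does not depend on lam. *)
Lemma adjoint_resolvent (lam : R) (phi : X) : gam + 1 <= lam ->
  exists z, [/\ V z, `|z| <= `|phi| & forall w, V w -> E w z + lam * ip w z = ip w phi].
Proof.
move=> gl; pose B u v := E v u + lam * ip v u.
have Bb : bilinear_on V B by have [Bl Br] := shift_bilinear lam; split.
have BM u v : V u -> V v -> B u v ^+ 2 <= (M + `|lam| * Cp) ^+ 2 * a u u * a v v.
  by move=> Vu Vv; rewrite mulrAC; exact: shift_bounded.
have Bc u : V u -> alpha * a u u <= B u u.
  move=> Vu; apply: le_trans (Ec Vu) _; rewrite lerD2l ler_wpM2r//.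
    by rewrite -ip_norm sqr_ge0.
  by apply: le_trans gl; rewrite lerDl.
have Fb v : V v -> ip phi v ^+ 2 <= (Cp * `|phi| ^+ 2) * a v v.
  move=> Vv; rewrite -N_sqr// -[Cp]sqr_sqrtr// -exprMn -exprMn.
  rewrite -[X in X ^+ 2 <= _]/(ip phi v) -[ip phi v ^+ 2]real_normK ?num_real//.
  rewrite ler_sqr ?nnegrE ?mulr_ge0 ?sqrtr_ge0//; exact: ip_leN.
have Fl : linear_on V (ip phi) by move=> k u v _ _; exact: ip_linr.
have [z Vz zP] := lax_milgram sV aP ac Bb (sqr_ge0 _) BM al0 Bc Fl Fb.
exists z; split=> // [|w Vw]; last by rewrite -[LHS]/(B z w) zP// ipC.
have h1 := zP z Vz; have h2 := Ec Vz.
have h3 : `|z| ^+ 2 <= `|phi| * `|z|.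
  apply: (@le_trans _ _ (ip phi z)); last first.
    by apply: le_trans (ler_norm _) _; exact: ip_cs.
  rewrite -h1 /B ip_norm; have a0 : 0 <= a z z by case: aP => _ _; exact.
  have l0 : 0 <= ip z z by rewrite -ip_norm sqr_ge0.
  have := mulr_ge0 (ltW al0) a0.
  have : (gam + 1) * ip z z <= lam * ip z z by exact: ler_wpM2r.
  by move: h2; move: (a z z) (E z z) (ip z z) => x y w; lra.
have [z0|z0] := leP `|z| 0; first exact: le_trans z0 (normr_ge0 _).
by move: h3; rewrite expr2 ler_pM2r.
Qed.

(** At lam = m, with z the adjoint resolvent of phi, e + m p = (v1 - v2, phi). Since |z| <= |phi|
    for every m, [laplace_decay] bounds the Laplace transform of the cut-off product with one
    constant for all m. *)
Lemma variational_orthogonal g v1 v2 (phi : X) : variational_solution g v1 ->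
  variational_solution g v2 ->
  {ae cleb, forall t : R, 0 < t < T -> ip (v1 t - v2 t) phi = 0}.
Proof.
move=> w1 w2.
have bv1 : bochner_L2 V N T v1 by have [? []] := w1.
have bv2 : bochner_L2 V N T v2 by have [? []] := w2.
have [[s1 [_ V1]] _] := bv1; have [[s2 [_ V2]] _] := bv2.
have nlip (x y : X) : V x -> V y -> `| `|x| - `|y| | <= Num.sqrt Cp * N (x - y).
  by move=> Vx Vy; apply: le_trans (ler_dist_dist _ _) _; apply: NX; exact: subspaceB.
have nle (x : X) : V x -> `| `|x| | <= Num.sqrt Cp * N x by move=> Vx; rewrite normr_id; exact: NX.
have in1 := bochner_L2_integrable T0 Nge0 Nlip bv1 nlip nle.
have in2 := bochner_L2_integrable T0 Nge0 Nlip bv2 nlip nle.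
have in12 := integrableD_fun mI in1 in2.
pose P := \int[cleb]_(t in I) (`|v1 t| + `|v2 t|).
have P0 : 0 <= P by apply: Rintegral_ge0 => t _; rewrite addr_ge0.
suff sub tau1 : 0 < tau1 -> tau1 < T ->
    {ae cleb, forall t : R, 0 < t < tau1 -> ip (v1 t - v2 t) phi = 0}.
  (* Exhaustion of []0, T[] by shorter intervals, which leaves room for the cut-off before T. *)
  pose tk (k : nat) : R := T - T * k.+2%:R^-1.
  have tk0 k : 0 < tk k.
    by rewrite subr_gt0 gtr_pMr// invf_lt1// ltr1n.
  have tkT k : tk k < T by rewrite gtrBl mulr_gt0.
  have := ae_foralln (fun k => sub _ (tk0 k) (tkT k)).
  apply: ae_imply => t h /andP[t0 tT].
  have d0 : 0 < (T - t) / T by rewrite divr_gt0// subr_gt0.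
  have [k _ /(_ k (leqnn k)) /= kd] := near_infty_natSinv_lt (PosNum d0).
  apply: (h k); rewrite t0 /tk ltrBrDr -ltrBrDl mulrC -ltr_pdivlMr//.
  by apply: le_lt_trans kd; rewrite lef_pV2 ?posrE// ler_nat.
move=> tau10 tau1T.
(* tau1 < tau < b < T: the conclusion is drawn before tau1, the decay rate is tau, and the cut-off
   falls to 0 between tau and b. *)
pose tau := (tau1 + T) / 2; pose b := (tau + T) / 2.
have [tt tauT] := midf_lt tau1T; have [tb bT] := midf_lt tauT.
have tau0 := lt_trans tau10 tt.
have [D decay] := laplace_decay T0 tau0 tb bT.
pose F (t : cR) := cutoff tau b t * ip (v1 t - v2 t) phi.
have iip (x : X) : cleb.-integrable I (EFin \o (fun t : cR => ip (v1 t - v2 t) x)).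
  have il v : bochner_L2 V N T v ->
      cleb.-integrable I (EFin \o ((fun y : X => ip y x) \o v : cR -> R)).
    move=> bv; apply: (bochner_L2_integrable T0 Nge0 Nlip (C := Num.sqrt Cp * `|x|) bv) => [y y' Vy Vy'|y Vy].
      rewrite -ipBl ipC; apply: ip_leN => //; exact: subspaceB.
    by rewrite ipC; exact: ip_leN.
  have := integrableB_fun mI (il _ bv1) (il _ bv2).
  by apply: eq_integrable => // t _ /=; rewrite ipBl.
have iF : cleb.-integrable I (EFin \o F).
  exact (time_smooth_integrableM T0 (cutoff_smooth tau b) (iip phi)).
pose m0 := (Num.truncn (`|gam| + 1)).+1.
have FD m : (m0 <= m)%N -> `|\int[cleb]_(t in I) (expR (- (m%:R * t)) * F t)| <=
    `|D| * (`|phi| * P) * expR (- (m%:R * tau)).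
  move=> m0m; have gm : gam + 1 <= m%:R.
    apply: (@le_trans _ _ m0%:R); last by rewrite ler_nat.
    apply: (@le_trans _ _ (`|gam| + 1)); first by rewrite lerD2r ler_norm.
    exact/ltW/truncnS_gt.
  have [z [Vz zphi zP]] := adjoint_resolvent phi gm.
  have [i1 j1 e1] := variational_test w1 Vz; have [i2 j2 e2] := variational_test w2 Vz.
  pose p (t : cR) := ip (v1 t) z - ip (v2 t) z; pose e (t : cR) := E (v1 t) z - E (v2 t) z.
  have ipp := integrableB_fun mI i1 i2; have ie := integrableB_fun mI j1 j2.
  have W eta : time_test_function T eta ->
      \int[cleb]_(t in I) (derive1 eta t * p t) = \int[cleb]_(t in I) (eta t * e t).
    move=> teta; have [deta _ _] := teta.
    have bnd (f : R -> R) : continuous f -> exists C : R, forall t, I t -> `|f t| <= C.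
      move=> cf; have [C [_ fC]] := continuous_bounded_itv (ltW T0) cf; exists C => t.
      by move=> /time_itvP/andP[t0 tT]; apply: fC; rewrite !ltW.
    have cont k : continuous (derive1n k eta).
      by move=> t; apply/differentiable_continuous/derivable1_diffP; exact: deta.
    have int (f : R -> R) (q : cR -> R) : continuous f -> cleb.-integrable I (EFin \o q) ->
        cleb.-integrable I (EFin \o (fun t => f t * q t)).
      move=> cf iq; have [C fC] := bnd f cf.
      exact: (integrableM_bounded mI (continuous_measurable_time cf) fC iq).1.
    have h1 := RintegralB mI (int _ _ (cont 1%N) i1) (int _ _ (cont 1%N) i2).
    have h2 := RintegralB mI (int _ _ (cont 0%N) j1) (int _ _ (cont 0%N) j2).
    transitivity (\int[cleb]_(t in I) (derive1 eta t * ip (v1 t) z - derive1 eta t * ip (v2 t) z)).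
      by apply: eq_Rintegral => t _; rewrite /p mulrBr.
    rewrite [LHS]h1; transitivity (\int[cleb]_(t in I) (eta t * E (v1 t) z - eta t * E (v2 t) z)).
      by rewrite [RHS]h2; congr (_ - _); [exact: e1|exact: e2].
    by apply: eq_Rintegral => t _; rewrite /e mulrBr.
  have p0 r : 0 < r -> exists2 dl, 0 < dl & forall t, 0 < t < T -> t < dl -> `|p t| <= r.
    move=> r0; have r1 : 0 < r / (`|z| + 1) by rewrite divr_gt0// ltr_wpDl.
    have [dl dl0 h] := variational_near0 w1 w2 r1; exists dl => // t /andP[t0 _] tdl.
    rewrite /p -ipBl.
    apply: le_trans (ip_cs _ _) _.
    apply: (@le_trans _ _ (r / (`|z| + 1) * (`|z| + 1))); last by rewrite divfK// gt_eqF// ltr_wpDl.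
    by apply: ler_pM => //; [exact: h|rewrite lerDl].
  have h := decay m%:R p e (ler0n _ _) ipp ie W p0.
  have hE : \int[cleb]_(t in I) (expR (- (m%:R * t)) * F t) =
      \int[cleb]_(t in I) (expR (- m%:R * t) * (cutoff tau b t * (e t + m%:R * p t))).
    have mE : measurable_fun I (fun t : cR => expR (- m%:R * t)).
      apply: continuous_measurable_time; apply: time_smooth_continuous.
      by apply: time_smooth_expR; apply: time_smoothM; [exact: time_smooth_cst|exact: time_smooth_id].
    have mcut : measurable_fun I (cutoff tau b : cR -> R).
      by apply: continuous_measurable_time; apply: time_smooth_continuous; exact: cutoff_smooth.
    have mF : measurable_fun I F by apply/measurable_EFinP; exact: measurable_int iF.
    have mp : measurable_fun I p by apply/measurable_EFinP; exact: measurable_int ipp.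
    have me : measurable_fun I e by apply/measurable_EFinP; exact: measurable_int ie.
    transitivity (\int[cleb]_(t in I) (expR (- m%:R * t) * F t)).
      by apply: eq_Rintegral => t _; rewrite mulNr.
    apply: (ae_eq_Rintegral_restr mI).
    - exact: measurable_funM.
    - have mlp := measurable_funM (measurable_cst (m%:R : R)) mp.
      exact: (measurable_funM mE (measurable_funM mcut (measurable_funD me mlp))).
    have V1' : {ae cleb, forall t : cR, I t -> V (v1 t)} by apply: time_ae V1 => t _ [].
    have V2' : {ae cleb, forall t : cR, I t -> V (v2 t)} by apply: time_ae V2 => t _ [].
    apply: ae_sub2 V1' V2' => t It Vv1 Vv2; rewrite /F; congr (_ * (_ * _)).
    rewrite ipBl -(zP _ Vv1) -(zP _ Vv2) /e /p; ring.
  rewrite hE; apply: le_trans h _.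
  have pP : \int[cleb]_(t in I) `|p t| <= `|phi| * P.
    rewrite -(RintegralZl _ mI in12); apply: le_Rintegral => //; first exact: integrable_norm ipp.
      exact: integrableZ_fun.
    move=> t _ /=; rewrite /p -ipBl.
    apply: le_trans (ip_cs _ _) _.
    by rewrite mulrC; apply: ler_pM => //; exact: ler_normB.
  have e0 : 0 <= expR (- m%:R * tau) := expR_ge0 _.
  have q0 : 0 <= \int[cleb]_(t in I) `|p t| by apply: Rintegral_ge0.
  apply: (@le_trans _ _ (`|D| * expR (- m%:R * tau) * \int[cleb]_(t in I) `|p t|)).
    by apply: ler_wpM2r => //; apply: ler_wpM2r => //; exact: ler_norm.
  by rewrite -mulNr [leRHS]mulrAC; apply: ler_wpM2l => //; exact: mulr_ge0.
have C0 : 0 <= `|D| * (`|phi| * P) by rewrite !mulr_ge0.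
have := laplace_ae0 iF C0 FD tau10 tt tau1T.
apply: ae_imply => t h tt1; have := h tt1; rewrite /F cutoff_left; last first.
  by have /andP[_ t1] := tt1; exact: ltW (lt_trans t1 tt).
by move=> /eqP; rewrite mulf_eq0 gt_eqF ?expR_gt0//= => /eqP.
Qed.

(** The null set attached to phi depends on phi. A simple function takes finitely many values, so
    one null set serves them all. *)
Lemma ae_simple_orthogonal (w s : R -> X) : simple_function V s ->
  (forall phi, {ae cleb, forall t : R, 0 < t < T -> ip (w t) phi = 0}) ->
  {ae cleb, forall t : R, 0 < t < T -> ip (w t) (s t) = 0}.
Proof.
move=> [fs _ _] w0; pose r : seq X := finmap.enum_fset (fset_set (range s)).
have := ae_foralln (fun k => w0 (nth 0 r k)); apply: ae_imply => t h tT.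
have tr : s t \in r by rewrite /r in_fset_set//; apply/mem_set; exists t.
by have := h (index (s t) r) tT; rewrite nth_index.
Qed.

(** v1 and v2 are themselves a.e. limits of simple functions; hence w = v1 - v2 is orthogonal to
    v1(t) and to v2(t) off one null set, and |w|^2 = 0 there. *)
Theorem variational_solution_unique g v1 v2 : variational_solution g v1 ->
  variational_solution g v2 -> {ae cleb, forall t : R, 0 < t < T -> v1 t = v2 t}.
Proof.
move=> w1 w2; have w0 phi := variational_orthogonal phi w1 w2.
have [_ [[[s1 [ss1 V1]] _] _ _ _ _]] := w1; have [_ [[[s2 [ss2 V2]] _] _ _ _ _]] := w2.
have h1 := ae_foralln (fun k => ae_simple_orthogonal (ss1 k) w0).
have h2 := ae_foralln (fun k => ae_simple_orthogonal (ss2 k) w0).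
have lim (v : R -> X) (s : nat -> R -> X) t : (forall k, simple_function V (s k)) -> V (v t) ->
    N (s k t - v t) @[k --> \oo] --> (0 : R) -> (forall k, ip (v1 t - v2 t) (s k t) = 0) ->
    ip (v1 t - v2 t) (v t) = 0.
  move=> ss Vv cs s0; set w := v1 t - v2 t.
  apply/eqP; rewrite -normr_le0; apply/ler_addgt0Pl => e e0; rewrite addr0.
  pose C := Num.sqrt Cp * `|w| + 1; have C0 : 0 < C by rewrite ltr_wpDl// mulr_ge0// sqrtr_ge0.
  have /cvgrPdist_le/(_ _ (divr_gt0 e0 C0)) [k _ /(_ k (leqnn k))] := cs.
  rewrite sub0r normrN (ger0_norm (Nge0 _)) => hk.
  have Vs : V (s k t) by have [_ Xs _] := ss k; apply: Xs; exists t.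
  have Vd := subspaceB sV Vs Vv.
  have -> : ip w (v t) = - ip w (s k t - v t).
    by rewrite ipC [in RHS]ipC ipBl (ipC (s k t)) s0; ring.
  rewrite normrN; apply: le_trans (ip_leN w Vd) _.
  apply: (@le_trans _ _ (C * N (s k t - v t))); first by rewrite ler_wpM2r// /C lerDl.
  by rewrite mulrC -ler_pdivlMr.
have W1 := time_ae (fun t _ h => h) V1; have W2 := time_ae (fun t _ h => h) V2.
have O1 : {ae cleb, forall t : cR, I t -> forall k, ip (v1 t - v2 t) (s1 k t) = 0}.
  by move: h1; apply: ae_imply => t h /time_itvP tT k; exact: h.
have O2 : {ae cleb, forall t : cR, I t -> forall k, ip (v1 t - v2 t) (s2 k t) = 0}.
  by move: h2; apply: ae_imply => t h /time_itvP tT k; exact: h.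
have F1 : {ae cleb, forall t : cR, I t -> ip (v1 t - v2 t) (v1 t) = 0}.
  by apply: ae_sub2 W1 O1 => t _ [Vv cs] o; exact: lim ss1 Vv cs o.
have F2 : {ae cleb, forall t : cR, I t -> ip (v1 t - v2 t) (v2 t) = 0}.
  by apply: ae_sub2 W2 O2 => t _ [Vv cs] o; exact: lim ss2 Vv cs o.
have F : {ae cleb, forall t : cR, I t -> v1 t = v2 t}.
  apply: ae_sub2 F1 F2 => t _ e1 e2.
  apply/eqP; rewrite -subr_eq0 -normr_eq0 -sqrf_eq0 ip_norm; apply/eqP.
  by rewrite ipBl (ipC (v1 t) (_ - _)) (ipC (v2 t) (_ - _)) e1 e2 subrr.
by move: F; apply: ae_imply => t h tT; apply: h; apply/time_itvP.
Qed.

Let HMs : subspace HM := @dual_subspace R X V N.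
Let HN0 := @dual_norm_ge0 R X V N.

Let HN_sub F G : HM F -> HM G -> HN (F - G) <= HN F + HN G.
Proof.
move=> hF hG; apply: (dual_norm_le sV NZ); first by rewrite addr_ge0.
move=> z; rewrite mulrDl; apply: le_trans (ler_normB (F z) (G z)) _.
by apply: lerD; [exact: (dual_normP sV Nge0 NZ z hF)|exact: (dual_normP sV Nge0 NZ z hG)].
Qed.

(** * Bochner integrals of compactly supported functions in the dual *)

Section dual_bochner.
Variables (f : R -> V -> R) (S : set R).
Hypotheses (Sc : compact S) (ST : S `<=` `]0, T[).
Hypothesis fin : forall t, 0 < t -> HM (f t).
Hypothesis f0 : forall t, ~ S t -> f t = 0.
Hypothesis fc : forall t e : R, S t -> 0 < e -> exists2 d, 0 < d &
  forall r, 0 < r -> `|r - t| < d -> HN (f r - f t) < e.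

Let S_gt0 t : S t -> 0 < t. Proof. by move=> /ST /=; rewrite in_itv/= => /andP[]. Qed.

Let HN_sym F G : HN (F - G) = HN (G - F).
Proof.
rewrite /dual_norm; congr sup; apply/seteqP; split=> _ [v Nv <-]; exists v => //.
  exact: (distrC (G v) (F v)).
exact: (distrC (F v) (G v)).
Qed.

(** Compactness of S turns continuity at its points into a common radius. If either time lies in S
    that radius applies, and if neither does, both values are 0. *)
Let uniform (e : R) : 0 < e -> exists2 d, 0 < d &
  forall r t, 0 < r -> 0 < t -> `|r - t| < d -> HN (f r - f t) < e.
Proof.
move=> e0; pose P (d t : R) := forall r, 0 < r -> `|r - t| < d -> HN (f r - f t) < e.
have : \forall d \near (0 : R)^'+, S `<=` P d.
  apply: (compact_near_coveringP _).1 => // x Sx.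
  have x0 := S_gt0 Sx; have e2 : 0 < e / 2 by rewrite divr_gt0.
  have [dl dl0 h] := fc Sx e2.
  pose k := Num.min (dl / 2) x; have k0 : 0 < k by rewrite lt_min x0 divr_gt0.
  near=> y d; have yk : `|y - x| < k.
    by near: y; apply/nbhs_ballP; exists k => //= y; rewrite /ball/= distrC.
  have [yk1 yk2] : `|y - x| < dl / 2 /\ `|y - x| < x by apply/andP; rewrite -lt_min.
  have dd : d < dl / 2 by near: d; apply: nbhs_right_lt; rewrite divr_gt0.
  have y0 : 0 < y by move: yk2; rewrite ltr_norml => /andP[]; lra.
  move=> r r0 ry; have rx : `|r - x| < dl.
    rewrite (splitr dl); apply: le_lt_trans (ler_distD y _ _) _.
    by rewrite ltrD// (lt_trans ry).
  have yx : `|y - x| < dl by apply: lt_le_trans yk1 _; lra.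
  have -> : f r - f y = (f r - f x) - (f y - f x).
    by rewrite opprB addrA subrK.
  apply: le_lt_trans (HN_sub _ _) _; try by apply: subspaceB => //; exact: fin.
  by rewrite [ltRHS](splitr e) ltrD// h.
rewrite /at_right near_withinE => /nbhs_ballP[d0 /= d00 h].
have d2 : 0 < d0 / 2 by rewrite divr_gt0.
have Pd : S `<=` P (d0 / 2).
  by apply: h => //; rewrite /ball/= sub0r normrN gtr0_norm//; lra.
exists (d0 / 2) => // r t r0 t0 rt.
have [St|nS] := pselect (S t); first exact: (Pd t St).
have [Sr|nR] := pselect (S r); first by rewrite HN_sym; apply: (Pd r Sr); rewrite // distrC.
rewrite !f0// subrr; apply: le_lt_trans e0; apply: (dual_norm_le sV NZ) => // z.
by rewrite normr0 mul0r.
Unshelve. all: by end_near. Qed.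

Let eval_continuous z : continuous (fun t => f t z).
Proof.
move=> t; have [St|nS] := pselect (S t).
  have t0 := S_gt0 St; apply/cvgrPdist_lt => e e0.
  have d0 : 0 < e / (N (val z) + 1) by rewrite divr_gt0// ltr_wpDl.
  have [dl dl0 h] := fc St d0; near=> r.
  have r0 : 0 < r by near: r; exact: lt_nbhsr.
  have rt : `|r - t| < dl.
    by near: r; apply/nbhs_ballP; exists dl => //= r; rewrite /ball/= distrC.
  have := h r r0 rt; rewrite ltr_pdivlMr ?ltr_wpDl// distrC; apply: le_lt_trans.
  apply: le_trans (dual_normP sV Nge0 NZ z (subspaceB HMs (fin r0) (fin t0))) _.
  by apply: ler_wpM2l; [exact: HN0|rewrite lerDl].
have near_nS : \forall r \near t, ~ S r.
  apply: open_nbhs_nbhs; split=> //; apply: closed_openC; exact: compact_closed.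
by rewrite /continuous_at f0//; apply: cvg_near_cst; near=> r; rewrite f0//; near: r.
Unshelve. all: by end_near. Qed.

Lemma dual_eval_integrable z : cleb.-integrable I (EFin \o (fun t : cR => f t z)).
Proof. exact: (continuous_integrable_time T0 (@eval_continuous z)). Qed.

Let if_ := dual_eval_integrable.

Let simple_near (s : R -> V -> R) (e : R) z : simple_function HM s -> 0 <= e ->
  (forall t, 0 < t < T -> HN (s t - f t) <= e) ->
  `|simple_integral T s z - \int[cleb]_(t in I) f t z| <= T * e * N (val z).
Proof.
move=> ss e0 sf; have ev_lin : linear_on HM (fun F => F z) by move=> k F G _ _.
have [_ is_ ->] := simple_integral_linear T0 HMs ss ev_lin.
have id_ := integrableB_fun mI is_ (if_ z).
rewrite -(RintegralB mI is_ (if_ z)); apply: le_trans (le_normr_Rintegral mI id_) _.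
have icst := integrable_cst_time (e * N (val z)) T0.
have -> : T * e * N (val z) = \int[cleb]_(t in I) (e * N (val z)).
  transitivity (e * N (val z) * fine (cleb I)); last by rewrite Rintegral_cst.
  by rewrite time_interval_length//=; ring.
apply: le_Rintegral => //; first exact: integrable_norm id_.
move=> t /time_itvP tT /=; have /andP[t0 _] := tT.
have Xs : HM (s t) by have [_ h _] := ss; apply: h; exists t.
apply: le_trans (dual_normP sV Nge0 NZ z (subspaceB HMs Xs (fin t0))) _.
by apply: ler_wpM2r => //; exact: sf.
Qed.

(** The integral is computed pointwise in z. It is a bounded functional because it stays within T
    times the seminorm from the integral of one grid function. *)
Lemma dual_bochner_integral :
  is_bochner_integral HM HN T f (fun z => \int[cleb]_(t in I) f t z).
Proof.
apply: (bochner_integral_continuous T0 HMs HN0 fin _ uniform).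
  have [n0 h] := grid_uniform T uniform ltr01.
  have gs := grid_simple T HMs n0 fin; have hn t := h n0 t (leqnn _).
  split=> [b u v w e|].
    transitivity (\int[cleb]_(t in I) (b * f t u + f t v)).
      apply: eq_Rintegral => t /set_mem/time_itvP/andP[t0 _].
      by have [l _] := fin t0; exact: l.
    have iu := integrableZ_fun mI b (if_ u).
    by rewrite (RintegralD mI iu (if_ v)) (RintegralZl b mI (if_ u)).
  have [Xs _ _] := simple_integral_linear T0 HMs gs (l := fun=> 0) (fun k F G _ _ => esym (etrans (congr1 (fun x => x + 0) (mulr0 k)) (addr0 0))).
  exists (HN (simple_integral T (grid T f n0)) + T) => v; rewrite mulrDl.
  have h1 := simple_near v gs ler01 hn; have h2 := dual_normP sV Nge0 NZ v Xs.
  rewrite mulr1 in h1; apply: (@le_trans _ _ (`|simple_integral T (grid T f n0) v| +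
    `|simple_integral T (grid T f n0) v - \int[cleb]_(t in I) f t v|)); last exact: lerD.
  by rewrite -{1}[\int[cleb]_(t in I) f t v](subKr (simple_integral T (grid T f n0) v)) ler_normB.
move=> s e ss e0 sf; apply: (dual_norm_le sV NZ); first by rewrite mulr_ge0// ltW.
by move=> z; exact: simple_near z ss (ltW e0) sf.
Qed.
End dual_bochner.

(** * Existence and the energy estimate for a smooth solution *)

Section existence.
Variables (g : X) (u : R -> X).
Hypothesis u_smooth : smooth_on_pos u.
Hypothesis u_eq : forall t v, 0 < t -> V v -> V (u t) /\ E (u t) v = - ip (derive1 u t) v.
Hypothesis u_g : u t @[t --> 0^'+] --> g.
Hypothesis u_bd : forall t, 0 < t -> `|u t| <= expR (gam * t) * `|g|.
Hypothesis gam0 : 0 <= gam.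

Let du := derive1 u.
Let uV t : 0 < t -> V (u t). Proof. by move=> t0; have [] := u_eq t0 sV.1. Qed.

Let uE t v : 0 < t -> V v -> E (u t) v = - ip (du t) v.
Proof. by move=> t0 Vv; have [] := u_eq t0 Vv. Qed.

Let u_cont t : 0 < t -> {for t, continuous u}. Proof. by move=> t0; have [_] := u_smooth 0 t0. Qed.
Let du_cont t : 0 < t -> {for t, continuous du}. Proof. by move=> t0; have [_] := u_smooth 1 t0. Qed.

Let u_der (t : R) : 0 < t -> is_derive t 1 u (du t).
Proof. by move=> t0; rewrite /du derive1E; apply: derivableP; have [] := u_smooth 0 t0. Qed.

Let continuous_dist (Y : normedModType R) (f : R -> Y) (t e : R) : {for t, continuous f} -> 0 < e ->
  exists2 d, 0 < d & forall r, `|r - t| < d -> `|f r - f t| < e.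
Proof.
move=> /cvgrPdist_lt/(_ e) /[apply] /nbhs_ballP[d /= d0 h]; exists d => // r rt.
by rewrite distrC; apply: h; rewrite /ball/= distrC.
Qed.

(** Continuity in the energy norm follows from the equation: for w = u r - u t, coercivity bounds
    alpha N(w)^2 by E(w, w) + gam |w|^2, and E(w, w) = -(u'(r) - u'(t), w) is small by continuity of
    u and u' in X. *)
Let N_cont (t e : R) : 0 < t -> 0 < e ->
  exists2 d, 0 < d & forall r, 0 < r -> `|r - t| < d -> N (u r - u t) < e.
Proof.
move=> t0 e0; pose k := Num.min 1 (alpha * e ^+ 2 / (1 + gam) / 2).
have g1 : 0 < 1 + gam by rewrite ltr_pwDl.
have k0 : 0 < k by rewrite lt_min ltr01 !divr_gt0// mulr_gt0// exprn_gt0.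
have [d1 d10 h1] := continuous_dist (u_cont t0) k0.
have [d2 d20 h2] := continuous_dist (du_cont t0) ltr01.
exists (Num.min d1 d2) => [|r r0]; first by rewrite lt_min d10.
rewrite lt_min => /andP[/h1 w1 /h2 w2].
set w := u r - u t in w1 *; have Vw : V w by apply: subspaceB => //; exact: uV.
have [El _] := Eb.
have Eww : E w w = - ip (du r - du t) w.
  by rewrite (linear_onB sV (El _ Vw) (uV r0) (uV t0)) !uE// ipBl; ring.
have b1 : - ip (du r - du t) w <= k.
  apply: le_trans (ler_norm _) _; rewrite normrN; apply: le_trans (ip_cs _ _) _.
  by rewrite -[leRHS]mul1r; apply: ler_pM => //; exact: ltW.
have b2 : ip w w <= k.
  rewrite -ip_norm; have kl : k <= 1 by rewrite ge_min lexx.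
  apply: (@le_trans _ _ (k * 1)); last by rewrite mulr1.
  by rewrite expr2; apply: ler_pM => //; [exact: ltW|exact: le_trans (ltW w1) kl].
have b3 := Ec Vw; rewrite Eww -N_sqr// in b3.
have b4 : alpha * N w ^+ 2 <= k * (1 + gam).
  apply: le_trans b3 _; rewrite mulrDr mulr1; apply: lerD => //.
  by rewrite mulrC; apply: ler_wpM2r.
have b5 : k * (1 + gam) < alpha * e ^+ 2.
  apply: (@le_lt_trans _ _ (alpha * e ^+ 2 / 2)).
    by rewrite -ler_pdivlMr// /k ge_min; apply/orP; right; rewrite mulrAC.
  have h0 : 0 < alpha * e ^+ 2 by rewrite mulr_gt0// exprn_gt0.
  by rewrite ltr_pdivrMr//; lra.
have := le_lt_trans b4 b5; rewrite ltr_pM2l// => h.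
by rewrite -ltr_sqr ?nnegrE// ltW.
Qed.

Let u' (t : R) (z : V) : R := - E (u t) (val z).

Let u'_in t : 0 < t -> HM (u' t).
Proof.
move=> t0; have [_ Er] := Eb; have Vu := uV t0.
apply: (@dual_spaceI R X V N (fun v => - E (u t) v) (M * N (u t))).
  by move=> k v w Vv Vw; rewrite (Er _ Vu k v w Vv Vw); ring.
by move=> v Vv; rewrite normrN; exact: E_le.
Qed.

Let u'_dist (k l r t : R) : 0 < r -> 0 < t ->
  HN (k *: u' r - l *: u' t) <= `|k - l| * (M * N (u t)) + `|k| * (M * N (u r - u t)).
Proof.
move=> r0 t0; have [El _] := Eb; have Vr := uV r0; have Vt := uV t0.
apply: (dual_norm_le sV NZ); first by rewrite addr_ge0// mulr_ge0// mulr_ge0.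
move=> z; have Vz : V (val z) by exact: set_valP.
have -> : (k *: u' r - l *: u' t) z =
    - ((k - l) * E (u t) (val z)) - k * E (u r - u t) (val z).
  rewrite (linear_onB sV (El _ Vz) Vr Vt) -[LHS]/(k * (- E (u r) (val z)) - l * (- E (u t) (val z))).
  ring.
apply: le_trans (ler_normB _ _) _; rewrite normrN !normrM mulrDl -!mulrA.
apply: lerD; apply: ler_wpM2l => //; rewrite mulrA; apply: E_le => //.
exact: subspaceB.
Qed.

Let lin_small (p q e : R) : 0 <= p -> 0 <= q -> 0 < e -> exists2 d, 0 < d &
  forall x y, 0 <= x -> 0 <= y -> x < d -> y < d -> x * p + (q + x) * y < e.
Proof.
move=> p0 q0 e0; pose s := p + q + 1; have s0 : 0 < s by rewrite ltr_wpDl// addr_ge0.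
exists (Num.min 1 (e / s / 2)); first by rewrite lt_min ltr01 !divr_gt0.
move=> x y x0 y0; rewrite !lt_min => /andP[x1 xe] /andP[y1 ye].
apply: (@le_lt_trans _ _ (e / s / 2 * s)); last first.
  by rewrite mulrAC divfK ?gt_eqF//; lra.
have h1 := ler_wpM2r p0 (ltW xe).
have h2 : (q + x) * y <= (q + 1) * (e / s / 2).
  by apply: ler_pM => //; [exact: addr_ge0|rewrite lerD2l ltW|exact: ltW].
by move: h1 h2; rewrite /s; move: (e / _ / 2) => w; lra.
Qed.

Let u_bochner_meas : strongly_measurable V N T u.
Proof.
by apply: strongly_measurable_continuous => // t e t0 e0; exact: N_cont.
Qed.

Let u'_bochner_meas : strongly_measurable HM HN T u'.
Proof.
apply: strongly_measurable_continuous => // t e t0 e0.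
have M1 : 0 < M + 1 by rewrite ltr_wpDl.
have [d d0 h] := N_cont t0 (divr_gt0 e0 M1); exists d => // r r0 rt.
have := u'_dist 1 1 r0 t0; rewrite !scale1r subrr normr0 mul0r add0r normr1 mul1r.
move=> /le_lt_trans; apply; have := h r r0 rt; rewrite ltr_pdivlMr//; apply: le_lt_trans.
by rewrite mulrC; apply: ler_wpM2l => //; rewrite lerDl.
Qed.

Let weight (t : R) : R := expR (- 2 * gam * t).
(** Minus the derivative of exp(-2 gam t) |u|^2. By the equation it equals 2 exp(-2 gam t) (E(u, u)
    + gam |u|^2), hence is at least 2 alpha exp(-2 gam t) N(u)^2. *)
Let dissipation (t : R) : R := 2 * (weight t * (gam * `|u t| ^+ 2 - ip (du t) (u t))).

Let weight_der (t : R) : is_derive t 1 weight (- 2 * gam * weight t).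
Proof.
have dl : is_derive t 1 (fun t : R => - 2 * gam * t) (- 2 * gam).
  have := is_deriveZ (- 2 * gam) (is_derive_id t (1 : R)); by rewrite -[_ *: _]/(_ * _) mulr1.
rewrite mulrC; exact: (@is_derive1_comp R expR _ t _ _ (is_derive_expR _) dl).
Qed.

Let energy_der (t : R) : 0 < t -> is_derive t 1 (fun t => weight t * `|u t| ^+ 2) (- dissipation t).
Proof.
move=> t0; have d2 := is_derive1_sqr_norm ipP ip_norm (u_der t0).
apply: is_derive_eq (is_deriveM (weight_der t) d2) _.
by rewrite -![_ *: _]/(_ * _) /dissipation; ring.
Qed.

Let dissipation_cont t : 0 < t -> {for t, continuous dissipation}.
Proof.
move=> t0; have cw : {for t, continuous weight} := is_derive1_continuous (weight_der t).
have cu := u_cont t0; have cdu := du_cont t0.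
have ci : ip (du r) (u r) @[r --> t] --> ip (du t) (u t).
  by apply: (cvg_ip ipP ip_norm); [exact: cdu|exact: cu].
have cn : (gam * `|u r| ^+ 2) @[r --> t] --> gam * `|u t| ^+ 2.
  by apply: cvgMr; rewrite expr2; under eq_cvg do rewrite expr2; apply: cvgM; exact: cvg_norm.
apply: (@cvgM _ _ _ _ (fun=> 2) (fun r => weight r * (gam * `|u r| ^+ 2 - ip (du r) (u r)))).
  exact: cvg_cst.
by apply: cvgM; [exact: cw|apply: cvgB; [exact: cn|exact: ci]].
Qed.

Let dissipation_ge t : 0 < t -> t <= T ->
  N (u t) ^+ 2 <= expR (2 * gam * T) / (2 * alpha) * dissipation t.
Proof.
move=> t0 tT; have Vu := uV t0; have h := Ec Vu.
rewrite uE// -ip_norm -N_sqr// addrC in h.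
have h2 : weight t * expR (2 * gam * T) >= 1.
  rewrite /weight -expRD -[X in X <= _]expR0 ler_expR.
  by have := ler_wpM2l gam0 tT; lra.
rewrite mulrC mulrA ler_pdivlMr ?mulr_gt0// /dissipation.
have q0 : 0 <= N (u t) ^+ 2 := sqr_ge0 _.
have w0 : 0 <= weight t * expR (2 * gam * T) by rewrite mulr_ge0// expR_ge0.
have := ler_wpM2l w0 h; have := ler_wpM2r (mulr_ge0 (ltW al0) q0) h2.
by move: (expR (2 * gam * T)) (weight t) (N (u t) ^+ 2) (gam * _) (ip _ _) => x y z v w; lra.
Qed.

(** u is differentiable at positive times only, so the energy identity starts at r > 0. The weight
    at r cancels the growth factor in the bound of |u r|^2, and the result does not depend on r. *)
Let energy_bound_eps (r : R) : 0 < r -> r < T ->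
  (\int[cleb]_(t in (`]r, T[%classic : set cR)) ((N (u t)) ^+ 2)%:E <=
    (expR (2 * gam * T) / (2 * alpha) * `|g| ^+ 2)%:E)%E.
Proof.
move=> r0 rT; set k := expR (2 * gam * T) / (2 * alpha).
have k0 : 0 <= k by rewrite divr_ge0 ?expR_ge0// mulr_ge0// ltW.
have cd : {within `[r, T], continuous dissipation}.
  apply: continuous_in_subspaceT => t; rewrite inE/= in_itv/= => /andP[rt _].
  exact: dissipation_cont (lt_le_trans r0 rt).
have md : measurable_fun (`[r, T]%classic : set (measurableTypeR R)) dissipation.
  exact: subspace_continuous_measurable_fun.
have md' : measurable_fun (`]r, T[%classic : set (measurableTypeR R)) dissipation.
  apply: measurable_funS md => // t /=; rewrite !in_itv/= => /andP[a1 a2].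
  by rewrite !ltW.
have d_ge0 t : 0 < t -> t <= T -> 0 <= dissipation t.
  move=> t0 tT; have := le_trans (sqr_ge0 (N (u t))) (dissipation_ge t0 tT).
  by rewrite pmulr_rge0// divr_gt0 ?expR_gt0// mulr_gt0.
pose F t := - (weight t * `|u t| ^+ 2).
have dF (t : R) : 0 < t -> is_derive t 1 F (dissipation t).
  by move=> t0; have := is_deriveN (energy_der t0); rewrite opprK.
have FTC : (\int[lebesgue_measure]_(t in `[r, T]) (dissipation t)%:E = (F T)%:E - (F r)%:E)%E.
  apply: (continuous_FTC2 rT cd); first split.
  - move=> t; rewrite in_itv/= => /andP[rt _].
    by have [] := dF t (lt_trans r0 rt).
  - exact: cvg_at_right_filter (is_derive1_continuous (dF _ r0)).
  - exact: cvg_at_left_filter (is_derive1_continuous (dF _ T0)).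
  - move=> t; rewrite in_itv/= => /andP[rt _].
    by rewrite derive1E; have [] := dF t (lt_trans r0 rt).
apply: (@le_trans _ _ (\int[cleb]_(t in (`]r, T[%classic : set cR)) (k * dissipation t)%:E)%E).
  apply: ge0_le_integral_nonmeasurable => t; first by rewrite lee_fin sqr_ge0.
  rewrite /= in_itv/= => /andP[rt tT]; rewrite lee_fin.
  by apply: dissipation_ge; [exact: lt_trans rt|exact: ltW].
have d0 t : `]r, T[%classic t -> (0 <= (dissipation t)%:E)%E.
  rewrite /= in_itv/= => /andP[rt tT]; rewrite lee_fin.
  by apply: d_ge0; [exact: lt_trans rt|exact: ltW].
rewrite ge0_integral_completed//; last 2 first.
- by apply/measurable_EFinP; apply: measurable_funM.
- by move=> t tI; rewrite EFinM mule_ge0 ?lee_fin//; have := d0 t tI; rewrite lee_fin.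
under eq_integral do rewrite EFinM.
rewrite ge0_integralZl//; last exact/measurable_EFinP.
rewrite (EFinM k); have kE : (0 <= k%:E)%E by rewrite lee_fin.
apply: (lee_wpmul2l kE).
apply: (@le_trans _ _ (\int[lebesgue_measure]_(t in `[r, T]) (dissipation t)%:E)%E).
  apply: ge0_subset_integral => //; first exact/measurable_EFinP.
    move=> t /=; rewrite in_itv/= => /andP[rt tT]; rewrite lee_fin.
    by apply: d_ge0 => //; exact: lt_le_trans rt.
  by move=> t /=; rewrite !in_itv/= => /andP[a1 a2]; rewrite !ltW.
rewrite FTC -EFinB lee_fin /F opprK addrC; apply: (@le_trans _ _ (weight r * `|u r| ^+ 2)).
  by rewrite gerBl mulr_ge0 ?expR_ge0// sqr_ge0.
apply: (@le_trans _ _ (weight r * (expR (gam * r) * `|g|) ^+ 2)).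
  apply: ler_wpM2l; first exact: expR_ge0.
  by rewrite ler_sqr ?nnegrE ?mulr_ge0 ?expR_ge0//; exact: u_bd.
rewrite exprMn mulrA -expRM_natl /weight -expRD.
by rewrite (_ : _ + _ = 0) ?expR0 ?mul1r//; ring.
Qed.

Let energy_bound_full :
  (\int[cleb]_(t in I) ((N (u t)) ^+ 2)%:E <=
    (expR (2 * gam * T) / (2 * alpha) * `|g| ^+ 2)%:E)%E.
Proof.
pose F (k : nat) : set cR := `](T / k.+2%:R), T[%classic.
have Tk k : 0 < T / k.+2%:R < T.
  by rewrite divr_gt0//= gtr_pMr// invf_lt1// ltr1n.
have IE : I = \bigcup_k F k.
  apply/seteqP; split=> t.
    move=> /time_itvP/andP[t0 tT]; have d0 : 0 < t / T by rewrite divr_gt0.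
    have [k _ /(_ k (leqnn k)) /= kd] := near_infty_natSinv_lt (PosNum d0).
    exists k => //; rewrite /F /= in_itv/= tT andbT mulrC -ltr_pdivlMr//.
    by apply: le_lt_trans kd; rewrite lef_pV2 ?posrE// ler_nat.
  move=> [k _]; rewrite /F /= !in_itv/= => /andP[h ->]; rewrite andbT.
  by apply: lt_trans h; have /andP[] := Tk k.
have mN : measurable_fun I (N \o u : cR -> R).
  apply: (strongly_measurable_lip Nge0 (C := 1) u_bochner_meas) => x y Vx Vy.
  by rewrite mul1r; exact: Nlip.
have mf : measurable_fun I (fun t : cR => ((N (u t)) ^+ 2)%:E).
  by apply/measurable_EFinP; exact: measurable_funX.
have FI k : F k `<=` I by rewrite IE => t Ft; exists k.
have c := @ge0_nondecreasing_set_cvg_integral _ cR R F (fun t => ((N (u t)) ^+ 2)%:E) cleb.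
rewrite IE; apply: cvge_le (c _ _ _ _).
- by apply: nearW => k; have /andP[h1 h2] := Tk k; exact: energy_bound_eps.
- apply/nondecreasing_seqP => k; apply/subsetPset => t; rewrite /F /= !in_itv/= => /andP[h ->].
  by rewrite andbT; apply: le_lt_trans h; rewrite ler_pM2l// lef_pV2 ?posrE// ler_nat.
- by move=> k; apply: borel_lebesgue_measurable; exact: measurable_itv.
- by move=> k; apply: measurable_funS mf.
- by move=> k t _; rewrite lee_fin sqr_ge0.
Qed.

Lemma variational_norm_bound : (bochner_norm2 N T u <=
  (Num.sqrt (expR (2 * gam * T) / (2 * alpha)) * `|g|)%:E)%E.
Proof.
have k0 : 0 <= expR (2 * gam * T) / (2 * alpha) by rewrite divr_ge0 ?expR_ge0// mulr_ge0// ltW.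
have -> : (Num.sqrt (expR (2 * gam * T) / (2 * alpha)) * `|g|)%:E =
    ((expR (2 * gam * T) / (2 * alpha) * `|g| ^+ 2)%:E `^ 2^-1)%E.
  have kg := mulr_ge0 k0 (sqr_ge0 `|g|); rewrite poweR_EFin; congr EFin; rewrite powR12_sqrt//.
  by rewrite [RHS]sqrtrM// sqrtr_sqr normr_id.
rewrite /bochner_norm2; apply: gt0_ler_poweR => //.
- by rewrite in_itv/= leey andbT; apply: integral_ge0 => t _; rewrite lee_fin sqr_ge0.
- by rewrite in_itv/= leey andbT lee_fin mulr_ge0// sqr_ge0.
Qed.

(** G = eta (u, z) vanishes at both ends of the interval, so its derivative k has integral 0; by the
    equation k is the sum of the two integrands evaluated at z. The compact support of eta provides
    both Bochner integrals. *)
Let weak_derivative : is_weak_time_derivative HM HN T (fun t z => ip (u t) (val z)) u'.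
Proof.
move=> eta teta; have [deta Sc ST] := teta; set S := closure _ in Sc ST.
have Scl : closed S by exact: closed_closure.
have S0 t : S t -> 0 < t by move=> /ST /=; rewrite in_itv/= => /andP[].
have nearS t : ~ S t -> \forall r \near t, ~ S r.
  by move=> nS; apply: open_nbhs_nbhs; split=> //; exact: closed_openC.
have eta0 t : ~ S t -> eta t = 0.
  by move=> nS; apply: contrapT => /eqP h; apply: nS; exact: subset_closure.
have eta_der (t : R) : is_derive t 1 eta (derive1 eta t).
  by rewrite derive1E; apply: derivableP; exact: (deta 0%N t).
have deta0 t : ~ S t -> derive1 eta t = 0.
  move=> nS; rewrite derive1E; apply: derive_val.
  by apply: (@near_eq_is_derive _ _ _ (cst (0 : R))); near=> r; rewrite eta0//; near: r; exact: nearS.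
have ceta : continuous eta by move=> t; exact: is_derive1_continuous (eta_der t).
have cdeta : continuous (derive1 eta).
  by move=> t; apply: differentiable_continuous; apply/derivable1_diffP; exact: (deta 1%N t).
pose f1 t := eta t *: u' t; pose f2 t : V -> R := derive1 eta t *: (fun z => ip (u t) (val z)).
have ip_in t : HM (fun z => ip (u t) (val z)).
  apply: (@dual_spaceI R X V N (ip (u t)) (Num.sqrt Cp * `|u t|)); first by move=> k v w _ _; exact: ip_linr.
  by move=> v Vv; exact: ip_leN.
have f1_in t : 0 < t -> HM (f1 t) by move=> t0; apply: subspaceZ => //; exact: u'_in.
have f2_in t : 0 < t -> HM (f2 t) by move=> t0; exact: subspaceZ.
have f10 t : ~ S t -> f1 t = 0 by move=> nS; rewrite /f1 eta0// scale0r.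
have f20 t : ~ S t -> f2 t = 0 by move=> nS; rewrite /f2 deta0// scale0r.
have f1c t e : S t -> 0 < e -> exists2 d, 0 < d &
    forall r, 0 < r -> `|r - t| < d -> HN (f1 r - f1 t) < e.
  move=> /S0 t0 e0.
  have [d d0 h] := lin_small (mulr_ge0 M0 (Nge0 (u t))) (normr_ge0 (eta t)) e0.
  have [d1 d10 h1] := continuous_dist (ceta t) d0.
  have M1 : 0 < M + 1 by rewrite ltr_wpDl.
  have [d2 d20 h2] := N_cont t0 (divr_gt0 d0 M1).
  exists (Num.min d1 d2) => [|r r0]; first by rewrite lt_min d10.
  rewrite lt_min => /andP[/h1 e1 /(h2 _ r0)]; rewrite ltr_pdivlMr// => e2.
  apply: le_lt_trans (u'_dist (eta r) (eta t) r0 t0) _.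
  have Mn : M * N (u r - u t) < d.
    by apply: le_lt_trans e2; rewrite mulrC; apply: ler_wpM2l => //; rewrite lerDl.
  have m0 : 0 <= M * N (u r - u t) by rewrite mulr_ge0.
  apply: le_lt_trans (h _ _ (normr_ge0 _) m0 e1 Mn); rewrite lerD2l; apply: ler_wpM2r => //.
  by rewrite -{1}(subrK (eta t) (eta r)) addrC; exact: ler_normD.
have f2c t e : S t -> 0 < e -> exists2 d, 0 < d &
    forall r, 0 < r -> `|r - t| < d -> HN (f2 r - f2 t) < e.
  move=> /S0 t0 e0; pose w r := derive1 eta r *: u r.
  have cw : {for t, continuous w} by apply: cvgZ; [exact: cdeta|exact: u_cont].
  have C0 : 0 < Num.sqrt Cp + 1 by rewrite ltr_wpDl// sqrtr_ge0.
  have [d d0 h] := continuous_dist cw (divr_gt0 e0 C0); exists d => // r r0 /h.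
  rewrite ltr_pdivlMr// => h1; apply: le_lt_trans h1.
  apply: (dual_norm_le sV NZ); first by rewrite mulr_ge0// ltW.
  move=> z; have Vz : V (val z) by exact: set_valP.
  have -> : (f2 r - f2 t) z = ip (w r - w t) (val z).
    rewrite ipBl /w -[derive1 eta r *: u r]addr0 -[derive1 eta t *: u t]addr0 !ip_linl.
    by rewrite -[LHS]/(derive1 eta r * ip (u r) (val z) - derive1 eta t * ip (u t) (val z)); ring.
  apply: le_trans (ip_leN _ Vz) _; apply: ler_wpM2r => //.
  by rewrite mulrC; apply: ler_wpM2l => //; rewrite lerDl.
have B1 := dual_bochner_integral Sc ST f1_in f10 f1c.
have B2 := dual_bochner_integral Sc ST f2_in f20 f2c.
exists (fun z => \int[cleb]_(t in I) f1 t z); split; first exact: B1.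
suff -> : - (fun z : V => \int[cleb]_(t in I) f1 t z) = (fun z => \int[cleb]_(t in I) f2 t z).
  exact: B2.
apply/funext => z; have Vz : V (val z) by exact: set_valP.
have j1 := dual_eval_integrable Sc ST f1_in f10 f1c z.
have j2 := dual_eval_integrable Sc ST f2_in f20 f2c z.
pose G t := eta t * ip (u t) (val z).
pose k t := derive1 eta t * ip (u t) (val z) + eta t * ip (du t) (val z).
have dG (t : R) : is_derive t 1 G (k t).
  have [St|nS] := pselect (S t).
    have d2 := is_derive1_ip ipP ip_norm (val z) (u_der (S0 _ St)).
    apply: is_derive_eq (is_deriveM (eta_der t) d2) _.
    by rewrite -![_ *: _]/(_ * _) /k; ring.
  rewrite /k eta0// deta0// !mul0r addr0.
  apply: (@near_eq_is_derive _ _ _ (cst (0 : R))); near=> r.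
  by rewrite /G eta0 ?mul0r//; near: r; exact: nearS.
have kc : continuous k.
  move=> t; have [St|nS] := pselect (S t).
    have t0 := S0 _ St; have cst_z : (fun=> val z) r @[r --> t] --> val z by exact: cvg_cst.
    apply: cvgD; apply: cvgM; [exact: cdeta| |exact: ceta|].
      exact: (cvg_ip ipP ip_norm _ (u_cont t0) cst_z).
    exact: (cvg_ip ipP ip_norm _ (du_cont t0) cst_z).
  have k0 r : ~ S r -> k r = 0 by move=> h; rewrite /k eta0// deta0// !mul0r addr0.
  rewrite /continuous_at k0//; apply: cvg_near_cst; near=> r; rewrite k0//.
  by near: r; exact: nearS.
have G0 : G 0 = 0 by rewrite /G eta0 ?mul0r// => /S0; rewrite ltxx.
have GT : G T = 0 by rewrite /G eta0 ?mul0r// => /ST /=; rewrite in_itv/= ltxx andbF.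
have FTC := FTC_itv T0 dG kc; rewrite G0 GT subrr in FTC.
have ik : lebesgue_measure.-integrable `]0%R, T[%classic (EFin \o k).
  apply: integrableS (continuous_compact_integrable (segment_compact (a := 0) (b := T)) (continuous_subspaceT kc)) => //.
  by move=> t /=; rewrite !in_itv/= => /andP[h1 h2]; rewrite !ltW.
have mk : measurable_fun (`]0, T[%classic : set (measurableTypeR R)) k.
  by apply: measurable_funTS; exact: continuous_measurable_fun.
have [_ ck] := integrable_completed (measurable_itv `]0, T[) mk ik.
have k0 : \int[cleb]_(t in I) k t = 0.
  rewrite [LHS]ck /Rintegral -[RHS]/(fine 0%:E) -FTC; congr fine.
  have mk' (D : set R) : measurable_fun (D : set (measurableTypeR R)) (EFin \o k).
    by apply/measurable_EFinP; apply: measurable_funTS; exact: continuous_measurable_fun.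
  by rewrite (integral_itv_obnd_cbnd (mk' _)) (integral_itv_bndo_bndc (mk' _)).
have h0 : \int[cleb]_(t in I) (f2 t z + f1 t z) = 0.
  rewrite -[RHS]k0; apply: eq_Rintegral => t /set_mem/time_itvP/andP[t0 _].
  rewrite /k -[f2 t z]/(derive1 eta t * ip (u t) (val z)) -[f1 t z]/(eta t * - E (u t) (val z)).
  by rewrite uE// opprK.
apply/eqP; rewrite -[(- _) z]/(- (\int[cleb]_(t in I) f1 t z)) eq_sym -addr_eq0; apply/eqP.
exact: etrans (esym (RintegralD mI j2 j1)) h0.
Unshelve. all: by end_near. Qed.

Lemma variational_existence : variational_solution g u.
Proof.
exists u'; split=> //.
- by split=> //; apply: le_lt_trans variational_norm_bound _; exact: ltry.
- split=> //; rewrite /bochner_norm2.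
  have h : (\int[cleb]_(t in I) ((HN (u' t)) ^+ 2)%:E <=
      \int[cleb]_(t in I) ((M ^+ 2)%:E * ((N (u t)) ^+ 2)%:E))%E.
    apply: ge0_le_integral_nonmeasurable => t; first by rewrite lee_fin sqr_ge0.
    move=> /time_itvP/andP[t0 _]; rewrite -EFinM lee_fin -exprMn ler_sqr ?nnegrE ?mulr_ge0//.
    apply: (dual_norm_le sV NZ); first by rewrite mulr_ge0.
    by move=> z; rewrite normrN; apply: E_le; [exact: uV|exact: set_valP].
  have fin : (\int[cleb]_(t in I) ((HN (u' t)) ^+ 2)%:E < +oo)%E.
    have mN : measurable_fun I (fun t : cR => ((N (u t)) ^+ 2)%:E).
      apply/measurable_EFinP; apply: measurable_funX.
      apply: (strongly_measurable_lip Nge0 (C := 1) u_bochner_meas) => x y Vx Vy.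
      by rewrite mul1r; exact: Nlip.
    have N2 (t : cR) : I t -> (0 <= ((N (u t)) ^+ 2)%:E)%E by rewrite lee_fin sqr_ge0.
    have M2 : (0 <= (M ^+ 2)%:E)%E by rewrite lee_fin sqr_ge0.
    apply: le_lt_trans h _; rewrite (ge0_integralZl cleb mI mN N2 M2).
    apply: le_lt_trans (lee_wpmul2l M2 energy_bound_full) _.
    by rewrite -EFinM ltry.
  by apply: poweR_lty.
- by move=> v; apply: aeW => t _; rewrite /u' addrC subrr.
Qed.
End existence.

(** * The semigroup of the shifted form as a solution *)

Section semigroup_solution.
Hypothesis gam0 : 0 <= gam.
Hypothesis Xc : forall u : nat -> X, (forall e : R, 0 < e -> exists n0 : nat,
  forall m n : nat, (n0 <= m)%N -> (n0 <= n)%N -> `|u m - u n| < e) ->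
  exists l : X, u n @[n --> \oo] --> l.
Hypothesis Vd : forall x (e : R), 0 < e -> exists2 v, V v & `|x - v| < e.
Let B u v := E u v + gam * ip u v.
Let S := sgroup ip V B.
Let Bb : bilinear_on V B := shift_bilinear gam.
Let BM := @shift_bounded gam.

Lemma semigroup_solution_C0 : C0_contraction_semigroup S.
Proof. exact (sgroup_C0 ipP ip_norm Xc sV aP ac Bb (sqr_ge0 _) BM al0 Ec Cp0 PC Vd). Qed.

Lemma semigroup_solution (g : X) :
  let u := fun t : R => if 0 < t then expR (gam * t) *: S t g else g in
  [/\ {within `[0, +oo[%classic, continuous u},
      variational_solution g u,
      forall t, 0 <= t -> `|u t| <= expR (gam * t) * `|g|,
      (bochner_norm2 N T u <= (Num.sqrt (expR (2 * gam * T) / (2 * alpha)) * `|g|)%:E)%E &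
      smooth_on_pos u].
Proof.
move=> u; have uE t : 0 < t -> u t = expR (gam * t) *: S t g by move=> t0; rewrite /u t0.
have us := sgroup_smooth ipP ip_norm Xc sV aP ac Bb (sqr_ge0 _) BM al0 Ec Cp0 PC Vd uE.
have ueq := sgroup_equation ipP ip_norm Xc sV aP ac Bb (sqr_ge0 _) BM al0 Ec Cp0 PC Vd uE.
have contr := sgroup_contr ipP ip_norm Xc sV aP ac Bb (sqr_ge0 _) BM al0 Ec Cp0 PC Vd.
have S0 : S t g @[t --> 0^'+] --> g.
  by have [_ _ h _] := semigroup_solution_C0; exact: (h g).
have ug : u t @[t --> 0^'+] --> g.
  have c0 : expR (gam * t) @[t --> 0^'+] --> expR (gam * (0 : R)).
    apply: cvg_at_right_filter; apply: (@continuous_comp _ _ _ ( *%R gam) expR).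
      by apply: cvgMr; exact: cvg_id.
    exact: continuous_expR.
  have c1 : expR (gam * t) *: S t g @[t --> 0^'+] --> g.
    have e : expR (gam * 0) *: g = g by rewrite mulr0 expR0 scale1r.
    by rewrite -[X in _ --> X]e; apply: cvgZ; [exact: c0|exact: S0].
  move: c1; apply: cvg_trans; apply: near_eq_cvg.
  by near=> t; rewrite uE//; near: t; exact: nbhs_right_gt.
have ubd t : 0 < t -> `|u t| <= expR (gam * t) * `|g|.
  move=> t0; rewrite uE// normrZ ger0_norm ?expR_ge0//.
  by apply: ler_wpM2l; [exact: expR_ge0|exact: contr (ltW t0)].
have ueq' (t : R) v : 0 < t -> V v -> V (u t) /\ E (u t) v = - ip (derive1 u t) v.
  by move=> t0 Vv; have [Vu <-] := ueq t v t0 Vv; split=> //; rewrite /B; ring.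
split=> //.
- apply/continuous_within_itvcyP; split.
    by move=> t; rewrite in_itv/= andbT => t0; have [_] := us 0%N t t0.
  by rewrite [X in _ --> X]/u ltxx.
- exact: variational_existence us ueq' ug ubd gam0.
- move=> t; rewrite le_eqVlt => /predU1P[<-|]; last exact: ubd.
  by rewrite /u ltxx mulr0 expR0 mul1r.
- exact: variational_norm_bound us ueq' ubd gam0.
Unshelve. all: by end_near. Qed.
End semigroup_solution.
End variational.

(** * Weak solutions of the initial-boundary value problem *)

Section weak_solutions.
Context (R : realType) (n : nat) (U : set 'rV[R]_n) (oU : open U) (bU : bounded_set U).
Local Notation leb := (@lebesgue_rV R n).
Local Notation rV := 'rV[R]_n.
Local Notation X := (L2 oU).
Local Notation V := (@H10 R n U oU).
Local Notation UR := (U : set (Rn R n)).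
Variables (p K r L : R).
Hypotheses (p2 : 2 < p) (K0 : 0 <= K) (HS : sobolev_on oU p K).
Hypotheses (r2 : 2 < r) (L0 : 0 <= L) (HL : sobolev_on oU r L).
Variables (q s : R).
Hypotheses (q0 : 0 < q) (s0 : 0 < s).
Hypotheses (qp : q^-1 + 2^-1 + p^-1 = 1) (sr : s^-1 + r^-1 + r^-1 = 1).
Variables (H : rV -> rV) (h : rV -> R) (A : rV -> 'M[R]_n) (c : rV -> R).
Hypothesis hH : forall i, Lp_on U q (fun x => H x 0 i).
Hypothesis hh : Lp_on U q h.
Hypothesis hHh : {ae leb, forall x, U x -> enorm (H x) <= h x}.
Hypothesis mA : forall i j, measurable_fun [set: Rn R n] ((fun x => A x i j) : Rn R n -> R).
Variables (M lambda theta N B : R).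
Hypotheses (M0 : 0 < M) (lambda0 : 0 < lambda) (theta0 : 0 <= theta) (N0 : 0 <= N).
Hypothesis hA : {ae leb, forall x, (forall i j, `|A x i j| <= M) /\
  (forall xi : rV, lambda * enorm xi ^+ 2 <= dot (xi *m (A x)^T) xi)}.
Hypothesis hc : Lp_on U s c.
Hypothesis c0 : {ae leb, forall x, U x -> 0 <= c x}.
Hypothesis hB : Lpnorm_le leb UR q (fun x => \1_[set y | N <= `|h y|] x * `|h x|) B.
Hypothesis hBK : B * Num.sqrt K <= lambda / 4.
Variables (T : R) (g : X).
Hypothesis T0 : 0 < T.
Local Notation E := (@energy_form R n U oU A H c theta).
Local Notation gam := (N ^+ 2 / lambda).

(** Once the integral over U is written as the L2 inner product, the concrete and the abstract
    notion agree by conversion. *)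
Lemma weak_solutionE (u : R -> X) : weak_solution A H c theta T g u <->
  variational_solution (@L2ip _ _ _ _) V E (@H10_norm R n U oU) T g u.
Proof.
have e t : L2_to_Hm1 (u t) = (fun z : V => L2ip (u t) (val z)).
  by apply/funext => z; rewrite L2ip_intU.
have ee : (fun t => L2_to_Hm1 (u t)) = (fun t (z : V) => L2ip (u t) (val z)).
  exact/funext.
by rewrite /weak_solution ee.
Qed.

Let Cp : R := K * fine (leb U) `^ (1 - 2 / p).
Let Cp0 : 0 <= Cp. Proof. by rewrite mulr_ge0// powR_ge0. Qed.

Let PC : forall u, V u -> `|u| ^+ 2 <= Cp * dirichlet u u. Proof. exact: poincare. Qed.
(** The absolute value makes the constant nonnegative; the bound on the form involves its square. *)
Let EM := `|energy_bound p K L hH M theta hc|.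

Lemma weak_solution_semigroup : exists S : R -> X -> X,
  C0_contraction_semigroup S /\
  let u := fun t : R => if 0 < t then expR (gam * t) *: S t g else g in
  [/\ {within `[0, +oo[%classic, continuous u},
      weak_solution A H c theta T g u,
      (forall v, weak_solution A H c theta T g v ->
         {ae (@completed_lebesgue_measure R), forall t : R, 0 < t < T -> v t = u t}),
      (forall t, 0 <= t -> `|u t| <= expR (gam * t) * `|g|) &
      (bochner_norm2 (@H10_norm R n U oU) T u
         <= (Num.sqrt (expR (2 * gam * T) / lambda) * `|g|)%:E)%E] /\
  smooth_on_pos u.
Proof.
have ipP := L2ipP (mrestr leb (open_measurable_rV oU)).
have ip_norm : forall x : X, `|x| ^+ 2 = L2ip x x by move=> x; exact: L2norm_sqr.
have M1 : 0 <= EM := normr_ge0 _.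
have al0 : 0 < lambda / 2 by rewrite divr_gt0.
have sV : subspace V := @H10_subspace R n U oU bU.
have aP : sym_psd_on V (@dirichlet R n U oU) := @dirichlet_sym_psd R n U oU bU.
have ac := H10_complete bU Cp0 PC.
have Nge0 (u : X) : 0 <= H10_norm u by exact: sqrtr_ge0.
have N_sqr (u : X) : V u -> H10_norm u ^+ 2 = dirichlet u u.
  by move=> _; rewrite H10_normE sqr_sqrtr// dirichlet_ge0.
have Eb : bilinear_on V E.
  exact (energy_bilinear bU p2 K0 HS r2 L0 HL q0 s0 qp sr hH mA theta M0 hA hc).
have EMP u v : V u -> V v -> E u v ^+ 2 <= EM ^+ 2 * dirichlet u u * dirichlet v v.
  by move=> Vu Vv; rewrite real_normK ?num_real//; exact (energy_bounded bU p2 K0 HS r2 L0 HL q0 s0 qp sr hH mA M0 theta0 hA hc Vu Vv).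
have Ec u : V u -> lambda / 2 * dirichlet u u <= E u u + gam * L2ip u u.
  exact (@energy_coercive _ _ _ _ bU _ _ _ _ p2 K0 HS r2 L0 HL _ _ q0 s0 qp sr _ _ _ _ hH hh hHh mA _ _ _ _ _
    M0 lambda0 theta0 N0 hA hc c0 hB hBK u).
have gam0 : 0 <= gam by rewrite divr_ge0 ?sqr_ge0// ltW.
pose S := sgroup (@L2ip _ _ _ _) V (fun u v => E u v + gam * L2ip u v).
exists S; split.
  exact (semigroup_solution_C0 ipP ip_norm Cp0 M1 al0 sV aP ac Nge0 N_sqr PC Eb EMP Ec
    (@L2_complete _ _ _ _) (@H10_dense R n U oU bU)).
have [h1 h2 h3 h4 h5] := semigroup_solution ipP ip_norm T0 Cp0 M1 al0 sV aP ac Nge0 N_sqr PC Eb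
  EMP Ec gam0 (@L2_complete _ _ _ _) (@H10_dense R n U oU bU) g.
move=> u; split; last exact h5.
split; [exact h1 | exact: (weak_solutionE _).2 | | exact h3 |].
  move=> v /weak_solutionE wv.
  exact (variational_solution_unique ipP ip_norm T0 Cp0 M1 al0 sV aP ac Nge0 N_sqr PC Eb EMP Ec wv h2).
have l2 : 2 * (lambda / 2) = lambda by field.
by move: h4; rewrite l2.
Qed.
End weak_solutions.

(** * Exponents and thresholds *)

Section exponents.
Variable R : realType.

Lemma truncated_Lpnorm d (T : measurableType d) (mu : {measure set T -> \bar R}) (D S : set T)
    (h : T -> R) (q B : R) : 0 < q -> 0 <= B ->
  ((\int[mu]_(x in D) (\1_S x * `|h x| `^ q)%:E) `^ (2 / q) <= (B ^+ 2)%:E)%E ->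
  Lpnorm_le mu D q (fun x => \1_S x * `|h x|) B.
Proof.
move=> q0 B0 hB; rewrite /Lpnorm_le.
have -> : (B%:E = ((B ^+ 2)%:E `^ 2^-1))%E.
  by rewrite poweR_EFin powR12_sqrt ?sqr_ge0// sqrtr_sqr ger0_norm.
have -> : (\int[mu]_(x in D) (`|\1_S x * `|h x| | `^ q)%:E =
    \int[mu]_(x in D) (\1_S x * `|h x| `^ q)%:E)%E.
  apply: eq_integral => x _; rewrite indicE; case: (_ \in _).
    by rewrite !mul1r normr_id.
  by rewrite !mul0r normr0 powR0// gt_eqF.
have -> : q^-1 = 2 / q * 2^-1 by field; rewrite gt_eqF.
have I0 : (0 <= \int[mu]_(x in D) (\1_S x * `|h x| `^ q)%:E)%E.
  by apply: integral_ge0 => x _; rewrite lee_fin mulr_ge0// powR_ge0.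
by rewrite poweRrM; apply: gt0_ler_poweR; rewrite ?in_itv/= ?leey ?andbT ?poweR_ge0// lee_fin sqr_ge0.
Qed.

(** p is fixed by 1/q + 1/2 + 1/p = 1, and B is the square root of the planar threshold. For m > 0
    the powers m^(-1/p) and m^(1/p) cancel and B sqrt(K) = lambda/4; for m = 0 both are 0 by
    convention, whence an inequality. *)
Lemma planar_constants (q m lambda : R) : 2 < q -> 0 <= m -> 0 < lambda ->
  let p := 2 * q / (q - 2) in let K := (p / 4) ^+ 2 * m `^ (2 / p) in
  let B := lambda / 2 * ((q - 2) / q) * m `^ (- 2^-1 + q^-1) in
  [/\ 2 < p, q^-1 + 2^-1 + p^-1 = 1, 0 <= B,
      B ^+ 2 = lambda ^+ 2 / 4 * ((q - 2) / q) ^+ 2 * m `^ (- 1 + 2 / q) &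
      B * Num.sqrt K <= lambda / 4].
Proof.
move=> q2 m0 l0 p K B.
have q0 : 0 < q by exact: lt_trans q2.
have q20 : 0 < q - 2 by rewrite subr_gt0.
have p0 : 0 < p by rewrite divr_gt0// mulr_gt0.
have pE : p^-1 = 2^-1 - q^-1 by rewrite /p; field; rewrite !gt_eqF.
have Bc : 0 <= lambda / 2 * ((q - 2) / q) by rewrite mulr_ge0 ?divr_ge0 ?ltW.
have KE : Num.sqrt K = p / 4 * m `^ p^-1.
  have p4 : 0 <= p / 4 by rewrite divr_ge0// ltW.
  rewrite /K sqrtrM ?sqr_ge0// sqrtr_sqr ger0_norm// -powR12_sqrt ?powR_ge0//.
  by rewrite -powRrM; congr (_ * _ `^ _); field; rewrite gt_eqF.
split.
- by rewrite /p ltr_pdivlMr//; lra.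
- by rewrite pE; lra.
- by rewrite mulr_ge0// powR_ge0.
- rewrite /B exprMn -(powR_mulrn _ (powR_ge0 _ _)) -powRrM; congr (_ * _ `^ _).
    by field; rewrite gt_eqF.
  by field; rewrite gt_eqF.
rewrite KE /B; have -> : - 2^-1 + q^-1 = - p^-1 by rewrite pE; lra.
have -> : lambda / 2 * ((q - 2) / q) * m `^ (- p^-1) * (p / 4 * m `^ p^-1) =
    lambda / 4 * (m `^ (- p^-1) * m `^ p^-1).
  rewrite /p; move: (m `^ _) (m `^ _) => x y; field; rewrite !gt_eqF//.
rewrite ler_piMr//; first by rewrite divr_ge0// ltW.
have [->|mn0] := eqVneq m 0; first by rewrite powR0 ?mul0r// oppr_eq0 gt_eqF// invr_gt0.
by rewrite -powRD ?mn0 ?implybT// addNr powRr0.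
Qed.
End exponents.

Theorem theorem3p7 (R : realType) (d : nat) (hd : (2 <= d)%N)
  (U : set 'rV[R]_d) (oU : open U) (bU : bounded_set U)
  (q : R) (hq2 : d = 2%N -> 2 < q) (hq3 : (3 <= d)%N -> q = d%:R)
  (H : 'rV[R]_d -> 'rV[R]_d) (hH : forall i, Lp_on U q (fun x => H x 0 i))
  (h : 'rV[R]_d -> R) (hh : Lp_on U q h)
  (hHh : {ae (@lebesgue_rV R d), forall x, U x -> enorm (H x) <= h x})
  (A : 'rV[R]_d -> 'M[R]_d)
  (mA : forall i j,
     measurable_fun [set: Rn R d] ((fun x => A x i j) : Rn R d -> R))
  (M lambda : R) (M0 : 0 < M) (lambda0 : 0 < lambda)
  (hA : {ae (@lebesgue_rV R d), forall x,
     (forall i j, `|A x i j| <= M) /\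
     (forall xi : 'rV[R]_d, lambda * enorm xi ^+ 2 <= dot (xi *m (A x)^T) xi)})
  (theta : R) (theta0 : 0 <= theta)
  (s : R) (hs2 : d = 2%N -> 1 < s) (hs3 : (3 <= d)%N -> s = d%:R / 2)
  (c : 'rV[R]_d -> R) (hc : Lp_on U s c)
  (c0 : {ae (@lebesgue_rV R d), forall x, U x -> 0 <= c x})
  (T : R) (T0 : 0 < T) (g : L2 oU)
  (N : R) (N0 : 0 <= N)
  (hN2 : d = 2%N ->
     ((\int[@lebesgue_rV R d]_(x in (U : set (Rn R d)))
         (\1_[set y | N <= `|h y|] x * `|h x| `^ q)%:E) `^ (2 / q)
      <= (lambda ^+ 2 / 4 * ((q - 2) / q) ^+ 2
          * fine (lebesgue_rV (U : set (Rn R d))) `^ (- 1 + 2 / q))%:E)%E)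
  (hN3 : (3 <= d)%N ->
     ((\int[@lebesgue_rV R d]_(x in (U : set (Rn R d)))
         (\1_[set y | N <= `|h y|] x * `|h x| `^ d%:R)%:E) `^ (2 / d%:R)
      <= (lambda ^+ 2 / 16 * ((d%:R - 2) / (d%:R - 1)) ^+ 2)%:E)%E) :
  let gamma := N ^+ 2 / lambda in
  exists S : R -> L2 oU -> L2 oU,
    C0_contraction_semigroup S /\
    let u := fun t : R => if 0 < t then expR (gamma * t) *: S t g else g in
    [/\ {within `[0, +oo[%classic, continuous u},
        weak_solution A H c theta T g u,
        (forall v, weak_solution A H c theta T g v ->
           {ae (@completed_lebesgue_measure R), forall t : R,
              0 < t < T -> v t = u t}),
        (forall t, 0 <= t -> `|u t| <= expR (gamma * t) * `|g|) &
        (bochner_norm2 (@H10_norm R d U oU) T u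
           <= (Num.sqrt (expR (2 * gamma * T) / lambda) * `|g|)%:E)%E] /\
    smooth_on_pos u.
Proof.
move=> gamma.
have mfin : (lebesgue_rV (U : set (Rn R d)) < +oo)%E := Ufin oU bU.
have m0 : 0 <= fine (lebesgue_rV (U : set (Rn R d))) by rewrite fine_ge0.
have [d2|d3] : d = 2%N \/ (3 <= d)%N by move: hd; rewrite leq_eqVlt => /predU1P[<-|]; [left|right].
  have q2 := hq2 d2; have s1 := hs2 d2; have hN := hN2 d2.
  have q0 : 0 < q by exact: lt_trans q2.
  have s0 : 0 < s by exact: lt_trans s1.
  have [p2 qp B0 BE BK] := planar_constants q2 m0 lambda0.
  (* In the plane every exponent above 2 is a Sobolev exponent; r solves 1/s + 2/r = 1. *)
  pose r := 2 * s / (s - 1).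
  have s10 : 0 < s - 1 by rewrite subr_gt0.
  have r2 : 2 < r by rewrite /r ltr_pdivlMr//; lra.
  have sr : s^-1 + r^-1 + r^-1 = 1 by rewrite /r; field; rewrite !gt_eqF.
  subst d; have HS := sobolev_on_2 oU bU p2; have HL := sobolev_on_2 oU bU r2.
  rewrite -BE in hN; have hB := truncated_Lpnorm q0 B0 hN.
  have K0 (e : R) : 0 <= (e / 4) ^+ 2 * fine (@lebesgue_rV R 2 U) `^ (2 / e).
    by rewrite mulr_ge0 ?sqr_ge0// powR_ge0.
  exact (weak_solution_semigroup bU p2 (K0 _) HS r2 (K0 _) HL q0 s0 qp sr hH hh hHh mA M0 lambda0
    theta0 N0 hA hc c0 hB BK g T0).
have qE := hq3 d3; have sE := hs3 d3; have hN := hN3 d3.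
have [k [dk k0]] : exists k, d = k.+2 /\ (0 < k)%N.
  by case: d d3 {hd U oU bU H hH h hh hHh A mA hA c hc c0 g hN2 hN3 hN hq2 hq3 hs2 hs3 mfin m0 qE sE} => [//|[//|k]] hk; exists k.
subst d; have kR : 0 < k%:R :> R by rewrite ltr0n.
have k2E : k.+2%:R = k%:R + 2 :> R by rewrite -addn2 natrD.
have k1E : k.+1%:R = k%:R + 1 :> R by rewrite -addn1 natrD.
have d0 : 0 < k.+2%:R :> R by rewrite ltr0n.
(* The critical exponent 2d/(d-2) serves both the drift, with q = d, and the potential, with s =
   d/2; hence the same Sobolev inequality is passed twice. *)
pose p : R := 2 * (k.+2%:R / k%:R).
have p2 : 2 < p by rewrite /p ltr_pMr// ltr_pdivlMr// mul1r ltr_nat.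
have q0 : 0 < q by rewrite qE.
have s0 : 0 < s by rewrite sE divr_gt0.
have qp : q^-1 + 2^-1 + p^-1 = 1.
  by rewrite qE /p k2E; field; rewrite !gt_eqF// addr_gt0.
have sp : s^-1 + p^-1 + p^-1 = 1.
  by rewrite sE /p k2E; field; rewrite !gt_eqF// addr_gt0.
have HS := sobolev_on_ge3 oU bU k0.
(* Square root of the threshold: lambda/4 divided by (k+1)/k = (d-1)/(d-2), the square root of the
   Sobolev constant. *)
pose B : R := lambda / 4 * (k%:R / k.+1%:R).
have B0 : 0 <= B by rewrite mulr_ge0// divr_ge0// ltW.
have BE : lambda ^+ 2 / 16 * ((k.+2%:R - 2) / (k.+2%:R - 1)) ^+ 2 = B ^+ 2.
  have k10 : k%:R + 1 != 0 :> R by rewrite gt_eqF// addr_gt0.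
  rewrite /B k2E k1E; have -> : k%:R + 2 - 2 = k%:R :> R by ring.
  have -> : k%:R + 2 - 1 = k%:R + 1 :> R by ring.
  by field.
have K0 : 0 <= (k.+1%:R / k%:R) ^+ 2 :> R by exact: sqr_ge0.
have BK : B * Num.sqrt ((k.+1%:R / k%:R) ^+ 2) <= lambda / 4.
  rewrite sqrtr_sqr ger0_norm ?divr_ge0// /B -mulrA.
  have -> : k%:R / k.+1%:R * (k.+1%:R / k%:R) = 1 :> R.
    by rewrite mulrA divfK ?divff ?gt_eqF.
  by rewrite mulr1.
rewrite BE -qE in hN; have hB := truncated_Lpnorm q0 B0 hN.
exact (weak_solution_semigroup bU p2 K0 HS p2 K0 HS q0 s0 qp sp hH hh hHh mA M0 lambda0
  theta0 N0 hA hc c0 hB BK g T0).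
Qed.
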